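(* Assume $\theta=-8$. Let $h_c\in\ker\mathcal L_{\lambda_c}$, $h_c\ne0$. There exist $\delta,\varepsilon>0$ and a neighborhood $\mathfrak A$ of $\chi_{\lambda_c}$ in $\mathcal H$ such that the solutions of $$DE_\lambda(Q)=0,\qquad(\lambda,Q)\in(\lambda_c-\delta,\lambda_c+\delta)\times\mathfrak A,$$ are exactly $$Q=\chi_\lambda\quad\text{or}\quad\begin{cases}\lambda=\lambda(t)\\Q=\chi_{\lambda_c}+t(0,0,h_c)+t^2H_t\end{cases}\text{ for some }t\in(-\varepsilon,\varepsilon),$$ where $\lambda(t)\in(\lambda_c-\delta,\lambda_c+\delta)$ and $H_t\in h_c^\perp$ are smooth functions of $t\in(-\varepsilon,\varepsilon)$. Moreover, writing $H_t=(h_{1,t},h_{2,t},h_{3,t})$, the following symmetry properties are satisfied: $$\lambda(-t)=\lambda(t),\qquad h_{1,-t}=h_{1,t},\quad h_{2,-t}=h_{2,t},\quad h_{3,-t}=-h_{3,t}.$$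
   Context: Here $\theta=-8$ and $q_+=2/3$. A triple $(q_1,q_2,q_3)$ of real functions on $[-1,1]$ is identified with the symmetric traceless matrix-valued map $$Q(x)=\begin{pmatrix}-2q_1(x)&0&0\\0&q_1(x)-q_2(x)&q_3(x)\\0&q_3(x)&q_1(x)+q_2(x)\end{pmatrix}.$$ With $|Q|^2=\mathrm{tr}(Q^2)$, let $$f(Q)=\frac{\theta}{6}|Q|^2-\frac23\mathrm{tr}(Q^3)+\frac18|Q|^4+c(\theta)=\frac{\theta}{3}(3q_1^2+q_2^2+q_3^2)+4q_1(q_1^2-q_2^2-q_3^2)+\frac12(3q_1^2+q_2^2+q_3^2)^2+c(\theta),$$ where the constant $c(\theta)$ is chosen so that $\min f=0$. Let $\mathcal H$ be the affine space of $Q=(q_1,q_2,q_3)\in H^1(-1,1)^3$ with $q_1(\pm1)=q_+$, $q_2(-1)=3q_+$, $q_2(1)=-3q_+$, $q_3(\pm1)=0$. For $\lambda>0$ the energy on $\mathcal H$ is $$E_\lambda(Q)=\int_{-1}^1\left(\frac{1}{2\lambda^2}|Q'|^2+f(Q)\right)dx,$$ with differential $DE_\lambda(Q)\in H^{-1}(-1,1)^3$; $Q$ is critical if $DE_\lambda(Q)=0$. $\mathcal H^{ee}=\{Q\in\mathcal H: q_3\equiv0\}$; its elements are written $(q_1,q_2)$. Smooth means $C^\infty$. For a critical point $\chi_\lambda=(q_1,q_2)\in\mathcal H^{ee}$ of $E_\lambda$, the second variation splits as $D^2E_\lambda(\chi_\lambda)[(h_1,h_2,h_3)]=\Phi_\lambda[h_1,h_2]+\Psi_\lambda[h_3]$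 for $h_i\in H^1_0(-1,1)$, with $$\Phi_\lambda[h_1,h_2]=\int_{-1}^1\Big\{\tfrac{6(h_1')^2+2(h_2')^2}{\lambda^2}+6\left(\tfrac\theta3+2q_1+9q_1^2+q_2^2\right)h_1^2+2\left(\tfrac\theta3-4q_1+3q_1^2+3q_2^2\right)h_2^2+8q_2(3q_1-2)h_1h_2\Big\}dx,$$ $$\Psi_\lambda[h]=\int_{-1}^1\Big\{\tfrac{2(h')^2}{\lambda^2}+2\left(\tfrac\theta3-4q_1+3q_1^2+q_2^2\right)h^2\Big\}dx,$$ $$\nu(\lambda)=\inf_{(h_1,h_2)\ne0}\frac{\Phi_\lambda[h_1,h_2]}{\int(h_1^2+h_2^2)},\qquad\mu(\lambda)=\inf_{h\ne0}\frac{\Psi_\lambda[h]}{\int h^2}$$ (infima over $H^1_0(-1,1)^2$ and $H^1_0(-1,1)$). The operator $\mathcal L_\lambda:H^1_0(-1,1)\to H^{-1}(-1,1)$ is $\mathcal L_\lambda h=-\frac{2}{\lambda^2}h''+2\left(\frac\theta3-4q_1+3q_1^2+q_2^2\right)h$, so $\langle\mathcal L_\lambda h,h\rangle=\Psi_\lambda[h]$. The branch: for all sufficiently small $\lambda>0$, $E_\lambda$ has a unique critical point $\chi_\lambda$ in $\mathcal H$, which lies in $\mathcal H^{ee}$. For $\theta=-8$ this family extends uniquely to a smooth branch $(0,+\infty)\ni\lambda\mapsto\chi_\lambda\in\mathcal H^{ee}$ of critical points of $E_\lambda$ with $\nu(\lambda)>0$ for all $\lambda>0$; along it $\mu$ is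 smooth with $\mu'<0$ everywhere, and $\lambda_c>0$ denotes the value such that $\mu>0$ on $(0,\lambda_c)$, $\mu(\lambda_c)=0$, $\mu'(\lambda_c)<0$. $h_c^\perp\subset H^1_0(-1,1)^3$ denotes the orthogonal complement of $(0,0,h_c)$ in the Hilbert space $H^1_0(-1,1)^3$ (inner product $\int_{-1}^1\sum_i h_i'k_i'\,dx$). *)

(* Defs.v *)
From mathcomp Require Import all_boot all_order all_algebra.
From mathcomp Require Import all_classical all_reals all_analysis.

Set Implicit Arguments.
Unset Strict Implicit.
Unset Printing Implicit Defensive.

Import Order.TTheory GRing.Theory Num.Theory.
Import numFieldNormedType.Exports.

Local Open Scope classical_set_scope.
Local Open Scope ring_scope.

Section Defs.
Context {R : realType}.
Implicit Types (u v g phi h k : R -> R) (lam t a : R).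

Definition theta : R := -8.
Definition qplus : R := 2 / 3.

(* Functions on [-1, 1] are total functions R -> R of which only the values on
   [-1, 1] matter: equality is [eqI], and the Sobolev spaces, forms and
   functionals below are invariant under [eqI]. *)
Definition I11 : set R := `[-1, 1].

Definition eqI u v : Prop := forall x, I11 x -> u x = v x.

Definition integ u : R := \int[lebesgue_measure]_(x in I11) u x.

Definition L2 g : Prop :=
  measurable_fun I11 g /\
  lebesgue_measure.-integrable I11 (fun x => (g x ^+ 2)%:E).

(* C^1 functions on R with compact support in (-1, 1); testing against these
   or against C^infinity functions defines the same weak derivatives. *)
Definition test_fun phi : Prop :=
  [/\ forall x, derivable phi x 1, continuous (derive1 phi) &
      exists2 r : R, r < 1 & forall x, r <= `|x| -> phi x = 0].

Definition weak_deriv u g : Prop :=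
  forall phi, test_fun phi ->
    integ (fun x => u x * derive1 phi x) = - integ (fun x => g x * phi x).

(* An element of H^1(-1,1) is given by its continuous representative on
   [-1, 1], so that boundary values are pointwise values. *)
Definition H1 u : Prop :=
  {within I11, continuous u} /\ exists2 g, L2 g & weak_deriv u g.

Definition H10 u : Prop := [/\ H1 u, u (-1) = 0 & u 1 = 0].

(* A choice of the weak derivative, which is unique up to a null set. *)
Definition wD u : R -> R := xget (fun=> 0) [set g | L2 g /\ weak_deriv u g].

Definition triple : Type := 'I_3 -> R -> R.
Implicit Types Q P : triple.

Definition q1 Q : R -> R := Q (inord 0).
Definition q2 Q : R -> R := Q (inord 1).
Definition q3 Q : R -> R := Q (inord 2).

Definition eq3 Q P : Prop := forall i, eqI (Q i) (P i).

Definition H10_3 : set triple := [set Q | forall i, H10 (Q i)].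

Definition dot3 Q P : R := integ (fun x => \sum_i wD (Q i) x * wD (P i) x).

Definition norm3 Q : R := Num.sqrt (dot3 Q Q).

Definition third h : triple := fun i => if i == inord 2 then h else 0.

Definition orth h : set triple := [set Q | H10_3 Q /\ dot3 Q (third h) = 0].

Definition Qtensor (a b c : R) : 'M[R]_3 :=
  \matrix_(i < 3, j < 3)
    nth 0 (nth [::] [:: [:: - 2 * a; 0; 0];
                        [:: 0; a - b; c];
                        [:: 0; c; a + b]] i) j.

Definition sqnorm (M : 'M[R]_3) : R := \tr (M *m M).

Definition fbulk0 (M : 'M[R]_3) : R :=
  theta / 6 * sqnorm M - 2 / 3 * \tr (M *m M *m M) + 1 / 8 * sqnorm M ^+ 2.

(* The additive constant normalizing the minimum of [fbulk] over symmetric traceless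
   matrices to 0. *)
Definition ctheta : R :=
  - inf [set fbulk0 M | M in [set M : 'M[R]_3 | M^T = M /\ \tr M = 0]].

Definition fbulk (M : 'M[R]_3) : R := fbulk0 M + ctheta.

Definition cH : set triple := [set Q |
  [/\ forall i, H1 (Q i),
      q1 Q (-1) = qplus /\ q1 Q 1 = qplus,
      q2 Q (-1) = 3 * qplus /\ q2 Q 1 = - 3 * qplus &
      q3 Q (-1) = 0 /\ q3 Q 1 = 0]].

Definition cHee : set triple := [set Q | cH Q /\ eqI (q3 Q) 0].

Definition energy lam Q : R :=
  integ (fun x =>
    1 / (2 * lam ^+ 2) *
      sqnorm (Qtensor (wD (q1 Q) x) (wD (q2 Q) x) (wD (q3 Q) x)) +
    fbulk (Qtensor (q1 Q x) (q2 Q x) (q3 Q x))).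

(* L, a continuous linear form on H^1_0(-1,1)^3, is the Frechet differential
   DE_lam(Q) of E_lam on the affine space cH. *)
Definition is_DE lam Q (L : triple -> R) : Prop :=
  [/\ forall a (h k : triple), H10_3 h -> H10_3 k ->
        L (a *: h + k) = a * L h + L k,
      exists C : R, forall h : triple, H10_3 h -> `|L h| <= C * norm3 h &
      forall e : R, 0 < e -> exists2 d : R, 0 < d &
        forall h : triple, H10_3 h -> norm3 h < d ->
          `|energy lam (Q + h) - energy lam Q - L h| <= e * norm3 h].

Definition critical lam Q : Prop := cH Q /\ is_DE lam Q (fun=> 0).

(* cH is an affine space directed by the Hilbert space H^1_0(-1,1)^3, whose
   norm defines its topology. *)
Definition nbhd_in_cH Q (A : set triple) : Prop :=
  A `<=` cH /\
  exists2 r : R, 0 < r & forall P, cH P -> norm3 (P - Q) < r -> A P.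

(* [smooth3 J u]: on the open set J, u is a C^infinity curve in cH or in
   H^1_0(-1,1)^3; D n is its n-th derivative. *)
Definition curve_deriv (u : R -> triple) t (v : triple) : Prop :=
  H10_3 v /\
  (fun s => norm3 (s^-1 *: (u (s + t) - u t) - v)) @ 0^' --> (0 : R).

Definition smooth3 (J : set R) (u : R -> triple) : Prop :=
  exists D : nat -> R -> triple,
    D 0%N = u /\ forall n t, J t -> curve_deriv (D n) t (D n.+1 t).

Definition smooth (J : set R) u : Prop :=
  forall n t, J t -> derivable (derive1n n u) t 1.

(* [Phi] and [Psi] are the two parts of the second variation of E_lam at a
   critical point Q with q_3 = 0. *)

Definition Phi lam Q h k : R :=
  integ (fun x =>
    (6 * wD h x ^+ 2 + 2 * wD k x ^+ 2) / lam ^+ 2 +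
    6 * (theta / 3 + 2 * q1 Q x + 9 * q1 Q x ^+ 2 + q2 Q x ^+ 2) * h x ^+ 2 +
    2 * (theta / 3 - 4 * q1 Q x + 3 * q1 Q x ^+ 2 + 3 * q2 Q x ^+ 2)
      * k x ^+ 2 +
    8 * q2 Q x * (3 * q1 Q x - 2) * h x * k x).

(* The element L_lam h of H^-1(-1,1), as a form on H^1_0(-1,1); h'' is a
   distributional derivative. *)
Definition opL lam Q h : (R -> R) -> R := fun k =>
  integ (fun x =>
    2 / lam ^+ 2 * wD h x * wD k x +
    2 * (theta / 3 - 4 * q1 Q x + 3 * q1 Q x ^+ 2 + q2 Q x ^+ 2)
      * h x * k x).

Definition kerL lam Q : set (R -> R) :=
  [set h | H10 h /\ forall k, H10 k -> opL lam Q h k = 0].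

Definition Psi lam Q h : R :=
  integ (fun x =>
    2 * wD h x ^+ 2 / lam ^+ 2 +
    2 * (theta / 3 - 4 * q1 Q x + 3 * q1 Q x ^+ 2 + q2 Q x ^+ 2) * h x ^+ 2).

Section Branch.
Variable chi : R -> triple.

Definition nu lam : R :=
  inf [set Phi lam (chi lam) h.1 h.2 / integ (fun x => h.1 x ^+ 2 + h.2 x ^+ 2)
      | h in [set h : (R -> R) * (R -> R) |
          [/\ H10 h.1, H10 h.2 & ~ (eqI h.1 0 /\ eqI h.2 0)]]].

Definition mu lam : R :=
  inf [set Psi lam (chi lam) h / integ (fun x => h x ^+ 2)
      | h in [set h | H10 h /\ ~ eqI h 0]].

Definition is_branch : Prop :=
  [/\ exists2 lam0 : R, 0 < lam0 & forall lam, 0 < lam < lam0 ->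
        forall Q, critical lam Q <-> eq3 Q (chi lam),
      forall lam, 0 < lam -> cHee (chi lam) /\ critical lam (chi lam),
      smooth3 [set lam | 0 < lam] chi &
      forall lam, 0 < lam -> 0 < nu lam].

Definition mu_decreasing : Prop :=
  smooth [set lam | 0 < lam] mu /\ forall lam, 0 < lam -> derive1 mu lam < 0.

Definition is_lambda_c lamc : Prop :=
  [/\ 0 < lamc, forall lam, 0 < lam < lamc -> 0 < mu lam,
      mu lamc = 0 & derive1 mu lamc < 0].

End Branch.
End Defs.

Arguments triple : clear implicits.

(* Main.v *)
Require Import Defs.
From mathcomp Require Import all_boot all_order all_algebra.
From mathcomp Require Import all_classical all_reals all_analysis.
From mathcomp Require Import measurable_realfun.
From mathcomp Require Import ring lra.
Set Implicit Arguments.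
Unset Strict Implicit.
Unset Printing Implicit Defensive.
Import Order.TTheory GRing.Theory Num.Theory.
Import numFieldNormedType.Exports.
Local Open Scope classical_set_scope.
Local Open Scope ring_scope.

(** The energy is quadratic in Q' and polynomial in Q, so a map is critical exactly when it
    is a classical solution of the Euler-Lagrange system ([critical_sol]). The plane q1 =
    2/3 is invariant for that system. A critical point close to this plane lies in it,
    because the equation for q1 - 2/3 is then coercive ([critical_near_planar]); and the
    whole branch lies in it, because nu > 0 isolates the plane along the branch and small
    values of lambda force it ([branch_q1]). The problem becomes (q2, q3)'' = lambda^2 (q2^2
    + q3^2 - 4) (q2, q3).

    Let c = q2 of chi at lambda_c. In the unknowns lambda = lambda_c + l, q2 = c + y2 and q3
    = t (h_c + y3), with y3 transverse to h_c, the second equation depends on t only through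
    s = t^2, and the third can be divided by t. What is left is a linear system [Srel] for
    (l, y2, y3), perturbed by a remainder [Gw] of order two when s counts for two. The
    linear system is uniquely solvable ([Srel_solve]): its second equation is nondegenerate
    since nu > 0, its third one is solvable under the Fredholm alternative, and l is the
    multiplier that meets the Fredholm condition. The coefficient of l in that condition is
    nonzero because it is a positive multiple of mu'(lambda_c), which is where mu'(lambda_c)
    < 0 enters ([transversality]): lambda^2 (Psi[h_c] - mu int h_c^2) is nonnegative and
    vanishes at lambda_c, so its derivative vanishes there.

    Inverting the linear system leaves a fixed point equation with a contraction. The
    remainder is a polynomial, so the contraction can be run on polynomials in s whose
    coefficients are functions of x, with a weighted l1 norm; the limit is a power series in
    s, and it gives the only small solution for each s ([analytic_fixed_point]). Setting s =
    t^2 yields curves that are power series in t for the H1 norm, hence smooth, and that are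
    even in t up to the explicit factor t in q3; the symmetries follow
    ([bifurcation_curve]).

    Conversely, let Q be a critical point near chi at lambda_c, and t its component along
    h_c. If t = 0, the third equation forces q3 = 0, and the second one, nondegenerate,
    forces Q = chi_lambda ([on_branch]). If t is nonzero, an a priori estimate on the third
    equation divided by t shows that q3 / t stays close to h_c ([off_branch]); then (l, y2,
    y3) is small, and uniqueness of the fixed point puts Q on the curve. *)

(** * Calculus on the line *)

Section Calculus.
Context {R : realType}.
Implicit Types (f g u v w F : R -> R) (x y a b : R).

(** Power series and energies are differentiated through second-order expansions; this turns
    such an expansion into a derivative. *)
Lemma is_derive_quad F x d C e : 0 < e ->
  (forall h, `|h| < e -> `|F (x + h) - F x - h * d| <= C * h ^+ 2) ->
  is_derive x 1 F d.
Proof.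
move=> e0 H.
have C0 : 0 <= C.
  have e2 : 0 < e / 2 by lra.
  have := H (e / 2); rewrite gtr0_norm // => /(_ ltac:(lra)) /(le_trans (normr_ge0 _)).
  by rewrite pmulr_lge0 // exprn_gt0.
have cv : (fun h => h^-1 *: (F (h *: 1 + x) - F x)) @ 0^' --> d.
  apply/cvgrPdist_le => eps eps0.
  near=> h.
  have h0 : h != 0 by near: h; exact: nbhs_dnbhs_neq.
  have he : `|h| < e.
    by near: h; apply: dnbhs0_lt.
  have hC : `|h| <= eps / (C + 1).
    near: h; apply: dnbhs0_le.
    by apply: divr_gt0 => //; lra.
  have -> : d - h^-1 *: (F (h *: 1 + x) - F x) =
     - (h^-1 * (F (x + h) - F x - h * d)).
    rewrite /GRing.scale /= mulr1 (addrC h x); field.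
    by [].
  rewrite normrN normrM normfV ler_pdivrMl ?normr_gt0//.
  apply: le_trans (H _ he) _.
  rewrite -real_normK ?num_real// expr2 mulrCA ler_wpM2l//.
  rewrite ler_pdivlMr in hC; last by lra.
  have := normr_ge0 h; nra.
apply: DeriveDef; first by apply/cvg_ex; exists d.
by rewrite /derive; apply: cvg_lim.
Unshelve. all: by end_near.
Qed.

(** Clamping to [-1, 1]: composing with it extends a function continuous on [-1, 1] to one
    continuous on the line, where derivatives at the end points make sense. *)
Definition cl x : R := Num.max (-1) (Num.min x 1).

Lemma cl_itv x : -1 <= cl x <= 1.
Proof. by rewrite /cl le_max ge_max ge_min lexx lexx orbT; apply/andP; split=> //; lra. Qed.

Lemma cl_I11 x : I11 (cl x).
Proof. by rewrite /I11 /= in_itv /= cl_itv. Qed.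

Lemma cl_id x : -1 <= x <= 1 -> cl x = x.
Proof. by move=> /andP[h1 h2]; rewrite /cl (min_idPl h2) (max_idPr h1). Qed.

Lemma I11P x : I11 x <-> -1 <= x <= 1.
Proof. by rewrite /I11 /= in_itv. Qed.

Lemma cl_idI x : I11 x -> cl x = x.
Proof. by move/I11P/cl_id. Qed.

Lemma cl_cl x : cl (cl x) = cl x.
Proof. by apply: cl_idI; exact: cl_I11. Qed.

Lemma continuous_cl : continuous cl.
Proof.
move=> x.
have h2 : {for x, continuous ((@id R) \min cst 1)}.
  by apply: continuous_min; [exact: cvg_id|exact: cst_continuous].
exact: (continuous_max (@cst_continuous R R (-1) x) h2).
Qed.

Lemma continuous_comp_cl f : {within I11, continuous f} -> continuous (f \o cl).
Proof.
move=> cf x.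
apply/cvgrPdist_lt => e e0.
have := cf (cl x) => /cvgrPdist_lt /(_ e e0).
rewrite {1}/nbhs /= -nbhs_subspace_in; last exact: cl_I11.
rewrite /within /= => H.
have := continuous_cl H; rewrite /nbhs /= => -[d d0 Hd].
exists d => // y xy; apply: (Hd y xy); exact: cl_I11.
Qed.

(** The primitive of w that vanishes at -1, on both sides of -1; one of the two integrals is
    over an empty segment. *)
Definition J w x : R :=
  \int[lebesgue_measure]_(t in `[-1, x]) w t -
  \int[lebesgue_measure]_(t in `[x, -1]) w t.

Lemma integrable_seg w a b : continuous w ->
  lebesgue_measure.-integrable `[a, b] (EFin \o w).
Proof.
move=> cw; apply: continuous_compact_integrable; first exact: segment_compact.
exact: continuous_subspaceT.
Qed.

Lemma Rint_empty w a b : b <= a -> \int[lebesgue_measure]_(t in `[a, b]) w t = 0.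
Proof.
rewrite le_eqVlt => /orP[/eqP ->|ba]; first by rewrite set_itv1 Rintegral_set1.
by rewrite set_itv_ge ?Rintegral_set0// bnd_simp -ltNge.
Qed.

Lemma Rint_sub w a x y : continuous w -> a <= x -> x <= y ->
  \int[lebesgue_measure]_(t in `[a, y]) w t -
  \int[lebesgue_measure]_(t in `[a, x]) w t =
  \int[lebesgue_measure]_(t in `[x, y]) w t.
Proof.
move=> cw ax xy; rewrite Rintegral_itvB ?bnd_simp//; last exact: integrable_seg.
rewrite Rintegral_itv_obnd_cbnd//.
apply: (@integrableS _ _ _ lebesgue_measure `[x, y]%classic) => //; last exact: integrable_seg.
by apply: subset_itvr; rewrite bnd_simp.
Qed.

(** Fundamental theorems of calculus hold to the right of a base point, so the primitive is
    based at an arbitrary point a to the left of -1. *)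
Lemma J_base w a x : continuous w -> a <= -1 -> a <= x ->
  J w x = \int[lebesgue_measure]_(t in `[a, x]) w t -
          \int[lebesgue_measure]_(t in `[a, -1]) w t.
Proof.
move=> cw a1 ax; rewrite /J; have [h|h] := leP x (-1).
  rewrite (@Rint_empty w (-1) x)// sub0r -(@Rint_sub w a x (-1))//.
  by rewrite opprB.
by rewrite (@Rint_empty w x (-1)) ?(ltW h)// subr0 (@Rint_sub w a)// ltW.
Qed.

Lemma derive1_is_derive F x d :
  derivable F x 1 -> derive1 F x = d -> is_derive x 1 F d.
Proof. by move=> dF E; apply: DeriveDef => //; rewrite -E derive1E. Qed.

Lemma is_derive_J w x : continuous w -> is_derive x 1 (J w) (w x).
Proof.
move=> cw.
pose a := Num.min x (-1) - 1.
have ax : a < x by rewrite /a ltrBlDr; rewrite gt_min ltrDl ltr01.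
have a1 : a <= -1 by rewrite /a lerBlDr ge_min; apply/orP; right; lra.
have x1 : x < x + 1 by rewrite ltrDl.
have [G GE dG] : exists2 G : R -> R,
    (forall y, G y = \int[lebesgue_measure]_(t in `[a, y]) w t) &
    is_derive x 1 G (w x).
  eexists; last first.
    have [dG G1] := continuous_FTC1_closed x1 (integrable_seg _ _ cw) ax (cw x).
    exact: (derive1_is_derive dG G1).
  by [].
pose c := G (-1).
have H : \forall y \near x, G y - c = J w y.
  near=> y; rewrite (@J_base w a y)// /c ?GE//.
  by apply: ltW; near: y; exact: lt_nbhsr.
apply: (near_eq_is_derive H).
by rewrite -[w x]subr0; apply: is_deriveB.
Unshelve. all: by end_near.
Qed.

Lemma J_N1 w : J w (-1) = 0.
Proof. by rewrite /J subrr. Qed.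

Lemma is_derive_cont F f : (forall x, is_derive x 1 F (f x)) -> continuous F.
Proof.
move=> dF x; apply: differentiable_continuous; apply/derivable1_diffP.
by have [] := dF x.
Qed.

Lemma deriv_mono F f a b : (forall x, is_derive x 1 F (f x)) -> a <= b ->
  (forall x, a <= x <= b -> 0 <= f x) -> F a <= F b.
Proof.
move=> dF; rewrite le_eqVlt => /orP[/eqP ->//|ab] f0.
have [c /itvP cab] := MVT ab (fun x _ => dF x)
   (continuous_subspaceT (is_derive_cont dF)).
move=> E; rewrite -subr_ge0 E mulr_ge0 ?subr_ge0 ?(ltW ab)// f0//.
by rewrite !cab.
Qed.

Lemma deriv0_cst F f a b : (forall x, is_derive x 1 F (f x)) -> a <= b ->
  (forall x, a <= x <= b -> f x = 0) -> F a = F b.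
Proof.
move=> dF ab f0; apply/eqP; rewrite eq_le (deriv_mono dF) ?andTb//; last first.
  by move=> x /f0 ->.
have dN x : is_derive x 1 (- F) (- f x) by apply: is_deriveN.
have := @deriv_mono (- F) (fun x => - f x) a b dN ab.
by rewrite lerN2; apply => x /f0 ->; rewrite oppr0.
Qed.

Lemma FTC2 F f a b : (forall x, is_derive x 1 F (f x)) -> continuous f ->
  a <= b -> \int[lebesgue_measure]_(t in `[a, b]) f t = F b - F a.
Proof.
move=> dF cf; rewrite le_eqVlt => /orP[/eqP ->|ab].
  by rewrite Rint_empty// subrr.
rewrite /Rintegral (@continuous_FTC2 _ f F)//.
- exact: continuous_subspaceT.
- have cF := is_derive_cont dF; split.
  + by move=> x _; have [] := dF x.
  + exact: cvg_at_right_filter (cF a).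
  + exact: cvg_at_left_filter (cF b).
- by move=> x _; rewrite derive1E; apply: derive_val.
Qed.

End Calculus.

(** * Integrals and the L2 pairing on [-1, 1] *)

Section Integrals.
Context {R : realType}.
Implicit Types (f g k u v w F : R -> R) (x y a b M : R).

Definition itg f := lebesgue_measure.-integrable (@I11 R) (EFin \o f).

Lemma measurable_I11 : measurable (@I11 R : set (measurableTypeR R)).
Proof. exact: measurable_itv. Qed.
Hint Resolve measurable_I11 : core.

Lemma integ_eq f g : (forall x, I11 x -> f x = g x) -> integ f = integ g.
Proof. by move=> H; apply: eq_Rintegral => x; rewrite inE => /H. Qed.

Lemma itg_eq f g : (forall x, I11 x -> f x = g x) -> itg f -> itg g.
Proof.
by move=> H; apply: eq_integrable => // x; rewrite inE => xI; rewrite /= (H x xI).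
Qed.

Lemma itg_cont f : {within I11, continuous f} -> itg f.
Proof. by move=> cf; apply: continuous_compact_integrable => //; exact: segment_compact. Qed.

Lemma itgD f g : itg f -> itg g -> itg (fun x => f x + g x).
Proof.
move=> itf itg_; have := integrableD measurable_I11 itf itg_.
by apply: eq_integrable => // x _ /=; rewrite EFinD.
Qed.

Lemma itgZ a f : itg f -> itg (fun x => a * f x).
Proof.
move=> itf; have := integrableZl measurable_I11 a itf.
by apply: eq_integrable => // x _ /=; rewrite EFinM.
Qed.

Lemma itgN f : itg f -> itg (fun x => - f x).
Proof. by move=> /(itgZ (-1)); apply: itg_eq => x _; rewrite mulN1r. Qed.

Lemma itgB f g : itg f -> itg g -> itg (fun x => f x - g x).
Proof. by move=> h1 h2; apply: itgD h1 (itgN h2). Qed.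

Lemma integD f g : itg f -> itg g ->
  integ (fun x => f x + g x) = integ f + integ g.
Proof. exact: RintegralD. Qed.

Lemma integZ a f : itg f -> integ (fun x => a * f x) = a * integ f.
Proof. exact: RintegralZl. Qed.

Lemma integN f : itg f -> integ (fun x => - f x) = - integ f.
Proof.
move=> itf; rewrite -mulN1r -integZ//; apply: integ_eq => x _.
by rewrite mulN1r.
Qed.

Lemma integB f g : itg f -> itg g ->
  integ (fun x => f x - g x) = integ f - integ g.
Proof. exact: RintegralB. Qed.

Lemma integ_ge0 f : (forall x, I11 x -> 0 <= f x) -> 0 <= integ f.
Proof. by move=> H; apply: Rintegral_ge0. Qed.

Lemma integ_le f g : itg f -> itg g -> (forall x, I11 x -> f x <= g x) ->
  integ f <= integ g.
Proof. exact: le_Rintegral. Qed.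

Lemma integ_cst a : integ (fun=> a) = 2 * a.
Proof.
rewrite /integ Rintegral_cst//.
have H : lebesgue_measure (@I11 R) = 2%:E.
  have := @lebesgue_measure_itv R `[(-1), 1]; rewrite /= lte_fin ifT; last by lra.
  by rewrite -EFinD opprK => ->.
rewrite mulrC; congr (_ * _); exact: (congr1 fine H).
Qed.

Lemma itg_cst a : itg (fun=> a).
Proof. by apply: itg_cont; apply: continuous_subspaceT => x; exact: cst_continuous. Qed.

Lemma integ_bound f M : itg f -> (forall x, I11 x -> `|f x| <= M) ->
  `|integ f| <= 2 * M.
Proof.
move=> itf fM; rewrite ler_norml -mulrN -!integ_cst; apply/andP; split.
  by apply: integ_le => // [|x /fM]; [exact: itg_cst|rewrite ler_norml => /andP[]].
by apply: integ_le => // [|x /fM]; [exact: itg_cst|rewrite ler_norml => /andP[]].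
Qed.

Lemma itg_measurable f : itg f -> measurable_fun (@I11 R) f.
Proof. by move=> /measurable_int /measurable_EFinP. Qed.

Lemma itg_dom f g : measurable_fun (@I11 R) f -> itg g ->
  (forall x, I11 x -> `|f x| <= g x) -> itg f.
Proof.
move=> mf itg_ fg; apply: le_integrable itg_ => //; first exact/measurable_EFinP.
move=> x xI /=; rewrite lee_fin; apply: (le_trans (fg x xI)); exact: ler_norm.
Qed.

Definition ip f g := integ (fun x => f x * g x).

Lemma L2M f g : L2 f -> L2 g -> itg (fun x => f x * g x).
Proof.
move=> [mf if2] [mg ig2]; apply: (@itg_dom _ (fun x => f x ^+ 2 + g x ^+ 2)).
- exact: measurable_funM.
- exact: (itgD if2 ig2).
- move=> x _; rewrite ler_norml; have h1 := sqr_ge0 (f x + g x).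
  have h2 := sqr_ge0 (f x - g x); apply/andP; split; nra.
Qed.

Lemma L2D f g : L2 f -> L2 g -> L2 (fun x => f x + g x).
Proof.
move=> Lf Lg; have fg := L2M Lf Lg; move: Lf Lg => [mf if2] [mg ig2]; split.
  exact: measurable_funD.
have := itgD (itgD if2 ig2) (itgZ 2 fg); apply: itg_eq => x _; ring.
Qed.

Lemma L2Z a f : L2 f -> L2 (fun x => a * f x).
Proof.
move=> [mf if2]; split; first exact: measurable_funM.
by have := itgZ (a ^+ 2) if2; apply: itg_eq => x _; ring.
Qed.

Lemma L2_eq f g : (forall x, I11 x -> f x = g x) -> L2 f -> L2 g.
Proof.
move=> H [mf if2]; split.
  by apply: eq_measurable_fun mf => x; rewrite inE => /H.
by have := if2; apply: itg_eq => x xI; rewrite H.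
Qed.

Lemma L2N f : L2 f -> L2 (fun x => - f x).
Proof. by move=> /(L2Z (-1)); apply: L2_eq => x _; ring. Qed.

Lemma L2B f g : L2 f -> L2 g -> L2 (fun x => f x - g x).
Proof. by move=> h1 h2; apply: L2D h1 (L2N h2). Qed.

Lemma L2_bounded f M : measurable_fun (@I11 R) f ->
  (forall x, I11 x -> `|f x| <= M) -> L2 f.
Proof.
move=> mf fM; split => //; apply: (@itg_dom _ (fun=> M ^+ 2)).
- exact: measurable_funX.
- exact: itg_cst.
- move=> x xI; rewrite normrX; have := fM x xI; have := normr_ge0 (f x).
  by move=> h1 h2; rewrite ler_pXn2r// nnegrE (le_trans h1).
Qed.

Lemma within_bounded f : {within I11, continuous f} ->
  exists2 M, 0 < M & forall x, I11 x -> `|f x| <= M.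
Proof.
move=> cf; have cn : {within I11, continuous (fun x => `|f x|)}.
  by move=> x; apply: (@cvg_norm _ _ _ (nbhs x)); exact: cf.
have h : (-1 : R) <= 1 by lra.
have [c _ Hc] := EVT_max h cn.
exists (`|f c| + 1); first by have := normr_ge0 (f c); lra.
by move=> x xI; apply: (le_trans (Hc x _)) => //; lra.
Qed.

Lemma L2_cont f : {within I11, continuous f} -> L2 f.
Proof.
move=> cf; have [M _ fM] := within_bounded cf.
by apply: (L2_bounded _ fM); apply: itg_measurable; exact: itg_cont.
Qed.

Lemma L2_itg f : L2 f -> itg f.
Proof.
move=> Lf; have L1 : L2 (fun=> 1 : R).
  by apply: (@L2_bounded _ 1) => [|x _]; [apply: itg_measurable; exact: itg_cst|rewrite normr1].
by apply: itg_eq (L2M Lf L1) => x _; rewrite mulr1.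
Qed.

Lemma ipC f g : ip f g = ip g f.
Proof. by apply: integ_eq => x _; rewrite mulrC. Qed.

Lemma ipDl f g k : L2 f -> L2 g -> L2 k -> ip (fun x => f x + g x) k = ip f k + ip g k.
Proof.
move=> h1 h2 h3; rewrite /ip -integD; try exact: L2M.
by apply: integ_eq => x _; ring.
Qed.

Lemma ipZl a f k : L2 f -> L2 k -> ip (fun x => a * f x) k = a * ip f k.
Proof.
move=> h1 h2; rewrite /ip -integZ; last exact: L2M.
by apply: integ_eq => x _; ring.
Qed.

Lemma ipBl f g k : L2 f -> L2 g -> L2 k -> ip (fun x => f x - g x) k = ip f k - ip g k.
Proof.
move=> h1 h2 h3; rewrite /ip -integB; try exact: L2M.
by apply: integ_eq => x _; ring.
Qed.

Lemma ip_eq f f' g g' : (forall x, I11 x -> f x = f' x) ->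
  (forall x, I11 x -> g x = g' x) -> ip f g = ip f' g'.
Proof. by move=> h1 h2; apply: integ_eq => x xI; rewrite h1// h2. Qed.

Lemma ip_ge0 f : 0 <= ip f f.
Proof. by apply: integ_ge0 => x _; rewrite -expr2 sqr_ge0. Qed.

(** For C > 0 evaluate at the minimum t = - B / C; for C = 0 a nonnegative affine function
    is constant. *)
Lemma quad_disc (A B C : R) : 0 <= A -> 0 <= C -> (forall t, 0 <= A + 2 * t * B + t ^+ 2 * C) ->
  B ^+ 2 <= A * C.
Proof.
move=> A0 + H; rewrite le_eqVlt => /orP[/eqP C0|C0]; last first.
  have := H (- B / C).
  have -> : A + 2 * (- B / C) * B + (- B / C) ^+ 2 * C = A - B ^+ 2 / C.
    by field; rewrite gt_eqF.
  by rewrite subr_ge0 ler_pdivrMr.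
rewrite -C0 mulr0.
have [->|B0] := eqVneq B 0; first by rewrite expr0n.
have := H (- (A + 1) / (2 * B)); rewrite -C0 mulr0 addr0.
have -> : A + 2 * (- (A + 1) / (2 * B)) * B = -1 by field.
by rewrite ler0N1.
Qed.

(** The quadratic polynomial t -> ip (f + t g) (f + t g) is nonnegative, so its discriminant
    is not positive. *)
Lemma ip_CS f g : L2 f -> L2 g -> ip f g ^+ 2 <= ip f f * ip g g.
Proof.
move=> Lf Lg.
have H t : 0 <= ip f f + 2 * t * ip f g + t ^+ 2 * ip g g.
  have -> : ip f f + 2 * t * ip f g + t ^+ 2 * ip g g =
     ip (fun x => f x + t * g x) (fun x => f x + t * g x).
    have Lt := L2Z t Lg.
    rewrite ipDl//; last exact: L2D.
    rewrite [X in _ = X + _]ipC [X in _ = _ + X]ipC !ipDl// !(ipC _ (fun x => t * g x)).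
    rewrite !ipZl// (ipC g (fun x => t * g x)) ipZl// (ipC g f); ring.
  exact: ip_ge0.
exact: quad_disc (ip_ge0 f) (ip_ge0 g) H.
Qed.

Lemma L2_indic (A : set R) : measurable A -> L2 (\1_A : R -> R).
Proof.
move=> mA; apply: (@L2_bounded _ 1).
  by apply: measurable_funTS; exact: measurable_indic.
by move=> x _; rewrite indicE; case: (x \in A); rewrite ?normr1 ?normr0.
Qed.

End Integrals.
#[global] Hint Resolve measurable_I11 : core.

(** * Cut-off functions *)

Section Cutoff.
Context {R : realType}.
Implicit Types (f g k u v w F psi : R -> R) (x y a b M eps : R).

Definition pos_sq y : R := Num.max 0 y ^+ 2.

Lemma is_derive_pos_sq y : is_derive y 1 pos_sq (2 * Num.max 0 y).
Proof.
apply: (@is_derive_quad _ _ _ _ 1 1) => // h _; rewrite mul1r /pos_sq.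
by rewrite ler_norml; have [h1|h1] := leP 0 y; have [h2|h2] := leP 0 (y + h);
  apply/andP; split; nra.
Qed.

(** The hat function supported in [-1, 1], as a combination of ramps. *)
Definition tent y : R := Num.max 0 (y + 1) - 2 * Num.max 0 y + Num.max 0 (y - 1).

(** A C^1 transition from 0 to 1 with derivative [tent]; squares of ramps make it C^1, which
    is the regularity asked of test functions. *)
Definition step y : R := (pos_sq (y + 1) - 2 * pos_sq y + pos_sq (y - 1)) / 2.

Lemma is_derive_affine F f (p q : R) x : (forall x, is_derive x 1 F (f x)) ->
  is_derive x 1 (fun x => F (p * x + q)) (p * f (p * x + q)).
Proof.
move=> dF; have d1 : is_derive x 1 (fun x => p * x + q) p.
  have -> : (fun x => p * x + q) = (p \*: (@id R)) + cst q by apply/funext.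
  by apply: is_derive_eq; rewrite addr0 /GRing.scale /= mulr1.
have d2 : is_derive ((fun x => p * x + q) x) 1 F (f (p * x + q)) by exact: dF.
have := @is_derive1_comp _ F (fun x => p * x + q) x _ _ d2 d1; rewrite /comp /=.
by move=> H; apply: is_derive_eq; rewrite /GRing.scale /= mulrC.
Qed.

Lemma is_derive_step y : is_derive y 1 step (tent y).
Proof.
have d1 := is_derive_affine 1 1 y is_derive_pos_sq.
have d2 := is_derive_affine 1 (-1) y is_derive_pos_sq.
have d0 := is_derive_pos_sq y.
have -> : step = 2^-1 \*: ((fun x => pos_sq (1 * x + 1)) - 2 \*: pos_sq + (fun x => pos_sq (1 * x + -1))).
  by apply/funext => x; rewrite /step !fctE /GRing.scale /= !mul1r mulrC.
apply: is_derive_eq; by rewrite /tent !mul1r /GRing.scale /=; field.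
Qed.

Lemma tent_ge0 y : 0 <= tent y.
Proof.
by rewrite /tent; case: (leP 0 (y+1)) => h1; case: (leP 0 y) => h2; case: (leP 0 (y-1)) => h3; lra.
Qed.

Lemma tent_out y : 1 <= `|y| -> tent y = 0.
Proof.
rewrite /tent; case: (leP 0 y) => h2; first rewrite (ger0_norm h2) => h.
  by case: (leP 0 (y+1)) => h1; case: (leP 0 (y-1)) => h3; lra.
rewrite (ltr0_norm h2) => h.
by case: (leP 0 (y+1)) => h1; case: (leP 0 (y-1)) => h3; lra.
Qed.

Lemma step_lo y : y <= -1 -> step y = 0.
Proof.
move=> h; rewrite /step /pos_sq.
rewrite (max_idPl _ : Num.max 0 (y + 1) = 0); last by lra.
rewrite (max_idPl _ : Num.max 0 y = 0); last by lra.
rewrite (max_idPl _ : Num.max 0 (y - 1) = 0); last by lra.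
by rewrite expr0n /= mulr0 subrr addr0 mul0r.
Qed.

Lemma step_hi y : 1 <= y -> step y = 1.
Proof.
move=> h; rewrite /step /pos_sq.
by case: (leP 0 (y+1)) => h1; case: (leP 0 y) => h2; case: (leP 0 (y-1)) => h3;
  (try lra); field.
Qed.

Lemma step_itv y : 0 <= step y <= 1.
Proof.
rewrite /step /pos_sq.
by case: (leP 0 (y+1)) => h1; case: (leP 0 y) => h2; case: (leP 0 (y-1)) => h3;
  (try lra); apply/andP; split; nra.
Qed.

Lemma continuous_tent : continuous tent.
Proof.
have cm (p : R) : continuous (fun y : R => Num.max 0 (y + p)).
  move=> x; apply: (@continuous_max _ _ (cst 0) (fun y => y + p) x).
    exact: cst_continuous.
  by apply: cvgD; [exact: cvg_id|exact: cvg_cst].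
move=> x; apply: cvgD; last exact: (cm (-1) x).
apply: cvgB; first exact: (cm 1 x).
apply: cvgM; first exact: cvg_cst.
by apply: (@continuous_max _ _ (cst 0) id x); [exact: cst_continuous|exact: cvg_id].
Qed.

(** The transition from 0 to 1 moved to [a + eps, a + 3 eps], hence strictly to the right of
    a. *)
Definition up eps a x : R := step ((x - a) / eps - 2).
Definition up' eps a x : R := tent ((x - a) / eps - 2) / eps.

Lemma is_derive_up eps a x : is_derive x 1 (up eps a) (up' eps a x).
Proof.
have := is_derive_affine (eps^-1) (- a / eps - 2) x is_derive_step.
have E z : eps^-1 * z + (- a / eps - 2) = (z - a) / eps - 2 by ring.
have -> : (fun z => step (eps^-1 * z + (- a / eps - 2))) = up eps a.
  by apply/funext => z; rewrite E.
by rewrite E mulrC.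
Qed.

Lemma continuous_up' eps a : continuous (up' eps a).
Proof.
move=> x; apply: cvgM; last exact: cvg_cst.
have h : {for x, continuous (fun z : R => (z - a) / eps - 2)}.
  apply: cvgB; last exact: cvg_cst.
  apply: cvgM; last exact: cvg_cst.
  by apply: cvgB; [exact: cvg_id|exact: cvg_cst].
exact: (@continuous_comp _ _ _ (fun z : R => (z - a) / eps - 2) tent x h (@continuous_tent _)).
Qed.

Lemma up_lo eps a x : 0 < eps -> x <= a + eps -> up eps a x = 0.
Proof. by move=> e0 h; apply: step_lo; rewrite lerBlDr ler_pdivrMr//; lra. Qed.

Lemma up_hi eps a x : 0 < eps -> a + 3 * eps <= x -> up eps a x = 1.
Proof. by move=> e0 h; apply: step_hi; rewrite lerBrDr ler_pdivlMr//; lra. Qed.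

Lemma up'_out eps a x : 0 < eps -> ~~ (a + eps <= x <= a + 3 * eps) -> up' eps a x = 0.
Proof.
move=> e0 h; rewrite /up' tent_out ?mul0r//.
move: h; rewrite negb_and -!ltNge => /orP[h|h].
  rewrite ltr0_norm; last by rewrite subr_lt0 ltr_pdivrMr//; lra.
  by rewrite lerNr lerBlDr ler_pdivrMr//; lra.
rewrite gtr0_norm; last by rewrite subr_gt0 ltr_pdivlMr//; lra.
by rewrite lerBrDr ler_pdivlMr//; lra.
Qed.

Lemma up'_ge0 eps a x : 0 < eps -> 0 <= up' eps a x.
Proof. by move=> e0; rewrite divr_ge0 ?tent_ge0// ltW. Qed.

Lemma integ_FTC F f : (forall x, is_derive x 1 F (f x)) -> continuous f ->
  integ f = F 1 - F (-1).
Proof. by move=> dF cf; rewrite /integ /I11 (FTC2 dF cf)//; lra. Qed.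

Lemma integ_up' eps a : 0 < eps -> -1 <= a -> a + 3 * eps <= 1 -> integ (up' eps a) = 1.
Proof.
move=> e0 a1 a2; rewrite (integ_FTC (is_derive_up eps a) (@continuous_up' eps a)).
by rewrite up_hi// up_lo// ?subr0//; lra.
Qed.

(** [up' eps a] is a probability density concentrated near a. *)
Lemma up_average F eps a (d l : R) : {within I11, continuous F} ->
  0 < eps -> -1 <= a -> a + 3 * eps <= 1 ->
  (forall x, a + eps <= x <= a + 3 * eps -> `|F x - l| <= d) ->
  `|integ (fun x => F x * up' eps a x) - l| <= d.
Proof.
move=> cF e0 a1 a2 H.
have iu : itg (up' eps a) by apply: itg_cont; apply: continuous_subspaceT; exact: continuous_up'.
have iFu : itg (fun x => F x * up' eps a x).
  apply: L2M; apply: L2_cont => //; apply: continuous_subspaceT; exact: continuous_up'.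
have E : integ (fun x => F x * up' eps a x) - l =
   integ (fun x => F x * up' eps a x - l * up' eps a x).
  by rewrite integB// ?integZ// ?integ_up'// ?mulr1//; exact: itgZ.
have B x : I11 x -> `|F x * up' eps a x - l * up' eps a x| <= d * up' eps a x.
  move=> xI; rewrite -mulrBl normrM (ger0_norm (up'_ge0 _ _ e0)).
  have [h|h] := boolP (a + eps <= x <= a + 3 * eps).
    by rewrite ler_wpM2r ?up'_ge0// H.
  by rewrite up'_out// !mulr0.
have S0 : d = integ (fun x => d * up' eps a x) by rewrite integZ// integ_up'// mulr1.
have it1 := itgB iFu (itgZ l iu).
rewrite E ler_norml {1}S0 [X in _ && (_ <= X)]S0 -integN ?integ_le ?andbT//; try exact: itgZ.
all: try exact: itgN (itgZ _ _).
all: by move=> x /B; rewrite ler_norml => /andP[].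
Qed.

End Cutoff.

(** * Integration by parts for weak derivatives *)

Section WeakDerivative.
Context {R : realType}.
Implicit Types (f g k u v w F psi : R -> R) (x y a b M eps : R).

Lemma dct_integ (f_ : nat -> R -> R) f g : (forall n, itg (f_ n)) -> itg f -> itg g ->
  (forall x, I11 x -> f_ n x @[n --> \oo] --> f x) ->
  (forall n x, I11 x -> `|f_ n x| <= g x) ->
  integ (f_ n) @[n --> \oo] --> integ f.
Proof.
move=> if_ iff ig cf fg.
have mf n := measurable_int lebesgue_measure (if_ n).
have cE x : I11 x -> (EFin \o f_ n) x @[n --> \oo] --> (EFin \o f) x.
  by move=> xI; apply: cvg_EFin; [exact: nearW | exact: cf].
have fgE x n : I11 x -> (`|(EFin \o f_ n) x| <= (EFin \o g) x)%E.
  by move=> xI; rewrite /= lee_fin fg.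
have cE' : {ae lebesgue_measure, forall x, I11 x ->
    (EFin \o f_ n) x @[n --> \oo] --> (EFin \o f) x} by apply: aeW.
have fgE' : {ae lebesgue_measure, forall x n, I11 x ->
    (`|(EFin \o f_ n) x| <= (EFin \o g) x)%E} by apply: aeW.
have [_ _ H] := dominated_convergence measurable_I11 mf (measurable_int _ iff) cE' ig fgE'.
by apply: fine_cvg; rewrite /integ /Rintegral fineK //; exact: integrable_fin_num.
Qed.

Lemma is_deriveM1 F g x (df dg : R) : is_derive x 1 F df -> is_derive x 1 g dg ->
  is_derive x 1 (fun x => F x * g x) (F x * dg + df * g x).
Proof.
move=> dF dG; have := is_deriveM dF dG.
by move=> H; apply: is_derive_eq; rewrite /GRing.scale /= (mulrC (g x)).
Qed.

Lemma derive1_of F (d x : R) : is_derive x 1 F d -> derive1 F x = d.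
Proof. by move=> h; rewrite derive1E; apply: derive_val. Qed.

Lemma up_itv eps a x : 0 <= up eps a x <= 1.
Proof. exact: step_itv. Qed.

(** The difference of two transitions is a plateau supported in ]a, b[, so its product with
    psi is a test function even when psi does not vanish at the end points. *)
Lemma weak_cutoff u g psi psi1 a b eps : weak_deriv u g ->
  (forall x, is_derive x 1 psi (psi1 x)) -> continuous psi1 ->
  -1 <= a -> b <= 1 -> 0 < eps -> a + 6 * eps <= b ->
  let eta x := up eps a x - up eps (b - 4 * eps) x in
  let eta' x := up' eps a x - up' eps (b - 4 * eps) x in
  integ (fun x => u x * (psi x * eta' x + psi1 x * eta x)) =
  - integ (fun x => g x * (psi x * eta x)).
Proof.
move=> ug dpsi cpsi1 a1 b1 e0 ab eta eta'.
have deta x : is_derive x 1 eta (eta' x).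
  by have d1 := is_derive_up eps a x; have d2 := is_derive_up eps (b - 4 * eps) x; exact: is_deriveB.
have ceta' : continuous eta'.
  by move=> x; apply: cvgB; exact: continuous_up'.
have dphi x := is_deriveM1 (dpsi x) (deta x).
have E x := derive1_of (dphi x).
have tphi : test_fun (fun x => psi x * eta x).
  split.
  - by move=> x; have [] := dphi x.
  - rewrite (_ : derive1 _ = fun x => psi x * eta' x + psi1 x * eta x); last exact/funext.
    move=> x; apply: cvgD; apply: cvgM.
    + exact: (is_derive_cont dpsi).
    + exact: ceta'.
    + exact: cpsi1.
    + exact: (is_derive_cont deta).
  - exists (1 - eps); first by lra.
    move=> x hx; rewrite /eta; have [x0|x0] := leP 0 x.
      by rewrite ger0_norm// in hx; rewrite !up_hi ?subrr ?mulr0//; lra.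
    by rewrite ltr0_norm// in hx; rewrite !up_lo ?subrr ?mulr0//; lra.
by rewrite -(ug _ tphi); apply: integ_eq => x _; rewrite E.
Qed.

(** Let the plateau of [weak_cutoff] tend to the indicator of ]a, b[: its derivative
    concentrates at a and at b, which produces the boundary terms. *)
Lemma weak_ibp u g psi psi1 a b : {within I11, continuous u} -> L2 g ->
  weak_deriv u g ->
  (forall x, is_derive x 1 psi (psi1 x)) -> continuous psi1 ->
  -1 <= a -> a < b -> b <= 1 ->
  ip (fun x => u x * psi1 x + g x * psi x) \1_(`]a, b[) = u b * psi b - u a * psi a.
Proof.
move=> cu Lg ug dpsi cpsi1 a1 ab b1.
have cwp1 : {within I11, continuous psi1} by apply: continuous_subspaceT.
have cwp : {within I11, continuous psi} by apply: continuous_subspaceT; exact: is_derive_cont dpsi.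
have Lu := L2_cont cu; have Lp := L2_cont cwp; have Lp1 := L2_cont cwp1.
have ih : itg (fun x => u x * psi1 x + g x * psi x) by apply: itgD; apply: L2M.
set h := (fun x => _) in ih *.
pose F x := u x * psi x.
have cF : {within I11, continuous F} by move=> x; apply: cvgM; [exact: cu|exact: cwp].
pose eps n : R := (b - a) / (n%:R + 6).
have n6 n : 0 < n%:R + 6 :> R by rewrite ltr_wpDl.
have e0 n : 0 < eps n by rewrite divr_gt0// subr_gt0.
have eab n : a + 6 * eps n <= b.
  have : (n%:R + 6) * eps n = b - a by rewrite /eps mulrC divfK ?gt_eqF.
  have : 0 <= n%:R * eps n by rewrite mulr_ge0 ?(ltW (e0 n)).
  nra.
have ecvg d : 0 < d -> \forall n \near \oo, 3 * eps n <= d.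
  move=> d0; near=> n; rewrite /eps mulrA ler_pdivrMr//.
  have : (3 * (b - a)) / d <= n%:R by near: n; exact: nbhs_infty_ger.
  by rewrite ler_pdivrMr// mulrDr; nra.
pose eta n x := up (eps n) a x - up (eps n) (b - 4 * eps n) x.
have ceta n : continuous (eta n).
  by move=> x; apply: cvgB; apply: (is_derive_cont (is_derive_up _ _)).
have eta1 n x : `|eta n x| <= 1.
  have /andP[h1 h2] := up_itv (eps n) a x.
  have /andP[h3 h4] := up_itv (eps n) (b - 4 * eps n) x.
  by rewrite /eta ler_norml; apply/andP; split; lra.
have Leta n : L2 (eta n) by apply: L2_cont; exact: continuous_subspaceT.
have Lup' n c : L2 (up' (eps n) c).
  by apply: L2_cont; apply: continuous_subspaceT; exact: continuous_up'.
have ihe n : itg (fun x => h x * eta n x).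
  apply: (@itg_dom _ _ (fun x => `|h x|)).
  - apply: measurable_funM; first exact: itg_measurable.
    by apply: itg_measurable; exact: L2_itg.
  - have := integrable_norm ih; exact.
  - by move=> x _; rewrite normrM ler_piMr.
(* The plateaus converge pointwise to the indicator of ]a, b[ and are bounded by 1:
   dominated convergence. *)
have c1 : integ (fun x => h x * eta n x) @[n --> \oo] --> ip h \1_(`]a, b[).
  apply: (@dct_integ _ _ (fun x => `|h x|)) => //.
  - apply: (@itg_dom _ _ (fun x => `|h x|)).
    + apply: measurable_funM; first exact: itg_measurable.
      by apply: itg_measurable; apply: L2_itg; apply: L2_indic; exact: measurable_itv.
    + exact: (integrable_norm ih).
    + move=> x _; rewrite normrM ler_piMr// indicE; case: (_ \in _); rewrite ?normr1 ?normr0//.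
  - exact: (integrable_norm ih).
  - move=> x _; apply: cvgM; first exact: cvg_cst.
    rewrite indicE; have [xI|xI] := pselect (`]a, b[%classic x).
      rewrite (mem_set xI); move: xI; rewrite /= in_itv /= => /andP[xa xb]; apply: cvg_near_cst; near=> n.
      have h1 : 3 * eps n <= x - a by near: n; apply: ecvg; rewrite subr_gt0.
      have h2 : 3 * eps n <= b - x by near: n; apply: ecvg; rewrite subr_gt0.
      by rewrite /eta up_hi ?up_lo ?subr0//; lra.
    rewrite (memNset xI); move: xI => /negP; rewrite /= in_itv /= negb_and -!leNgt => xab; apply: cvg_near_cst; near=> n.
    have := e0 n; have := eab n => h1 h2.
    case/orP: xab => xab; rewrite /eta; first by rewrite !up_lo ?subrr//; lra.
    by rewrite !up_hi ?subrr//; lra.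
  - by move=> n x _; rewrite normrM ler_piMr.
(* By the cut-off identity the same integrals are differences of averages of u psi near b
   and near a. *)
have E n : integ (fun x => h x * eta n x) =
   integ (fun x => F x * up' (eps n) (b - 4 * eps n) x) -
   integ (fun x => F x * up' (eps n) a x).
  have := @weak_cutoff u g psi psi1 a b (eps n) ug dpsi cpsi1 a1 b1 (e0 n) (eab n).
  cbv zeta; rewrite -/(eta n) => H.
  have i1 : itg (fun x => F x * up' (eps n) (b - 4 * eps n) x) by apply: L2M => //; exact: L2_cont.
  have i2 : itg (fun x => F x * up' (eps n) a x) by apply: L2M => //; exact: L2_cont.
  have Lpe : L2 (fun x => psi x * eta n x).
    apply: L2_cont => x; apply: cvgM; first exact: cwp.
    by apply: continuous_subspaceT; exact: ceta.
  have i3 := L2M Lg Lpe.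
  have H2 : integ (fun x => u x * (psi x * (up' (eps n) a x - up' (eps n) (b - 4 * eps n) x) + psi1 x * eta n x)) =
    integ (fun x => h x * eta n x) - integ (fun x => g x * (psi x * eta n x)) -
     (integ (fun x => F x * up' (eps n) (b - 4 * eps n) x) -
      integ (fun x => F x * up' (eps n) a x)).
    rewrite -integB// -integB// -integB//; try exact: itgB.
    by apply: integ_eq => x _; rewrite /h /F; ring.
  by move: H; rewrite H2; lra.
have cend c c' : -1 <= c <= 1 -> (forall n, -1 <= c' n) ->
   (forall n, c' n + 3 * eps n <= 1) ->
   (forall n x, c' n + eps n <= x <= c' n + 3 * eps n -> `|x - c| <= 3 * eps n) ->
   integ (fun x => F x * up' (eps n) (c' n) x) @[n --> \oo] --> F c.
  move=> cI h1 h2 h3; apply/cvgrPdist_le => d d0.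
  have := cF c => /cvgrPdist_le /(_ d d0).
  rewrite {1}/nbhs /= -nbhs_subspace_in; last exact/I11P.
  rewrite /within /= /nbhs /= => -[r r0 Hr].
  near=> n; rewrite distrC; apply: up_average => // x hx.
  rewrite distrC; apply: Hr => /=.
    rewrite distrC; apply: (le_lt_trans (h3 n x hx)).
    apply: (@le_lt_trans _ _ (r / 2)); last by rewrite gtr_pMr//; lra.
    by near: n; apply: ecvg; rewrite divr_gt0.
  apply/I11P; case/andP: hx => hx1 hx2; have := h1 n; have := h2 n; have := e0 n; lra.
have c2 : integ (fun x => h x * eta n x) @[n --> \oo] --> F b - F a.
  rewrite (_ : (fun n => _) = fun n => integ (fun x => F x * up' (eps n) (b - 4 * eps n) x) -
   integ (fun x => F x * up' (eps n) a x)); last exact/funext.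
  apply: cvgB; apply: cend.
  - lra.
  - by move=> n; have := e0 n; have := eab n; lra.
  - by move=> n; have := e0 n; have := eab n; lra.
  - by move=> n x /andP[h1 h2]; have := e0 n; rewrite ler_norml; lra.
  - lra.
  - by move=> n.
  - by move=> n; have := e0 n; have := eab n; lra.
  - by move=> n x /andP[h1 h2]; have := e0 n; rewrite ler_norml; lra.
exact: (cvg_unique _ c1 c2).
Unshelve. all: by end_near.
Qed.

End WeakDerivative.

(** * Uniqueness of weak derivatives and the space H1 *)

Section SobolevTools.
Context {R : realType}.
Implicit Types (f g k u v w F psi h : R -> R) (x y a b M eps : R).

Lemma itg_sub f c d : itg f -> lebesgue_measure.-integrable
  [set` Interval (BSide c (-1)) (BSide d (1:R))] (EFin \o f).
Proof.
move=> itf; apply: (integrableS _ _ _ itf); [exact: measurable_I11|exact: measurable_itv|].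
by apply: subset_itv; case: c; case: d; rewrite ?bnd_simp.
Qed.

Lemma integ_oo f : itg f -> integ f = \int[lebesgue_measure]_(x in `]-1, 1[) f x.
Proof.
move=> itf; rewrite /integ /I11 -Rintegral_itv_obnd_cbnd; last exact: itg_sub.
by rewrite -Rintegral_itv_bndo_bndc//; exact: itg_sub.
Qed.

Lemma integ_indic_oo f : itg f -> ip f \1_(`]-1, 1[) = integ f.
Proof.
move=> itf; have itf1 : itg (fun x => f x * \1_(`]-1, 1[) x).
  apply: (@itg_dom _ _ (fun x => `|f x|)).
  - apply: measurable_funM; first exact: itg_measurable.
    by apply: itg_measurable; apply: L2_itg; apply: L2_indic; exact: measurable_itv.
  - exact: (integrable_norm itf).
  - by move=> x _; rewrite normrM ler_piMr// indicE; case: (_ \in _); rewrite ?normr1 ?normr0.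
rewrite /ip !integ_oo//.
by apply: eq_Rintegral => x xI; rewrite indicE xI mulr1.
Qed.

(** By Lebesgue differentiation a function whose integrals over all intervals vanish is zero
    almost everywhere. *)
Lemma ae_zero_ip f k : itg f -> itg (fun x => f x * k x) ->
  (forall a b, -1 <= a -> a < b -> b <= 1 -> ip f \1_(`]a, b[) = 0) ->
  ip f k = 0.
Proof.
move=> itf itfk H.
pose fI := f \_ (@I11 R).
have ifI : lebesgue_measure.-integrable setT (EFin \o fI).
  by move: itf; rewrite /itg integrable_mkcond// restrict_EFin.
have ifIS (A : set R) : measurable A -> lebesgue_measure.-integrable A (EFin \o fI).
  by move=> mA; apply: integrableS ifI.
have lfI : locally_integrable setT fI by exact: (integrable_locally measurable_I11 itf).
have := @FTC1 R fI (BRight (-1)) (fun y => ifIS _ (measurable_itv _)) lfI.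
cbv zeta; set G := (fun x => Rintegral _ _ _) => dG.
have G0 y : -1 < y < 1 -> G y = 0.
  move=> /andP[y1 y2]; rewrite /G -Rintegral_itv_bndo_bndc; last exact: ifIS.
  have y1' : -1 <= (-1 : R) by [].
  rewrite -(H (-1) y y1' y1 (ltW y2)) /ip /integ.
  rewrite (@eq_Rintegral _ _ _ lebesgue_measure `]-1, y[ f fI); last first.
    move=> x; rewrite inE /= in_itv /= => /andP[x1 x2].
    by rewrite /fI patchE mem_set//; apply/I11P; lra.
  rewrite (_ : `]-1, y[%classic = @I11 R `&` `]-1, y[%classic); last first.
    apply/seteqP; split => x /=; rewrite in_itv /=; last by case.
    by move=> /andP[h1 h2]; split; [apply/I11P; lra|apply/andP].
  rewrite Rintegral_mkcondr; apply: eq_Rintegral => x xI.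
  by rewrite patchE indicE in_setI xI /=; case: (x \in `]-1, y[%classic); rewrite ?mulr1 ?mulr0.
have f0 : {ae lebesgue_measure, forall x, `]-1, 1[%classic x -> f x = 0}.
  move: dG; apply: filterS; first exact: (ae_filter_ringOfSetsType lebesgue_measure).
  move=> x Hx; rewrite /= in_itv /= => /andP[x1 x2].
  have xb : (BRight (-1) < BRight x)%O by rewrite bnd_simp.
  have [_] := Hx xb.
  rewrite /fI patchE mem_set; last by apply/I11P; lra.
  move=> <-; apply: derive1_of.
  apply: (@near_eq_is_derive _ _ _ (cst 0)).
    near=> y; rewrite G0//; apply/andP; split; near: y; [exact: lt_nbhsr|exact: lt_nbhsl].
have mo : measurable (`]-1, 1[%classic : set R) by exact: measurable_itv.
rewrite /ip integ_oo//.
rewrite /Rintegral (@ae_eq_integral _ _ _ lebesgue_measure _ (cst 0%E))//.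
- by rewrite integral0.
- exact: (measurable_int lebesgue_measure (itg_sub false true itfk)).
- move: f0; apply: filterS; first exact: (ae_filter_ringOfSetsType lebesgue_measure).
  by move=> x H0 xI /=; rewrite H0// mul0r.
Unshelve. all: by end_near.
Qed.

(** g is some weak derivative of u in L2, not necessarily the one selected by [wD]. *)
Definition wd u g := L2 g /\ weak_deriv u g.

Lemma H1_wd u : H1 u -> wd u (wD u).
Proof. by move=> [cu [g Lg ug]]; apply: xgetPex; exists g. Qed.

Lemma H1_cont u : H1 u -> {within I11, continuous u}.
Proof. by case. Qed.

Lemma is_derive_one x : is_derive x 1 (fun=> 1 : R) (0 : R).
Proof. exact: is_derive_cst. Qed.

Lemma continuous_cst0 : continuous (fun _ : R => 0 : R).
Proof. by move=> x; exact: cst_continuous. Qed.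

(** Integration by parts against psi = 1. *)
Lemma wd_ftc u g a b : {within I11, continuous u} -> wd u g ->
  -1 <= a -> a < b -> b <= 1 -> ip g \1_(`]a, b[) = u b - u a.
Proof.
move=> cu [Lg ug] a1 ab b1.
have := weak_ibp cu Lg ug is_derive_one continuous_cst0 a1 ab b1.
by rewrite !mulr1 => <-; apply: ip_eq => // x _; rewrite mulr0 mulr1 add0r.
Qed.

(** By [wd_ftc] two weak derivatives have the same integral over every interval. *)
Lemma wd_uniq u g g' k : {within I11, continuous u} -> wd u g -> wd u g' ->
  L2 k -> ip g k = ip g' k.
Proof.
move=> cu ug ug' Lk; have [Lg _] := ug; have [Lg' _] := ug'.
apply/eqP; rewrite -subr_eq0 -ipBl//; apply/eqP; apply: ae_zero_ip.
- by apply: L2_itg; exact: L2B.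
- by apply: L2M => //; exact: L2B.
- move=> a b a1 ab b1; rewrite ipBl//; last by apply: L2_indic; exact: measurable_itv.
  by rewrite !(wd_ftc cu)// subrr.
Qed.

Lemma wd_eqI u u' g g' : eqI u u' -> eqI g g' -> wd u g -> wd u' g'.
Proof.
move=> E E' [Lg ug]; split; first exact: L2_eq Lg.
move=> phi tphi; rewrite -(integ_eq (f := fun x => u x * derive1 phi x)); last by move=> x /E ->.
by rewrite ug//; congr (- _); apply: integ_eq => x /E' ->.
Qed.

Lemma test_cont phi : @test_fun R phi -> L2 phi /\ L2 (derive1 phi).
Proof.
move=> [dphi cphi _]; split; apply: L2_cont; apply: continuous_subspaceT => //.
by apply: (@is_derive_cont _ _ (derive1 phi)) => x; apply: derive1_is_derive.
Qed.

Lemma wdD u v g g' : {within I11, continuous u} -> {within I11, continuous v} ->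
  wd u g -> wd v g' -> wd (fun x => u x + v x) (fun x => g x + g' x).
Proof.
move=> /L2_cont Lu /L2_cont Lv [Lg ug] [Lg' ug']; split; first exact: L2D.
move=> phi tphi; have [L1 L2'] := test_cont tphi.
have := ipDl Lu Lv L2'; rewrite /ip => ->; have := ipDl Lg Lg' L1; rewrite /ip => ->.
by rewrite ug// ug'// opprD.
Qed.

Lemma wdZ a u g : {within I11, continuous u} -> wd u g -> wd (fun x => a * u x) (fun x => a * g x).
Proof.
move=> /L2_cont Lu [Lg ug]; split; first exact: L2Z.
move=> phi tphi; have [L1 L2'] := test_cont tphi.
have := ipZl a Lu L2'; rewrite /ip => ->; have := ipZl a Lg L1; rewrite /ip => ->.
by rewrite ug// mulrN.
Qed.

Lemma contD u v : {within I11, continuous u} -> {within I11, continuous v} ->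
  {within I11, continuous (fun x => u x + v x)}.
Proof. by move=> cu cv x; apply: cvgD; [exact: cu|exact: cv]. Qed.

Lemma contM u v : {within I11, continuous u} -> {within I11, continuous v} ->
  {within I11, continuous (fun x => u x * v x)}.
Proof. by move=> cu cv x; apply: cvgM; [exact: cu|exact: cv]. Qed.

Lemma contC a : {within I11, continuous (fun _ : R => a)}.
Proof. by apply: continuous_subspaceT => x; exact: cst_continuous. Qed.

Lemma contZ a u : {within I11, continuous u} -> {within I11, continuous (fun x => a * u x)}.
Proof. by move=> cu; apply: contM => //; exact: contC. Qed.

Lemma cont_eqI u v : eqI u v -> {within I11, continuous u} -> {within I11, continuous v}.
Proof. by move=> E cu; apply: subspace_eq_continuous cu => x; rewrite inE => /E. Qed.

Lemma wd_H1 u g : {within I11, continuous u} -> wd u g -> H1 u.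
Proof. by move=> cu [Lg ug]; split => //; exists g. Qed.

Lemma H1D u v : H1 u -> H1 v -> H1 (fun x => u x + v x).
Proof.
move=> hu hv; have wu := H1_wd hu; have wv := H1_wd hv.
by apply: (wd_H1 _ (wdD hu.1 hv.1 wu wv)); apply: contD; [exact: hu.1|exact: hv.1].
Qed.

Lemma H1Z a u : H1 u -> H1 (fun x => a * u x).
Proof.
move=> hu; have wu := H1_wd hu.
by apply: (wd_H1 _ (wdZ a hu.1 wu)); apply: contZ; exact: hu.1.
Qed.

Lemma H1_eqI u v : eqI u v -> H1 u -> H1 v.
Proof.
move=> E hu; apply: (wd_H1 (cont_eqI E hu.1)).
by apply: (wd_eqI E _ (H1_wd hu)).
Qed.

Lemma eqI_sym u v : eqI u v -> eqI v u. Proof. by move=> h x xI; rewrite h. Qed.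

Lemma I11_N1 : @I11 R (-1). Proof. by apply/I11P; lra. Qed.
Lemma I11_1 : @I11 R 1. Proof. by apply/I11P; lra. Qed.

Lemma H10_eqI u v : eqI u v -> H10 u -> H10 v.
Proof.
move=> E [hu u1 u2]; split; first exact: H1_eqI hu.
  by rewrite -E//; exact: I11_N1.
by rewrite -E//; exact: I11_1.
Qed.

Lemma H10D u v : H10 u -> H10 v -> H10 (fun x => u x + v x).
Proof.
by move=> [hu u1 u2] [hv v1 v2]; split; [exact: H1D|rewrite u1 v1 addr0|rewrite u2 v2 addr0].
Qed.

Lemma H10Z a u : H10 u -> H10 (fun x => a * u x).
Proof. by move=> [hu u1 u2]; split; [exact: H1Z|rewrite u1 mulr0|rewrite u2 mulr0]. Qed.

Lemma wd_C1 u u1 : (forall x, is_derive x 1 u (u1 x)) -> continuous u1 -> wd u u1.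
Proof.
move=> du cu1.
have cwu1 : {within I11, continuous u1} by exact: continuous_subspaceT.
have cu := is_derive_cont du.
have cwu : {within I11, continuous u} by exact: continuous_subspaceT.
split; first exact: L2_cont.
move=> phi tphi; have [Lp Lp1] := test_cont tphi.
have [dphi cphi [r r1 phi0]] := tphi.
have dp x : is_derive x 1 phi (derive1 phi x) by apply: derive1_is_derive.
have dup x := is_deriveM1 (du x) (dp x).
have cf : continuous (fun x => u x * derive1 phi x + u1 x * phi x).
  move=> x; apply: cvgD; apply: cvgM; [exact: cu|exact: cphi|exact: cu1|exact: (is_derive_cont dp)].
have := integ_FTC dup cf; rewrite (phi0 1) ?(phi0 (-1)) ?normrN ?normr1 ?(ltW r1)// !mulr0 subrr.
by rewrite integD; [move=> h; apply/eqP; rewrite -addr_eq0 h|apply: L2M => //; exact: L2_cont..].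
Qed.

Lemma C1_H1 u u1 : (forall x, is_derive x 1 u (u1 x)) -> continuous u1 -> H1 u.
Proof.
move=> du cu1; apply: (wd_H1 _ (wd_C1 du cu1)).
by apply: continuous_subspaceT; exact: is_derive_cont du.
Qed.

Lemma wD_ip u g k : {within I11, continuous u} -> wd u g -> L2 k -> ip (wD u) k = ip g k.
Proof. by move=> cu ug; apply: wd_uniq => //; apply: H1_wd; exact: wd_H1 ug. Qed.

Lemma wd_ibp u g psi psi1 : {within I11, continuous u} -> wd u g ->
  (forall x, is_derive x 1 psi (psi1 x)) -> continuous psi1 ->
  ip g psi = u 1 * psi 1 - u (-1) * psi (-1) - ip u psi1.
Proof.
move=> cu [Lg ug] dpsi cpsi1.
have h1 : (-1 : R) <= -1 by []. have h2 : (-1 : R) < 1 by lra. have h3 : (1:R) <= 1 by [].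
have Lu := L2_cont cu.
have Lp1 : L2 psi1 by apply: L2_cont; exact: continuous_subspaceT.
have Lp : L2 psi by apply: L2_cont; apply: continuous_subspaceT; exact: is_derive_cont dpsi.
rewrite -(weak_ibp cu Lg ug dpsi cpsi1 h1 h2 h3).
suff -> : ip (fun x => u x * psi1 x + g x * psi x) \1_(`]-1, 1[) = ip u psi1 + ip g psi.
  ring.
have ii : itg (fun x => u x * psi1 x + g x * psi x) by apply: itgD; apply: L2M.
by rewrite integ_indic_oo// integD//; exact: L2M.
Qed.

Lemma ip_indic_le a b : -1 <= a -> a < b -> b <= 1 -> ip \1_(`]a, b[) \1_(`]a, b[) <= 2 :> R.
Proof.
move=> a1 ab b1; rewrite -[leRHS]mulr1 -integ_cst; apply: integ_le.
- by apply: L2M; apply: L2_indic; exact: measurable_itv.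
- exact: itg_cst.
- by move=> x _; rewrite indicE; case: (_ \in _); rewrite ?mulr1 ?mulr0.
Qed.

(** u x is the integral of g over [-1, x]; apply Cauchy-Schwarz. *)
Lemma poincare u g : H10 u -> wd u g -> forall x, I11 x -> u x ^+ 2 <= 2 * ip g g.
Proof.
move=> [hu u0 _] ug x /I11P /andP[]; rewrite le_eqVlt => /orP[/eqP <- _|x1 x2].
  by rewrite u0 expr0n /= mulr_ge0// ip_ge0.
have := wd_ftc (H1_cont hu) ug (lexx _) x1 x2; rewrite u0 subr0 => <-.
have L1 : L2 (\1_(`]-1, x[%classic) : R -> R) by apply: L2_indic; exact: measurable_itv.
have CS := ip_CS ug.1 L1.
apply: (le_trans CS); rewrite mulrC ler_wpM2r ?ip_ge0//.
by apply: ip_indic_le.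
Qed.

End SobolevTools.

(** * Majorants and the bulk energy *)

Section Majorants.
Context {R : realType}.

(** B x M reads: the size of x is at most M, for a submultiplicative size. Estimates on
    polynomial expressions are derived once from these rules and used for numbers, for
    functions of x and for power series in the bifurcation parameter. *)
Record majorant (A : pzRingType) (B : A -> R -> Prop) : Prop := Majorant {
  majD : forall x y M N, B x M -> B y N -> B (x + y) (M + N);
  majM : forall x y M N, B x M -> B y N -> B (x * y) (M * N);
  majN : forall x M, B x M -> B (- x) M;
  maj_le : forall x M N, B x M -> M <= N -> B x N;
  maj_ge0 : forall x M, B x M -> 0 <= M }.

Section Smallness.
Context (A : pzRingType) (B : A -> R -> Prop) (majB : majorant B).
Context (eps del : R) (eps01 : 0 <= eps <= 1) (del0 : 0 <= del).
Implicit Types (x y : A) (K : R) (k l : nat).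

(** x and x' have order eps^k and differ by eps^(k-1) del. This pairing of a bound with a
    Lipschitz bound is stable under ring operations, the orders adding up in products, so
    that contraction estimates can be read off the shape of an expression. *)
Definition cl2 k K x x' :=
  [/\ 0 <= K, B x (K * eps ^+ k), B x' (K * eps ^+ k) &
      B (x - x') (K * eps ^+ k.-1 * del)].

Lemma eps_le k l : (l <= k)%N -> eps ^+ k <= eps ^+ l.
Proof. by move=> lk; case/andP: eps01 => e0 e1; rewrite ler_wiXn2l. Qed.

Lemma eps_ge0 k : 0 <= eps ^+ k.
Proof. by case/andP: eps01 => e0 e1; rewrite exprn_ge0. Qed.

Lemma cl2_weak k l K K' x x' : cl2 k K x x' -> (l <= k)%N -> K <= K' -> cl2 l K' x x'.
Proof.
move=> [K0 h1 h2 h3] lk KK; split.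
- exact: le_trans KK.
- by apply: (maj_le majB h1); apply: ler_pM => //; [exact: eps_ge0|exact: eps_le].
- by apply: (maj_le majB h2); apply: ler_pM => //; [exact: eps_ge0|exact: eps_le].
- apply: (maj_le majB h3); rewrite ler_wpM2r//; apply: ler_pM => //; first exact: eps_ge0.
  by apply: eps_le; case: k l lk {h1 h2 h3} => [|k] [|l].
Qed.

Lemma cl2N k K x x' : cl2 k K x x' -> cl2 k K (- x) (- x').
Proof.
move=> [K0 h1 h2 h3]; split => //; try exact: (majN majB).
by rewrite -opprD; exact: (majN majB).
Qed.

Lemma cl2D k K K' x x' y y' : cl2 k K x x' -> cl2 k K' y y' ->
  cl2 k (K + K') (x + y) (x' + y').
Proof.
move=> [K0 h1 h2 h3] [K0' h1' h2' h3']; split.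
- exact: addr_ge0.
- by rewrite mulrDl; exact: (majD majB).
- by rewrite mulrDl; exact: (majD majB).
- rewrite (_ : x + y - (x' + y') = (x - x') + (y - y')); last by rewrite opprD addrACA.
  by rewrite !mulrDl; exact: (majD majB).
Qed.

Lemma cl2Dmin k l K K' x x' y y' : cl2 k K x x' -> cl2 l K' y y' ->
  cl2 (minn k l) (K + K') (x + y) (x' + y').
Proof.
by move=> h1 h2; apply: cl2D; [apply: cl2_weak h1 _ (lexx K); exact: geq_minl
  |apply: cl2_weak h2 _ (lexx K'); exact: geq_minr].
Qed.

Lemma cl2Bmin k l K K' x x' y y' : cl2 k K x x' -> cl2 l K' y y' ->
  cl2 (minn k l) (K + K') (x - y) (x' - y').
Proof. by move=> h1 h2; apply: cl2Dmin h1 (cl2N h2). Qed.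

Lemma cl2M k l K K' x x' y y' : cl2 k K x x' -> cl2 l K' y y' ->
  cl2 (k + l) (2 * K * K') (x * y) (x' * y').
Proof.
move=> [K0 h1 h2 h3] [K0' h1' h2' h3'].
have KK : 0 <= K * K' by exact: mulr_ge0.
have E2 : K * eps ^+ k * (K' * eps ^+ l) <= 2 * K * K' * eps ^+ (k + l).
  rewrite exprD mulrACA; have := mulr_ge0 KK (mulr_ge0 (eps_ge0 k) (eps_ge0 l)); lra.
split.
- by rewrite !mulr_ge0.
- by apply: (maj_le majB _ E2); exact: (majM majB).
- by apply: (maj_le majB _ E2); exact: (majM majB).
- rewrite (_ : x * y - x' * y' = x * (y - y') + (x - x') * y'); last first.
    by rewrite mulrBr mulrBl addrA subrK.
  apply: (maj_le majB (majD majB (majM majB h1 h3') (majM majB h3 h2'))).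
  have e1 : eps ^+ k * eps ^+ l.-1 <= eps ^+ (k + l).-1.
    by rewrite -exprD; apply: eps_le; case: l {E2 h1' h2' h3'} => [|l]; rewrite ?addn0 ?addnS// leq_pred.
  have e2 : eps ^+ k.-1 * eps ^+ l <= eps ^+ (k + l).-1.
    by rewrite -exprD; apply: eps_le; case: k {E2 h1 h2 h3 e1} => [|k]; rewrite ?add0n ?addSn// leq_pred.
  have := ler_wpM2r del0 (ler_wpM2l KK e1); have := ler_wpM2r del0 (ler_wpM2l KK e2); lra.
Qed.

Lemma cl2_cst K x : 0 <= K -> B x K -> B 0 0 -> cl2 0 K x x.
Proof.
move=> K0 h h0; split=> //; rewrite ?expr0 ?mulr1//.
by rewrite subrr; apply: (maj_le majB h0); rewrite mulr_ge0.
Qed.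

End Smallness.

Lemma cl2_down (A : pzRingType) (B : A -> R -> Prop) (majB : majorant B) (eps del : R) k l K x x' :
  0 <= eps <= 1 -> 0 <= del -> cl2 B eps del k K x x' -> (l <= k)%N -> cl2 B eps del l K x x'.
Proof. by move=> e d h lk; apply: (cl2_weak majB e d h lk). Qed.

Definition Babs (x M : R) := `|x| <= M.

Lemma majorant_abs : majorant (A := R) Babs.
Proof.
rewrite /Babs; split => [x y M N h1 h2|x y M N h1 h2|x M|x M N h1 h2|x M h1].
- by apply: (le_trans (ler_normD _ _)); apply: lerD.
- by rewrite normrM; apply: ler_pM.
- by rewrite normrN.
- exact: le_trans h2.
- exact: le_trans h1.
Qed.

End Majorants.

(** Builds the estimate by following the syntax of the expression; the constant is an
    existential variable that unification fills in. *)
Ltac cl2_auto := first [ eassumption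
  | eapply cl2Bmin; [eassumption|eassumption|eassumption|cl2_auto|cl2_auto]
  | eapply cl2Dmin; [eassumption|eassumption|eassumption|cl2_auto|cl2_auto]
  | eapply cl2M; [eassumption|eassumption|eassumption|cl2_auto|cl2_auto]
  | eapply cl2N; [eassumption|cl2_auto] ].
Ltac cl2_solve := eapply cl2_down; [eassumption|eassumption|eassumption|cl2_auto|done].

Section Bulk.
Context {R : realType}.
Implicit Types (a b c x y z M eps : R).

(** Half of |Q|^2. *)
Definition msq a b c : R := 3 * a ^+ 2 + b ^+ 2 + c ^+ 2.

(** The bulk energy without its additive constant. *)
Definition Wb a b c : R := - (8 / 3) * msq a b c + 4 * a * (a ^+ 2 - b ^+ 2 - c ^+ 2)
  + msq a b c ^+ 2 / 2.

(** Together with [N23]: the gradient of [Wb] is (6 N1, 2 b N23, 2 c N23). *)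
Definition N1 a b c : R := - (8 / 3) * a + 2 * a ^+ 2 - 2 / 3 * (b ^+ 2 + c ^+ 2) + a * msq a b c.
Definition N23 a b c : R := msq a b c - 4 * a - 8 / 3.

Lemma sum_ord3 (V : nmodType) (F : 'I_3 -> V) :
  \sum_i F i = F (inord 0) + F (inord 1) + F (inord 2).
Proof.
rewrite !big_ord_recl big_ord0 addr0 addrA; congr (F _ + F _ + F _);
  by apply/val_inj; rewrite /= inordK.
Qed.

Lemma sqnorm_Qtensor a b c : sqnorm (Qtensor a b c) = 6 * a ^+ 2 + 2 * b ^+ 2 + 2 * c ^+ 2.
Proof.
rewrite /sqnorm /mxtrace; under eq_bigr do rewrite mxE.
rewrite !sum_ord3 !mxE !inordK//=; ring.
Qed.

Lemma fbulk_Qtensor a b c : fbulk (Qtensor a b c) = Wb a b c + ctheta.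
Proof.
rewrite /fbulk /fbulk0 sqnorm_Qtensor /mxtrace.
have -> : \sum_i (Qtensor a b c *m Qtensor a b c *m Qtensor a b c) i i =
  - 6 * a ^+ 3 + 6 * a * (b ^+ 2 + c ^+ 2).
  rewrite sum_ord3 !mxE !sum_ord3 !mxE !sum_ord3 !mxE !inordK//=; ring.
by rewrite /Wb /msq /theta; field.
Qed.

(** The remainder is a polynomial whose monomials all have degree at least two in (x, y, z). *)
Lemma Wb_taylor M : 0 <= M -> exists2 K, 0 <= K & forall eps a b c x y z, 0 <= eps <= 1 ->
  `|a| <= M -> `|b| <= M -> `|c| <= M -> `|x| <= eps -> `|y| <= eps -> `|z| <= eps ->
  `|Wb (a + x) (b + y) (c + z) - Wb a b c
    - (6 * N1 a b c * x + 2 * b * N23 a b c * y + 2 * c * N23 a b c * z)| <= K * eps ^+ 2.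
Proof.
move=> M0.
pose rem a b c x y z := 4 * (x * x) * (3 * a + x) - 4 * x * (2 * (b * y) + 2 * (c * z))
  - 4 * (a + x) * (y * y + z * z) + (3 * (a * a) + b * b + c * c - 8/3) * (3 * (x * x) + y * y + z * z)
  + 1/2 * ((6 * (a * x) + 2 * (b * y) + 2 * (c * z) + (3 * (x * x) + y * y + z * z)) *
           (6 * (a * x) + 2 * (b * y) + 2 * (c * z) + (3 * (x * x) + y * y + z * z))).
suff [K K0 HK] : exists2 K, 0 <= K & forall eps a b c x y z, 0 <= eps <= 1 ->
  `|a| <= M -> `|b| <= M -> `|c| <= M -> `|x| <= eps -> `|y| <= eps -> `|z| <= eps ->
  cl2 (Babs (R:=R)) eps 0 2 K (rem a b c x y z) (rem a b c x y z).
  exists K => // eps a b c x y z e01 ha hb hc hx hy hz.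
  have [_ + _ _] := HK _ _ _ _ _ _ _ e01 ha hb hc hx hy hz.
  by rewrite /Babs; congr (`|_| <= _); rewrite /rem /Wb /N1 /N23 /msq; field.
have H : exists K, forall eps a b c x y z, 0 <= eps <= 1 ->
  `|a| <= M -> `|b| <= M -> `|c| <= M -> `|x| <= eps -> `|y| <= eps -> `|z| <= eps ->
  cl2 (Babs (R:=R)) eps 0 2 K (rem a b c x y z) (rem a b c x y z).
  eexists => eps a b c x y z e01 ha hb hc hx hy hz.
  have mB := @majorant_abs R.
  have B0 : Babs (0 : R) 0 by rewrite /Babs normr0.
  have cM t : `|t| <= M -> cl2 (Babs (R:=R)) eps 0 0 M t t by move=> h; apply: cl2_cst.
  have cc (t : R) : cl2 (Babs (R:=R)) eps 0 0 `|t| t t by apply: cl2_cst => //; rewrite /Babs.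
  have c1 t : `|t| <= eps -> cl2 (Babs (R:=R)) eps 0 1 1 t t.
    by move=> h; split; rewrite ?mul1r ?expr1 ?subrr ?mulr0 /Babs ?normr0.
  have ca := cM _ ha; have cb := cM _ hb; have c_c := cM _ hc.
  have cx := c1 _ hx; have cy := c1 _ hy; have cz := c1 _ hz.
  have d0 : 0 <= (0 : R) by [].
  have c2 := cc 2; have c3 := cc 3; have c4 := cc 4; have c6 := cc 6.
  have c83 := cc (8 / 3); have c12 := cc (1 / 2).
  rewrite /rem; cl2_solve.
case: H => K HK; exists K => //.
have [] // := HK 0 0 0 0 0 0 0 _ _ _ _ _ _ _; by rewrite ?normr0 ?lexx ?ler01.
Qed.

End Bulk.

(** * Critical points as solutions of the Euler-Lagrange system *)

Section Energy.
Context {R : realType}.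
Implicit Types (f g u v w k : R -> R) (x y a b c M eps lam t : R) (Q P h G : triple R).

Lemma forall3 (P : 'I_3 -> Prop) :
  P (inord 0) -> P (inord 1) -> P (inord 2) -> forall i, P i.
Proof.
move=> h0 h1 h2; case=> [[|[|[|n]]]] Hn //.
- by rewrite (_ : Ordinal Hn = inord 0)//; apply/val_inj; rewrite /= inordK.
- by rewrite (_ : Ordinal Hn = inord 1)//; apply/val_inj; rewrite /= inordK.
- by rewrite (_ : Ordinal Hn = inord 2)//; apply/val_inj; rewrite /= inordK.
Qed.

Lemma contN u : {within I11, continuous u} -> {within I11, continuous (fun x => - u x)}.
Proof. by move=> cu x; apply: cvgN; exact: cu. Qed.

Lemma contX u n : {within I11, continuous u} -> {within I11, continuous (fun x => u x ^+ n)}.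
Proof.
move=> cu; elim: n => [|n IH].
  by rewrite (_ : (fun x => _) = fun=> 1)//; exact: contC.
rewrite (_ : (fun x => _) = fun x => u x * u x ^+ n); last by apply/funext => x; rewrite exprS.
exact: contM.
Qed.

End Energy.

Definition cI {R : realType} (u : R -> R) : Prop := {within I11, continuous u}.

Section ContinuityOnI.
Context {R : realType}.
Implicit Types (u v : R -> R).
Lemma cID u v : cI u -> cI v -> cI (fun x => u x + v x). Proof. exact: contD. Qed.
Lemma cIM u v : cI u -> cI v -> cI (fun x => u x * v x). Proof. exact: contM. Qed.
Lemma cIN u : cI u -> cI (fun x => - u x). Proof. exact: contN. Qed.
Lemma cIX u n : cI u -> cI (fun x => u x ^+ n). Proof. exact: contX. Qed.
Lemma cIC (a : R) : cI (fun _ : R => a). Proof. exact: contC. Qed.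
End ContinuityOnI.

Ltac wc := lazymatch goal with
  | |- cI (fun _ => ?c) => exact (@cIC _ c)
  | |- cI (fun x => (@?u x + @?v x)%R) => refine (@cID _ u v _ _); wc
  | |- cI (fun x => (@?u x * @?v x)%R) => refine (@cIM _ u v _ _); wc
  | |- cI (fun x => (- @?u x)%R) => refine (@cIN _ u _); wc
  | |- cI (fun x => (@?u x ^+ ?n)%R) => refine (@cIX _ u n _); wc
  | |- _ => assumption end.
Ltac wcont := lazymatch goal with
  | |- cI _ => wc
  | |- forall x, continuous_at x (@from_subspace _ _ _ ?f) => change (cI f); wc end.

Opaque integ wD inord.
Lemma scale3E (R : realType) (t : R) (h : triple R) : t *: h = (fun i x => t * h i x).
Proof. by []. Qed.
Section Energy2.
Context {R : realType}.
Implicit Types (f g u v w k : R -> R) (x y a b c M eps lam t : R) (Q P h G : triple R).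

Definition wd3 Q G := forall i, wd (Q i) (G i).

Lemma H1_wd3 Q : (forall i, H1 (Q i)) -> wd3 Q (fun i => wD (Q i)).
Proof. by move=> hQ i; apply: H1_wd. Qed.

Lemma dot3E Q P G G' : (forall i, H1 (Q i)) -> (forall i, H1 (P i)) -> wd3 Q G -> wd3 P G' ->
  dot3 Q P = \sum_i ip (G i) (G' i).
Proof.
move=> hQ hP dQ dP; rewrite /dot3.
have itg_i i : itg (fun x => wD (Q i) x * wD (P i) x).
  by apply: L2M; [exact: (H1_wd (hQ i)).1|exact: (H1_wd (hP i)).1].
rewrite (integ_eq (g := fun x => wD (Q (inord 0)) x * wD (P (inord 0)) x +
   wD (Q (inord 1)) x * wD (P (inord 1)) x + wD (Q (inord 2)) x * wD (P (inord 2)) x)); last first.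
  by move=> x _; rewrite sum_ord3.
rewrite sum_ord3 integD//; last exact: itgD.
rewrite integD//.
have E i : integ (fun x => wD (Q i) x * wD (P i) x) = ip (G i) (G' i).
  rewrite -[LHS]/(ip _ _) (wD_ip (hQ i).1 (dQ i)); last exact: (H1_wd (hP i)).1.
  by rewrite ipC (wD_ip (hP i).1 (dP i)) ?(ipC (G' i))//; exact: (dQ i).1.
by rewrite !E.
Qed.

Lemma norm3_ge0 Q : 0 <= norm3 Q.
Proof. exact: sqrtr_ge0. Qed.

Lemma norm3_sq Q G : (forall i, H1 (Q i)) -> wd3 Q G -> norm3 Q ^+ 2 = \sum_i ip (G i) (G i).
Proof.
move=> hQ dQ; rewrite /norm3 sqr_sqrtr (dot3E hQ hQ dQ dQ)//.
by apply: sumr_ge0 => i _; exact: ip_ge0.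
Qed.

Opaque norm3.

Lemma norm3_comp Q G i : (forall i, H1 (Q i)) -> wd3 Q G -> ip (G i) (G i) <= norm3 Q ^+ 2.
Proof.
move=> hQ dQ; rewrite (norm3_sq hQ dQ) (bigD1 i)//= lerDl.
by apply: sumr_ge0 => j _; exact: ip_ge0.
Qed.

Lemma H10_3_H1 h : H10_3 h -> forall i, H1 (h i).
Proof. by move=> hh i; case: (hh i). Qed.

Lemma norm3_sup h i x : H10_3 h -> I11 x -> `|h i x| <= 2 * norm3 h.
Proof.
move=> hh xI; have hH := H10_3_H1 hh.
have h1 := poincare (hh i) (H1_wd (hH i)) xI.
have h2 := norm3_comp i hH (H1_wd3 hH).
have n0 := norm3_ge0 h.
rewrite -(ler_pXn2r (n := 2))// ?nnegrE ?mulr_ge0// real_normK ?num_real//.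
by apply: (le_trans h1); rewrite exprMn; nra.
Qed.

(** The first variation of the energy. *)
Definition DE lam Q h : R := 2 / lam ^+ 2 *
   (3 * ip (wD (q1 Q)) (wD (q1 h)) + ip (wD (q2 Q)) (wD (q2 h)) + ip (wD (q3 Q)) (wD (q3 h)))
 + (ip (fun x => 6 * N1 (q1 Q x) (q2 Q x) (q3 Q x)) (q1 h)
   + ip (fun x => 2 * q2 Q x * N23 (q1 Q x) (q2 Q x) (q3 Q x)) (q2 h)
   + ip (fun x => 2 * q3 Q x * N23 (q1 Q x) (q2 Q x) (q3 Q x)) (q3 h)).

Lemma contWb u v w : cI (u) -> cI (v) ->
  cI (w) -> cI (fun x => Wb (u x) (v x) (w x)).
Proof. by move=> cu cv cw; rewrite /Wb /msq; wcont. Qed.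

Lemma contN1 u v w : cI (u) -> cI (v) ->
  cI (w) -> cI ((fun x => N1 (u x) (v x) (w x))).
Proof. by move=> cu cv cw; rewrite /N1 /msq; wcont. Qed.

Lemma energyE lam Q G : lam != 0 -> (forall i, H1 (Q i)) -> wd3 Q G ->
  energy lam Q = 1 / lam ^+ 2 * (3 * ip (G (inord 0)) (G (inord 0)) + ip (G (inord 1)) (G (inord 1))
     + ip (G (inord 2)) (G (inord 2)))
  + integ (fun x => Wb (q1 Q x) (q2 Q x) (q3 Q x) + ctheta).
Proof.
move=> l0 hQ dQ.
have LL i : itg (fun x => wD (Q i) x * wD (Q i) x).
  by have L := (H1_wd (hQ i)).1; exact: L2M.
have iW : itg (fun x => Wb (q1 Q x) (q2 Q x) (q3 Q x) + ctheta).
  apply: itg_cont; apply: contD; last exact: contC.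
  by apply: contWb; exact: (hQ _).1.
have E i : integ (fun x => wD (Q i) x * wD (Q i) x) = ip (G i) (G i).
  have L := (H1_wd (hQ i)).1.
  by rewrite -[LHS]/(ip _ _) (wD_ip (hQ i).1 (dQ i))// ipC (wD_ip (hQ i).1 (dQ i))//; exact: (dQ i).1.
rewrite /energy (integ_eq (g := fun x => 1 / lam ^+ 2 *
   (3 * (wD (Q (inord 0)) x * wD (Q (inord 0)) x) + wD (Q (inord 1)) x * wD (Q (inord 1)) x +
     wD (Q (inord 2)) x * wD (Q (inord 2)) x) + (Wb (q1 Q x) (q2 Q x) (q3 Q x) + ctheta))); last first.
  by move=> x _; rewrite sqnorm_Qtensor fbulk_Qtensor /q1 /q2 /q3; congr (_ + _); field.
have i3 := itgZ 3 (LL (inord 0)); have i4 := itgD i3 (LL (inord 1)).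
have i5 := itgD i4 (LL (inord 2)).
have i6 := itgZ (1 / lam ^+ 2) i5.
by rewrite (integD i6 iW) (integZ _ i5) (integD i4 (LL _)) (integD i3 (LL _)) (integZ _ (LL _)) !E.
Qed.

Lemma wd3D Q h G H : (forall i, H1 (Q i)) -> (forall i, H1 (h i)) -> wd3 Q G -> wd3 h H ->
  wd3 (Q + h) (fun i x => G i x + H i x).
Proof. by move=> hQ hh dQ dh i; apply: wdD; [exact: (hQ i).1|exact: (hh i).1|exact: dQ|exact: dh]. Qed.

Lemma H1_3D Q h : (forall i, H1 (Q i)) -> (forall i, H1 (h i)) -> forall i, H1 ((Q + h) i).
Proof. by move=> hQ hh i; apply: H1D; [exact: hQ|exact: hh]. Qed.

Lemma ip_sqD f g : L2 f -> L2 g -> ip (fun x => f x + g x) (fun x => f x + g x) =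
  ip f f + 2 * ip f g + ip g g.
Proof.
move=> Lf Lg; rewrite ipDl//; last exact: L2D.
by rewrite [X in X + _]ipC [X in _ + X]ipC !ipDl// (ipC g f); ring.
Qed.

(** The gradient part of the energy is quadratic, and the H1 norm controls the sup norm, in
    which [Wb_taylor] bounds the remainder of the bulk part. *)
Lemma energy_taylor lam Q : 0 < lam -> (forall i, H1 (Q i)) ->
  exists2 C, 0 <= C & forall h, H10_3 h -> norm3 h <= 1 / 2 ->
    `|energy lam (Q + h) - energy lam Q - DE lam Q h| <= C * norm3 h ^+ 2.
Proof.
move=> l0 hQ; have ln : lam != 0 by rewrite gt_eqF.
have l2 : 0 < lam ^+ 2 by rewrite exprn_gt0.
have [M M0 HM] : exists2 M : R, 0 <= M & forall i x, I11 x -> `|Q i x| <= M.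
  have [M0 p0 B0] := within_bounded (hQ (inord 0)).1.
  have [M1 p1 B1] := within_bounded (hQ (inord 1)).1.
  have [M2 p2 B2] := within_bounded (hQ (inord 2)).1.
  exists (M0 + M1 + M2); first by lra.
  by apply: forall3 => x xI; [have := B0 x xI|have := B1 x xI|have := B2 x xI]; lra.
have [K K0 HK] := Wb_taylor M0.
exists (5 / lam ^+ 2 + 8 * K); first by rewrite addr_ge0 ?mulr_ge0 ?invr_ge0 ?(ltW l2)//; lra.
move=> h hh hn; have hH := H10_3_H1 hh.
have dQ := H1_wd3 hQ; have dh := H1_wd3 hH.
rewrite (energyE ln (H1_3D hQ hH) (wd3D hQ hH dQ dh)) (energyE ln hQ dQ).
have LQ i : L2 (wD (Q i)) by exact: (dQ i).1.
have Lh i : L2 (wD (h i)) by exact: (dh i).1.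
rewrite !ip_sqD//.
have cQ i := (hQ i).1; have ch i := (hH i).1.
have cQ0 : cI ((q1 Q)) := cQ _.
have cQ1 : cI ((q2 Q)) := cQ _.
have cQ2 : cI ((q3 Q)) := cQ _.
have ch0 : cI ((q1 h)) := ch _.
have ch1 : cI ((q2 h)) := ch _.
have ch2 : cI ((q3 h)) := ch _.
pose rem x := Wb (q1 Q x + q1 h x) (q2 Q x + q2 h x) (q3 Q x + q3 h x) - Wb (q1 Q x) (q2 Q x) (q3 Q x)
   - (6 * N1 (q1 Q x) (q2 Q x) (q3 Q x) * q1 h x + 2 * q2 Q x * N23 (q1 Q x) (q2 Q x) (q3 Q x) * q2 h x
      + 2 * q3 Q x * N23 (q1 Q x) (q2 Q x) (q3 Q x) * q3 h x).
have crem : cI (rem) by rewrite /rem /Wb /N1 /N23 /msq; wcont.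
have E1 : integ (fun x => Wb (q1 (Q + h) x) (q2 (Q + h) x) (q3 (Q + h) x) + ctheta)
   = integ (fun x => Wb (q1 Q x) (q2 Q x) (q3 Q x) + ctheta) + integ rem
   + (ip (fun x => 6 * N1 (q1 Q x) (q2 Q x) (q3 Q x)) (q1 h)
   + ip (fun x => 2 * q2 Q x * N23 (q1 Q x) (q2 Q x) (q3 Q x)) (q2 h)
   + ip (fun x => 2 * q3 Q x * N23 (q1 Q x) (q2 Q x) (q3 Q x)) (q3 h)).
  rewrite /ip -!integD; first last.
  all: try (apply: itg_cont; rewrite /rem /Wb /N1 /N23 /msq; wcont; fail).
  by apply: integ_eq => x _; rewrite /rem /q1 /q2 /q3 /= !fctE; ring.
rewrite E1 /DE; set T := ip _ _ + ip _ _ + ip (fun x => 2 * q3 Q x * _) _.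
set W := integ _; rewrite -/(q1 Q) -/(q2 Q) -/(q3 Q).
rewrite -/(q1 h) -/(q2 h) -/(q3 h).
set A0 := ip (wD (q1 h)) (wD (q1 h)); set A1 := ip (wD (q2 h)) (wD (q2 h)); set A2 := ip (wD (q3 h)) (wD (q3 h)).
set B0 := ip (wD (q1 Q)) (wD (q1 Q)); set B1 := ip (wD (q2 Q)) (wD (q2 Q)); set B2 := ip (wD (q3 Q)) (wD (q3 Q)).
set C0 := ip (wD (q1 Q)) (wD (q1 h)); set C1 := ip (wD (q2 Q)) (wD (q2 h)); set C2 := ip (wD (q3 Q)) (wD (q3 h)).
have nA0 : A0 <= norm3 h ^+ 2 := norm3_comp (inord 0) hH dh.
have nA1 : A1 <= norm3 h ^+ 2 := norm3_comp (inord 1) hH dh.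
have nA2 : A2 <= norm3 h ^+ 2 := norm3_comp (inord 2) hH dh.
have pA0 : 0 <= A0 by exact: ip_ge0.
have pA1 : 0 <= A1 by exact: ip_ge0.
have pA2 : 0 <= A2 by exact: ip_ge0.
have e01 : 0 <= 2 * norm3 h <= 1 by have := norm3_ge0 h; lra.
have remB : `|integ rem| <= 2 * (K * (2 * norm3 h) ^+ 2).
  apply: integ_bound; first exact: itg_cont.
  move=> x xI; apply: HK => //; try exact: HM; exact: norm3_sup.
rewrite (_ : _ - _ = 1 / lam ^+ 2 * (3 * A0 + A1 + A2) + integ rem); last by field.
apply: (le_trans (ler_normD _ _)); rewrite [X in _ <= X]mulrDl; apply: lerD.
  rewrite ger0_norm; last first.
    by apply: mulr_ge0; [rewrite divr_ge0// ltW|lra].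
  rewrite mul1r mulrC [X in _ <= X]mulrAC ler_pM2r ?invr_gt0//; lra.
by apply: (le_trans remB); rewrite exprMn; nra.
Qed.

Lemma ip0r f : ip f 0 = 0.
Proof. by rewrite /ip (integ_eq (g := fun=> 0)) ?integ_cst ?mulr0// => x _; exact: mulr0. Qed.

Lemma wd0 : wd (0 : R -> R) 0.
Proof.
have h0 x : is_derive x 1 (0 : R -> R) ((0 : R -> R) x) by exact: is_derive_cst.
by apply: (wd_C1 h0) => x; exact: cst_continuous.
Qed.

Lemma cI0 : cI (0 : R -> R).
Proof. exact: cIC. Qed.

Lemma H10_0 : H10 (0 : R -> R).
Proof. by split=> //; apply: wd_H1 wd0; exact: cI0. Qed.

Lemma ip_wD0 f : L2 f -> ip f (wD 0) = 0.
Proof. by move=> Lf; rewrite ipC (wD_ip cI0 wd0)// ipC ip0r. Qed.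

Definition single (i : 'I_3) (k : R -> R) : triple R := fun j => if j == i then k else 0.

Lemma single_H10 i k : H10 k -> H10_3 (single i k).
Proof. by move=> hk j; rewrite /single; case: eqP => // _; exact: H10_0. Qed.

Lemma ip_wDZ f t k : L2 f -> H1 k -> ip f (wD (fun x => t * k x)) = t * ip f (wD k).
Proof.
move=> Lf hk; have wk := H1_wd hk.
have c : cI (fun x => t * k x) by apply: cIM; [exact: cIC|exact: hk.1].
by rewrite ipC (wD_ip c (wdZ t hk.1 wk))// ipZl ?(ipC f)//; exact: wk.1.
Qed.

Lemma DEZ lam Q t h : (forall i, H1 (Q i)) -> (forall i, H1 (h i)) ->
  DE lam Q (t *: h) = t * DE lam Q h.
Proof.
move=> hQ hh; rewrite scale3E /DE.
set th := (fun i x => t * h i x).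
have LQ i : L2 (wD (Q i)) by exact: (H1_wd (hQ i)).1.
have E i : ip (wD (Q i)) (wD (th i)) = t * ip (wD (Q i)) (wD (h i)) by exact: ip_wDZ.
have cQ0 : cI (q1 Q) by exact: (hQ _).1.
have cQ1 : cI (q2 Q) by exact: (hQ _).1.
have cQ2 : cI (q3 Q) by exact: (hQ _).1.
have E2 f i : cI f -> ip f (th i) = t * ip f (h i).
  by move=> cf; rewrite ipC ipZl ?(ipC f)//; apply: L2_cont => //; exact: (hh i).1.
have gen (l A B C D F G A' B' C' D' F' G' : R) : A' = t * A -> B' = t * B -> C' = t * C ->
    D' = t * D -> F' = t * F -> G' = t * G ->
    2 / l * (3 * A' + B' + C') + (D' + F' + G') = t * (2 / l * (3 * A + B + C) + (D + F + G)).
  by move=> -> -> -> -> -> ->; ring.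
apply: gen; try exact: E; apply: E2; rewrite /N1 /N23 /msq; wcont.
Qed.

Lemma norm3Z t h : H10_3 h -> norm3 (t *: h) = `|t| * norm3 h.
Proof.
move=> hh; have hH := H10_3_H1 hh; have dh := H1_wd3 hH.
rewrite scale3E; set th := (fun i x => t * h i x).
have dt : wd3 th (fun i x => t * wD (h i) x).
  by move=> i; apply: wdZ; [exact: (hH i).1|exact: dh].
have hHt i : H1 (th i) by apply: H1Z; exact: hH.
have S1 := norm3_sq hHt dt; have S2 := norm3_sq hH dh.
have S : \sum_i ip (fun x => t * wD (h i) x) (fun x => t * wD (h i) x) =
    t ^+ 2 * \sum_i ip (wD (h i)) (wD (h i)).
  rewrite mulr_sumr; apply: eq_bigr => i _; have L := (dh i).1.
  rewrite ipZl//; last exact: L2Z.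
  by rewrite ipC ipZl// mulrA -expr2.
rewrite S -S2 in S1.
move: (norm3_ge0 th) (norm3_ge0 h) S1; move: (norm3 th) (norm3 h) => p q p0 q0 S1.
apply/eqP; rewrite -(eqrXn2 (n := 2))// ?mulr_ge0// S1 exprMn.
by rewrite real_normK ?num_real.
Qed.

Lemma H10_3Z t h : H10_3 h -> H10_3 (t *: h).
Proof. by move=> hh i; apply: H10Z; exact: hh. Qed.

(** The energy differs from its linearization by a quadratic error, so the differential is
    [DE]; a linear form that is o(norm) vanishes by homogeneity. *)
Lemma critical_weak lam Q : 0 < lam -> cH Q ->
  critical lam Q <-> forall h, H10_3 h -> DE lam Q h = 0.
Proof.
move=> l0 hQ; have hQ1 : forall i, H1 (Q i) by case: hQ.
have [C C0 HC] := energy_taylor l0 hQ1.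
split=> [[_ [_ _ Hd]] h hh|H]; last first.
  split=> //; split.
  - by move=> a h k _ _; rewrite mulr0 addr0.
  - by exists 0 => h _; rewrite normr0 mul0r.
  - move=> e e0; exists (Num.min (1 / 2) (e / (C + 1))).
      by rewrite lt_min divr_gt0// ?divr_gt0//; lra.
    move=> h hh; rewrite lt_min => /andP[h1 h2]; rewrite subr0.
    have := HC h hh (ltW h1); rewrite H// subr0 => /le_trans; apply.
    rewrite expr2 mulrA ler_wpM2r ?norm3_ge0//.
    have C1 : 0 < C + 1 by lra.
    by move: h2; rewrite ltr_pdivlMr// => h2; have := norm3_ge0 h; nra.
have hH := H10_3_H1 hh.
have N0 := norm3_ge0 h; set N := norm3 h in N0.
apply/eqP; rewrite -normr_le0; apply/ler_addgt0Pr => e e0; rewrite add0r.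
have e1 : 0 < e / (2 * (N + 1)) by rewrite divr_gt0// mulr_gt0//; lra.
have [d d0 Hd'] := Hd _ e1.
(* The scaling t = 1 / T meets all the smallness conditions at once. *)
pose T := 1 + N / d + 2 * N + 2 * C * N ^+ 2 / e.
have Nd0 : 0 <= N / d by rewrite divr_ge0// ltW.
have Ce0 : 0 <= 2 * C * N ^+ 2 / e by rewrite divr_ge0 ?(ltW e0)// !mulr_ge0// sqr_ge0.
have T0 : 0 < T by rewrite /T; lra.
pose t := T^-1.
have t0 : 0 < t by rewrite invr_gt0.
have tT : t * T = 1 by rewrite mulVf// gt_eqF.
have nt : norm3 (t *: h) = t * N by rewrite norm3Z// gtr0_norm.
have tN1 : t * N < d.
  have -> : t * N = t * (N / d) * d by field; rewrite gt_eqF.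
  by rewrite gtr_pMl//; move: tT; rewrite /T !mulrDr; have := mulr_ge0 (ltW t0) Ce0; have := mulr_ge0 (ltW t0) N0; nra.
have tN2 : t * N <= 1 / 2.
  by move: tT; rewrite /T !mulrDr; have := mulr_ge0 (ltW t0) Ce0; have := mulr_ge0 (ltW t0) Nd0; nra.
have tN3 : C * (t * N) * N <= e / 2.
  have : t * (2 * C * N ^+ 2 / e) <= 1.
    by move: tT; rewrite /T !mulrDr; have := mulr_ge0 (ltW t0) N0; have := mulr_ge0 (ltW t0) Nd0; nra.
  rewrite mulrA ler_pdivrMr// => h1; nra.
have hth := H10_3Z t hh.
have A := Hd' _ hth; rewrite nt subr0 in A; have {}A := A tN1.
have B := HC _ hth; rewrite nt in B; have {}B := B tN2.
rewrite DEZ// in B.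
have eN : e / (2 * (N + 1)) * (t * N) <= t * (e / 2).
  have -> : e / (2 * (N + 1)) * (t * N) = t * (e / 2) * (N / (N + 1)) by field; rewrite gt_eqF//; lra.
  apply: ler_piMr; first by rewrite mulr_ge0 ?(ltW t0)//; lra.
  by rewrite ler_pdivrMr; lra.
have : t * `|DE lam Q h| <= t * e.
  rewrite -(gtr0_norm t0) -normrM (gtr0_norm t0).
  set X := energy _ _ - _ in A B.
  have -> : t * DE lam Q h = X - (X - t * DE lam Q h) by ring.
  apply: (le_trans (ler_normB _ _)).
  have : C * (t * N) ^+ 2 <= t * (e / 2).
    have -> : C * (t * N) ^+ 2 = t * (C * (t * N) * N) by ring.
    by rewrite ler_wpM2l// ltW.
  by move: A B; rewrite -/X; lra.
by rewrite ler_pM2l.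
Qed.

(** u'' = w in the classical sense on [-1, 1]: z extends u to the line, and w is continued
    by its end values, so that derivatives are two-sided. *)
Definition sol u w := exists z z1 : R -> R,
  [/\ eqI u z, forall x, is_derive x 1 z (z1 x) & forall x, is_derive x 1 z1 (w (cl x))].

Lemma sol_H1 u w : cI w -> sol u w -> H1 u.
Proof.
move=> cw [z [z1 [uz dz dz1]]]; apply: H1_eqI (eqI_sym uz) _.
by apply: C1_H1 dz _; exact: is_derive_cont dz1.
Qed.

Lemma sol_weak u w k : cI w -> sol u w -> H10 k -> ip (wD u) (wD k) = - ip w k.
Proof.
move=> cw [z [z1 [uz dz dz1]]] [hk k0 k1].
have cz1 := is_derive_cont dz1; have cz := is_derive_cont dz.
have wu : wd u z1 by apply: wd_eqI (eqI_sym uz) _ (wd_C1 dz cz1).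
have cu : cI u by apply: cont_eqI (eqI_sym uz) _; exact: continuous_subspaceT.
have wk := H1_wd hk.
rewrite (wD_ip cu wu); last exact: wk.1.
rewrite ipC (wd_ibp hk.1 wk dz1); last exact: continuous_comp_cl.
by rewrite k0 k1 !mul0r subrr sub0r ipC; congr (- _); apply: ip_eq => // x /cl_idI ->.
Qed.

(** Solve z'' = w classically with the boundary values of u. Then u - z is in H10 and its
    derivative is orthogonal to itself. *)
Lemma weak_sol u w : H1 u -> cI w ->
  (forall k, H10 k -> ip (wD u) (wD k) = - ip w k) -> sol u w.
Proof.
move=> hu cw H; pose w' := w \o cl.
have cw' : continuous w' by exact: continuous_comp_cl.
have dJw x := is_derive_J x cw'; have cJw := is_derive_cont dJw.
have dJJw x := is_derive_J x cJw.
pose b := (u 1 - u (-1) - J (J w') 1) / 2.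
pose z x := (u (-1) + b) + b * x + J (J w') x.
pose z1 x := b + J w' x.
have dz x : is_derive x 1 z (z1 x).
  have d1 : is_derive x 1 (fun x => (u (-1) + b) + b * x) b.
    have := is_derive_affine b (u (-1) + b) x (fun x => is_derive_id x 1).
    rewrite mulr1; apply: near_eq_is_derive; near=> y; by rewrite addrC.
  exact: is_deriveD.
have dz1 x : is_derive x 1 z1 (w' x).
  by rewrite -[w' x]add0r; apply: is_deriveD.
have cz1 := is_derive_cont dz1.
exists z, z1; split => //.
pose h x := u x + (-1) * z x.
have cz : cI z by apply: continuous_subspaceT; exact: is_derive_cont dz.
have ch : cI h by apply: cID; [exact: hu.1|apply: cIM => //; exact: cIC].
have wh : wd h (fun x => wD u x + (-1) * z1 x).
  apply: wdD; [exact: hu.1|by apply: cIM => //; exact: cIC|exact: H1_wd|].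
  by apply: wdZ => //; exact: wd_C1.
have hh : H10 h.
  split; first exact: wd_H1 wh.
    rewrite /h /z J_N1; ring.
  by rewrite /h /z /b; field.
have Lz1 : L2 z1 by apply: L2_cont; exact: continuous_subspaceT.
have Lu := (H1_wd hu).1.
have sz : sol z w by exists z, z1.
have E : ip (fun x => wD u x + (-1) * z1 x) (fun x => wD u x + (-1) * z1 x) = 0.
  have L1 := wh.1; have Lwh := (H1_wd (wd_H1 ch wh)).1.
  rewrite -(wD_ip ch wh)// ipC ipDl//; last exact: L2Z.
  rewrite ipZl// H// -(wD_ip cz (wd_C1 dz cz1))// (sol_weak cw sz hh); ring.
move=> x xI; have := poincare hh wh xI; rewrite E mulr0 => h2.
have : h x ^+ 2 == 0 by rewrite eq_le h2 sqr_ge0.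
by rewrite sqrf_eq0 /h mulN1r subr_eq0 => /eqP.
Unshelve. all: by end_near.
Qed.

(** Test the first variation against one component at a time; regularity comes from
    [weak_sol]. *)
Lemma critical_sol lam Q : 0 < lam -> cH Q -> critical lam Q <->
  [/\ sol (q1 Q) (fun x => lam ^+ 2 * N1 (q1 Q x) (q2 Q x) (q3 Q x)),
      sol (q2 Q) (fun x => lam ^+ 2 * (q2 Q x * N23 (q1 Q x) (q2 Q x) (q3 Q x))) &
      sol (q3 Q) (fun x => lam ^+ 2 * (q3 Q x * N23 (q1 Q x) (q2 Q x) (q3 Q x)))].
Proof.
move=> l0 hQ; have hQ1 : forall i, H1 (Q i) by case: hQ.
rewrite critical_weak//.
have cQ0 : cI (q1 Q) by exact: (hQ1 _).1.
have cQ1 : cI (q2 Q) by exact: (hQ1 _).1.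
have cQ2 : cI (q3 Q) by exact: (hQ1 _).1.
have LQ i : L2 (wD (Q i)) by exact: (H1_wd (hQ1 i)).1.
set f1 := (fun x => lam ^+ 2 * N1 _ _ _).
set f2 := (fun x => lam ^+ 2 * (q2 Q x * _)).
set f3 := (fun x => lam ^+ 2 * (q3 Q x * _)).
have c1 : cI f1 by rewrite /f1 /N1 /msq; wcont.
have c2 : cI f2 by rewrite /f2 /N23 /msq; wcont.
have c3 : cI f3 by rewrite /f3 /N23 /msq; wcont.
have ln : lam ^+ 2 != 0 by rewrite expf_neq0// gt_eqF.
have scale c f k : cI f -> cI k -> ip (fun x => c * f x) k = c * ip f k.
  by move=> cf ck; rewrite ipZl//; exact: L2_cont.
have DEE h : H10_3 h -> DE lam Q h = 2 / lam ^+ 2 *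
   (3 * (ip (wD (q1 Q)) (wD (q1 h)) + ip f1 (q1 h)) + (ip (wD (q2 Q)) (wD (q2 h)) + ip f2 (q2 h))
     + (ip (wD (q3 Q)) (wD (q3 h)) + ip f3 (q3 h))).
  move=> hh; have ch i : cI (h i) by exact: (H10_3_H1 hh i).1.
  have ch0 : cI (q1 h) by exact: ch.
  have ch1 : cI (q2 h) by exact: ch.
  have ch2 : cI (q3 h) by exact: ch.
  have cc1 : cI (fun x => N1 (q1 Q x) (q2 Q x) (q3 Q x)) by exact: contN1.
  have cc2 : cI (fun x => q2 Q x * N23 (q1 Q x) (q2 Q x) (q3 Q x)) by rewrite /N23 /msq; wcont.
  have cc3 : cI (fun x => q3 Q x * N23 (q1 Q x) (q2 Q x) (q3 Q x)) by rewrite /N23 /msq; wcont.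
  rewrite /DE /f1 /f2 /f3 !scale//.
  rewrite (ip_eq (f := fun x => 2 * q2 Q x * _) (f' := fun x => 2 * (q2 Q x * N23 (q1 Q x) (q2 Q x) (q3 Q x))) (g := q2 h) (g' := q2 h))//; last by move=> x _; rewrite mulrA.
  rewrite (ip_eq (f := fun x => 2 * q3 Q x * _) (f' := fun x => 2 * (q3 Q x * N23 (q1 Q x) (q2 Q x) (q3 Q x))) (g := q3 h) (g' := q3 h))//; last by move=> x _; rewrite mulrA.
  rewrite !scale//.
  have gen (l A B C D E F : R) : l != 0 -> 2 / l * (3 * A + B + C) + (6 * D + 2 * E + 2 * F) =
     2 / l * (3 * (A + l * D) + (B + l * E) + (C + l * F)) by move=> l1; field.
  exact: gen.
split=> [H|[s1 s2 s3] h hh]; last first.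
  rewrite DEE// (sol_weak c1 s1 (hh _)) (sol_weak c2 s2 (hh _)) (sol_weak c3 s3 (hh _)).
  by rewrite !addNr mulr0 !addr0 mulr0.
have l2 : 2 / lam ^+ 2 != 0 by rewrite mulf_neq0// invr_neq0.
have ne01 : (inord 0 : 'I_3) == inord 1 = false by rewrite -val_eqE /= !inordK.
have ne02 : (inord 0 : 'I_3) == inord 2 = false by rewrite -val_eqE /= !inordK.
have ne12 : (inord 1 : 'I_3) == inord 2 = false by rewrite -val_eqE /= !inordK.
have ne10 : (inord 1 : 'I_3) == inord 0 = false by rewrite -val_eqE /= !inordK.
have ne20 : (inord 2 : 'I_3) == inord 0 = false by rewrite -val_eqE /= !inordK.
have ne21 : (inord 2 : 'I_3) == inord 1 = false by rewrite -val_eqE /= !inordK.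
split; apply: (weak_sol (hQ1 _)) => // k hk; apply/eqP; rewrite -addr_eq0.
- have := H _ (single_H10 (inord 0) hk); rewrite DEE ?single_H10//; last exact: single_H10.
  rewrite /q1 /q2 /q3 /single eqxx ne10 ne20 !ip_wD0// !ip0r !addr0.
  by move/eqP; rewrite mulf_eq0 (negbTE l2) orFb mulf_eq0 pnatr_eq0.
- have := H _ (single_H10 (inord 1) hk); rewrite DEE ?single_H10//; last exact: single_H10.
  rewrite /q1 /q2 /q3 /single eqxx ne01 ne21 !ip_wD0// !ip0r !addr0 mulr0 add0r.
  by move/eqP; rewrite mulf_eq0 (negbTE l2).
- have := H _ (single_H10 (inord 2) hk); rewrite DEE ?single_H10//; last exact: single_H10.
  rewrite /q1 /q2 /q3 /single eqxx ne02 ne12 !ip_wD0// !ip0r !addr0 mulr0 !add0r.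
  by move/eqP; rewrite mulf_eq0 (negbTE l2).
Qed.

End Energy2.

(** * The branch lies in the plane q1 = 2/3 *)

Section Norms.
Context {R : realType}.
Implicit Types (x y a b c M lam s t e d : R) (Q P h k v : triple R).

Lemma norm3_expand h k t : H10_3 h -> H10_3 k ->
  norm3 (h + t *: k) ^+ 2 = norm3 h ^+ 2 + 2 * t * dot3 h k + t ^+ 2 * norm3 k ^+ 2.
Proof.
move=> hh hk; have hH := H10_3_H1 hh; have kH := H10_3_H1 hk.
have dh := H1_wd3 hH; have dk := H1_wd3 kH.
have hkt : H10_3 (t *: k) by exact: H10_3Z.
have dkt : wd3 (t *: k) (fun i x => t * wD (k i) x).
  by move=> i; apply: wdZ; [exact: (kH i).1|exact: dk].
have E1 := norm3_sq (H1_3D hH (H10_3_H1 hkt)) (wd3D hH (H10_3_H1 hkt) dh dkt).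
have E2 := norm3_sq hH dh; have E3 := norm3_sq kH dk; have E4 := dot3E hH kH dh dk.
have G (p q r : 'I_3 -> R) (n A B C : R) : n = \sum_i (p i + 2 * t * q i + t ^+ 2 * r i) ->
    A = \sum_i p i -> B = \sum_i q i -> C = \sum_i r i -> n = A + 2 * t * B + t ^+ 2 * C.
  by move=> -> -> -> ->; rewrite !big_split /= !mulr_sumr.
apply: (G _ _ _ _ _ _ _ _ E2 E4 E3); apply: (etrans E1); apply: eq_bigr => i _.
have Lh := (dh i).1; have Lk := (dk i).1; have Lt := L2Z t Lk.
rewrite ip_sqD//; congr (_ + _ + _); first by rewrite ipC ipZl// ipC mulrA.
by rewrite ipZl// ipC ipZl// mulrA expr2.
Qed.

Lemma dot3_CS h k : H10_3 h -> H10_3 k -> `|dot3 h k| <= norm3 h * norm3 k.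
Proof.
move=> hh hk.
have := @quad_disc _ (norm3 h ^+ 2) (dot3 h k) (norm3 k ^+ 2) (sqr_ge0 _) (sqr_ge0 _).
have E t := norm3_expand t hh hk.
move=> H; have {}H : dot3 h k ^+ 2 <= norm3 h ^+ 2 * norm3 k ^+ 2.
  by apply: H => t; rewrite -E sqr_ge0.
have h0 := norm3_ge0 h; have k0 := norm3_ge0 k.
move: H h0 k0; move: (norm3 h) (norm3 k) (dot3 h k) => p q r H h0 k0.
rewrite -(ler_pXn2r (n := 2))// ?nnegrE ?mulr_ge0//.
by rewrite real_normK ?num_real// exprMn.
Qed.

Lemma norm3D h k : H10_3 h -> H10_3 k -> norm3 (h + k) <= norm3 h + norm3 k.
Proof.
move=> hh hk; have := norm3_expand 1 hh hk; have := dot3_CS hh hk.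
rewrite scale1r mulr1 expr1n mul1r => H1 H2.
have h0 := norm3_ge0 h; have k0 := norm3_ge0 k; have n0 := norm3_ge0 (h + k).
move: H1 H2 h0 k0 n0; move: (norm3 (h + k)) (norm3 h) (norm3 k) (dot3 h k) => n p q r H1 H2 h0 k0 n0.
rewrite -(ler_pXn2r (n := 2))// ?nnegrE ?addr_ge0// H2.
by have := ler_norm r; nra.
Qed.

Lemma H10_3D h k : H10_3 h -> H10_3 k -> H10_3 (h + k).
Proof. by move=> hh hk i; apply: H10D; [exact: hh|exact: hk]. Qed.

Lemma H10_3B h k : H10_3 h -> H10_3 k -> H10_3 (h - k).
Proof. by move=> hh hk; rewrite -scaleN1r; apply: H10_3D => //; exact: H10_3Z. Qed.

Lemma cH_bc Q P i : cH Q -> cH P -> Q i (-1) = P i (-1) /\ Q i 1 = P i 1.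
Proof.
move=> [_ [a1 a2] [b1 b2] [c1 c2]] [_ [a1' a2'] [b1' b2'] [c1' c2']]; move: i.
apply: forall3; rewrite -?[Q (inord 0)]/(q1 Q) -?[Q (inord 1)]/(q2 Q) -?[Q (inord 2)]/(q3 Q);
rewrite -?[P (inord 0)]/(q1 P) -?[P (inord 1)]/(q2 P) -?[P (inord 2)]/(q3 P).
- by rewrite a1 a2 a1' a2'.
- by rewrite b1 b2 b1' b2'.
- by rewrite c1 c2 c1' c2'.
Qed.

Lemma cH_sub Q P : cH Q -> cH P -> H10_3 (Q - P).
Proof.
move=> hQ hP i; have [E1 E2] := cH_bc i hQ hP.
have [hQ1 _ _ _] := hQ; have [hP1 _ _ _] := hP.
split.
- have := H1D (hQ1 i) (H1Z (-1) (hP1 i)); apply: H1_eqI => x _.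
  by rewrite mulN1r.
- by rewrite !fctE E1 subrr.
- by rewrite !fctE E2 subrr.
Qed.

Lemma norm3_0 : norm3 (0 : triple R) = 0.
Proof.
have h0 : H10_3 (0 : triple R) by move=> i; exact: H10_0.
by rewrite -(scale0r (0 : triple R)) norm3Z// normr0 mul0r.
Qed.

Lemma H10_H1 (u : R -> R) : H10 u -> H1 u. Proof. by case. Qed.
Lemma H10_cI (u : R -> R) : H10 u -> cI u. Proof. by case=> -[]. Qed.

Lemma curve_lim (u : R -> triple R) t v e : curve_deriv u t v -> 0 < e ->
  exists2 d, 0 < d & forall s, s != 0 -> `|s| < d ->
    norm3 (s^-1 *: (u (s + t) - u t) - v) < e.
Proof.
move=> [_ /cvgrPdist_lt H] e0; have := H e e0.
rewrite /dnbhs /within /= /nbhs /= => -[d d0 Hd]; exists d => // s s0 sd.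
have := Hd s; rewrite /ball_ /= sub0r normrN => /(_ sd s0).
by rewrite sub0r normrN ger0_norm// norm3_ge0.
Qed.

Lemma curve_cont (u : R -> triple R) t v e : (forall s, 0 < s -> cH (u s)) -> 0 < t ->
  curve_deriv u t v -> 0 < e ->
  exists2 d, 0 < d & forall s, `|s| < d -> 0 < s + t /\ norm3 (u (s + t) - u t) < e.
Proof.
move=> hu t0 dv e0; have [d1 d10 Hd] := curve_lim dv ltr01.
have hv : H10_3 v by case: dv.
have nv := norm3_ge0 v.
have [d3 d30 d3E] : exists2 d3, 0 < d3 & d3 * (2 + norm3 v) = e.
  move: (norm3 v) nv => n nv; have n2 : 0 < 2 + n by lra.
  by exists (e / (2 + n)); [rewrite divr_gt0|rewrite divfK// gt_eqF].
exists (Num.min d1 (Num.min t d3)).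
  by rewrite !lt_min d10 t0.
move=> s; rewrite !lt_min => /and3P[s1 s2 s3].
have st : 0 < s + t by move: s2; rewrite ltr_norml => /andP[]; lra.
split => //; have [->|s0] := eqVneq s 0; first by rewrite add0r subrr norm3_0.
have hd : H10_3 (u (s + t) - u t) by apply: cH_sub; exact: hu.
have E : u (s + t) - u t = s *: ((s^-1 *: (u (s + t) - u t) - v) + v).
  by rewrite subrK scalerA divff// scale1r.
rewrite E norm3Z; last first.
  by apply: H10_3D => //; apply: H10_3B => //; exact: H10_3Z.
have hw : H10_3 (s^-1 *: (u (s + t) - u t) - v) by apply: H10_3B => //; exact: H10_3Z.
have T := norm3D hw hv; have B := Hd s s0 s1.
move: (normr_ge0 s) nv s3 d3E (norm3_ge0 (s^-1 *: (u (s + t) - u t) - v + v)) T B {Hd E}.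
move: (norm3 (s^-1 *: (u (s + t) - u t) - v + v)) (norm3 (s^-1 *: (u (s + t) - u t) - v)) (norm3 v) `|s|.
by move=> p q n z z0 n0 zd dE p0 T B; nra.
Qed.

End Norms.

Section Branch.
Context {R : realType}.
Implicit Types (f g u v w k : R -> R) (x y a b c M lam s t e d : R) (Q P h : triple R).

(** The infimum of a set that is not bounded below is 0 by convention, so a positive infimum
    is a true lower bound. *)
Lemma inf_pos_le (S : set R) x : 0 < inf S -> S x -> inf S <= x.
Proof.
move=> h Sx; apply: ge_inf => //; apply: contrapT => nS.
by have := h; rewrite inf_out ?ltxx// => -[_ /nS].
Qed.

Lemma nu_le (chi : R -> triple R) lam u v : 0 < nu chi lam -> H10 u -> H10 v ->
  ~ (eqI u 0 /\ eqI v 0) ->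
  0 < integ (fun x => u x ^+ 2 + v x ^+ 2) /\
  nu chi lam * integ (fun x => u x ^+ 2 + v x ^+ 2) <= Phi lam (chi lam) u v.
Proof.
move=> n0 hu hv uv; set I := integ _.
have I0 : 0 <= I by apply: integ_ge0 => x _; rewrite addr_ge0 ?sqr_ge0.
have H : nu chi lam <= Phi lam (chi lam) u v / I.
  by apply: inf_pos_le => //; exists (u, v) => //; split.
have Ip : 0 < I.
  rewrite lt_neqAle I0 andbT; apply/eqP => E; move: H; rewrite -E invr0 mulr0.
  by rewrite leNgt n0.
by split => //; move: H; rewrite ler_pdivlMr.
Qed.

Lemma PhiE lam Q u v : (forall i, H1 (Q i)) -> H1 u -> H1 v ->
  Phi lam Q u v = 6 / lam ^+ 2 * ip (wD u) (wD u) + 2 / lam ^+ 2 * ip (wD v) (wD v)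
  + integ (fun x => 6 * (theta / 3 + 2 * q1 Q x + 9 * q1 Q x ^+ 2 + q2 Q x ^+ 2) * u x ^+ 2 +
    2 * (theta / 3 - 4 * q1 Q x + 3 * q1 Q x ^+ 2 + 3 * q2 Q x ^+ 2) * v x ^+ 2 +
    8 * q2 Q x * (3 * q1 Q x - 2) * u x * v x).
Proof.
move=> hQ hu hv.
have c1 : cI (q1 Q) by exact: (hQ _).1.
have c2 : cI (q2 Q) by exact: (hQ _).1.
have cu : cI u by exact: hu.1. have cv : cI v by exact: hv.1.
have Lu := (H1_wd hu).1; have Lv := (H1_wd hv).1.
have iu := L2M Lu Lu; have iv := L2M Lv Lv.
set f := (fun x => 6 * _ * _ + _ + _).
have cf : cI f by rewrite /f /theta; wcont.
have i1 := itgZ (6 / lam ^+ 2) iu; have i2 := itgZ (2 / lam ^+ 2) iv.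
rewrite /Phi (integ_eq (g := fun x => 6 / lam ^+ 2 * (wD u x * wD u x) +
   2 / lam ^+ 2 * (wD v x * wD v x) + f x)); last by move=> x _; rewrite /f; ring.
by rewrite (integD (itgD i1 i2) (itg_cont cf)) (integD i1 i2) (integZ _ iu) (integZ _ iv).
Qed.

Lemma ip_wD0_wD0 : ip (wD (0 : R -> R)) (wD 0) = 0.
Proof. by rewrite ip_wD0//; exact: (H1_wd (H10_H1 H10_0)).1. Qed.

(** The factor a makes the plane q1 = 2/3 invariant. *)
Lemma N1_fact a b : N1 (2 / 3 + a) b 0 = a * (b ^+ 2 + 3 * (2 / 3 + a) ^+ 2 + 4 * (2 / 3 + a)).
Proof. by rewrite /N1 /msq; field. Qed.

Lemma eqI0_dec u : eqI u 0 \/ exists2 x, I11 x & u x != 0.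
Proof.
have [h|h] := pselect (exists2 x, I11 x & u x != 0); first by right.
left => x xI; apply/eqP; apply: contrapT => /negP ux; apply: h; by exists x.
Qed.

(** The equation of a = q1 - 2/3, tested against a itself. *)
Lemma branch_q1_weak (chi : R -> triple R) lam : is_branch chi -> 0 < lam ->
  let a := fun x => q1 (chi lam) x - 2 / 3 in
  [/\ H10 a, cI (q2 (chi lam)) & ip (wD a) (wD a) = - lam ^+ 2 *
    integ (fun x => a x ^+ 2 * (q2 (chi lam) x ^+ 2 + 3 * (2 / 3 + a x) ^+ 2 + 4 * (2 / 3 + a x)))].
Proof.
move=> [_ hb _ _] l0 a; have [[hcH q30] hcr] := hb lam l0.
have [hH1 [b1 b2] _ _] := hcH.
have [s1 _ _] := (critical_sol l0 hcH).1 hcr.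
have hq : H1 (q1 (chi lam)) by exact: hH1.
have cq1 : cI (q1 (chi lam)) by exact: hq.1.
have cq2 : cI (q2 (chi lam)) by exact: (hH1 _).1.
have cq3 : cI (q3 (chi lam)) by exact: (hH1 _).1.
have ca : cI a by rewrite /a; wcont.
have wa : wd a (wD (q1 (chi lam))).
  have h1 : wd (fun _ : R => - (2 / 3) : R) 0.
    have d x : is_derive x 1 (fun _ : R => - (2 / 3) : R) ((0 : R -> R) x) by exact: is_derive_cst.
    by apply: (wd_C1 d) => x; exact: cst_continuous.
  have := wdD hq.1 (@cIC R (- (2 / 3))) (H1_wd hq) h1.
  by apply: wd_eqI => // x _ /=; rewrite addr0.
have ha : H10 a.
  split; first exact: wd_H1 wa.
    by rewrite /a b1 /qplus subrr.
  by rewrite /a b2 /qplus subrr.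
split => //.
set f := (fun x => lam ^+ 2 * N1 _ _ _) in s1.
have cf : cI f by rewrite /f /N1 /msq; wcont.
have := sol_weak cf s1 ha.
have Lw := (H1_wd (H10_H1 ha)).1 => /= E.
rewrite (wD_ip ca wa)// E mulNr; congr (- _).
rewrite -integZ; last by apply: itg_cont; wcont.
apply: integ_eq => x xI; rewrite /f (q30 x xI).
have -> : q1 (chi lam) x = 2 / 3 + a x by rewrite /a addrC subrK.
by rewrite N1_fact; ring.
Qed.

(** The factor of a^2 in [branch_q1_weak] is at least -4/3, and for small lambda the
    resulting negative term is absorbed by the Poincare inequality. *)
Lemma small_lam_q1 (chi : R -> triple R) lam : is_branch chi -> 0 < lam -> lam <= 1 / 4 ->
  eqI (fun x => q1 (chi lam) x - 2 / 3) 0.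
Proof.
move=> hb l0 l4; have [ha c2 E] := branch_q1_weak hb l0.
set a := (fun x => _ - _) in ha E *; set A := ip (wD a) (wD a) in E.
have P := poincare ha (H1_wd (H10_H1 ha)).
have ca : cI a by exact: H10_cI.
have A0 : 0 <= A by exact: ip_ge0.
have i2 : itg (fun x => a x ^+ 2) by apply: itg_cont; wcont.
have B : - (4 / 3) * integ (fun x => a x ^+ 2) <= integ (fun x => a x ^+ 2 * (q2 (chi lam) x ^+ 2 + 3 * (2 / 3 + a x) ^+ 2 + 4 * (2 / 3 + a x))).
  rewrite -integZ//; apply: integ_le; [exact: itgZ|by apply: itg_cont; wcont|].
  move=> x _; rewrite mulrC ler_wpM2l ?sqr_ge0//.
  by have := sqr_ge0 (q2 (chi lam) x); have := sqr_ge0 (3 * (2 / 3 + a x) + 2); nra.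
have I2 : integ (fun x => a x ^+ 2) <= 4 * A.
  have -> : 4 * A = 2 * (2 * A) by ring.
  by rewrite -(integ_cst (2 * A)); apply: integ_le => //; exact: itg_cst.
have A00 : A = 0.
  apply/eqP; rewrite eq_le A0 andbT.
  have l2 : lam ^+ 2 <= 1 / 16 by nra.
  have l20 : 0 <= lam ^+ 2 by exact: sqr_ge0.
  move: E B I2; move: (integ _) (integ _) => X Y E B I2.
  nra.
move=> x xI; have := P x xI; rewrite -/A A00 mulr0 => h.
by apply/eqP; rewrite -sqrf_eq0 eq_le h sqr_ge0.
Qed.

(** In the direction (a, 0), with a = q1 - 2/3, the second variation reduces by
    [branch_q1_weak] to the integral of 6 a^2 (6 a^2 + 6 a - 4/3), which is not positive
    when a is small. As nu > 0, this direction is zero. *)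
Lemma gap_q1 (chi : R -> triple R) lam : is_branch chi -> 0 < lam ->
  (forall x, I11 x -> `|q1 (chi lam) x - 2 / 3| <= 1 / 8) ->
  eqI (fun x => q1 (chi lam) x - 2 / 3) 0.
Proof.
move=> hb l0 sm; have [ha c2 E] := branch_q1_weak hb l0.
set a := (fun x => _ - _) in ha E *; set A := ip (wD a) (wD a) in E.
have [//|[x0 x0I ax0]] := eqI0_dec a; exfalso.
have [_ /(_ lam l0) [[hcH _] _] _ /(_ lam l0) n0] := hb.
have [hH1 _ _ _] := hcH.
have ne : ~ (eqI a 0 /\ eqI (0 : R -> R) 0) by move=> [/(_ x0 x0I) h _]; move: ax0; rewrite h eqxx.
have [I0 NP] := nu_le n0 ha H10_0 ne.
have ca : cI a by exact: H10_cI.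
have c1 : cI (q1 (chi lam)) by exact: (hH1 _).1.
have c0 := @cI0 R.
have : Phi lam (chi lam) a 0 <= 0.
  rewrite (PhiE _ hH1 (H10_H1 ha) (H10_H1 H10_0)) ip_wD0_wD0 mulr0 addr0 -/A E.
  have -> x y : 6 / lam ^+ 2 * (- lam ^+ 2 * x) + y = - 6 * x + y.
    by field; rewrite gt_eqF.
  rewrite -integZ; last by apply: itg_cont; wcont.
  rewrite -integD.
  - rewrite -[leRHS](mulr0 2) -(integ_cst 0); apply: integ_le; [|exact: itg_cst|].
    + by apply: itg_cont; rewrite /theta; wcont.
    + move=> x xI; have -> : q1 (chi lam) x = 2 / 3 + a x by rewrite /a addrC subrK.
      have := sm x xI; rewrite -/(a x) ler_norml => /andP[h1 h2].
      have -> : (0 : R -> R) x = 0 by [].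
      rewrite /theta; move: (a x) (q2 (chi lam) x) h1 h2 => z q h1 h2.
      rewrite (_ : _ + _ = z ^+ 2 * (6 * (6 * z ^+ 2 + 6 * z - 4 / 3))); last by field.
      by rewrite mulr_ge0_le0 ?sqr_ge0//; nra.
  - by apply: itg_cont; wcont.
  - by apply: itg_cont; rewrite /theta; wcont.
move=> /(le_trans NP); apply/negP; rewrite -ltNge; exact: mulr_gt0.
Qed.

Lemma branch_cH (chi : R -> triple R) lam : is_branch chi -> 0 < lam -> cH (chi lam).
Proof. by move=> [_ hb _ _] l0; have [[]] := hb lam l0. Qed.

Lemma branch_cont (chi : R -> triple R) lam e : is_branch chi -> 0 < lam -> 0 < e ->
  exists2 d, 0 < d & forall s, `|s| < d -> 0 < s + lam /\ norm3 (chi (s + lam) - chi lam) < e.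
Proof.
move=> hb l0 e0; have [_ _ [D [D0 dD]] _] := hb.
have := dD 0%N lam l0; rewrite D0 => dv.
by apply: curve_cont dv e0 => // s s0; exact: branch_cH.
Qed.

(** By [gap_q1] and continuity of the branch, the set of parameters at which q1 = 2/3 is
    open and closed; it contains the small ones. Connectedness of the half-line is used
    through the intermediate value theorem for the indicator of that set. *)
Lemma branch_q1 (chi : R -> triple R) lam : is_branch chi -> 0 < lam ->
  eqI (q1 (chi lam)) (fun=> 2 / 3).
Proof.
move=> hb; suff H l : 0 < l -> eqI (fun x => q1 (chi l) x - 2 / 3) 0.
  by move=> l0 x xI; have /eqP := H _ l0 x xI; rewrite subr_eq0 => /eqP.
move=> l0; have [l4|l4] := leP l (1 / 4); first exact: small_lam_q1.
apply: contrapT => nl.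
(* The indicator of the parameters at which q1 differs from 2/3, to be shown locally
   constant. *)
pose F (t : R) : R := if pselect (eqI (fun x => q1 (chi t) x - 2 / 3) 0) then 0 else 1.
have close t t' x : 0 < t -> 0 < t' -> norm3 (chi t' - chi t) < 1 / 32 -> I11 x ->
   `|q1 (chi t') x - q1 (chi t) x| <= 1 / 16.
  move=> t0 t0' hn xI.
  have := norm3_sup (inord 0) (cH_sub (branch_cH hb t0') (branch_cH hb t0)) xI.
  rewrite !fctE => /le_trans; apply; lra.
have loc t t' : 0 < t -> 0 < t' -> norm3 (chi t' - chi t) < 1 / 32 -> F t' = F t.
  move=> t0 t0' hn; have cl := close t t' _ t0 t0' hn.
  rewrite /F; case: pselect => h1; case: pselect => h2 //; exfalso.
    apply: h2; apply: gap_q1 => // x xI; have := cl x xI.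
    have /eqP := h1 x xI; rewrite subr_eq0 => /eqP ->; rewrite distrC; lra.
  apply: h1; apply: gap_q1 => // x xI; have := cl x xI.
  by have /eqP := h2 x xI; rewrite subr_eq0 => /eqP ->; lra.
have cF : {within `[1 / 4, l], continuous F}.
  apply: continuous_in_subspaceT => t; rewrite inE /= in_itv /= => /andP[t1 t2].
  have t0 : 0 < t by lra.
  have [d d0 Hd] := @branch_cont chi t (1 / 32) hb t0 ltac:(lra).
  apply: cvg_near_cst; rewrite /nbhs /=; exists d => // t' /=; rewrite distrC => ht.
  have := Hd (t' - t) ht; rewrite subrK => -[t0' hn]; exact: loc.
have F1 : F (1 / 4) = 0.
  by rewrite /F; case: pselect => // -[]; apply: small_lam_q1 => //; lra.
have F2 : F l = 1 by rewrite /F; case: pselect.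
have [|t _] := IVT (v := 1 / 2) (ltW l4) cF.
  by rewrite F1 F2 (min_idPl _)// (max_idPr _)//; lra.
move=> Ft; have [] : F t = 0 \/ F t = 1 by rewrite /F; case: pselect => h; [left|right].
  by rewrite Ft; lra.
by rewrite Ft; lra.
Qed.

End Branch.

(** * Linearization along the branch and transversality *)

Section BranchODE.
Context {R : realType}.
Implicit Types (f g h u v w k : R -> R) (x y a b c M lam s t e d : R) (Q P : triple R).

Lemma sol_eqI u w w' : eqI w w' -> sol u w -> sol u w'.
Proof.
move=> E [z [z1 [h1 h2 h3]]]; exists z, z1; split => // x.
by rewrite -E//; exact: cl_I11.
Qed.

Lemma branch_q2 (chi : R -> triple R) lam : is_branch chi -> 0 < lam ->
  let c := q2 (chi lam) in cI c /\ sol c (fun x => lam ^+ 2 * (c x * (c x ^+ 2 - 4))).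
Proof.
move=> hb l0 c; have q1E := branch_q1 hb l0.
have [_ /(_ lam l0) [[hcH q30] hcr] _ _] := hb.
have [hH1 _ _ _] := hcH.
split; first exact: (hH1 _).1.
have [_ s2 _] := (critical_sol l0 hcH).1 hcr.
apply: sol_eqI s2 => x xI; rewrite q1E// q30// /N23 /msq -/c; congr (_ * (_ * _)).
have -> : (0 : R -> R) x = 0 by [].
by field.
Qed.

Lemma kerL_sol (chi : R -> triple R) lam h : is_branch chi -> 0 < lam -> kerL lam (chi lam) h ->
  let c := q2 (chi lam) in sol h (fun x => lam ^+ 2 * ((c x ^+ 2 - 4) * h x)).
Proof.
move=> hb l0 [hh hk] c; have [cc _] := branch_q2 hb l0; rewrite -/c in cc.
have ch := H10_cI hh.
apply: weak_sol => [||k k10]; [exact: H10_H1|by wcont|].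
have ck := H10_cI k10.
have := hk k k10; rewrite /opL.
have q1E := branch_q1 hb l0.
have Lh := (H1_wd (H10_H1 hh)).1; have Lk := (H1_wd (H10_H1 k10)).1.
have i1 := L2M Lh Lk.
have i2 : itg (fun x => (c x ^+ 2 - 4) * h x * k x) by apply: itg_cont; wcont.
rewrite (integ_eq (g := fun x => 2 / lam ^+ 2 * (wD h x * wD k x) + 2 * ((c x ^+ 2 - 4) * h x * k x))); last first.
  by move=> x xI; rewrite q1E// /theta -/c; field; rewrite gt_eqF.
rewrite (integD (itgZ _ i1) (itgZ _ i2)) (integZ _ i1) (integZ _ i2).
rewrite /ip (integ_eq (f := fun x => lam ^+ 2 * _ * k x) (g := fun x => lam ^+ 2 * ((c x ^+ 2 - 4) * h x * k x))); last by move=> x _; ring.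
rewrite (integZ _ i2); move: (integ _) (integ _) => q p E.
have : lam ^+ 2 / 2 * (2 / lam ^+ 2 * p + 2 * q) = 0 by rewrite E mulr0.
have -> : lam ^+ 2 / 2 * (2 / lam ^+ 2 * p + 2 * q) = p + lam ^+ 2 * q by field; rewrite gt_eqF.
by move/eqP; rewrite addr_eq0 => /eqP.
Qed.

Lemma H10_int0 u : H10 u -> integ (fun x => u x ^+ 2) = 0 -> eqI u 0.
Proof.
move=> hu I0; have [_ um up] := hu.
have cu : continuous (u \o cl) by apply: continuous_comp_cl; exact: H10_cI.
pose w (x : R) : R := (u \o cl) x * (u \o cl) x.
have cw : continuous w by move=> x; apply: cvgM; exact: cu.
have dJ x := is_derive_J x cw.
have J1 : J w 1 = 0.
  rewrite -[LHS]subr0 -[X in _ - X](J_N1 w) -(integ_FTC dJ cw) -I0.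
  by apply: integ_eq => x xI; rewrite /w /= cl_idI// expr2.
have w0 x : 0 <= w x by rewrite /w -expr2 sqr_ge0.
have J0 x : -1 <= x <= 1 -> J w x = 0.
  move=> /andP[x1 x2]; apply/eqP; rewrite eq_le; apply/andP; split.
    by rewrite -J1; apply: (deriv_mono dJ).
  by rewrite -(J_N1 w); apply: (deriv_mono dJ).
move=> x /I11P /andP[]; rewrite !le_eqVlt => /orP[/eqP <- _|x1 /orP[/eqP ->|x2]] //.
have : w x = 0.
  rewrite -(derive1_of (dJ x)); apply: derive1_of.
  apply: (@near_eq_is_derive _ _ _ (cst 0)).
  near=> y; rewrite J0//; apply/andP; split; apply: ltW; near: y; [exact: lt_nbhsr|exact: lt_nbhsl].
rewrite /w /= cl_id; last by rewrite !ltW.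
by move/eqP; rewrite mulf_eq0 orbb => /eqP.
Unshelve. all: by end_near.
Qed.

Lemma H10_int_gt0 u : H10 u -> ~ eqI u 0 -> 0 < integ (fun x => u x ^+ 2).
Proof.
move=> hu nu; rewrite lt_neqAle; apply/andP; split; last by apply: integ_ge0 => x _; exact: sqr_ge0.
by apply/eqP => E; apply: nu; exact: H10_int0.
Qed.

(** nu > 0 in the directions (0, k); the cross terms of the second variation vanish since
    the first component of the direction is zero, and q1 = 2/3 simplifies the potential. *)
Lemma nu_coercive (chi : R -> triple R) lam : is_branch chi -> 0 < lam ->
  let c := q2 (chi lam) in
  exists2 n0, 0 < n0 & forall k, H10 k ->
  n0 * integ (fun x => k x ^+ 2) <= ip (wD k) (wD k) + lam ^+ 2 * integ (fun x => (3 * c x ^+ 2 - 4) * k x ^+ 2).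
Proof.
move=> hb l0 c; have [cc _] := branch_q2 hb l0; rewrite -/c in cc.
have [_ _ _ /(_ lam l0) n0] := hb.
exists (lam ^+ 2 / 2 * nu chi lam).
  by rewrite mulr_gt0// divr_gt0// exprn_gt0.
move=> k hk; have ck := H10_cI hk; have c0 := @cI0 R.
have i2 : itg (fun x => (3 * c x ^+ 2 - 4) * k x ^+ 2) by apply: itg_cont; wcont.
have [k0|nk] := pselect (eqI k 0).
  rewrite !(integ_eq (g := fun=> 0)); first by rewrite !integ_cst !mulr0 addr0 ip_ge0.
  - by move=> x /k0 ->; rewrite expr0n mulr0.
  - by move=> x /k0 ->; rewrite expr0n.
have ne : ~ (eqI (0 : R -> R) 0 /\ eqI k 0) by case.
have [I0] := nu_le n0 H10_0 hk ne.
have hcH := branch_cH hb l0; have [hH1 _ _ _] := hcH.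
rewrite (PhiE _ hH1 (H10_H1 H10_0) (H10_H1 hk)) ip_wD0_wD0 mulr0 add0r.
have q1E := branch_q1 hb l0.
rewrite (integ_eq (f := fun x => 6 * _ * _ + _ + _) (g := fun x => 2 * ((3 * c x ^+ 2 - 4) * k x ^+ 2))); last first.
  move=> x xI; rewrite q1E// -/c /theta; have -> : (0 : R -> R) x = 0 by [].
  by field.
rewrite (integZ _ i2) (integ_eq (g := fun x => k x ^+ 2)); last first.
  by move=> x _; rewrite (_ : (0 : R -> R) x = 0)// expr0n add0r.
have l2 : 0 < lam ^+ 2 / 2 by rewrite divr_gt0// exprn_gt0.
move: (integ _) (integ _) (ip _ _) (nu _ _) => q p r n H.
have := ler_wpM2l (ltW l2) H.
have -> : lam ^+ 2 / 2 * (2 / lam ^+ 2 * r + 2 * q) = r + lam ^+ 2 * q by field; rewrite gt_eqF.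
by rewrite mulrA.
Qed.

Lemma PsiE (chi : R -> triple R) lam h : is_branch chi -> 0 < lam -> H10 h ->
  Psi lam (chi lam) h = 2 / lam ^+ 2 * ip (wD h) (wD h) +
    2 * integ (fun x => (q2 (chi lam) x ^+ 2 - 4) * h x ^+ 2).
Proof.
move=> hb l0 hh; have [cc _] := branch_q2 hb l0.
have ch := H10_cI hh; have Lh := (H1_wd (H10_H1 hh)).1.
have i1 := L2M Lh Lh.
have i2 : itg (fun x => (q2 (chi lam) x ^+ 2 - 4) * h x ^+ 2) by apply: itg_cont; wcont.
rewrite /Psi (integ_eq (g := fun x => 2 / lam ^+ 2 * (wD h x * wD h x) + 2 * ((q2 (chi lam) x ^+ 2 - 4) * h x ^+ 2))).
  by rewrite (integD (itgZ _ i1) (itgZ _ i2)) (integZ _ i1) (integZ _ i2).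
by move=> x xI; rewrite (branch_q1 hb l0)// /theta; field; rewrite gt_eqF.
Qed.

Lemma mu_le (chi : R -> triple R) lam h : is_branch chi -> 0 < lam -> H10 h -> ~ eqI h 0 ->
  mu chi lam * integ (fun x => h x ^+ 2) <= Psi lam (chi lam) h.
Proof.
move=> hb l0 hh nh; have I0 := H10_int_gt0 hh nh.
rewrite -ler_pdivlMr//; apply: ge_inf; last by exists h.
have [cc _] := branch_q2 hb l0.
have cV : cI (fun x => q2 (chi lam) x ^+ 2 - 4) by wcont.
have [M M0 HM] := within_bounded cV.
exists (- (2 * M)) => _ [u [hu nu] <-].
have J0 := H10_int_gt0 hu nu.
rewrite ler_pdivlMr// (PsiE hb l0 hu).
have cu := H10_cI hu; have i2 : itg (fun x => u x ^+ 2) by apply: itg_cont; wcont.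
have B : - (M * integ (fun x => u x ^+ 2)) <= integ (fun x => (q2 (chi lam) x ^+ 2 - 4) * u x ^+ 2).
  rewrite -integZ// -integN; last exact: itgZ.
  apply: integ_le; [exact: itgN (itgZ _ _)|by apply: itg_cont; wcont|].
  move=> x xI; rewrite -mulNr ler_wpM2r ?sqr_ge0//.
  by have := HM x xI; rewrite ler_norml => /andP[].
have P : 0 <= 2 / lam ^+ 2 * ip (wD u) (wD u) by rewrite mulr_ge0 ?ip_ge0// divr_ge0// sqr_ge0.
move: B P; set p := integ (fun x => u x ^+ 2); set q := integ (fun x => (_ - 4) * _).
move: (2 / lam ^+ 2 * ip _ _) => r B P.
have -> : - (2 * M) * p = 2 * (- (M * p)) by ring.
lra.
Qed.

(** The derivative of q2 along the branch, with the H10 convergence of the difference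
    quotients expressed through sup norms and Dirichlet integrals. *)
Lemma branch_dot (chi : R -> triple R) lam : is_branch chi -> 0 < lam ->
  exists2 cd, H10 cd & forall e, 0 < e -> exists2 d, 0 < d & forall s, s != 0 -> `|s| < d ->
    0 < s + lam /\ let r := fun x => s^-1 * (q2 (chi (s + lam)) x - q2 (chi lam) x) - cd x in
    [/\ H10 r, forall x, I11 x -> `|r x| <= e & ip (wD r) (wD r) <= e ^+ 2].
Proof.
move=> hb l0; have [_ _ [D [D0 dD]] _] := hb.
have dv := dD 0%N lam l0; rewrite D0 in dv.
have hv : H10_3 (D 1%N lam) by case: dv.
exists (D 1%N lam (inord 1)) => [|e e0]; first exact: hv.
have e2 : 0 < e / 2 by rewrite divr_gt0.
have [d1 d10 H1] := curve_lim dv e2.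
have [d2 d20 H2] := @branch_cont _ chi lam 1 hb l0 ltr01.
exists (Num.min d1 d2); first by rewrite lt_min d10.
move=> s s0; rewrite lt_min => /andP[s1 s2].
have [sl _] := H2 s s2; split => //; have n1 := H1 s s0 s1 => r.
have hcs : H10_3 (chi (s + lam) - chi lam) by apply: cH_sub; exact: branch_cH.
set T := (s^-1 *: _ - _) in n1.
have hT : H10_3 T by apply: H10_3B => //; exact: H10_3Z.
have TE : T (inord 1) = r by [].
have n0 := norm3_ge0 T.
split.
- by rewrite -TE; exact: hT.
- by move=> x xI; rewrite -TE; have := norm3_sup (inord 1) hT xI; lra.
- rewrite -TE; have := norm3_comp (inord 1) (H10_3_H1 hT) (H1_wd3 (H10_3_H1 hT)).
  by move: n0 n1; move: (norm3 T) (ip _ _) => p q p0 p1 H; nra.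
Qed.

(** The difference quotients of the nonlinear terms, at increment s of the parameter and
    with error r in the quotient of q2, are polynomials in (s, r), hence Lipschitz near (0,
    0). The zeros mark the places of s and r in the value at (0, 0). *)
Lemma quotient_lip (L M : R) : 0 <= M -> exists2 K, 0 <= K & forall d c y r s,
  0 <= d <= 1 -> `|c| <= M -> `|y| <= M -> `|r| <= d -> `|s| <= d ->
  `|((2 * L + s) * ((c + s * (y + r)) * ((c + s * (y + r)) * (c + s * (y + r)) - 4))
     + L * L * ((y + r) * ((c + s * (y + r)) * (c + s * (y + r)) + (c + s * (y + r)) * c + c * c - 4)))
   - ((2 * L + 0) * ((c + 0 * (y + 0)) * ((c + 0 * (y + 0)) * (c + 0 * (y + 0)) - 4))
     + L * L * ((y + 0) * ((c + 0 * (y + 0)) * (c + 0 * (y + 0)) + (c + 0 * (y + 0)) * c + c * c - 4)))|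
   <= K * d /\
  `|((2 * L + s) * ((c + s * (y + r)) * (c + s * (y + r)) - 4) + L * L * ((y + r) * (2 * c + s * (y + r))))
   - ((2 * L + 0) * ((c + 0 * (y + 0)) * (c + 0 * (y + 0)) - 4) + L * L * ((y + 0) * (2 * c + 0 * (y + 0))))|
   <= K * d.
Proof.
move=> M0.
have pre d (d01 : 0 <= d <= 1) : 0 <= (1 : R) <= 1 /\ 0 <= d by split; [rewrite lexx ler01|case/andP: d01].
have mB := @majorant_abs R.
have B0 : Babs (0 : R) 0 by rewrite /Babs normr0.
have cM t d : 0 <= d -> `|t| <= M -> cl2 (Babs (R:=R)) 1 d 0 M t t by move=> d0 h; apply: cl2_cst.
have cc (t : R) d : 0 <= d -> cl2 (Babs (R:=R)) 1 d 0 `|t| t t by move=> d0; apply: cl2_cst => //; rewrite /Babs.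
have c1 t d : 0 <= d <= 1 -> `|t| <= d -> cl2 (Babs (R:=R)) 1 d 0 1 t 0.
  move=> /andP[d0 d1] h; split; rewrite ?mul1r ?expr1n ?subr0 /Babs ?normr0 ?mul1r//.
  exact: le_trans d1.
have [K1 H1] : exists K, forall d c y r s, 0 <= d <= 1 -> `|c| <= M -> `|y| <= M -> `|r| <= d -> `|s| <= d ->
  cl2 (Babs (R:=R)) 1 d 0 K
   ((2 * L + s) * ((c + s * (y + r)) * ((c + s * (y + r)) * (c + s * (y + r)) - 4))
     + L * L * ((y + r) * ((c + s * (y + r)) * (c + s * (y + r)) + (c + s * (y + r)) * c + c * c - 4)))
   ((2 * L + 0) * ((c + 0 * (y + 0)) * ((c + 0 * (y + 0)) * (c + 0 * (y + 0)) - 4))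
     + L * L * ((y + 0) * ((c + 0 * (y + 0)) * (c + 0 * (y + 0)) + (c + 0 * (y + 0)) * c + c * c - 4))).
  eexists => d c y r s d01 hc hy hr hs; have [e01 d0] := pre d d01.
  have h1 := cM _ _ d0 hc; have h2 := cM _ _ d0 hy; have h3 := c1 _ _ d01 hr; have h4 := c1 _ _ d01 hs.
  have h5 := cc 2 _ d0; have h6 := cc 4 _ d0; have h7 := cc L _ d0.
  cl2_solve.
have [K2 H2] : exists K, forall d c y r s, 0 <= d <= 1 -> `|c| <= M -> `|y| <= M -> `|r| <= d -> `|s| <= d ->
  cl2 (Babs (R:=R)) 1 d 0 K
   ((2 * L + s) * ((c + s * (y + r)) * (c + s * (y + r)) - 4) + L * L * ((y + r) * (2 * c + s * (y + r))))
   ((2 * L + 0) * ((c + 0 * (y + 0)) * (c + 0 * (y + 0)) - 4) + L * L * ((y + 0) * (2 * c + 0 * (y + 0)))).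
  eexists => d c y r s d01 hc hy hr hs; have [e01 d0] := pre d d01.
  have h1 := cM _ _ d0 hc; have h2 := cM _ _ d0 hy; have h3 := c1 _ _ d01 hr; have h4 := c1 _ _ d01 hs.
  have h5 := cc 2 _ d0; have h6 := cc 4 _ d0; have h7 := cc L _ d0.
  cl2_solve.
have z1 : 0 <= (0 : R) <= 1 by rewrite lexx ler01.
have n0 : `|0 : R| <= M by rewrite normr0.
have n1 : `|0 : R| <= 0 by rewrite normr0.
have K10 : 0 <= K1 by have [] := H1 0 0 0 0 0 z1 n0 n0 n1 n1.
have K20 : 0 <= K2 by have [] := H2 0 0 0 0 0 z1 n0 n0 n1 n1.
exists (K1 + K2); first exact: addr_ge0.
move=> d c y r s d01 hc hy hr hs; have d0 : 0 <= d by case/andP: d01.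
have [_ _ _ E1] := H1 d c y r s d01 hc hy hr hs.
have [_ _ _ E2] := H2 d c y r s d01 hc hy hr hs.
rewrite /Babs !expr1n !mulr1 in E1 E2; split.
  by apply: (le_trans E1); rewrite ler_wpM2r// lerDl.
by apply: (le_trans E2); rewrite ler_wpM2r// lerDr.
Qed.

Lemma le_eps_0 (X C : R) : 0 <= C -> (forall e, 0 < e -> e <= 1 -> `|X| <= C * e) -> X = 0.
Proof.
move=> C0 H; apply/eqP; rewrite -normr_le0; apply/ler_addgt0Pr => e e0; rewrite add0r.
have C1 : 0 < C + 1 by lra.
have m0 : 0 < Num.min 1 (e / (C + 1)) by rewrite lt_min ltr01 divr_gt0.
have m1 : Num.min 1 (e / (C + 1)) <= 1 by rewrite ge_min lexx.
apply: (le_trans (H _ m0 m1)).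
have m2 : Num.min 1 (e / (C + 1)) <= e / (C + 1) by rewrite ge_min lexx orbT.
rewrite ler_pdivlMr// in m2; nra.
Qed.

Lemma abs_from_CS (t p a e : R) : t ^+ 2 <= p * a -> 0 <= p -> p <= e ^+ 2 -> 0 <= a -> 0 < e ->
  `|t| <= (a + 1) * e.
Proof.
move=> CS p0 pe a0 e0; have A1 : a <= (a + 1) ^+ 2 by nra.
have A2 : 0 <= (a + 1) * e by rewrite mulr_ge0 ?addr_ge0// ltW.
rewrite -(ler_pXn2r (n := 2))// ?nnegrE// real_normK ?num_real//.
by apply: (le_trans CS); rewrite exprMn mulrC; apply: ler_pM.
Qed.

(** Subtract the equations at two parameters, divide by the increment and pass to the limit:
    the derivative of the branch solves the linearized equation. *)
Lemma branch_dot_weak (chi : R -> triple R) lam cd : is_branch chi -> 0 < lam ->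
  let c := q2 (chi lam) in H10 cd ->
  (forall e, 0 < e -> exists2 d, 0 < d & forall s, s != 0 -> `|s| < d ->
    0 < s + lam /\ let r := fun x => s^-1 * (q2 (chi (s + lam)) x - q2 (chi lam) x) - cd x in
    [/\ H10 r, forall x, I11 x -> `|r x| <= e & ip (wD r) (wD r) <= e ^+ 2]) ->
  forall k, H10 k -> ip (wD cd) (wD k) =
    - ip (fun x => 2 * lam * (c x * (c x ^+ 2 - 4)) + lam ^+ 2 * ((3 * c x ^+ 2 - 4) * cd x)) k.
Proof.
move=> hb l0 c hcd H k hk.
have [cc sc] := branch_q2 hb l0; rewrite -/c in cc sc.
have ccd := H10_cI hcd; have ck := H10_cI hk.
have [M1 M10 HM1] := within_bounded cc.
have [M2 M20 HM2] := within_bounded ccd.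
have [M3 M30 HM3] := within_bounded ck.
pose M := M1 + M2.
have M1M : M1 <= M by rewrite lerDl ltW.
have M2M : M2 <= M by rewrite lerDr ltW.
have M0 : 0 <= M := le_trans (ltW M10) M1M.
have [K K0 HK] := quotient_lip lam M0.
have Lk := (H1_wd (H10_H1 hk)).1.
set A := ip (wD k) (wD k); have A0 : 0 <= A by exact: ip_ge0.
apply/eqP; rewrite -addr_eq0; apply/eqP.
pose C := A + 1 + 2 * K * M3.
have C0 : 0 <= C by rewrite /C; have := mulr_ge0 K0 (ltW M30); lra.
apply: (@le_eps_0 _ C C0) => e e0 e1.
have [d d0 Hd] := H e e0.
pose s := Num.min (d / 2) e.
have s0 : 0 < s by rewrite /s lt_min e0 divr_gt0.
have se : s <= e by rewrite /s ge_min lexx orbT.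
have sd : `|s| < d by rewrite gtr0_norm// /s; apply: (le_lt_trans (_ : _ <= d / 2)); [rewrite ge_min lexx|lra].
have sn : s != 0 by rewrite gt_eqF.
have [sl [hr rb rn]] := Hd s sn sd.
set r := (fun x => s^-1 * _ - _) in hr rb rn.
have [ccs scs] := branch_q2 hb sl; set cs := q2 _ in ccs scs r hr rb rn.
have cr := H10_cI hr.
have csE x : cs x = c x + s * (cd x + r x).
  by rewrite /r /c; field.
have hcs : H1 cs by apply: sol_H1 scs; wcont.
have hc : H1 c by apply: sol_H1 sc; wcont.
have Lcd := (H1_wd (H10_H1 hcd)).1; have Lr := (H1_wd (H10_H1 hr)).1.
have Lc := (H1_wd hc).1.
have wcs : wd cs (fun x => wD c x + s * (wD cd x + wD r x)).
  have cy : cI (fun x => cd x + r x) by wcont.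
  have csy : cI (fun x => s * (cd x + r x)) by wcont.
  have w1 := wdD ccd cr (H1_wd (H10_H1 hcd)) (H1_wd (H10_H1 hr)).
  have w2 := wdD cc csy (H1_wd hc) (wdZ s cy w1).
  by apply: wd_eqI w2 => // x _; rewrite csE.
have c1 : cI (fun x => (s + lam) ^+ 2 * (cs x * (cs x ^+ 2 - 4))) by wcont.
have c2 : cI (fun x => lam ^+ 2 * (c x * (c x ^+ 2 - 4))) by wcont.
have W1 := sol_weak c1 scs hk; have W2 := sol_weak c2 sc hk.
have Ly := L2D Lcd Lr; have Lsy := L2Z s Ly.
rewrite (wD_ip ccs wcs Lk) (ipDl Lc Lsy Lk) (ipZl _ Ly Lk) (ipDl Lcd Lr Lk) W2 in W1.
pose F r s x := (2 * lam + s) * ((c x + s * (cd x + r)) * ((c x + s * (cd x + r)) * (c x + s * (cd x + r)) - 4))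
     + lam * lam * ((cd x + r) * ((c x + s * (cd x + r)) * (c x + s * (cd x + r)) + (c x + s * (cd x + r)) * c x + c x * c x - 4)).
have cF : cI (fun x => F (r x) s x * k x) by rewrite /F; wcont.
have cF0 : cI (fun x => F 0 0 x * k x) by rewrite /F; wcont.
have i1 : itg (fun x => (s + lam) ^+ 2 * (cs x * (cs x ^+ 2 - 4)) * k x) by apply: itg_cont; wcont.
have i2 : itg (fun x => lam ^+ 2 * (c x * (c x ^+ 2 - 4)) * k x) by apply: itg_cont; wcont.
have E1 : ip (wD cd) (wD k) + ip (wD r) (wD k) = - integ (fun x => F (r x) s x * k x).
  apply: (mulfI sn); rewrite mulrN -integZ; last exact: itg_cont.
  rewrite (integ_eq (g := fun x => (s + lam) ^+ 2 * (cs x * (cs x ^+ 2 - 4)) * k x - lam ^+ 2 * (c x * (c x ^+ 2 - 4)) * k x)).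
    rewrite integB//; move: W1; rewrite -![integ (fun x => _ * k x)]/(ip _ k).
    move: (ip (wD cd) (wD k)) (ip (wD r) (wD k)) (ip _ k) (ip _ k) => a b p q W1.
    have -> : s * (a + b) = - p - (- q) by rewrite -W1; ring.
    by ring.
  by move=> x _; rewrite csE /F; ring.
have E2 : ip (fun x => 2 * lam * (c x * (c x ^+ 2 - 4)) + lam ^+ 2 * ((3 * c x ^+ 2 - 4) * cd x)) k = integ (fun x => F 0 0 x * k x).
  by apply: integ_eq => x _; rewrite /F; ring.
have -> : ip (wD cd) (wD k) = - integ (fun x => F (r x) s x * k x) - ip (wD r) (wD k).
  by move: E1; move: (ip (wD cd) (wD k)) (ip (wD r) (wD k)) (integ (fun x => F (r x) s x * k x)) => p q t E1; rewrite -E1; ring.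
rewrite E2.
have E3 : `|integ (fun x => F (r x) s x * k x) - integ (fun x => F 0 0 x * k x)| <= 2 * (K * e * M3).
  rewrite -integB; try exact: itg_cont.
  apply: integ_bound; first exact: (itg_cont (cID cF (cIN cF0))).
  move=> x xI; rewrite -mulrBl normrM; apply: ler_pM => //; last exact: HM3.
  have e01 : 0 <= e <= 1 by rewrite ltW.
  have h1 : `|c x| <= M by exact: le_trans (HM1 x xI) M1M.
  have h2 : `|cd x| <= M by exact: le_trans (HM2 x xI) M2M.
  have h4 : `|s| <= e by rewrite gtr0_norm.
  by have [] := HK e (c x) (cd x) (r x) s e01 h1 h2 (rb x xI) h4.
have E4 : `|ip (wD r) (wD k)| <= (A + 1) * e.
  exact: (abs_from_CS (ip_CS Lr Lk) (ip_ge0 _) rn A0 e0).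
have -> p q t : - p - t + q = - (p - q) - t :> R by ring.
apply: (le_trans (ler_normB _ _)); rewrite normrN.
have -> : C * e = 2 * (K * e * M3) + (A + 1) * e by rewrite /C; move: (A); clear => a; ring.
exact: (lerD E3 E4).
Qed.

(** D l = l^2 (Psi_l[h_c] - mu l * int h_c^2) is nonnegative and vanishes at lambda_c, so
    its derivative is zero there. As mu (lambda_c) = 0, the derivative of l^2 Psi_l[h_c] at
    lambda_c is lambda_c^2 mu' int h_c^2 < 0, and it is a positive multiple of the integral
    on the left once the derivative of the branch is identified with 2 lambda_c w. *)
Lemma transversality (chi : R -> triple R) lam hc w : is_branch chi -> mu_decreasing chi ->
  is_lambda_c chi lam -> kerL lam (chi lam) hc -> ~ eqI hc 0 ->
  let c := q2 (chi lam) in H10 w ->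
  sol w (fun x => lam ^+ 2 * ((3 * c x ^+ 2 - 4) * w x) + c x * (c x ^+ 2 - 4)) ->
  integ (fun x => ((c x ^+ 2 - 4) + 2 * lam ^+ 2 * (c x * w x)) * hc x ^+ 2) < 0.
Proof.
move=> hb [smu dmu] [l0 mup mu0 dmu0] khc nhc c hw sw.
have [cc sc] := branch_q2 hb l0; rewrite -/c in cc sc.
have shc := kerL_sol hb l0 khc; rewrite -/c in shc.
have hhc : H10 hc by case: khc.
have chc := H10_cI hhc; have cw := H10_cI hw.
have [cd hcd Hcd] := branch_dot hb l0.
have ccd := H10_cI hcd.
have Wcd := branch_dot_weak hb l0 hcd Hcd; rewrite -/c in Wcd.
(* The derivative of the branch solves the same nondegenerate linear equation as 2
   lambda_c w. *)
have cdE : eqI cd (fun x => 2 * lam * w x).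
  pose dd x := cd x + (- (2 * lam)) * w x.
  have hdd : H10 dd by apply: H10D => //; exact: H10Z.
  have cdd := H10_cI hdd.
  have c1 : cI (fun x => lam ^+ 2 * ((3 * c x ^+ 2 - 4) * w x) + c x * (c x ^+ 2 - 4)) by wcont.
  have Ww := sol_weak c1 sw hdd.
  have wdd := wdD ccd (_ : cI (fun x => - (2 * lam) * w x)) (H1_wd (H10_H1 hcd)) (wdZ (- (2 * lam)) cw (H1_wd (H10_H1 hw))).
  have {}wdd := wdd ltac:(wcont).
  have Ldd := (H1_wd (H10_H1 hdd)).1.
  have Lcd := (H1_wd (H10_H1 hcd)).1. have Lw := (H1_wd (H10_H1 hw)).1.
  have E : ip (wD dd) (wD dd) = - lam ^+ 2 * integ (fun x => (3 * c x ^+ 2 - 4) * dd x ^+ 2).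
    rewrite (wD_ip cdd wdd Ldd) (ipDl Lcd (L2Z _ Lw) Ldd) (ipZl _ Lw Ldd) Wcd// Ww.
    rewrite mulNr mulrN opprK -integZ; last by apply: itg_cont; wcont.
    rewrite -integZ; last by apply: itg_cont; wcont.
    rewrite /ip -integN; last by apply: itg_cont; wcont.
    rewrite -integD; try by apply: itg_cont; wcont.
    by apply: integ_eq => x _; rewrite /dd; ring.
  have [n0 n00 Hn] := nu_coercive hb l0; rewrite -/c in Hn.
  have := Hn dd hdd; rewrite E mulNr addNr => hle.
  have I0 : integ (fun x => dd x ^+ 2) = 0.
    apply/eqP; rewrite eq_le; apply/andP; split; last by apply: integ_ge0 => x _; exact: sqr_ge0.
    by move: hle; rewrite pmulr_rle0.
  move=> x xI; have := H10_int0 hdd I0 xI; rewrite /dd mulNr => /eqP.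
  by rewrite subr_eq0 => /eqP.
set m := integ (fun x => hc x ^+ 2).
have m0 : 0 < m by exact: H10_int_gt0.
pose p0 x := (2 * lam + 0) * ((c x + 0 * (cd x + 0)) * (c x + 0 * (cd x + 0)) - 4) + lam * lam * ((cd x + 0) * (2 * c x + 0 * (cd x + 0))).
have cp0 : cI (fun x => p0 x * hc x ^+ 2) by rewrite /p0; wcont.
set X := 2 * integ (fun x => p0 x * hc x ^+ 2).
suff XE : X = lam ^+ 2 * derive1 (mu chi) lam * m.
  have X0 : X < 0 by rewrite XE pmulr_llt0// pmulr_rlt0// exprn_gt0.
  have : X = 4 * lam * integ (fun x => ((c x ^+ 2 - 4) + 2 * lam ^+ 2 * (c x * w x)) * hc x ^+ 2).
    rewrite /X -integZ; last exact: itg_cont.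
    rewrite -integZ; last by apply: itg_cont; wcont.
    by apply: integ_eq => x xI; rewrite /p0 cdE//; ring.
  by move=> XE2; move: X0; rewrite XE2 pmulr_rlt0// mulr_gt0.
have dmul : derivable (mu chi) lam 1 by exact: (smu 0%N lam l0).
have cvmu : (fun s => s^-1 * mu chi (s + lam)) @ 0^' --> derive1 (mu chi) lam.
  have F : (fun h : R => h^-1 *: ((mu chi \o shift lam) (h *: 1) - mu chi lam)) = (fun s => s^-1 * mu chi (s + lam)).
    by apply/funext => s; rewrite mu0 subr0 /GRing.scale /= mulr1.
  have := dmul; rewrite derive1E /derivable /derive F => /cvg_ex[l hl].
  by have -> := cvg_lim (@Rhausdorff R) hl.
have cvl : (fun s : R => (s + lam) ^+ 2) @ 0^' --> lam ^+ 2.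
  have cvs : (fun s : R => s + lam) @ 0^' --> lam.
    rewrite -[X in _ --> X]add0r; apply: cvgD; last exact: cvg_cst.
    exact: cvg_within.
  rewrite (_ : (fun s : R => (s + lam) ^+ 2) = (fun s => (s + lam) * (s + lam))); last first.
    by apply/funext => s; rewrite expr2.
  by rewrite expr2; apply: cvgM.
have cvH : (fun s => (s + lam) ^+ 2 * (s^-1 * mu chi (s + lam)) * m) @ 0^' --> lam ^+ 2 * derive1 (mu chi) lam * m.
  by apply: cvgM; [exact: cvgM|exact: cvg_cst].
have [M1 M10 HM1] := within_bounded cc.
have [M2 M20 HM2] := within_bounded ccd.
pose M := M1 + M2.
have M1M : M1 <= M by rewrite lerDl ltW.
have M2M : M2 <= M by rewrite lerDr ltW.
have M0 : 0 <= M := le_trans (ltW M10) M1M.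
have [K K0 HK] := quotient_lip lam M0.
set Y := lam ^+ 2 * _ * m in cvH *.
pose C := 1 + 2 * K * m.
have C0 : 0 <= C by rewrite /C; have := mulr_ge0 K0 (ltW m0); lra.
(* Z is the difference quotient D (lambda_c + s) / s. As D >= 0 it has the sign of s, and
   it is close to X - Y, which is therefore zero. *)
have key e : 0 < e -> e <= 1 -> exists2 d, 0 < d & forall s, s != 0 -> `|s| < d ->
    exists2 Z, 0 <= s * Z & `|Z - (X - Y)| <= C * e.
  move=> e0 e1; have [d d0 Hd] := Hcd e e0.
  move/cvgrPdist_lt : cvH => /(_ e e0).
  rewrite /dnbhs /within /= /nbhs /= => -[d' d'0 Hd'].
  exists (Num.min e (Num.min d d')); first by rewrite !lt_min e0 d0.
  move=> s sn; rewrite !lt_min => /and3P[se s1 s2].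
  have [sl [hr rb rn]] := Hd s sn s1.
  set r := (fun x => s^-1 * _ - _) in hr rb rn.
  have [ccs scs] := branch_q2 hb sl; set cs := q2 _ in ccs scs r hr rb rn.
  have cr := H10_cI hr.
  have csE x : cs x = c x + s * (cd x + r x) by rewrite /r /c; field.
  pose P r s x := (2 * lam + s) * ((c x + s * (cd x + r)) * (c x + s * (cd x + r)) - 4) + lam * lam * ((cd x + r) * (2 * c x + s * (cd x + r))).
  have cP : cI (fun x => P (r x) s x * hc x ^+ 2) by rewrite /P; wcont.
  have EP : `|integ (fun x => P (r x) s x * hc x ^+ 2) - integ (fun x => p0 x * hc x ^+ 2)| <= K * e * m.
    rewrite -integB; try exact: itg_cont.
    have B x : I11 x -> `|P (r x) s x * hc x ^+ 2 - p0 x * hc x ^+ 2| <= K * e * hc x ^+ 2.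
      move=> xI; rewrite -mulrBl normrM (ger0_norm (sqr_ge0 _)) ler_wpM2r ?sqr_ge0//.
      have e01 : 0 <= e <= 1 by rewrite ltW.
      have h1 : `|c x| <= M by exact: le_trans (HM1 x xI) M1M.
      have h2 : `|cd x| <= M by exact: le_trans (HM2 x xI) M2M.
      by have [] := HK e (c x) (cd x) (r x) s e01 h1 h2 (rb x xI) (ltW se).
    have i0 : itg (fun x => P (r x) s x * hc x ^+ 2 - p0 x * hc x ^+ 2) by exact: (itg_cont (cID cP (cIN cp0))).
    have i1 : itg (fun x => hc x ^+ 2) by apply: itg_cont; wcont.
    rewrite /m -integZ// ler_norml -integN; last exact: itgZ.
    apply/andP; split; apply: integ_le => //; try exact: itgZ.
    + exact: itgN (itgZ _ _).
    + by move=> x /B; rewrite ler_norml => /andP[].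
    + by move=> x /B; rewrite ler_norml => /andP[].
  exists (2 * integ (fun x => P (r x) s x * hc x ^+ 2) - (s + lam) ^+ 2 * (s^-1 * mu chi (s + lam)) * m); last first.
    have := Hd' s; rewrite /ball_ /= sub0r normrN => /(_ s2 sn).
    rewrite -/Y /X /C; move: EP.
    move: (integ _) (integ _) (_ * _ * m) (ltW m0) => p q t; clear; rewrite !ler_norml ltr_norml.
    move=> m0 /andP[a1 a2] /andP[b1 b2]; apply/andP; split; nra.
  have ms := mu_le hb sl hhc nhc; rewrite -/m in ms.
  rewrite (PsiE hb sl hhc) -/cs in ms.
  have c1 : cI (fun x => lam ^+ 2 * ((c x ^+ 2 - 4) * hc x)) by wcont.
  have A := sol_weak c1 shc hhc.
  have l2 : 0 < (s + lam) ^+ 2 by rewrite exprn_gt0.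
  have := ler_wpM2l (ltW l2) ms.
  rewrite mulrDr; have -> t : (s + lam) ^+ 2 * (2 / (s + lam) ^+ 2 * t) = 2 * t.
    by field; rewrite gt_eqF.
  rewrite A /ip => H.
  have i1 : itg (fun x => lam ^+ 2 * ((c x ^+ 2 - 4) * hc x) * hc x) by apply: itg_cont; wcont.
  have i2 : itg (fun x => (cs x ^+ 2 - 4) * hc x ^+ 2) by apply: itg_cont; wcont.
  have E : s * integ (fun x => P (r x) s x * hc x ^+ 2) =
     (s + lam) ^+ 2 * integ (fun x => (cs x ^+ 2 - 4) * hc x ^+ 2) - integ (fun x => lam ^+ 2 * ((c x ^+ 2 - 4) * hc x) * hc x).
    rewrite -integZ; last exact: itg_cont.
    rewrite -integZ// -integB//; last exact: itgZ.
    by apply: integ_eq => x _; rewrite /P csE; ring.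
  rewrite mulrBr mulrCA E; have -> : s * ((s + lam) ^+ 2 * (s^-1 * mu chi (s + lam)) * m) = (s + lam) ^+ 2 * (mu chi (s + lam) * m) by field.
  move: H; move: (integ _) (integ _) (_ ^+ 2) (mu _ _ * m) => p q t n; clear; move=> H; nra.
apply/eqP; rewrite -subr_eq0; apply/eqP.
apply: (@le_eps_0 _ C C0) => e e0 e1; have [d d0 Hd] := key e e0 e1.
have d2 : d / 2 != 0 by rewrite gt_eqF// divr_gt0.
have [|Z1 Z10 HZ1] := Hd (d / 2) d2; first by rewrite gtr0_norm; lra.
have [||Z2 Z20 HZ2] := Hd (- (d / 2)); [by rewrite oppr_eq0|by rewrite normrN gtr0_norm; lra|].
have z1 : 0 <= Z1 by move: Z10; rewrite pmulr_rge0// divr_gt0.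
have z2 : Z2 <= 0 by move: Z20; rewrite mulNr oppr_ge0 pmulr_rle0// divr_gt0.
move: HZ1 HZ2; rewrite !ler_norml => /andP[a1 a2] /andP[b1 b2]; apply/andP; split; lra.
Qed.

End BranchODE.

(** * Continuous functions on [-1, 1] and Volterra equations *)

Section GoodFunctions.
Context {R : realType}.
Implicit Types (f g h u v w y A F : R -> R) (x a b m M K t s q bt : R).

(** Continuous functions determined by their restriction to [-1, 1], so that agreement on
    [-1, 1] is equality and a bound on [-1, 1] is a global one. *)
Definition good f := continuous f /\ forall x, f (cl x) = f x.

Lemma good_cI f : good f -> cI f.
Proof. by move=> [cf _]; exact: continuous_subspaceT. Qed.

Lemma good_L2 f : good f -> L2 f.
Proof. by move/good_cI/L2_cont. Qed.

Lemma good_cl f : cI f -> good (f \o cl).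
Proof. by move=> cf; split; [exact: continuous_comp_cl|move=> x /=; rewrite cl_cl]. Qed.

Lemma goodD f g : good f -> good g -> good (fun x => f x + g x).
Proof.
move=> [cf ef] [cg eg]; split=> [x|x]; last by rewrite ef eg.
by apply: cvgD; [exact: cf|exact: cg].
Qed.

Lemma goodM f g : good f -> good g -> good (fun x => f x * g x).
Proof.
move=> [cf ef] [cg eg]; split=> [x|x]; last by rewrite ef eg.
by apply: cvgM; [exact: cf|exact: cg].
Qed.

Lemma goodC a : good (fun=> a).
Proof. by split=> // x; exact: cst_continuous. Qed.

Lemma goodN f : good f -> good (fun x => - f x).
Proof. by move=> [cf ef]; split=> [x|x]; [apply: cvgN; exact: cf|rewrite ef]. Qed.

Lemma goodB f g : good f -> good g -> good (fun x => f x - g x).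
Proof. by move=> hf hg; apply: goodD hf (goodN hg). Qed.

Lemma goodZ a f : good f -> good (fun x => a * f x).
Proof. by move=> hf; apply: goodM (goodC a) hf. Qed.

Lemma good_eq f g : (forall x, I11 x -> f x = g x) -> good f -> good g -> f = g.
Proof.
by move=> E [_ ef] [_ eg]; apply/funext => x; rewrite -ef -eg E//; exact: cl_I11.
Qed.

Lemma good_le f m : good f -> (forall x, I11 x -> `|f x| <= m) -> forall x, `|f x| <= m.
Proof. by move=> [_ ef] H x; rewrite -ef H//; exact: cl_I11. Qed.

Lemma good_bounded f : good f -> exists2 M, 0 < M & forall x, `|f x| <= M.
Proof.
move=> hf; have [M M0 HM] := within_bounded (good_cI hf).
by exists M => //; exact: good_le.
Qed.

Lemma geom_small q M e : 0 <= q < 1 -> 0 < e -> exists k, M * q ^+ k <= e.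
Proof.
move=> /andP[q0 q1] e0; pose M' := `|M| + 1.
have M0 : 0 < M' by rewrite /M'; have := normr_ge0 M; lra.
have := @cvg_expr R q; rewrite ger0_norm// => /(_ q1) /cvgrPdist_lt /(_ (e / M')).
rewrite divr_gt0// => /(_ isT) [k _ Hk]; exists k.
have := Hk k (leqnn k); rewrite /= sub0r normrN ger0_norm ?exprn_ge0// ltr_pdivlMr// => h.
apply: le_trans (ltW h); rewrite mulrC ler_wpM2l ?exprn_ge0// /M'.
by have := ler_norm M; lra.
Qed.

(** The sequences f_k - B_k and f_k + B_k, where B_k bounds the tail of the geometric
    series, are monotone and squeeze the limit. *)
Lemma good_limit (f_ : nat -> R -> R) q M : 0 <= q < 1 -> 0 <= M -> (forall k, good (f_ k)) ->
  (forall k x, `|f_ k.+1 x - f_ k x| <= M * q ^+ k) ->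
  exists2 f, good f & forall k x, `|f x - f_ k x| <= M / (1 - q) * q ^+ k.
Proof.
move=> /andP[q0 q1] M0 gf Hf.
have q10 : 0 < 1 - q by lra.
pose B k := M / (1 - q) * q ^+ k.
have BE k : B k = B k.+1 + M * q ^+ k by rewrite /B exprS; field; rewrite gt_eqF.
have B0 k : 0 <= B k by rewrite !mulr_ge0 ?invr_ge0 ?exprn_ge0// ltW.
pose lo x k := f_ k x - B k; pose hi x k := f_ k x + B k.
have st k x : lo x k <= lo x k.+1 /\ hi x k.+1 <= hi x k.
  have := Hf k x; rewrite ler_norml /lo /hi (BE k) => /andP[h1 h2]; split; lra.
have lom x k n : lo x k <= lo x (k + n)%N.
  by elim: n => [|n IH]; rewrite ?addn0// addnS (le_trans IH)//; case: (st (k + n)%N x).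
have him x k n : hi x (k + n)%N <= hi x k.
  by elim: n => [|n IH]; rewrite ?addn0// addnS; apply: le_trans IH; case: (st (k + n)%N x).
have lohi x k j : lo x k <= hi x j.
  apply: (le_trans (lom x k j)); apply: (@le_trans _ _ (hi x (k + j)%N)).
    by rewrite /lo /hi; have := B0 (k + j)%N; lra.
  by rewrite addnC him.
pose f x := sup [set lo x k | k in setT].
have fB k x : `|f x - f_ k x| <= B k.
  have h1 : lo x k <= f x.
    by apply: ub_le_sup; [exists (hi x 0%N) => _ [j _ <-]|exists k].
  have h2 : f x <= hi x k.
    by apply: ge_sup; [exists (lo x 0%N), 0%N|move=> _ [j _ <-]].
  by move: h1 h2; rewrite /lo /hi ler_norml => h1 h2; apply/andP; split; lra.
exists f => //; split; last first.
  by move=> x; rewrite /f; congr sup; apply/eq_imagel => k _; rewrite /lo (gf k).2.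
move=> x; apply/cvgrPdist_le => e e0.
have e3 : 0 < e / 3 by rewrite divr_gt0.
have [||k Hk] := @geom_small q (M / (1 - q)) (e / 3); [by rewrite q0|by []|].
have ck := (gf k).1 x; move/cvgrPdist_le : ck => /(_ (e / 3) e3).
apply: filterS => z hz.
have -> : f x - f z = (f x - f_ k x) + (f_ k x - f_ k z) - (f z - f_ k z) by ring.
apply: (le_trans (ler_normB _ _)).
apply: (le_trans (lerD (ler_normD _ _) (fB k z))).
by have := fB k x; rewrite /B; move: hz Hk; move: (M / (1 - q) * q ^+ k) => t h1 h2 h3; lra.
Qed.

Lemma J_good f : continuous f -> good (fun x => J f (cl x)).
Proof.
move=> cf; apply: (@good_cl (J f)); apply: continuous_subspaceT.
by apply: is_derive_cont => x; exact: is_derive_J.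
Qed.

Lemma J_cont f : continuous f -> continuous (J f).
Proof. by move=> cf; apply: is_derive_cont => x; exact: is_derive_J. Qed.

Lemma J_lin f g a x : continuous f -> continuous g -> -1 <= x ->
  J (fun t => f t + a * g t) x = J f x + a * J g x.
Proof.
move=> cf cg x1.
have cfg : continuous (fun t => f t + a * g t).
  by move=> t; apply: cvgD; [exact: cf|apply: cvgM; [exact: cvg_cst|exact: cg]].
pose F t := J (fun t => f t + a * g t) t - (J f t + a * J g t).
have dF t : is_derive t 1 F 0.
  have d1 := is_derive_J t cfg; have d2 := is_derive_J t cf; have d3 := is_derive_J t cg.
  have d4 : is_derive t 1 (fun t => a * J g t) (a * g t).
    have dc : is_derive t 1 (fun=> a : R) (0 : R) by exact: is_derive_cst.
    by have := is_deriveM1 dc d3; rewrite mul0r addr0.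
  have := is_deriveB d1 (is_deriveD d2 d4); rewrite subrr; exact.
have := @deriv0_cst _ F (fun=> 0) (-1) x dF x1 (fun _ _ => erefl).
rewrite /F !J_N1 mulr0 addr0 subrr => /esym /eqP.
by rewrite subr_eq0 => /eqP.
Qed.

Lemma J_ext f g x : continuous f -> continuous g -> -1 <= x <= 1 -> eqI f g -> J f x = J g x.
Proof.
move=> cf cg /andP[x1 x2] E.
pose F t := J f t - J g t.
have dF t : is_derive t 1 F (f t - g t).
  by have d1 := is_derive_J t cf; have d2 := is_derive_J t cg; exact: is_deriveB.
have := @deriv0_cst _ F _ (-1) x dF x1; rewrite /F !J_N1 subrr => H.
apply/eqP; rewrite -subr_eq0 -H// => t /andP[t1 t2]; rewrite E ?subrr//.
by apply/I11P; rewrite t1 (le_trans t2).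
Qed.

(** Compare with the primitive of a function that dominates f. *)
Lemma J_bound f F F1 x : continuous f -> (forall t, is_derive t 1 F (F1 t)) -> 0 <= F (-1) ->
  (forall t, -1 <= t <= 1 -> `|f t| <= F1 t) -> -1 <= x <= 1 -> `|J f x| <= F x.
Proof.
move=> cf dF F0 H /andP[x1 x2].
have dJ t := is_derive_J t cf.
have le1 : F (-1) - J f (-1) <= F x - J f x.
  apply: (@deriv_mono _ (fun t => F t - J f t) (fun t => F1 t - f t)) => // t /andP[t1 t2].
  by have := H t; rewrite t1 (le_trans t2)// ler_norml => /(_ isT) /andP[]; lra.
have le2 : F (-1) + J f (-1) <= F x + J f x.
  apply: (@deriv_mono _ (fun t => F t + J f t) (fun t => F1 t + f t)) => // t /andP[t1 t2].
  by have := H t; rewrite t1 (le_trans t2)// ler_norml => /(_ isT) /andP[]; lra.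
by move: le1 le2; rewrite J_N1 ler_norml => *; apply/andP; split; lra.
Qed.

Lemma J_sup f m x : continuous f -> (forall t, I11 t -> `|f t| <= m) -> -1 <= x <= 1 ->
  `|J f x| <= 2 * m.
Proof.
move=> cf H xI.
have m0 : 0 <= m by apply: (le_trans (normr_ge0 _) (H 0 _)); apply/I11P; lra.
have dF t : is_derive t 1 (fun t => m * t + m) (m * (fun=> 1) (m * t + m)).
  exact: (is_derive_affine m m t (fun x => is_derive_id x 1)).
have := @J_bound f (fun t => m * t + m) (fun t => m * 1) x cf dF.
rewrite mulr1 mulrN1 addNr lexx => /(_ isT) /(_ _ xI) H2.
apply: (le_trans (H2 _)) => [t tI|]; first by apply: H; apply/I11P.
by case/andP: xI => x1 x2; nra.
Qed.

End GoodFunctions.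

Section LinearODE.
Context {R : realType}.
Implicit Types (f g h u v w y A F : R -> R) (x a b m M K t s q bt : R).

(** The initial value problem y'' = A y + g, y(-1) = 0, y'(-1) = b as a Volterra equation,
    which makes sense for continuous functions. *)
Definition iv A g b y :=
  good y /\ forall x, y x = b * (cl x + 1) + J (J (fun t => A t * y t + g t)) (cl x).

Lemma is_derive_expw (bt : R) x :
  is_derive x 1 (fun x => expR (bt * x + bt)) (bt * expR (bt * x + bt)).
Proof. by apply: (is_derive_affine bt bt x) => t; exact: is_derive_expR. Qed.

Lemma cont_good_comb A y g : good A -> good y -> good g ->
  good (fun t => A t * y t + g t).
Proof. by move=> hA hy hg; apply: goodD hg; exact: goodM. Qed.

(** In the norm weighted by exp (bt (x + 1)), integration is contracting by the factor 1 /
    bt. *)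
Lemma JJ_weight f m bt x : continuous f -> 0 < bt -> 0 <= m ->
  (forall t, -1 <= t <= 1 -> `|f t| <= m * expR (bt * t + bt)) -> -1 <= x <= 1 ->
  `|J f x| <= m / bt * expR (bt * x + bt).
Proof.
move=> cf b0 m0 H xI.
have dF t : is_derive t 1 (fun t => m / bt * expR (bt * t + bt)) (m * expR (bt * t + bt)).
  have d1 := is_derive_expw bt t.
  have dc : is_derive t 1 (fun=> m / bt : R) (0 : R) by exact: is_derive_cst.
  have := is_deriveM1 dc d1; rewrite mul0r addr0.
  by rewrite mulrA divfK// gt_eqF.
apply: (J_bound cf dF) => //.
by rewrite mulr_ge0 ?expR_ge0// divr_ge0// ltW.
Qed.

(** Picard iteration. For bt = 2 (M + 1), where M bounds A, the weighted norm of [JJ_weight]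
    makes the iteration contracting by 1/2 on the whole of [-1, 1]. *)
Lemma volterra A g : good A -> good g -> exists y, iv A g 0 y.
Proof.
move=> hA hg; have [M M0 HM] := good_bounded hA; have [m m0 Hm] := good_bounded hg.
pose T y x := J (J (fun t => A t * y t + g t)) (cl x).
have gT y : good y -> good (T y).
  by move=> hy; apply: J_good; apply: J_cont; have [] := cont_good_comb hA hy hg.
pose y_ k := iter k T (fun=> 0).
have gy k : good (y_ k) by elim: k => [|k IH]; [exact: goodC|exact: gT].
pose bt := 2 * (M + 1).
have b0 : 0 < bt by rewrite /bt; lra.
have step y y' q : good y -> good y' -> 0 <= q ->
   (forall t, -1 <= t <= 1 -> `|y' t - y t| <= q * expR (bt * t + bt)) ->
   forall t, -1 <= t <= 1 -> `|T y' t - T y t| <= q / 2 * expR (bt * t + bt).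
  move=> hy hy' q0 H t tI.
  have c1 := (cont_good_comb hA hy hg).1; have c2 := (cont_good_comb hA hy' hg).1.
  pose f t := (A t * y' t + g t) + (-1) * (A t * y t + g t).
  have cf : continuous f.
    by move=> x; apply: cvgD; [exact: c2|apply: cvgM; [exact: cvg_cst|exact: c1]].
  have E : T y' t - T y t = J (J f) t.
    rewrite /T cl_id//; case/andP: tI => t1 t2.
    rewrite (@J_ext _ (J f) (fun x => J (fun t => A t * y' t + g t) x + (-1) * J (fun t => A t * y t + g t) x)).
    - rewrite J_lin//; try exact: J_cont; by rewrite mulN1r.
    - exact: J_cont.
    - by move=> x; apply: cvgD; [exact: J_cont|apply: cvgM; [exact: cvg_cst|exact: J_cont]].
    - by rewrite t1.
    - by move=> x /I11P/andP[x1 x2]; rewrite /f J_lin.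
  rewrite E.
  have f1 s : -1 <= s <= 1 -> `|f s| <= M * q * expR (bt * s + bt).
    move=> sI; have -> : f s = A s * (y' s - y s) by rewrite /f; ring.
    by rewrite normrM -mulrA; apply: ler_pM => //; exact: H.
  have Mq : 0 <= M * q by rewrite mulr_ge0// ltW.
  have f2 := JJ_weight cf b0 Mq f1.
  have Mqb : 0 <= M * q / bt by rewrite divr_ge0// ltW.
  have := JJ_weight (J_cont cf) b0 Mqb f2 tI => /le_trans; apply.
  rewrite ler_wpM2r ?expR_ge0// ler_pdivrMr// ler_pdivrMr//.
  rewrite /bt; clear -M0 q0; nra.
pose q0 := m.
have d0 k t : -1 <= t <= 1 -> `|y_ k.+1 t - y_ k t| <= m * (1 / 2) ^+ k * expR (bt * t + bt).
  elim: k t => [|k IH] t tI.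
    rewrite expr0 mulr1 /y_ /= subr0 /T cl_id//.
    have c1 := (cont_good_comb hA (goodC 0) hg).1.
    have f1 s : -1 <= s <= 1 -> `|A s * 0 + g s| <= m * expR (bt * s + bt).
      move=> /andP[s1 s2]; rewrite mulr0 add0r; apply: (le_trans (Hm s)).
      rewrite ler_peMr ?(ltW m0)// -expR0 ler_expR.
      have -> : bt * s + bt = bt * (s + 1) by ring.
      by rewrite mulr_ge0 ?(ltW b0)//; lra.
    have f2 := JJ_weight c1 b0 (ltW m0) f1.
    have mb : 0 <= m / bt by rewrite divr_ge0// ltW.
    have := JJ_weight (J_cont c1) b0 mb f2 tI => /le_trans; apply.
    rewrite ler_wpM2r ?expR_ge0// ler_pdivrMr// ler_pdivrMr//.
    rewrite /bt; clear -M0 m0; nra.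
  have p0 : 0 <= m * (1 / 2) ^+ k by rewrite mulr_ge0 ?(ltW m0)// exprn_ge0.
  have := step _ _ _ (gy k) (gy k.+1) p0 IH t tI => /le_trans; apply.
  by rewrite exprS le_eqVlt; apply/orP; left; apply/eqP; field.
have d1 k t : `|y_ k.+1 t - y_ k t| <= m * expR (2 * bt) * (1 / 2) ^+ k.
  rewrite -(gy k.+1).2 -(gy k).2; have tI := cl_itv t.
  apply: (le_trans (d0 k _ tI)); rewrite mulrAC ler_wpM2r ?exprn_ge0//.
  rewrite ler_wpM2l ?(ltW m0)// ler_expR; case/andP: tI => t1 t2.
  by clear -b0 t2; nra.
have h12 : 0 <= (1 / 2 : R) < 1 by lra.
have M'0 : 0 <= m * expR (2 * bt) by rewrite mulr_ge0 ?expR_ge0// ltW.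
have [y gy' Hy] := good_limit h12 M'0 gy d1.
exists y; split => // x; rewrite mul0r add0r -/(T y x).
have bT k : `|T y x - y x| <= 3 * (expR (2 * bt) * (m * expR (2 * bt) / (1 - 1 / 2))) * (1 / 2) ^+ k.
  have -> : T y x - y x = (T y (cl x) - T (y_ k) (cl x)) - (y (cl x) - y_ k.+1 (cl x)).
    have E (a b c : R) : a - b = (a - c) - (b - c) by ring.
    by rewrite (gT y gy').2 gy'.2; exact: E.
  have B0 : 0 <= m * expR (2 * bt) / (1 - 1 / 2) * (1 / 2) ^+ k.
    by apply: le_trans (Hy k x); exact: normr_ge0.
  have st := step (y_ k) y _ (gy k) gy' B0 _ (cl x) (cl_itv x).
  apply: (le_trans (ler_normB _ _)).
  have e1 : 1 <= expR (2 * bt) by rewrite -expR0 ler_expR mulr_ge0// ltW.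
  have e2 : expR (bt * cl x + bt) <= expR (2 * bt).
    by rewrite ler_expR; have /andP[x1 x2] := cl_itv x; clear -b0 x2; nra.
  have h1 : `|T y (cl x) - T (y_ k) (cl x)| <= m * expR (2 * bt) / (1 - 1 / 2) * (1 / 2) ^+ k * expR (2 * bt).
    apply: (le_trans (st _)) => [t tI|].
      apply: (le_trans (Hy k t)); rewrite ler_peMr// -expR0 ler_expR.
      have -> : bt * t + bt = bt * (t + 1) by ring.
      by rewrite mulr_ge0 ?(ltW b0)//; case/andP: tI; lra.
    apply: ler_pM; [by rewrite divr_ge0|exact: expR_ge0| |exact: e2].
    by rewrite ler_pdivrMr// ler_peMr//; lra.
  have h2 : `|y (cl x) - y_ k.+1 (cl x)| <= m * expR (2 * bt) / (1 - 1 / 2) * (1 / 2) ^+ k.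
    apply: (le_trans (Hy k.+1 _)); rewrite exprSr mulrA ler_piMr//; clear; lra.
  move: h1 h2 B0 e1; move: `|_ - _| `|_ - _| (expR (2 * bt)) ((1 / 2) ^+ k) => p q E r; clear; nra.
apply/eqP; rewrite eq_sym -subr_eq0 -normr_le0; apply/ler_addgt0Pr => e e0; rewrite add0r.
have [k Hk] := geom_small (3 * (expR (2 * bt) * (m * expR (2 * bt) / (1 - 1 / 2)))) h12 e0.
exact: le_trans (bT k) Hk.
Qed.

End LinearODE.

(** * Linear two-point boundary value problems *)

Opaque integ wD inord norm3 J cl.
Section LinearBVP.
Context {R : realType}.
Implicit Types (f g h u v w y A F : R -> R) (x a b m M K t s q bt : R).

Lemma iv_w A g b y : good A -> good g -> iv A g b y -> good (fun t => A t * y t + g t).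
Proof. by move=> hA hg [hy _]; apply: goodD hg; exact: goodM. Qed.

(** An antiderivative pair on the whole line that extends y and its derivative. *)
Lemma iv_C2 A g b y : good A -> good g -> iv A g b y ->
  exists z z1, [/\ forall x, y x = z (cl x), z (-1) = 0, z1 (-1) = b,
     forall x, is_derive x 1 z (z1 x) & forall x, is_derive x 1 z1 (A x * y x + g x)].
Proof.
move=> hA hg hy; have [cw _] := iv_w hA hg hy.
pose w x := A x * y x + g x.
have dJw x := is_derive_J x cw; have cJw := is_derive_cont dJw.
have dJJw x := is_derive_J x cJw.
exists (fun x => b * (x + 1) + J (J w) x), (fun x => b + J w x); split.
- by move=> x; rewrite hy.2.
- by rewrite addNr mulr0 J_N1 addr0.
- by rewrite J_N1 addr0.
- move=> x.
  have := is_derive_affine b b x (fun x => is_derive_id x 1).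
  have E : (fun t => b * t + b) = (fun t => b * (t + 1)).
    by apply/funext => t; rewrite mulrDr mulr1.
  rewrite /id mulr1 E => d1; exact: is_deriveD d1 (dJJw x).
- move=> x.
  have dc : is_derive x 1 (fun=> b : R) (0 : R) by exact: is_derive_cst.
  by have := is_deriveD dc (dJw x); rewrite add0r.
Qed.

Lemma iv_lin A g g' b b' y y' a : good A -> good g -> good g' -> iv A g b y -> iv A g' b' y' ->
  iv A (fun x => g x + a * g' x) (b + a * b') (fun x => y x + a * y' x).
Proof.
move=> hA hg hg' hy hy'; have hw := iv_w hA hg hy; have hw' := iv_w hA hg' hy'.
have gy : good (fun x => y x + a * y' x) by apply: goodD hy.1 (goodZ a hy'.1).
split=> // x; have /andP[x1 x2] := cl_itv x.
have gg : good (fun x => A x * (y x + a * y' x) + (g x + a * g' x)).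
  by apply: goodD (goodM hA gy) (goodD hg (goodZ a hg')).
have gL : good (fun t => (A t * y t + g t) + a * (A t * y' t + g' t)).
  exact: goodD hw (goodZ a hw').
have EJ s : -1 <= s -> J (fun t => A t * (y t + a * y' t) + (g t + a * g' t)) s =
   J (fun t => A t * y t + g t) s + a * J (fun t => A t * y' t + g' t) s.
  move=> s1; rewrite -(J_lin a hw.1 hw'.1 s1); congr (J _ s).
  by apply/funext => t; ring.
rewrite (@J_ext _ _ (fun s => J (fun t => A t * y t + g t) s + a * J (fun t => A t * y' t + g' t) s)).
- rewrite J_lin//; try (apply: J_cont; by [exact: hw.1|exact: hw'.1]).
  by rewrite hy.2 hy'.2; ring.
- exact: J_cont gg.1.
- move=> s; apply: cvgD; first exact: (J_cont hw.1).
  apply: cvgM; [exact: cvg_cst|exact: (J_cont hw'.1)].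
- by rewrite x1.
- by move=> s /I11P/andP[s1 s2]; rewrite EJ.
Qed.

Lemma iv_exists A g b : good A -> good g -> exists y, iv A g b y.
Proof.
move=> hA hg.
have gl : good (fun x : R => b * (cl x + 1)).
  apply: (@good_cl _ (fun x => b * (x + 1))).
  by apply: continuous_subspaceT => x; apply: cvgM; [exact: cvg_cst|apply: cvgD; [exact: cvg_id|exact: cvg_cst]].
have [v hv] := volterra hA (goodD (goodM hA gl) hg).
exists (fun x => b * (cl x + 1) + v x); split; first exact: goodD gl hv.1.
have E : (fun t => A t * v t + (A t * (b * (cl t + 1)) + g t)) =
    (fun t => A t * (b * (cl t + 1) + v t) + g t) by apply/funext => t; ring.
by move=> x; rewrite [v x]hv.2 mul0r add0r E.
Qed.

(** In the weighted norm the equation bounds y by data plus one half of y; iterating the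
    estimate halves the contribution of y each time. *)
Lemma iv_bound A : good A -> exists2 K, 0 <= K & forall g b y m, good g -> iv A g b y ->
  (forall x, `|g x| <= m) -> forall x, `|y x| <= K * (`|b| + m).
Proof.
move=> hA; have [M M0 HM] := good_bounded hA.
pose bt := 2 * (M + 1).
have b0 : 0 < bt by rewrite /bt; lra.
have w1 t : -1 <= t -> 1 <= expR (bt * t + bt).
  move=> t1; rewrite -expR0 ler_expR; have -> : bt * t + bt = bt * (t + 1) by ring.
  by rewrite mulr_ge0 ?(ltW b0)//; lra.
exists (4 * expR (2 * bt)); first by rewrite mulr_ge0// expR_ge0.
move=> g b y m hg hy Hm; have cw := (iv_w hA hg hy).1; set w := (fun _ => _) in cw.
have m0 : 0 <= m by apply: le_trans (Hm 0).
have B0 : 0 <= `|b| by [].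
have [q q0 Hq] := good_bounded hy.1.
pose P := 2 * (2 * `|b| + m).
have P0 : 0 <= P by rewrite /P; lra.
have st k t : -1 <= t <= 1 -> `|y t| <= (P + q * (1 / 2) ^+ k) * expR (bt * t + bt).
  elim: k t => [|k IH] t tI; have /andP[t1 t2] := tI.
    rewrite expr0 mulr1; apply: (le_trans (Hq t)).
    by have := w1 t t1; move: (expR _) => E E1; clear -P0 q0 E1; nra.
  set Q := P + q * (1 / 2) ^+ k in IH.
  have Q0 : 0 <= Q by rewrite addr_ge0// mulr_ge0 ?(ltW q0)// exprn_ge0.
  have f1 s : -1 <= s <= 1 -> `|w s| <= (M * Q + m) * expR (bt * s + bt).
    move=> sI; have /andP[s1 s2] := sI.
    apply: (le_trans (ler_normD _ _)); rewrite normrM mulrDl -mulrA; apply: lerD.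
      by apply: ler_pM => //; exact: IH.
    by apply: (le_trans (Hm s)); rewrite ler_peMr// w1.
  have MQ : 0 <= M * Q + m by rewrite addr_ge0// mulr_ge0// ltW.
  have f2 := JJ_weight cw b0 MQ f1.
  have MQb : 0 <= (M * Q + m) / bt by rewrite divr_ge0// ltW.
  have f3 := JJ_weight (J_cont cw) b0 MQb f2 tI.
  have e2 : (M * Q + m) / bt / bt <= (Q + m) / 2.
    rewrite ler_pdivrMr// ler_pdivrMr// /bt; clear -M0 Q0 m0; nra.
  have hb : `|b * (cl t + 1)| <= 2 * `|b|.
    by rewrite normrM mulrC ler_wpM2r// cl_id// ger0_norm; lra.
  rewrite hy.2; apply: (le_trans (ler_normD _ _)); rewrite {2}cl_id//.
  have e3 : P + q * (1 / 2) ^+ k.+1 = (4 * `|b| + 2 * m + q * (1 / 2) ^+ k - 2 * `|b| - m) / 2 + (2 * `|b| + m) / 2 + P / 2 - q * (1/2) ^+ k / 2 + q * (1/2) ^+ k / 2.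
    by rewrite exprS /P; field.
  have E1 := w1 t t1.
  have QE : P + q * (1 / 2) ^+ k.+1 = P / 2 + Q / 2 by rewrite /Q exprS; field.
  rewrite QE; move: hb f3 e2 E1 m0 B0 Q0; rewrite /P.
  move: `|b * _| `|J _ _| (expR _) `|b| ((M * Q + m) / bt / bt) => p r E bb z h1 h2 h3 h4 h5 h6 h7.
  by clear -h1 h2 h3 h4 h5 h6 h7; nra.
move=> x; rewrite -hy.1.2; have xI := cl_itv x; have /andP[x1 x2] := xI.
have e2 : expR (bt * cl x + bt) <= expR (2 * bt).
  by rewrite ler_expR; clear -b0 x2; nra.
suff H : `|y (cl x)| <= P * expR (2 * bt).
  apply: (le_trans H); rewrite /P; have := expR_ge0 (2 * bt); move: (expR _) `|b| B0 => E bb h1 h2.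
  by clear -h1 h2 m0; nra.
apply/ler_addgt0Pr => e e0.
have h12 : 0 <= (1 / 2 : R) < 1 by lra.
have [k Hk] := geom_small (q * expR (2 * bt)) h12 e0.
apply: (le_trans (st k _ xI)).
have : 0 <= P + q * (1 / 2) ^+ k by rewrite addr_ge0// mulr_ge0 ?(ltW q0)// exprn_ge0.
move=> h; apply: (le_trans (ler_wpM2l h e2)); move: Hk.
by move: (expR (2 * bt)) ((1/2)^+k) => E r; clear; nra.
Qed.

Lemma iv_uniq A g b y y' : good A -> good g -> iv A g b y -> iv A g b y' -> y = y'.
Proof.
move=> hA hg hy hy'; have [K K0 HK] := iv_bound hA.
have := iv_lin (-1) hA hg hg hy hy'; rewrite mulN1r subrr.
have -> : (fun x => g x + (-1) * g x) = (fun=> 0) by apply/funext => x; ring.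
move=> h; apply/funext => x; have := HK _ _ _ 0 (goodC 0) h; rewrite normr0 addr0 mulr0.
move=> H; apply/eqP; rewrite -subr_eq0 -normr_le0 -(mulN1r (y' x)); apply: H => z.
by rewrite ?normr0 lexx.
Qed.

(** Integrate (y u' - y' u)' = y g - f u. The value of u' at 1 is recorded separately
    because it depends on u only. *)
Lemma iv_green A f g b b' y u : good A -> good f -> good g -> iv A f b y -> iv A g b' u ->
  exists y1 u1 : R, y 1 * u1 - y1 * u 1 = ip y g - ip f u /\
    (u1 = b' + ip A u + integ g).
Proof.
move=> hA hf hg hy hu.
have [z [z1 [zE z0 z10 dz dz1]]] := iv_C2 hA hf hy.
have [v [v1 [vE v0 v10 dv dv1]]] := iv_C2 hA hg hu.
have cw := (iv_w hA hf hy).1; have cw' := (iv_w hA hg hu).1.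
exists (z1 1), (v1 1); split; last first.
  have := integ_FTC dv1 cw'; rewrite v10 => /eqP; rewrite eq_sym subr_eq => /eqP ->.
  rewrite integD; last 2 first.
  - by apply: itg_cont; apply: good_cI; apply: goodM => //; exact: hu.1.
  - by apply: itg_cont; exact: good_cI.
  by rewrite /ip; ring.
have cz := is_derive_cont dz; have cv := is_derive_cont dv.
have dW x : is_derive x 1 (fun t => z t * v1 t - z1 t * v t)
   (z x * (A x * u x + g x) - (A x * y x + f x) * v x).
  have := is_deriveB (is_deriveM1 (dz x) (dv1 x)) (is_deriveM1 (dz1 x) (dv x)).
  have G (a p c d e : R) : a * p + c * d - (c * d + e) = a * p - e by ring.
  by rewrite G.
have cD : continuous (fun x => z x * (A x * u x + g x) - (A x * y x + f x) * v x).
  move=> x; apply: cvgB; apply: cvgM; [exact: cz|exact: cw'|exact: cw|exact: cv].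
have := integ_FTC dW cD; rewrite z0 v0 mul0r mulr0 subrr subr0.
have y1E : y 1 = z 1 by rewrite zE cl_id//; lra.
have u1E : u 1 = v 1 by rewrite vE cl_id//; lra.
rewrite y1E u1E => <-.
have Ly := good_L2 hy.1; have Lu := good_L2 hu.1; have Lg := good_L2 hg; have Lf := good_L2 hf.
rewrite /ip -integB; last 2 first.
- exact: L2M.
- exact: L2M.
apply: integ_eq => x xI; rewrite zE vE cl_idI//; ring.
Qed.

End LinearBVP.

Section Solver.
Context {R : realType}.
Implicit Types (f g h u v w y A F : R -> R) (x a b m M K t s q bt l : R).

(** The boundary value problem y'' = A y + g, y(-1) = y(1) = 0; the slope at -1 is free. *)
Definition bvp A g y := (exists b, iv A g b y) /\ y 1 = 0.

Lemma bvp_good A g y : bvp A g y -> good y. Proof. by move=> [[b []]]. Qed.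

Lemma bvp_lin A g g' y y' a : good A -> good g -> good g' -> bvp A g y -> bvp A g' y' ->
  bvp A (fun x => g x + a * g' x) (fun x => y x + a * y' x).
Proof.
move=> hA hg hg' [[b hy] y1] [[b' hy'] y1']; split; last by rewrite y1 y1' mulr0 addr0.
by exists (b + a * b'); exact: iv_lin.
Qed.

(** Shooting: add to the solution with zero initial data the multiple of the homogeneous
    solution with slope 1 that corrects the value at 1. Nondegeneracy says that the latter
    does not vanish at 1. *)
Lemma coercive_bvp A : good A -> (forall b y, iv A (fun=> 0) b y -> y 1 = 0 -> b = 0) ->
  (forall g, good g -> exists y, bvp A g y) /\
  exists2 K, 0 <= K & forall g y m, good g -> bvp A g y -> (forall x, `|g x| <= m) ->
    forall x, `|y x| <= K * m.
Proof.
move=> hA nd; have [y0 hy0] := iv_exists 1 hA (goodC 0).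
have y01 : y0 1 != 0.
  by apply/eqP => E; have := nd _ _ hy0 E; move/eqP; rewrite oner_eq0.
split=> [g hg|].
  have [yg hyg] := iv_exists 0 hA hg.
  exists (fun x => yg x + (- yg 1 / y0 1) * y0 x); split; last first.
    by rewrite divfK// addrN.
  exists (0 + (- yg 1 / y0 1) * 1).
  have := iv_lin (- yg 1 / y0 1) hA hg (goodC 0) hyg hy0.
  have -> : (fun x => g x + - yg 1 / y0 1 * 0) = g by apply/funext => x; rewrite mulr0 addr0.
  by [].
have [K K0 HK] := iv_bound hA.
exists (K * (K / `|y0 1| + 1)); first by rewrite mulr_ge0// addr_ge0// divr_ge0.
move=> g y m hg [[b hy] y1] Hm x.
have m0 : 0 <= m by apply: le_trans (Hm 0).
have [yg hyg] := iv_exists 0 hA hg.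
have E : y = fun x => yg x + b * y0 x.
  have h := iv_lin b hA hg (goodC 0) hyg hy0.
  move: h; rewrite add0r mulr1.
  have -> : (fun x => g x + b * 0) = g by apply/funext => z; rewrite mulr0 addr0.
  exact: iv_uniq.
have hb : `|b| <= K / `|y0 1| * m.
  have : yg 1 = - (b * y0 1) by apply/eqP; rewrite -subr_eq0 opprK -y1 E.
  have := HK _ _ _ m hg hyg Hm 1; rewrite normr0 add0r => h Eg; move: h.
  by rewrite Eg normrN normrM mulrAC ler_pdivlMr// normr_gt0.
apply: (le_trans (HK _ _ _ m hg hy Hm x)).
by rewrite -mulrA ler_wpM2l// mulrDl mul1r lerD2r.
Qed.

(** The Fredholm alternative by Green's identity: a solution y starting from zero data
    satisfies y(1) h'(1) = - ip f h. The solution orthogonal to the kernel is obtained by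
    subtracting a multiple of h, which requires the pairing of A h with h to be nonzero. *)
Lemma kernel_bvp A h bh : good A -> iv A (fun=> 0) bh h -> bh != 0 -> h 1 = 0 ->
  ip (fun x => A x * h x) h != 0 ->
  [/\ forall f, good f -> ip f h = 0 ->
        exists2 y, bvp A f y & ip (fun x => A x * h x) y = 0,
      forall f y, good f -> bvp A f y -> ip f h = 0 &
  exists2 K, 0 <= K & forall f y m, good f -> bvp A f y -> ip (fun x => A x * h x) y = 0 ->
    (forall x, `|f x| <= m) -> forall x, `|y x| <= K * m].
Proof.
move=> hA hh bh0 h1 Nh; have gh := hh.1; have Lh := good_L2 gh.
have gAh : good (fun x => A x * h x) by exact: goodM.
have LAh := good_L2 gAh.
have int0 : integ (fun=> 0 : R) = 0 by rewrite integ_cst mulr0.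
have ip0 f : ip f (fun=> 0) = 0 by rewrite -[RHS]int0; apply: integ_eq => x _; rewrite mulr0.
have green f b y : good f -> iv A f b y -> exists2 h1 : R, h1 != 0 & y 1 * h1 = - ip f h.
  move=> hf hy.
  have [y1 [u1 [E1 E2]]] := iv_green hA hf (goodC 0) hy hh.
  exists u1; last by move: E1; rewrite h1 mulr0 subr0 ip0 sub0r.
  (* The slope of h at 1 is nonzero: otherwise Green's identity with the solution v of
     v'' = A v + A (so that 1 + v solves the homogeneous equation) would give zero slope
     at -1. *)
  have [v hv] := iv_exists 0 hA hA.
  have [v1 [u1' [E1' E2']]] := iv_green hA hA (goodC 0) hv hh.
  move: E1'; rewrite h1 mulr0 subr0 ip0 sub0r.
  have -> : u1' = u1 by rewrite E2 E2'.
  move=> E3; apply/eqP => u10; move: E2 E3; rewrite u10 mulr0 int0 addr0 => E4 E5.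
  by move/eqP: bh0; apply; lra.
have sol_ f y m : good f -> bvp A f y -> ip f h = 0 by move=> hf [[b hy] y1];
  have [h1' _ E] := green f b y hf hy; move: E; rewrite y1 mul0r => /eqP; rewrite eq_sym oppr_eq0 => /eqP.
split; [|by move=> f y hf hy; exact: (sol_ f y 0 hf hy)|].
- move=> f hf fh; have [y hy] := iv_exists 0 hA hf.
  have y1 : y 1 = 0.
    by have [h1' h1n E] := green f 0 y hf hy; move: E; rewrite fh oppr0 => /eqP; rewrite mulf_eq0 (negbTE h1n) orbF => /eqP.
  pose k := - ip (fun x => A x * h x) y / ip (fun x => A x * h x) h.
  have Ly := good_L2 hy.1.
  exists (fun x => y x + k * h x).
    have hb : bvp A (fun=> 0) h by split=> //; exists bh.
    have hy' : bvp A f y by split=> //; exists 0.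
    have := bvp_lin k hA hf (goodC 0) hy' hb.
    by have -> : (fun x => f x + k * 0) = f by apply/funext => z; rewrite mulr0 addr0.
  rewrite ipC ipDl//; last exact: L2Z.
  by rewrite ipZl// ipC (ipC h) /k divfK ?addrN// addrN.
have [K K0 HK] := iv_bound hA.
have [a a0 Ha] := good_bounded gAh; have [c c0 Hc] := good_bounded gh.
pose N := `|ip (fun x => A x * h x) h|; have N0 : 0 < N by rewrite normr_gt0.
exists (K + 2 * (a * K) / N * c); first by rewrite addr_ge0// !mulr_ge0// ?invr_ge0 ?(ltW a0)// ltW.
move=> f y m hf [[b hy] y1] Ny Hm x.
have m0 : 0 <= m by apply: le_trans (Hm 0).
have [yf hyf] := iv_exists 0 hA hf.
have E : y = fun x => yf x + (b / bh) * h x.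
  have := iv_lin (b / bh) hA hf (goodC 0) hyf hh.
  rewrite add0r divfK//.
  have -> : (fun x => f x + b / bh * 0) = f by apply/funext => z; rewrite mulr0 addr0.
  exact: iv_uniq.
have Lyf := good_L2 hyf.1.
have yfB z : `|yf z| <= K * m by have := HK _ _ _ m hf hyf Hm z; rewrite normr0 add0r.
have hb : `|b / bh| <= 2 * (a * K) / N * m.
  move: Ny; rewrite E ipC ipDl//; last exact: L2Z.
  rewrite ipZl// (ipC h) => /eqP; rewrite addrC addr_eq0 => /eqP /(congr1 Num.norm).
  rewrite normrN normrM -/N => E2.
  rewrite mulrAC ler_pdivlMr// E2.
  have := @integ_bound _ (fun x => yf x * (A x * h x)) (a * K * m).
  rewrite -[2 * (a * K) * m]mulrA; apply; first exact: L2M.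
  move=> z _; rewrite normrM mulrC -mulrA; apply: ler_pM => //.
rewrite E; apply: (le_trans (ler_normD _ _)); rewrite mulrDl; apply: lerD => //.
by rewrite normrM mulrAC; apply: ler_pM.
Qed.

End Solver.

Section LinearSystem.
Context {R : realType} (A2 A3 B2 B3 F h : R -> R) (bh : R).
Implicit Types (f g u v w y : R -> R) (x a b m M K t s q bt l : R).

(** The linearized bifurcation problem. The normalization of y3 is orthogonality to the
    kernel in H10, and l is an unknown: it is the variation of the parameter. *)
Definition Srel g2 g3 l y2 y3 := [/\ bvp A2 (fun x => g2 x + l * B2 x) y2,
  bvp A3 (fun x => F x * y2 x + l * B3 x + g3 x) y3 & ip (fun x => A3 x * h x) y3 = 0].

Context (hA2 : good A2) (hA3 : good A3) (hB2 : good B2) (hB3 : good B3) (hF : good F).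
Context (nd : forall b y, iv A2 (fun=> 0) b y -> y 1 = 0 -> b = 0).
Context (hh : iv A3 (fun=> 0) bh h) (bh0 : bh != 0) (h1 : h 1 = 0).
Context (Nh : ip (fun x => A3 x * h x) h != 0).
Context (tr : forall y, bvp A2 B2 y -> ip (fun x => F x * y x + B3 x) h != 0).

Lemma Srel_good g2 g3 l y2 y3 : Srel g2 g3 l y2 y3 -> good y2 /\ good y3.
Proof. by move=> [b2 b3 _]; split; [exact: bvp_good b2|exact: bvp_good b3]. Qed.

Lemma Srel_lin g2 g3 g2' g3' l y2 y3 l' y2' y3' a : good g2 -> good g3 -> good g2' -> good g3' ->
  Srel g2 g3 l y2 y3 -> Srel g2' g3' l' y2' y3' ->
  Srel (fun x => g2 x + a * g2' x) (fun x => g3 x + a * g3' x) (l + a * l')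
    (fun x => y2 x + a * y2' x) (fun x => y3 x + a * y3' x).
Proof.
move=> hg2 hg3 hg2' hg3' [b2 b3 N] [b2' b3' N'].
have gy2 := bvp_good b2; have gy3 := bvp_good b3.
have gy2' := bvp_good b2'; have gy3' := bvp_good b3'.
have G2 (p q r p' q' : R) : p + q * r + a * (p' + q' * r) = p + a * p' + (q + a * q') * r by ring.
have G3 (n p q r s n' p' q' s' : R) : n * p + q * r + s + a * (n * p' + q' * r + s') =
  n * (p + a * p') + (q + a * q') * r + (s + a * s') by ring.
split.
- have := bvp_lin a hA2 (goodD hg2 (goodZ l hB2)) (goodD hg2' (goodZ l' hB2)) b2 b2'.
  by congr bvp; apply/funext => x; exact: G2.
- have := bvp_lin a hA3 (goodD (goodD (goodM hF gy2) (goodZ l hB3)) hg3)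
    (goodD (goodD (goodM hF gy2') (goodZ l' hB3)) hg3') b3 b3'.
  by congr bvp; apply/funext => x; exact: G3.
- have LA : L2 (fun x => A3 x * h x) by apply: good_L2; exact: goodM hh.1.
  rewrite ipC ipDl//; [|exact: good_L2|by apply: L2Z; exact: good_L2].
  rewrite ipZl//; last exact: good_L2.
  by rewrite ipC N ipC N' mulr0 addr0.
Qed.

(** y2 is the sum of the response to g2 and l times the response to B2. The Fredholm
    condition of the third equation then reads (term in g2, g3) + l D = 0, where D is
    nonzero by transversality, and determines l. *)
Lemma Srel_solve :
  (forall g2 g3, good g2 -> good g3 -> exists l y2 y3, Srel g2 g3 l y2 y3) /\
  exists2 K, 0 <= K & forall g2 g3 l y2 y3 m, good g2 -> good g3 -> Srel g2 g3 l y2 y3 ->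
    (forall x, `|g2 x| <= m) -> (forall x, `|g3 x| <= m) ->
    `|l| <= K * m /\ forall x, `|y2 x| <= K * m /\ `|y3 x| <= K * m.
Proof.
have [ex2 [K2 K20 HK2]] := coercive_bvp hA2 nd.
have [ex3 nec3 [K3 K30 HK3]] := kernel_bvp hA3 hh bh0 h1 Nh.
have [yB hyB] := ex2 _ hB2; have gyB := bvp_good hyB.
pose D := ip (fun x => F x * yB x + B3 x) h.
have D0 : D != 0 := tr hyB.
have gh := hh.1; have Lh := good_L2 gh.
have gFB : good (fun x => F x * yB x + B3 x) by apply: goodD hB3; exact: goodM.
have split_ g2 g3 l y2 yg : good g2 -> good g3 -> bvp A2 g2 yg -> y2 = (fun x => yg x + l * yB x) ->
    ip (fun x => F x * y2 x + l * B3 x + g3 x) h = ip (fun x => F x * yg x + g3 x) h + l * D.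
  move=> hg2 hg3 hyg ->; have gyg := bvp_good hyg.
  have gFg : good (fun x => F x * yg x + g3 x) by apply: goodD hg3; exact: goodM.
  rewrite /D -ipZl//; last exact: good_L2.
  rewrite -ipDl//; [|exact: good_L2|by apply: L2Z; exact: good_L2].
  by apply: ip_eq => // x _; ring.
split=> [g2 g3 hg2 hg3|].
  have [yg hyg] := ex2 _ hg2; have gyg := bvp_good hyg.
  pose l := - ip (fun x => F x * yg x + g3 x) h / D.
  pose y2 x := yg x + l * yB x.
  have b2 : bvp A2 (fun x => g2 x + l * B2 x) y2 by exact: bvp_lin.
  have gy2 := bvp_good b2.
  have [||y3 b3 N3] := ex3 (fun x => F x * y2 x + l * B3 x + g3 x).
  - by apply: goodD hg3; apply: goodD (goodZ l hB3); exact: goodM.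
  - by rewrite (split_ g2 g3 l y2 yg)// /l divfK// addrN.
  by exists l, y2, y3.
have [c c0 Hc] := good_bounded gh; have [aF aF0 HF] := good_bounded hF.
have [aB2 aB20 HB2] := good_bounded hB2; have [aB3 aB30 HB3] := good_bounded hB3.
pose Kl := 2 * (aF * K2 + 1) * c / `|D|.
have D0' : 0 < `|D| by rewrite normr_gt0.
have Kl0 : 0 <= Kl by rewrite !mulr_ge0// ?invr_ge0 ?addr_ge0// ?mulr_ge0// ltW.
pose Ky := K2 * (1 + Kl * aB2).
have Ky0 : 0 <= Ky by rewrite mulr_ge0// addr_ge0// mulr_ge0// ltW.
pose Kz := K3 * (aF * Ky + Kl * aB3 + 1).
have Kz0 : 0 <= Kz by rewrite mulr_ge0// !addr_ge0// mulr_ge0// ltW.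
exists (Kl + Ky + Kz); first by rewrite !addr_ge0.
move=> g2 g3 l y2 y3 m hg2 hg3 [b2 b3 N3] Hm2 Hm3.
have m0 : 0 <= m by apply: le_trans (Hm2 0).
have [yg hyg] := ex2 _ hg2; have gyg := bvp_good hyg.
have gy2 := bvp_good b2.
have gr2 : good (fun x => g2 x + l * B2 x) by exact: goodD (goodZ l hB2).
have gr3 : good (fun x => F x * y2 x + l * B3 x + g3 x).
  by apply: goodD hg3; apply: goodD (goodZ l hB3); exact: goodM.
have E2 : y2 = fun x => yg x + l * yB x.
  have := bvp_lin (-1) hA2 gr2 gr2 b2 (bvp_lin l hA2 hg2 hB2 hyg hyB).
  have -> : (fun x => g2 x + l * B2 x + -1 * (g2 x + l * B2 x)) = (fun=> 0).
    by apply/funext => x; ring.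
  move=> hb2; have H := HK2 _ _ 0 (goodC 0) hb2; apply/funext => x; apply/eqP; rewrite -subr_eq0 -normr_le0.
  rewrite -(mulN1r (_ + _)) -[X in _ <= X](mulr0 K2); apply: H => z.
  by rewrite normr0.
have hl : `|l| <= Kl * m.
  have := nec3 _ _ gr3 b3; rewrite (split_ g2 g3 l y2 yg)// => /eqP.
  rewrite addrC addr_eq0 => /eqP /(congr1 Num.norm); rewrite normrM normrN => E.
  rewrite /Kl mulrAC ler_pdivlMr// E.
  have -> : 2 * (aF * K2 + 1) * c * m = 2 * ((aF * (K2 * m) + m) * c) by ring.
  apply: integ_bound.
    by apply: L2M; apply: good_L2 => //; apply: goodD hg3; exact: goodM.
  move=> x _; rewrite normrM; apply: ler_pM => //.
  apply: (le_trans (ler_normD _ _)); apply: lerD => //; rewrite normrM; apply: ler_pM => //.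
  exact: HK2 hyg _ _.
have hy2 x : `|y2 x| <= Ky * m.
  rewrite /Ky -mulrA; apply: HK2 b2 _ x => // z; apply: (le_trans (ler_normD _ _)).
  by rewrite mulrDl mul1r mulrAC; apply: lerD => //; rewrite normrM; apply: ler_pM.
have hy3 x : `|y3 x| <= Kz * m.
  rewrite /Kz -mulrA; apply: HK3 b3 _ _ x => // z; apply: (le_trans (ler_normD _ _)).
  rewrite !mulrDl mul1r; apply: lerD => //; apply: (le_trans (ler_normD _ _)); apply: lerD.
    by rewrite normrM -mulrA; apply: ler_pM.
  by rewrite normrM mulrAC; apply: ler_pM.
move: hl hy2 hy3; move: (Kl) (Ky) (Kz) Kl0 Ky0 Kz0 => p q r p0 q0 r0 hl hy2 hy3.
have G1 : p * m <= (p + q + r) * m by rewrite ler_wpM2r// -addrA lerDl addr_ge0.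
have G2 : q * m <= (p + q + r) * m by rewrite ler_wpM2r// addrAC lerDr addr_ge0.
have G3 : r * m <= (p + q + r) * m by rewrite ler_wpM2r// lerDr addr_ge0.
split=> [|x]; first exact: (le_trans hl).
by split; [apply: (le_trans (hy2 x))|apply: (le_trans (hy3 x))].
Qed.

(** Choice of the unique solution; uniqueness gives linearity. *)
Lemma solution_operator : exists (Sl : (R -> R) -> (R -> R) -> R) (S2 S3 : (R -> R) -> (R -> R) -> R -> R),
 [/\ forall g2 g3, good g2 -> good g3 ->
      Srel g2 g3 (Sl g2 g3) (S2 g2 g3) (S3 g2 g3),
     forall g2 g3 l y2 y3, good g2 -> good g3 -> Srel g2 g3 l y2 y3 ->
      [/\ l = Sl g2 g3, y2 = S2 g2 g3 & y3 = S3 g2 g3] &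
     exists2 K, 0 < K & forall g2 g3 m, good g2 -> good g3 ->
       (forall x, `|g2 x| <= m) -> (forall x, `|g3 x| <= m) ->
      `|Sl g2 g3| <= K * m /\ forall x, `|S2 g2 g3 x| <= K * m /\ `|S3 g2 g3 x| <= K * m].
Proof.
have [ex [K K0 HK]] := Srel_solve.
have /choice [S HS] : forall g : (R -> R) * (R -> R), exists p : R * (R -> R) * (R -> R),
    good g.1 -> good g.2 -> Srel g.1 g.2 p.1.1 p.1.2 p.2.
  move=> [g2 g3]; have [[h2 h3]|nh] := pselect (good g2 /\ good g3).
    by have [l [y2 [y3 H]]] := ex _ _ h2 h3; exists ((l, y2), y3).
  by exists ((0, 0), 0) => h2 h3; case: nh.
exists (fun g2 g3 => (S (g2, g3)).1.1), (fun g2 g3 => (S (g2, g3)).1.2), (fun g2 g3 => (S (g2, g3)).2).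
split=> [g2 g3 h2 h3|g2 g3 l y2 y3 h2 h3 H|].
- exact: (HS (g2, g3)).
- have H' := HS (g2, g3) h2 h3; have H0 := Srel_lin (-1) h2 h3 h2 h3 H H'.
  have E f : (fun x => f x + -1 * f x) = (fun=> 0) by apply/funext => x; ring.
  move: H0 => /=; rewrite !E => H0.
  have z0 (x : R) : `|(fun=> 0 : R) x| <= 0 :> R by rewrite normr0.
  have [e1 e2] := HK _ _ _ _ _ 0 (goodC 0) (goodC 0) H0 z0 z0.
  have G (p q : R) : `|p + -1 * q| <= K * 0 -> p = q.
    by rewrite mulr0 normr_le0 mulN1r subr_eq0 => /eqP.
  by split; [exact: G|apply/funext => x; apply: G; exact: (e2 x).1|apply/funext => x; apply: G; exact: (e2 x).2].
- exists (K + 1); first by lra.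
  move=> g2 g3 m h2 h3 H2 H3; have m0 : 0 <= m by apply: le_trans (H2 0).
  have Kle : K * m <= (K + 1) * m by rewrite ler_wpM2r//; lra.
  have [e1 e2] := HK _ _ _ _ _ m h2 h3 (HS (g2, g3) h2 h3) H2 H3.
  split; first exact: le_trans Kle.
  by move=> x; have [e3 e4] := e2 x; split; apply: le_trans Kle.
Qed.

End LinearSystem.

(** * The nonlinear remainder and its majorants *)

Section Remainder.
Context {R : realType}.

(** The part of the equations that is of degree at least two in (l, y2, y3) when s has
    degree two. In w0 + w1 + w2, the expansion of q2^2 + q3^2 - 4, the terms are ordered by
    degree, and L0 + L is (lc + l)^2. The ring is arbitrary because the expression is
    evaluated on numbers, on functions and on polynomials in s. *)
Definition Gw (C : pzRingType) (L0 lc c h w0 s l y2 y3 : C) : C * C :=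
  let w1 := c * y2 + c * y2 in
  let p := h + y3 in
  let w2 := y2 * y2 + s * (p * p) in
  let L := lc * l + lc * l + l * l in
  ((L0 + L) * w2 * (c + y2) + L * w1 * (c + y2) + (L0 * w1 * y2 + L * w0 * y2) + l * l * w0 * c,
   (L0 + L) * w2 * p + L * w1 * p + (L0 * w1 * y3 + L * w0 * y3) + l * l * w0 * h).

(** Every monomial of [Gw] has degree at least two, hence order eps^2 if s has order eps^2
    and the other unknowns order eps. *)
Lemma Gw_cl2 (M K1 : R) : 0 <= M -> 0 <= K1 -> exists2 K, 0 <= K &
  forall (C : pzRingType) (B : C -> R -> Prop) (eps del : R) (L0 lc c h w0 s l y2 y3 l' y2' y3' : C),
  majorant B -> B 0 0 -> 0 <= eps <= 1 -> 0 <= del ->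
  B L0 M -> B lc M -> B c M -> B h M -> B w0 M -> B s (eps ^+ 2) ->
  cl2 B eps del 1 K1 l l' -> cl2 B eps del 1 K1 y2 y2' -> cl2 B eps del 1 K1 y3 y3' ->
  let g := Gw L0 lc c h w0 s l y2 y3 in let g' := Gw L0 lc c h w0 s l' y2' y3' in
  cl2 B eps del 2 K g.1 g'.1 /\ cl2 B eps del 2 K g.2 g'.2.
Proof.
move=> M0 K10.
have [Ka Ha] : exists Ka, forall (C : pzRingType) (B : C -> R -> Prop) (eps del : R) (L0 lc c h w0 s l y2 y3 l' y2' y3' : C),
  majorant B -> B 0 0 -> 0 <= eps <= 1 -> 0 <= del ->
  B L0 M -> B lc M -> B c M -> B h M -> B w0 M -> B s (eps ^+ 2) ->
  cl2 B eps del 1 K1 l l' -> cl2 B eps del 1 K1 y2 y2' -> cl2 B eps del 1 K1 y3 y3' ->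
  cl2 B eps del 2 Ka (Gw L0 lc c h w0 s l y2 y3).1 (Gw L0 lc c h w0 s l' y2' y3').1.
  eexists => C B eps del L0 lc c h w0 s l y2 y3 l' y2' y3' mB B0 e01 d0 b1 b2 b3 b4 b5 b6 x1 x2 x3.
  have k1 := @cl2_cst _ _ _ mB eps del d0 M _ M0 b1 B0.
  have k2 := @cl2_cst _ _ _ mB eps del d0 M _ M0 b2 B0.
  have k3 := @cl2_cst _ _ _ mB eps del d0 M _ M0 b3 B0.
  have k4 := @cl2_cst _ _ _ mB eps del d0 M _ M0 b4 B0.
  have k5 := @cl2_cst _ _ _ mB eps del d0 M _ M0 b5 B0.
  have k6 : cl2 B eps del 2 1 s s.
    split; rewrite ?mul1r// subrr; apply: (maj_le mB B0); rewrite mulr_ge0// exprn_ge0//.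
    by case/andP: e01.
  rewrite /Gw /=; cl2_solve.
have [Kb Hb] : exists Ka, forall (C : pzRingType) (B : C -> R -> Prop) (eps del : R) (L0 lc c h w0 s l y2 y3 l' y2' y3' : C),
  majorant B -> B 0 0 -> 0 <= eps <= 1 -> 0 <= del ->
  B L0 M -> B lc M -> B c M -> B h M -> B w0 M -> B s (eps ^+ 2) ->
  cl2 B eps del 1 K1 l l' -> cl2 B eps del 1 K1 y2 y2' -> cl2 B eps del 1 K1 y3 y3' ->
  cl2 B eps del 2 Ka (Gw L0 lc c h w0 s l y2 y3).2 (Gw L0 lc c h w0 s l' y2' y3').2.
  eexists => C B eps del L0 lc c h w0 s l y2 y3 l' y2' y3' mB B0 e01 d0 b1 b2 b3 b4 b5 b6 x1 x2 x3.
  have k1 := @cl2_cst _ _ _ mB eps del d0 M _ M0 b1 B0.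
  have k2 := @cl2_cst _ _ _ mB eps del d0 M _ M0 b2 B0.
  have k3 := @cl2_cst _ _ _ mB eps del d0 M _ M0 b3 B0.
  have k4 := @cl2_cst _ _ _ mB eps del d0 M _ M0 b4 B0.
  have k5 := @cl2_cst _ _ _ mB eps del d0 M _ M0 b5 B0.
  have k6 : cl2 B eps del 2 1 s s.
    split; rewrite ?mul1r// subrr; apply: (maj_le mB B0); rewrite mulr_ge0// exprn_ge0//.
    by case/andP: e01.
  rewrite /Gw /=; cl2_solve.
exists (`|Ka| + `|Kb|); first exact: addr_ge0.
move=> C B eps del L0 lc c h w0 s l y2 y3 l' y2' y3' mB B0 e01 d0 b1 b2 b3 b4 b5 b6 x1 x2 x3 /=.
have h1 := Ha _ _ _ _ _ _ _ _ _ _ _ _ _ _ _ _ mB B0 e01 d0 b1 b2 b3 b4 b5 b6 x1 x2 x3.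
have h2 := Hb _ _ _ _ _ _ _ _ _ _ _ _ _ _ _ _ mB B0 e01 d0 b1 b2 b3 b4 b5 b6 x1 x2 x3.
split; [apply: (cl2_weak mB e01 d0 h1 (leqnn 2))|apply: (cl2_weak mB e01 d0 h2 (leqnn 2))].
  by apply: (le_trans (ler_norm _)); rewrite lerDl.
by apply: (le_trans (ler_norm _)); rewrite lerDr.
Qed.

Definition Bfun (f : R -> R) (M : R) := forall x, `|f x| <= M.

Lemma majorant_fun : majorant (A := R -> R) Bfun.
Proof.
split=> [f g M N h1 h2 x|f g M N h1 h2 x|f M h x|f M N h MN x|f M h].
- by apply: (le_trans (ler_normD _ _)); apply: lerD.
- by rewrite normrM; apply: ler_pM.
- by rewrite normrN.
- exact: le_trans (h x) MN.
- exact: le_trans (normr_ge0 _) (h 0).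
Qed.

(** The sum of sup_x |p_n(x)| r^n is at most M, expressed by a scalar majorant polynomial in
    order to avoid suprema. *)
Definition Bpoly (r : R) (p : {poly (R -> R)}) (M : R) :=
  exists2 P : {poly R}, forall n, Bfun p`_n P`_n & P.[r] <= M.

Lemma Bfun_ge0 f M : Bfun f M -> 0 <= M.
Proof. by move/(_ 0); exact: le_trans. Qed.

Lemma horner_ge0 (P : {poly R}) r : 0 <= r -> (forall n, 0 <= P`_n) -> 0 <= P.[r].
Proof.
by move=> r0 P0; rewrite horner_coef sumr_ge0// => i _; rewrite mulr_ge0// exprn_ge0.
Qed.

Lemma majorant_poly r : 0 <= r -> majorant (A := {poly (R -> R)}) (Bpoly r).
Proof.
move=> r0; have mf := majorant_fun.
have Bsum (I : Type) (s : seq I) (F : I -> R -> R) (M : I -> R) :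
    (forall i, Bfun (F i) (M i)) -> Bfun (\sum_(i <- s) F i) (\sum_(i <- s) M i).
  move=> H; elim: s => [|i s IH]; first by rewrite !big_nil => x; rewrite normr0.
  by rewrite !big_cons; exact: (majD mf).
split=> [p q M N [P hP PM] [Q hQ QN]|p q M N [P hP PM] [Q hQ QN]|p M [P hP PM]|p M N [P hP PM] MN|p M [P hP PM]].
- exists (P + Q); last by rewrite hornerD; exact: lerD.
  by move=> n; rewrite !coefD; exact: (majD mf).
- exists (P * Q).
    by move=> n; rewrite !coefM; apply: Bsum => i; exact: (majM mf).
  rewrite hornerM; apply: ler_pM => //; apply: horner_ge0 => // n.
    exact: Bfun_ge0 (hP n).
  exact: Bfun_ge0 (hQ n).
- by exists P => // n; rewrite coefN; exact: (majN mf).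
- by exists P => //; exact: le_trans MN.
- by apply: le_trans PM; apply: horner_ge0 => // n; exact: Bfun_ge0 (hP n).
Qed.

Lemma Bpoly_coef r p M n : 0 <= r -> Bpoly r p M -> forall x, `|p`_n x| * r ^+ n <= M.
Proof.
move=> r0 [P hP PM] x; apply: le_trans PM.
have P0 m : 0 <= P`_m by exact: Bfun_ge0 (hP m).
apply: (@le_trans _ _ (P`_n * r ^+ n)); first by rewrite ler_wpM2r// ?exprn_ge0//; exact: hP.
rewrite horner_coef; have [nP|nP] := ltnP n (size P); last first.
  rewrite nth_default// mul0r sumr_ge0// => i _; by rewrite mulr_ge0// exprn_ge0.
rewrite (bigD1 (Ordinal nP))//= lerDl sumr_ge0// => i _; by rewrite mulr_ge0// exprn_ge0.
Qed.

Lemma Bpoly0 r : Bpoly r 0 0.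
Proof. by exists 0; rewrite ?horner0// => n x; rewrite !coef0 normr0. Qed.

Lemma BpolyC r f M : Bfun f M -> Bpoly r f%:P M.
Proof.
move=> h; exists M%:P; last by rewrite hornerC.
by move=> n; rewrite !coefC; case: eqP => // _ x; rewrite normr0.
Qed.

Lemma BpolyX r : 0 <= r -> Bpoly r 'X r.
Proof.
move=> r0; exists 'X; last by rewrite hornerX.
by move=> n x; rewrite !coefX; case: eqP => _; rewrite ?normr1 ?normr0.
Qed.

(** Evaluation at s is bounded by the norm of radius r as soon as |s| <= r. *)
Lemma Bpoly_horner r p M (s : R) : `|s| <= r -> Bpoly r p M -> Bfun p.[fun=> s] M.
Proof.
move=> sr [P hP PM] x; apply: le_trans PM.
have r0 : 0 <= r by apply: le_trans sr.
have P0 m : 0 <= P`_m by exact: Bfun_ge0 (hP m).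
have E (n : nat) : ((fun=> s : R) ^+ n) x = s ^+ n.
  by elim: n => [//|n IH]; rewrite !exprS /= -IH.
have Es (I : Type) (t : seq I) (F : I -> R -> R) : (\sum_(i <- t) F i) x = \sum_(i <- t) F i x.
  by elim: t => [|i t IH]; rewrite ?big_nil// !big_cons -IH.
rewrite (@horner_coef_wide _ (maxn (size p) (size P)) p)// ?leq_maxl//.
rewrite (@horner_coef_wide _ (maxn (size p) (size P)) P)// ?leq_maxr//.
rewrite Es; apply: (le_trans (ler_norm_sum _ _ _)); apply: ler_sum => i _.
rewrite [(_ * _) x]/(p`_i x * ((fun=> s : R) ^+ i) x) E normrM normrX.
by apply: ler_pM; rewrite ?exprn_ge0//; [exact: hP|rewrite lerXn2r// ?nnegrE].
Qed.

End Remainder.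

(** * Power series of functions *)

Section PowerSeries.
Context {R : realType}.
Implicit Types (a b : nat -> R -> R) (r s t x C k K q B l : R) (n N : nat).

Definition part a N s x : R := \sum_(n < N) a n x * s ^+ n.
Definition psum a s x : R := limn (fun N => part a N s x).

(** The power series a converges uniformly on [-1, 1] on every smaller disc, that is, its
    radius of convergence is at least r uniformly in x. *)
Definition convrad a r := (forall n, good (a n)) /\
  forall r', 0 < r' < r -> exists2 C, 0 <= C & forall n x, `|a n x| * r' ^+ n <= C.

Lemma rad_bound a r C : (forall n, good (a n)) -> (forall n x, `|a n x| * r ^+ n <= C) -> convrad a r.
Proof.
move=> ga H; split=> // r' /andP[r0 r1]; exists C.
  by apply: le_trans (H 0%N 0); rewrite mulr_ge0// exprn_ge0// ltW// (lt_trans r0).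
move=> n x; apply: le_trans (H n x); rewrite ler_wpM2l// lerXn2r ?nnegrE ?ltW//.
exact: lt_trans r1.
Qed.

Lemma between s r : `|s| < r -> exists2 r', `|s| < r' & 0 < r' < r.
Proof.
move=> sr; exists ((`|s| + r) / 2); first by lra.
by have := normr_ge0 s; move: (`|s|) sr => p pr p0; apply/andP; split; lra.
Qed.

Lemma part_S a N s x : part a N.+1 s x = part a N s x + a N x * s ^+ N.
Proof. by rewrite /part big_ord_recr. Qed.

Lemma part_good a N s : (forall n, good (a n)) -> good (part a N s).
Proof.
move=> ga; have E : part a N s = fun x => part a N s x by [].
elim: N {E} => [|N IH].
  rewrite (_ : part a 0 s = fun=> 0); first exact: goodC.
  by apply/funext => x; rewrite /part big_ord0.
rewrite (_ : part a N.+1 s = fun x => part a N s x + s ^+ N * a N x).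
  by apply: goodD IH (goodZ _ (ga N)).
by apply/funext => x; rewrite part_S mulrC.
Qed.

Lemma psum_tail a r s : convrad a r -> `|s| < r -> exists C q,
  [/\ 0 <= C, 0 <= q < 1, good (psum a s) & forall N x, `|psum a s x - part a N s x| <= C * q ^+ N].
Proof.
move=> [ga H] sr; have [r' sr' rr] := between sr; have [C C0 HC] := H r' rr.
have r0 : 0 < r' by case/andP: rr.
pose q := `|s| / r'.
have q01 : 0 <= q < 1.
  by rewrite /q ltr_pdivrMr// mul1r sr' andbT divr_ge0// ltW.
have step N x : `|part a N.+1 s x - part a N s x| <= C * q ^+ N.
  rewrite part_S addrAC subrr add0r normrM normrX /q expr_div_n mulrA ler_pdivlMr ?exprn_gt0//.
  by rewrite mulrAC ler_wpM2r ?exprn_ge0.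
have [f gf Hf] := good_limit q01 C0 (fun N => part_good N s ga) step.
exists (C / (1 - q)), q; have q1 : 0 < 1 - q by case/andP: q01; lra.
have E : psum a s = f.
  apply/funext => x; apply: cvg_lim => //; apply/cvgrPdist_le => e e0.
  have [k Hk] := geom_small (C / (1 - q)) q01 e0; exists k => // n /= kn.
  have Cq : 0 <= C / (1 - q) by rewrite divr_ge0// ltW.
  apply: (le_trans (Hf n x)); apply: le_trans Hk; rewrite ler_wpM2l//.
  by case/andP: q01 => q0 /ltW q1'; rewrite ler_wiXn2l.
by rewrite E; split=> //; rewrite divr_ge0// ltW.
Qed.

Lemma psum_good a r s : convrad a r -> `|s| < r -> good (psum a s).
Proof. by move=> h1 h2; have [C [q []]] := psum_tail h1 h2. Qed.

Lemma psum_cvg a r s x : convrad a r -> `|s| < r -> part a N s x @[N --> \oo] --> psum a s x.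
Proof.
move=> h1 h2; have [C [q [C0 q01 _ H]]] := psum_tail h1 h2.
apply/cvgrPdist_le => e e0; have [k Hk] := geom_small C q01 e0; exists k => // n /= kn.
apply: (le_trans (H n x)); apply: le_trans Hk; rewrite ler_wpM2l//.
by case/andP: q01 => q0 /ltW q1'; rewrite ler_wiXn2l.
Qed.

Arguments psum_cvg [a r s] x.

Lemma cvg_S (F : nat -> R) l :
  (F N.+1 @[N --> \oo] --> l) = (F N @[N --> \oo] --> l).
Proof. exact: cvg_shiftS. Qed.

Lemma psum_lim a s x l : part a N s x @[N --> \oo] --> l -> psum a s x = l.
Proof. by move=> h; apply: cvg_lim. Qed.

Lemma cvg_le (F : nat -> R) l B : F @ \oo --> l -> (forall N, F N <= B) -> l <= B.
Proof.
by move=> Fl H; apply: (ler_cvg_to Fl (cvg_cst B)); apply: nearW.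
Qed.

Lemma cvg_norm_le (F : nat -> R) l B : F @ \oo --> l -> (forall N, `|F N| <= B) -> `|l| <= B.
Proof.
by move=> Fl H; have h : `|F N| @[N --> \oo] --> `|l|; [exact: cvg_norm|exact: cvg_le h H].
Qed.

Lemma geom_sum q N : 0 <= q < 1 -> \sum_(n < N) q ^+ n <= (1 - q)^-1.
Proof.
move=> /andP[q0 q1]; have q2 : 0 < 1 - q by lra.
rewrite -[leRHS]mul1r ler_pdivlMr// mulrC -[X in X * _]opprB mulNr -subrX1 opprB.
by rewrite gerBl exprn_ge0.
Qed.

(** n q^n is at most the sum of the first n powers of q. *)
Lemma linear_geom q n : 0 <= q < 1 -> n%:R * q ^+ n <= (1 - q)^-1.
Proof.
move=> q01; apply: le_trans (geom_sum n q01); have /andP[q0 /ltW q1] := q01.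
rewrite -{1}(card_ord n) mulr_natl -sumr_const; apply: ler_sum => i _.
by rewrite ler_wiXn2l// ltnW.
Qed.

Lemma rad_shift a r : 0 < r -> convrad a r -> convrad (fun n => a n.+1) r.
Proof.
move=> r0 [ga H]; split=> // r' rr; have [C C0 HC] := H r' rr; have /andP[r'0 _] := rr.
exists (C / r'); first by rewrite divr_ge0// ltW.
by move=> n x; rewrite ler_pdivlMr// -mulrA -exprSr.
Qed.

Lemma rad_nat a r : convrad a r -> convrad (fun n x => n%:R * a n x) r.
Proof.
move=> [ga H]; split=> [n|r' /andP[r'0 rr]]; first exact: goodZ.
have [|r2 r12 r2r] := @between r' r; first by rewrite ger0_norm// ltW.
rewrite ger0_norm ?ltW// in r12; have [C C0 HC] := H r2 r2r.
have r20 : 0 < r2 by case/andP: r2r.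
have q01 : 0 <= r' / r2 < 1 by rewrite divr_ge0 ?ltW//= ltr_pdivrMr// mul1r.
exists ((1 - r' / r2)^-1 * C); first by rewrite mulr_ge0// invr_ge0; case/andP: q01; lra.
move=> n x; have E : r' ^+ n = (r' / r2) ^+ n * r2 ^+ n by rewrite -exprMn divfK// gt_eqF.
rewrite E normrM normr_nat; have G (p z u v : R) : p * z * (u * v) = p * u * (z * v) by ring.
rewrite G; apply: ler_pM; [by rewrite mulr_ge0// exprn_ge0//; case/andP: q01|by rewrite mulr_ge0// exprn_ge0// ltW| |exact: HC].
exact: linear_geom.
Qed.

Definition dser a n x : R := n.+1%:R * a n.+1 x.

Lemma rad_dser a r : 0 < r -> convrad a r -> convrad (dser a) r.
Proof. by move=> r0 ha; apply: (rad_shift r0 (rad_nat ha)). Qed.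

(** Induction on n from e_{n+1} = (t + u) e_n + n t^(n-1) u^2, where e_n is the error; the
    factor r1^2 avoids negative exponents. *)
Lemma monomial_taylor n (t u r1 : R) : 0 <= r1 -> `|t| <= r1 -> `|t + u| <= r1 ->
  `|(t + u) ^+ n - t ^+ n - u * (n%:R * t ^+ n.-1)| * r1 ^+ 2 <= n%:R * (n%:R * r1 ^+ n) * u ^+ 2.
Proof.
move=> r10 h1 h2; elim: n => [|n IH].
  by rewrite !expr0 subrr !mul0r mulr0 subr0 normr0 mul0r.
have E : (t + u) ^+ n.+1 - t ^+ n.+1 - u * (n.+1%:R * t ^+ n.+1.-1) =
  (t + u) * ((t + u) ^+ n - t ^+ n - u * (n%:R * t ^+ n.-1)) + n%:R * t ^+ n.-1 * u ^+ 2.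
  rewrite /= -natr1; case: n IH => [|n] IH; first by rewrite !expr1 !expr0; ring.
  by rewrite /= !exprS; ring.
rewrite E; clear E.
apply: (@le_trans _ _ (r1 * (n%:R * (n%:R * r1 ^+ n) * u ^+ 2) + n%:R * r1 ^+ n.+1 * u ^+ 2)).
  apply: (le_trans (ler_wpM2r (exprn_ge0 2 r10) (ler_normD _ _))); rewrite mulrDl; apply: lerD.
    by rewrite normrM -mulrA; apply: ler_pM => //; rewrite mulr_ge0// exprn_ge0.
  rewrite 2!normrM normr_nat [`|u ^+ 2|]ger0_norm ?sqr_ge0// normrX.
  case: n {IH} => [|n]; first by rewrite !mul0r.
  have G (p q v w : R) : p * q * v * w = p * (q * w) * v by ring.
  rewrite G ler_wpM2r ?sqr_ge0// ler_wpM2l//= (_ : n.+2 = (n + 2)%N); last by rewrite addn2.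
  by rewrite exprD ler_wpM2r ?exprn_ge0// lerXn2r// ?nnegrE.
rewrite (exprS r1 n) -natr1 -subr_ge0.
have -> : (n%:R + 1) * ((n%:R + 1) * (r1 * r1 ^+ n)) * u ^+ 2 - (r1 * (n%:R * (n%:R * r1 ^+ n) * u ^+ 2) + n%:R * (r1 * r1 ^+ n) * u ^+ 2) = (n%:R + 1) * (r1 * r1 ^+ n) * u ^+ 2 by ring.
by rewrite mulr_ge0 ?sqr_ge0// mulr_ge0 ?addr_ge0// mulr_ge0 ?exprn_ge0.
Qed.

(** Sum [monomial_taylor] over the series; the factors n are absorbed by a larger radius. *)
Lemma psum_taylor a r t : convrad a r -> `|t| < r -> exists C d, [/\ 0 <= C, 0 < d &
  forall u x, `|u| < d -> `|t + u| < r /\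
    `|psum a (t + u) x - psum a t x - u * psum (dser a) t x| <= C * u ^+ 2].
Proof.
move=> ha tr; have [r1 tr1 /andP[r10 r1r]] := between tr.
have r0 : 0 < r by exact: lt_trans r1r.
have hd := rad_dser r0 ha.
have [|r2 r12 r2r] := @between r1 r; first by rewrite ger0_norm// ltW.
rewrite ger0_norm ?ltW// in r12; have r20 : 0 < r2 by case/andP: r2r.
have [_ /(_ r2 r2r) [C C0 HC]] := rad_nat (rad_nat ha).
have q01 : 0 <= r1 / r2 < 1 by rewrite divr_ge0 ?ltW//= ltr_pdivrMr// mul1r.
have q1 : 0 < 1 - r1 / r2 by case/andP: q01; lra.
exists (C * (1 - r1 / r2)^-1 / r1 ^+ 2), (r1 - `|t|); split.
- by rewrite !mulr_ge0 ?invr_ge0 ?exprn_ge0// ltW.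
- by rewrite subr_gt0.
move=> u x ud.
have tu : `|t + u| <= r1 by apply: (le_trans (ler_normD _ _)); rewrite -lerBrDl ltW.
have tur : `|t + u| < r by exact: le_lt_trans r1r.
split=> //.
have c1 := psum_cvg x ha tur; have c2 := psum_cvg x ha tr; have c3 := psum_cvg x hd tr.
have c1' : part a N.+1 (t + u) x @[N --> \oo] --> psum a (t + u) x by rewrite (cvg_S (fun N => part a N (t + u) x)).
have c2' : part a N.+1 t x @[N --> \oo] --> psum a t x by rewrite (cvg_S (fun N => part a N t x)).
have c3' : u * part (dser a) N t x @[N --> \oo] --> u * psum (dser a) t x.
  by apply: cvgM => //; exact: cvg_cst.
have c4 : part a N.+1 (t + u) x - part a N.+1 t x - u * part (dser a) N t x @[N --> \oo] -->
    psum a (t + u) x - psum a t x - u * psum (dser a) t x by apply: cvgB => //; exact: cvgB.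
apply: (cvg_norm_le c4) => N.
have -> : (part a N.+1 (t + u) x - part a N.+1 t x) - u * part (dser a) N t x =
  \sum_(n < N.+1) a n x * ((t + u) ^+ n - t ^+ n - u * (n%:R * t ^+ n.-1)).
  rewrite /part -sumrB mulr_sumr.
  under [RHS]eq_bigr do rewrite mulrBr.
  rewrite [RHS]sumrB; congr (_ - _); first by apply: eq_bigr => i _; rewrite mulrBr.
  rewrite big_ord_recl /= !mul0r !mulr0 add0r; apply: eq_bigr => i _.
  rewrite /dser /bump /=; ring.
have G0 (p q v w : R) : p * q / v * w = p * q * w / v by ring.
rewrite G0 ler_pdivlMr ?exprn_gt0//.
apply: (@le_trans _ _ (\sum_(n < N.+1) C * (r1 / r2) ^+ n * u ^+ 2)); last first.
  rewrite -mulr_suml -mulr_sumr ler_wpM2r ?sqr_ge0// ler_wpM2l//; exact: geom_sum.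
have r1sq : 0 <= r1 ^+ 2 by exact: sqr_ge0.
rewrite -[X in _ * X](ger0_norm r1sq) -normrM mulr_suml.
apply: (le_trans (ler_norm_sum _ _ _)); apply: ler_sum => n _.
rewrite normrM [`|r1 ^+ 2|]ger0_norm// normrM -mulrA.
apply: (le_trans (ler_wpM2l (normr_ge0 _) (monomial_taylor n (ltW r10) (ltW tr1) tu))).
have := HC n x; rewrite !normrM normr_nat expr_div_n => h.
have G (p q v w : R) : p * (q * (q * v) * w) = q * (q * p) * v * w by ring.
rewrite G ler_wpM2r ?sqr_ge0// [leRHS]mulrA ler_pdivlMr ?exprn_gt0//.
by rewrite [leLHS]mulrAC; apply: ler_wpM2r h; rewrite exprn_ge0// ltW.
Qed.

Lemma part_lin a b N s x k :
  part (fun n x => a n x + k * b n x) N s x = part a N s x + k * part b N s x.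
Proof.
rewrite /part mulr_sumr -big_split; apply: eq_bigr => i _ /=; ring.
Qed.

Lemma psum_lin a b r s x k : convrad a r -> convrad b r -> `|s| < r ->
  psum (fun n x => a n x + k * b n x) s x = psum a s x + k * psum b s x.
Proof.
move=> ha hb sr; apply: psum_lim.
under eq_fun do rewrite part_lin.
apply: cvgD; first exact: (psum_cvg x ha sr).
by apply: cvgM; [exact: cvg_cst|exact: (psum_cvg x hb sr)].
Qed.

Lemma psum_bound a r s C : 0 < r -> (forall n, good (a n)) ->
  (forall n x, `|a n x| * r ^+ n <= C) -> `|s| <= r / 2 -> forall x, `|psum a s x| <= 2 * C.
Proof.
move=> r0 ga H sr x; have ha := rad_bound ga H.
have sr' : `|s| < r by lra.
apply: (cvg_norm_le (psum_cvg x ha sr')) => N.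
have C0 : 0 <= C by apply: le_trans (H 0%N x); rewrite mulr_ge0// exprn_ge0 ?ltW.
have h12 : 0 <= (1 / 2 : R) < 1 by lra.
apply: (@le_trans _ _ (\sum_(n < N) C * (1 / 2) ^+ n)); last first.
  rewrite -mulr_sumr mulrC ler_wpM2r//; apply: (le_trans (geom_sum N h12)).
  by rewrite -[leRHS]invrK lef_pV2 ?posrE; lra.
apply: (le_trans (ler_norm_sum _ _ _)); apply: ler_sum => n _; rewrite normrM normrX.
apply: (@le_trans _ _ (`|a n x| * (r ^+ n * (1 / 2) ^+ n))); last first.
  by rewrite mulrA ler_wpM2r// exprn_ge0//; lra.
rewrite ler_wpM2l// -exprMn lerXn2r// ?nnegrE//; first by rewrite mulr_ge0 ?ltW//; lra.
by rewrite mul1r.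
Qed.

Lemma psum0 a s x : s = 0 -> psum a s x = a 0%N x.
Proof.
move=> ->; apply: psum_lim.
rewrite -(cvg_S (fun N => part a N 0 x)).
have E N : part a N.+1 0 x = a 0%N x.
  rewrite /part big_ord_recl expr0 mulr1 big1 ?addr0// => i _.
  by rewrite expr0n mulr0.
under eq_fun do rewrite E.
exact: cvg_cst.
Qed.

Lemma psum_shift a r s x : 0 < r -> convrad a r -> `|s| < r ->
  psum a s x = a 0%N x + s * psum (fun n => a n.+1) s x.
Proof.
move=> r0 ha sr; apply: psum_lim.
rewrite -(cvg_S (fun N => part a N s x)).
have E N : part a N.+1 s x = a 0%N x + s * part (fun n => a n.+1) N s x.
  rewrite /part big_ord_recl expr0 mulr1 mulr_sumr; congr (_ + _); apply: eq_bigr => i _.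
  rewrite /= /bump /= exprS; ring.
under eq_fun do rewrite E.
apply: cvgD; first exact: cvg_cst.
by apply: cvgM; [exact: cvg_cst|exact: (psum_cvg x (rad_shift r0 ha) sr)].
Qed.

(** The coefficients of a(t^2), and in [oddc] those of t a(t^2): the parity of the
    bifurcating curve is built into its series. *)
Definition evenc a n : R -> R := if odd n then (fun=> 0) else a n./2.
Definition oddc a n : R -> R := if odd n then a n./2 else (fun=> 0).

Lemma sqr_lt s r : 0 <= r -> `|s| < r -> `|s ^+ 2| < r ^+ 2.
Proof. by move=> r0 sr; rewrite normrX ltrXn2r// ?nnegrE. Qed.

Lemma rad_evenc a r : 0 < r -> convrad a (r ^+ 2) -> convrad (evenc a) r.
Proof.
move=> r0 [ga H]; split=> [n|r' /andP[r'0 rr]].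
  by rewrite /evenc; case: ifP => _; [exact: goodC|].
have [|C C0 HC] := H (r' ^+ 2); first by rewrite exprn_gt0//= ltrXn2r ?nnegrE ?ltW.
exists C => // n x; rewrite /evenc; case: ifPn => [_|on]; first by rewrite normr0 mul0r.
by apply: le_trans (HC n./2 x); rewrite -exprM mul2n (even_halfK on).
Qed.

Lemma rad_oddc a r : 0 < r -> convrad a (r ^+ 2) -> convrad (oddc a) r.
Proof.
move=> r0 [ga H]; split=> [n|r' /andP[r'0 rr]].
  by rewrite /oddc; case: ifP => _; [|exact: goodC].
have [|C C0 HC] := H (r' ^+ 2); first by rewrite exprn_gt0//= ltrXn2r ?nnegrE ?ltW.
exists (C * r'); first by rewrite mulr_ge0// ltW.
move=> n x; rewrite /oddc; case: ifPn => [on|_]; last by rewrite normr0 mul0r mulr_ge0// ltW.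
have E : r' ^+ n = (r' ^+ 2) ^+ n./2 * r'.
  by rewrite -exprM mul2n (odd_halfK on) -exprSr prednK//; case: n on.
rewrite E mulrA ler_wpM2r//; exact: ltW.
Qed.

Lemma part_even a N s x : part (evenc a) (N.*2) s x = part a N (s ^+ 2) x.
Proof.
elim: N => [|N IH]; first by rewrite /part !big_ord0.
rewrite doubleS !part_S IH /evenc /= odd_double /= mul0r addr0 doubleK -exprM mul2n.
by [].
Qed.

Lemma part_odd a N s x : part (oddc a) (N.*2) s x = s * part a N (s ^+ 2) x.
Proof.
elim: N => [|N IH]; first by rewrite /part !big_ord0 mulr0.
rewrite doubleS !part_S IH /oddc /= odd_double /= mul0r addr0 uphalf_double -exprM mul2n exprS mulrDr.
by rewrite (exprS s N.*2) mulrCA.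
Qed.

Lemma cvg_double (F : nat -> R) l : F N @[N --> \oo] --> l -> F N.*2 @[N --> \oo] --> l.
Proof.
move/cvgrPdist_le => H; apply/cvgrPdist_le => e e0; have [k _ Hk] := H e e0.
exists k => // n /= kn; apply: Hk => /=; apply: (leq_trans kn); rewrite -addnn leq_addr//.
Qed.

Lemma psum_even a r s x : 0 < r -> convrad a (r ^+ 2) -> `|s| < r ->
  psum (evenc a) s x = psum a (s ^+ 2) x.
Proof.
move=> r0 ha sr; have sr2 := sqr_lt (ltW r0) sr.
have c1 := cvg_double (psum_cvg x (rad_evenc r0 ha) sr); have c2 := psum_cvg x ha sr2.
apply/esym; apply: psum_lim; move: c1; under eq_fun do rewrite part_even.
by [].
Qed.

Lemma psum_odd a r s x : 0 < r -> convrad a (r ^+ 2) -> `|s| < r ->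
  psum (oddc a) s x = s * psum a (s ^+ 2) x.
Proof.
move=> r0 ha sr; have sr2 := sqr_lt (ltW r0) sr.
have c1 := cvg_double (psum_cvg x (rad_oddc r0 ha) sr).
have c2 : s * part a N (s ^+ 2) x @[N --> \oo] --> s * psum a (s ^+ 2) x.
  by apply: cvgM; [exact: cvg_cst|exact: (psum_cvg x ha sr2)].
move: c1; under eq_fun do rewrite part_odd.
by move=> c1; exact: cvg_unique c1 c2.
Qed.

End PowerSeries.

(** * The analytic fixed point *)

Section PairOperators.
Context {R : realType}.
Implicit Types (f g u v : R -> R) (r s x C k K m : R) (n N : nat) (T : (R -> R) -> (R -> R) -> R -> R).
Implicit Types (p q : {poly (R -> R)}).

(** Linear in the pair of its arguments, and bounded for the sup norm. *)
Definition bop K T := [/\ forall g2 g3, good g2 -> good g3 -> good (T g2 g3),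
  forall g2 g3 g2' g3' a, good g2 -> good g3 -> good g2' -> good g3' ->
    T (fun x => g2 x + a * g2' x) (fun x => g3 x + a * g3' x) = (fun x => T g2 g3 x + a * T g2' g3' x) &
  forall g2 g3 m, good g2 -> good g3 -> Bfun g2 m -> Bfun g3 m -> Bfun (T g2 g3) (K * m)].

Lemma bop0 K T : bop K T -> T (fun=> 0) (fun=> 0) = fun=> 0.
Proof.
move=> [_ _ TB]; have B0 : Bfun (fun=> 0 : R) 0 by move=> x; rewrite normr0.
have := TB _ _ 0 (goodC 0) (goodC 0) B0 B0; rewrite mulr0 => H; apply/funext => x.
by apply/eqP; rewrite -normr_le0.
Qed.

Lemma bop_part K T (a b : nat -> R -> R) N s : bop K T -> (forall n, good (a n)) -> (forall n, good (b n)) ->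
  T (part a N s) (part b N s) = part (fun n => T (a n) (b n)) N s.
Proof.
move=> hT ga gb; have [_ TL _] := hT.
have p0 (c : nat -> R -> R) : part c 0 s = fun=> 0 by apply/funext => x; rewrite /part big_ord0.
have pS (c : nat -> R -> R) n : part c n.+1 s = fun x => part c n s x + s ^+ n * c n x.
  by apply/funext => x; rewrite part_S mulrC.
elim: N => [|N IH]; first by rewrite !p0 (bop0 hT).
by rewrite !pS TL ?IH//; exact: part_good.
Qed.

Lemma bop_rad K T (a b : nat -> R -> R) r : 0 <= K -> bop K T -> convrad a r -> convrad b r ->
  convrad (fun n => T (a n) (b n)) r.
Proof.
move=> K0 [TG _ TB] [ga Ha] [gb Hb]; split=> [n|r' rr]; first exact: TG.
have [C C0 HC] := Ha r' rr; have [D D0 HD] := Hb r' rr.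
have r'0 : 0 < r' by case/andP: rr.
exists (K * (C + D)); first by rewrite mulr_ge0// addr_ge0.
move=> n x; rewrite -ler_pdivlMr ?exprn_gt0// -mulrA; apply: TB => // z.
  by rewrite ler_pdivlMr ?exprn_gt0//; apply: (le_trans (HC n z)); rewrite lerDl.
by rewrite ler_pdivlMr ?exprn_gt0//; apply: (le_trans (HD n z)); rewrite lerDr.
Qed.

(** The operator commutes with finite sums, and by boundedness the tails stay small. *)
Lemma psum_op K T (a b : nat -> R -> R) r s : 0 <= K -> bop K T -> convrad a r -> convrad b r -> `|s| < r ->
  psum (fun n => T (a n) (b n)) s = T (psum a s) (psum b s).
Proof.
move=> K0 hT ha hb sr; have [TG TL TB] := hT.
have [C [q [C0 q01 gA HA]]] := psum_tail ha sr.
have [D [q' [D0 q01' gB HB]]] := psum_tail hb sr.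
have [ga _] := ha; have [gb _] := hb.
apply/funext => x; apply: psum_lim; apply/cvgrPdist_le => e e0.
have e2 : 0 < e / (2 * (K + 1)) by rewrite divr_gt0//; lra.
have [k Hk] := geom_small C q01 e2; have [k' Hk'] := geom_small D q01' e2.
exists (maxn k k') => // N /= kN.
rewrite -(bop_part N s hT ga gb).
have pA := part_good N s ga; have pB := part_good N s gb.
have -> : T (psum a s) (psum b s) x - T (part a N s) (part b N s) x =
   T (fun x => psum a s x + (-1) * part a N s x) (fun x => psum b s x + (-1) * part b N s x) x.
  by rewrite TL// mulN1r.
have mono (q0 : R) (j : nat) (E : R) : 0 <= q0 < 1 -> 0 <= E -> (j <= N)%N -> E * q0 ^+ N <= E * q0 ^+ j.
  by move=> /andP[h1 /ltW h2] E0 jN; rewrite ler_wpM2l// ler_wiXn2l.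
have Ke : K * (e / (2 * (K + 1))) <= e.
  rewrite mulrA ler_pdivrMr; last by lra.
  by clear -K0 e0; nra.
apply: le_trans Ke; apply: TB => [||z|z].
- exact: goodD gA (goodZ _ pA).
- exact: goodD gB (goodZ _ pB).
- rewrite mulN1r; apply: (le_trans (HA N z)); apply: le_trans Hk; apply: mono => //.
  by apply: leq_trans kN; exact: leq_maxl.
- rewrite mulN1r; apply: (le_trans (HB N z)); apply: le_trans Hk'; apply: mono => //.
  by apply: leq_trans kN; exact: leq_maxr.
Qed.

(** The operator acting coefficientwise on polynomials in the parameter. *)
Definition TP T p q : {poly (R -> R)} := \poly_(i < maxn (size p) (size q)) T p`_i q`_i.

Definition gp p := forall n, good p`_n.

Lemma TP_coef K T p q n : bop K T -> (TP T p q)`_n = T p`_n q`_n.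
Proof.
move=> hT; rewrite coef_poly; case: ltnP => //; rewrite geq_max => /andP[h1 h2].
by rewrite !nth_default//; exact/esym/(bop0 hT).
Qed.

Lemma gpD p q : gp p -> gp q -> gp (p + q).
Proof. by move=> hp hq n; rewrite coefD; exact: goodD. Qed.

Lemma good_sum (I : Type) (t : seq I) (F : I -> R -> R) : (forall i, good (F i)) ->
  good (\sum_(i <- t) F i).
Proof.
move=> H; elim: t => [|i t IH]; first by rewrite big_nil; exact: (goodC 0).
by rewrite big_cons; exact: goodD.
Qed.

Lemma gpM p q : gp p -> gp q -> gp (p * q).
Proof. by move=> hp hq n; rewrite coefM; apply: good_sum => i; exact: goodM. Qed.

Lemma gpC f : good f -> gp f%:P.
Proof. by move=> hf n; rewrite coefC; case: eqP => _ //; exact: (goodC 0). Qed.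

Lemma gpX : gp 'X.
Proof. by move=> n; rewrite coefX; case: eqP => _; [exact: (goodC 1)|exact: (goodC 0)]. Qed.

Lemma gp0 : gp 0.
Proof. by move=> n; rewrite coef0; exact: (goodC 0). Qed.

Lemma TP_gp K T p q : bop K T -> gp p -> gp q -> gp (TP T p q).
Proof. by move=> hT hp hq n; rewrite (TP_coef _ _ _ hT); have [TG _ _] := hT; exact: TG. Qed.

Lemma TP_sub K T p q p' q' : bop K T -> gp p -> gp q -> gp p' -> gp q' ->
  TP T p q - TP T p' q' = TP T (p - p') (q - q').
Proof.
move=> hT hp hq hp' hq'; have [_ TL _] := hT; apply/polyP => n.
rewrite coefB !(TP_coef _ _ _ hT) !coefB.
have E f g : f - g = fun x => f x + (-1) * g x by apply/funext => x; rewrite mulN1r.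
by rewrite !E TL.
Qed.

Lemma TP_B K T p q r M : 0 <= K -> bop K T -> gp p -> gp q -> Bpoly r p M -> Bpoly r q M ->
  Bpoly r (TP T p q) (2 * K * M).
Proof.
move=> K0 hT hp hq [P hP PM] [Q hQ QM]; have [_ _ TB] := hT.
exists (K *: (P + Q)); last first.
  rewrite hornerZ hornerD; have G : 2 * K * M = K * (M + M) by ring.
  by rewrite G ler_wpM2l// lerD.
move=> n; rewrite (TP_coef _ _ _ hT) coefZ coefD.
have P0 := Bfun_ge0 (hP n); have Q0 := Bfun_ge0 (hQ n).
by apply: TB => // x; [apply: (le_trans (hP n x)); rewrite lerDl|apply: (le_trans (hQ n x)); rewrite lerDr].
Qed.

Lemma horner_part p s N : (size p <= N)%N -> p.[fun=> s] = part (fun n => p`_n) N s.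
Proof.
move=> sp; rewrite (horner_coef_wide _ sp); apply/funext => x.
have E (n : nat) : ((fun=> s : R) ^+ n) x = s ^+ n.
  by elim: n => [//|n IH]; rewrite !exprS /= -IH.
have Es (I : Type) (t : seq I) (F : I -> R -> R) : (\sum_(i <- t) F i) x = \sum_(i <- t) F i x.
  by elim: t => [|i t IH]; rewrite ?big_nil// !big_cons -IH.
rewrite Es /part; apply: eq_bigr => i _.
by rewrite [LHS]/(p`_i x * ((fun=> s : R) ^+ i) x) E.
Qed.

Lemma horner_psum p s : p.[fun=> s] = psum (fun n => p`_n) s.
Proof.
apply/funext => x; apply/esym; apply: psum_lim; apply/cvgrPdist_le => e e0.
exists (size p) => // N /= sN; rewrite (horner_part s sN) subrr normr0; exact: ltW.
Qed.

(** The parameter is a scalar, so evaluation commutes with the coefficientwise action. *)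
Lemma TP_horner K T p q s : bop K T -> gp p -> gp q ->
  (TP T p q).[fun=> s] = T p.[fun=> s] q.[fun=> s].
Proof.
move=> hT hp hq; pose N := maxn (size p) (size q).
have sN : (size (TP T p q) <= N)%N by exact: size_poly.
rewrite (horner_part s sN) (@horner_part p s N) ?leq_maxl// (@horner_part q s N) ?leq_maxr//.
rewrite (bop_part N s hT hp hq); congr part; apply/funext => n.
by rewrite (TP_coef _ _ _ hT).
Qed.

(** [Gw] preserves every predicate stable under sums and products, for instance continuity. *)
Lemma Gw_closed (C : pzRingType) (P : C -> Prop) (L0 lc c h w0 s l y2 y3 : C) :
  (forall u v : C, P u -> P v -> P (u + v)) -> (forall u v : C, P u -> P v -> P (u * v)) ->
  P L0 -> P lc -> P c -> P h -> P w0 -> P s -> P l -> P y2 -> P y3 ->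
  P (Gw L0 lc c h w0 s l y2 y3).1 /\ P (Gw L0 lc c h w0 s l y2 y3).2.
Proof.
move=> PD PM h1 h2 h3 h4 h5 h6 h7 h8 h9; split; rewrite /Gw /=; by repeat first [assumption | apply PD | apply PM].
Qed.

End PairOperators.

Lemma half_of_small (R : realType) (e K : R) : 0 < e -> 0 <= K -> e <= 1 / (2 * (K + 1)) -> K * e <= 1 / 2.
Proof.
move=> e0 K0; rewrite ler_pdivlMr; last by lra.
by nra.
Qed.

Section FixedPoint.
Context {R : realType} (T1 T2 T3 : (R -> R) -> (R -> R) -> R -> R) (K : R).
Context (L0 lc c h w0 : R -> R).
Context (K0 : 0 <= K) (b1 : bop K T1) (b2 : bop K T2) (b3 : bop K T3).
Context (g1 : good L0) (g2 : good lc) (g3 : good c) (g4 : good h) (g5 : good w0).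
Implicit Types (p q : {poly (R -> R)} * {poly (R -> R)}) (f g : (R -> R) * (R -> R)).

(** The fixed point map at a fixed parameter s: the unknown f is the right-hand side of the
    linear system, and T1, T2, T3 return its solution (l, y2, y3). *)
Definition GF s f := Gw L0 lc c h w0 (fun=> s : R) (T1 f.1 f.2) (T2 f.1 f.2) (T3 f.1 f.2).

(** The same map with the parameter as the polynomial variable. *)
Definition GP p := Gw L0%:P lc%:P c%:P h%:P w0%:P 'X (TP T1 p.1 p.2) (TP T2 p.1 p.2) (TP T3 p.1 p.2).

Definition gp2 p := gp p.1 /\ gp p.2.
Definition good2 f := good f.1 /\ good f.2.
Definition hor s p : (R -> R) * (R -> R) := (p.1.[fun=> s], p.2.[fun=> s]).

Lemma GP_gp p : gp2 p -> gp2 (GP p).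
Proof.
move=> [h1 h2]; apply: (Gw_closed (P := @gp R)); try exact: gpC; try exact: gpX.
- exact: gpD.
- exact: gpM.
- exact: TP_gp b1 h1 h2.
- exact: TP_gp b2 h1 h2.
- exact: TP_gp b3 h1 h2.
Qed.

Lemma GP_hor s p : gp2 p -> hor s (GP p) = GF s (hor s p).
Proof.
move=> [h1 h2]; rewrite /hor /GF /GP /Gw /= !(hornerD, hornerM, hornerC, hornerX).
by rewrite !(TP_horner s b1)// !(TP_horner s b2)// !(TP_horner s b3).
Qed.

Lemma hor_good s p : gp2 p -> good2 (hor s p).
Proof.
by move=> [h1 h2]; split; rewrite /= (horner_part s (leqnn _)); exact: part_good.
Qed.

(** The remainder is of order two, so its Lipschitz constant on the ball of radius e is at
    most K' e; the parameter s has size e^2. *)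
Lemma contraction : exists2 e0, 0 < e0 & forall e, 0 < e <= e0 -> e <= 1 /\
  (forall p q del, gp2 p -> gp2 q -> 0 <= del ->
    Bpoly (e ^+ 2) p.1 e -> Bpoly (e ^+ 2) p.2 e -> Bpoly (e ^+ 2) q.1 e -> Bpoly (e ^+ 2) q.2 e ->
    Bpoly (e ^+ 2) (p.1 - q.1) del -> Bpoly (e ^+ 2) (p.2 - q.2) del ->
    [/\ Bpoly (e ^+ 2) (GP p).1 e, Bpoly (e ^+ 2) (GP p).2 e,
     Bpoly (e ^+ 2) ((GP p).1 - (GP q).1) (del / 2) & Bpoly (e ^+ 2) ((GP p).2 - (GP q).2) (del / 2)]) /\
  (forall s f g del, good2 f -> good2 g -> 0 <= del -> `|s| <= e ^+ 2 ->
    Bfun f.1 e -> Bfun f.2 e -> Bfun g.1 e -> Bfun g.2 e ->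
    Bfun (f.1 - g.1) del -> Bfun (f.2 - g.2) del ->
    Bfun ((GF s f).1 - (GF s g).1) (del / 2) /\ Bfun ((GF s f).2 - (GF s g).2) (del / 2)).
Proof.
have [M [M0 [HL0 Hlc Hc Hh Hw0]]] : exists M, 0 <= M /\ [/\ Bfun L0 M, Bfun lc M, Bfun c M, Bfun h M & Bfun w0 M].
  have [M1 m1 H1] := good_bounded g1; have [M2 m2 H2] := good_bounded g2.
  have [M3 m3 H3] := good_bounded g3; have [M4 m4 H4] := good_bounded g4.
  have [M5 m5 H5] := good_bounded g5.
  exists (M1 + M2 + M3 + M4 + M5); split; first by rewrite !addr_ge0// ltW.
  by split=> x; [apply: (le_trans (H1 x))|apply: (le_trans (H2 x))|apply: (le_trans (H3 x))
    |apply: (le_trans (H4 x))|apply: (le_trans (H5 x))]; lra.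
have K20 : 0 <= 2 * K by rewrite mulr_ge0.
have [K' K'0 HK] := Gw_cl2 M0 K20.
exists (1 / (2 * (K' + 1))); first by rewrite divr_gt0//; lra.
move=> e /andP[e0 ee].
have Ke : K' * e <= 1 / 2 by exact: half_of_small.
have e1 : e <= 1.
  apply: (le_trans ee); rewrite ler_pdivrMr; last by lra.
  by lra.
have e01 : 0 <= e <= 1 by rewrite ltW.
have sm : K' * e ^+ 2 <= e.
  rewrite expr2 mulrA; apply: (le_trans (ler_wpM2r (ltW e0) Ke)); lra.
have half del : 0 <= del -> K' * e ^+ 2.-1 * del <= del / 2.
  by rewrite expr1 => d0; apply: (le_trans (ler_wpM2r d0 Ke)); lra.
split=> //; split.
- move=> p q del [p1 p2] [q1 q2] d0 P1 P2 Q1 Q2 D1 D2.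
  have r0 : 0 <= e ^+ 2 by exact: sqr_ge0.
  have mB := majorant_poly r0.
  have cl T : bop K T -> cl2 (Bpoly (e ^+ 2)) e del 1 (2 * K) (TP T p.1 p.2) (TP T q.1 q.2).
    move=> bT; split=> //; rewrite ?expr1.
    + exact: (TP_B K0 bT).
    + exact: (TP_B K0 bT).
    + by rewrite (TP_sub bT)// expr0 mulr1; apply: (TP_B K0 bT) => // n; rewrite coefB; exact: goodB.
  have [] := HK _ (Bpoly (e ^+ 2)) e del L0%:P lc%:P c%:P h%:P w0%:P 'X _ _ _ _ _ _ mB
    (Bpoly0 _) e01 d0 (BpolyC _ HL0) (BpolyC _ Hlc) (BpolyC _ Hc) (BpolyC _ Hh) (BpolyC _ Hw0) (BpolyX r0)
    (cl T1 b1) (cl T2 b2) (cl T3 b3).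
  move=> [_ a1 _ a2] [_ a3 _ a4]; split.
  + exact: (maj_le mB a1).
  + exact: (maj_le mB a3).
  + exact: (maj_le mB a2 (half _ d0)).
  + exact: (maj_le mB a4 (half _ d0)).
- move=> s f g del [f1 f2] [f1' f2'] d0 se P1 P2 Q1 Q2 D1 D2.
  have mB := @majorant_fun R.
  have B00 : Bfun (0 : R -> R) 0 by move=> x; rewrite normr0.
  have Bs : Bfun (fun=> s) (e ^+ 2) by move=> x.
  have Kle m : 0 <= m -> K * m <= 2 * K * m.
    by move=> m0; rewrite ler_wpM2r//; lra.
  have cl T : bop K T -> cl2 Bfun e del 1 (2 * K) (T f.1 f.2) (T g.1 g.2).
    move=> [_ TL TB]; split=> //; rewrite ?expr1.
    + by apply: (maj_le mB (TB _ _ e _ _ _ _)) => //; apply: Kle; exact: ltW.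
    + by apply: (maj_le mB (TB _ _ e _ _ _ _)) => //; apply: Kle; exact: ltW.
    + have E u v : u - v = fun x => u x + (-1) * v x :> R by apply/funext => x; rewrite mulN1r.
      rewrite expr0 mulr1 E -TL// -!E; apply: (maj_le mB (TB _ _ del _ _ _ _)) => //; try exact: goodB.
      exact: Kle.
  have [] := HK _ Bfun e del L0 lc c h w0 (fun=> s) _ _ _ _ _ _ mB
    B00 e01 d0 HL0 Hlc Hc Hh Hw0 Bs (cl T1 b1) (cl T2 b2) (cl T3 b3).
  move=> [_ _ _ a2] [_ _ _ a4]; split.
  + exact: (maj_le mB a2 (half _ d0)).
  + exact: (maj_le mB a4 (half _ d0)).
Qed.

(** Iterate the map on polynomials in s. The iterates converge geometrically in the weighted
    norm, hence coefficientwise, to power series; evaluation at s is a ring morphism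
    compatible with the linear operators, so the sums are fixed points for each s.
    Uniqueness is that of the contraction at fixed s. *)
Theorem analytic_fixed_point : exists e0 a2 a3, [/\ 0 < e0,
  (forall n, good (a2 n)) /\ (forall n, good (a3 n)),
  (forall n x, `|a2 n x| * (e0 ^+ 2) ^+ n <= 2 * e0 /\ `|a3 n x| * (e0 ^+ 2) ^+ n <= 2 * e0),
  (forall s, `|s| <= e0 ^+ 2 / 2 -> GF s (psum a2 s, psum a3 s) = (psum a2 s, psum a3 s)) &
  (forall s f, `|s| <= e0 ^+ 2 / 2 -> good2 f -> Bfun f.1 e0 -> Bfun f.2 e0 -> GF s f = f ->
    f = (psum a2 s, psum a3 s))].
Proof.
have [e e0 /(_ e)] := contraction; rewrite e0 lexx => /(_ isT) [e1 [HP HF]].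
pose P k := iter k GP (0, 0).
have r0 : 0 < e ^+ 2 by rewrite exprn_gt0.
have mB := majorant_poly (ltW r0); have mF := @majorant_fun R.
have Pg k : gp2 (P k) by elim: k => [|k IH]; [split; exact: gp0|exact: GP_gp].
have Pst k : [/\ Bpoly (e ^+ 2) (P k).1 e, Bpoly (e ^+ 2) (P k).2 e,
    Bpoly (e ^+ 2) ((P k.+1).1 - (P k).1) (e * (1 / 2) ^+ k) &
    Bpoly (e ^+ 2) ((P k.+1).2 - (P k).2) (e * (1 / 2) ^+ k)].
  have B0 : Bpoly (e ^+ 2) 0 e by apply: (maj_le mB (Bpoly0 _)); exact: ltW.
  elim: k => [|k [h1 h2 h3 h4]].
    have B00 : Bpoly (e ^+ 2) (0 - 0) e by rewrite subr0.
    have [h1 h2 _ _] := HP (0, 0) (0, 0) e (Pg 0%N) (Pg 0%N) (ltW e0) B0 B0 B0 B0 B00 B00.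
    by split=> //; rewrite expr0 mulr1 subr0.
  have d0 : 0 <= e * (1 / 2) ^+ k by rewrite mulr_ge0 ?exprn_ge0// ltW.
  have B00 : Bpoly (e ^+ 2) ((P k).1 - (P k).1) e by rewrite subrr.
  have B01 : Bpoly (e ^+ 2) ((P k).2 - (P k).2) e by rewrite subrr.
  have [i1 i2 _ _] := HP (P k) (P k) e (Pg k) (Pg k) (ltW e0) h1 h2 h1 h2 B00 B01.
  have [i3 i4 i5 i6] := HP (P k.+1) (P k) _ (Pg k.+1) (Pg k) d0 i1 i2 h1 h2 h3 h4.
  have E : e * (1 / 2) ^+ k.+1 = e * (1 / 2) ^+ k / 2 by rewrite exprSr; field.
  by split=> //; rewrite E.
have h12 : 0 <= (1 / 2 : R) < 1 by lra.
have lim (F : nat -> {poly (R -> R)}) : (forall k, gp (F k)) -> F 0%N = 0 ->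
    (forall k, Bpoly (e ^+ 2) (F k.+1 - F k) (e * (1 / 2) ^+ k)) ->
    exists a : nat -> R -> R, forall n, good (a n) /\
      forall k x, `|a n x - (F k)`_n x| * (e ^+ 2) ^+ n <= 2 * e * (1 / 2) ^+ k.
  move=> Fg F0 HFk; suff /choice [a Ha] : forall n, exists u : R -> R, good u /\
      forall k x, `|u x - (F k)`_n x| * (e ^+ 2) ^+ n <= 2 * e * (1 / 2) ^+ k by exists a.
  move=> n.
  have rn : 0 < (e ^+ 2) ^+ n by rewrite exprn_gt0.
  have [||k x|f gf Hf] := @good_limit _ (fun k => (F k)`_n) (1 / 2) (e / (e ^+ 2) ^+ n) h12.
  - by rewrite divr_ge0 ?ltW.
  - by move=> k; exact: Fg.
  - rewrite mulrAC ler_pdivlMr//; have := Bpoly_coef n (ltW r0) (HFk k) x.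
    by rewrite coefB.
  exists f; split=> // k x; have := Hf k x.
  have -> : e / (e ^+ 2) ^+ n / (1 - 1 / 2) * (1 / 2) ^+ k = 2 * e * (1 / 2) ^+ k / (e ^+ 2) ^+ n.
    by field; rewrite gt_eqF.
  by rewrite ler_pdivlMr.
have [a2 H2] := lim (fun k => (P k).1) (fun k => (Pg k).1) erefl (fun k => let: And4 _ _ h _ := Pst k in h).
have [a3 H3] := lim (fun k => (P k).2) (fun k => (Pg k).2) erefl (fun k => let: And4 _ _ _ h := Pst k in h).
have ga2 n : good (a2 n) by case: (H2 n).
have ga3 n : good (a3 n) by case: (H3 n).
have bnd (F : nat -> {poly (R -> R)}) (a : nat -> R -> R) : F 0%N = 0 -> (forall n, good (a n) /\
      forall k x, `|a n x - (F k)`_n x| * (e ^+ 2) ^+ n <= 2 * e * (1 / 2) ^+ k) ->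
   forall n x, `|a n x| * (e ^+ 2) ^+ n <= 2 * e.
  move=> F0 H n x; have [_ /(_ 0%N x)] := H n.
  by rewrite F0 coef0 expr0 mulr1 subr0.
have B2 := bnd (fun k => (P k).1) a2 erefl H2.
have B3 := bnd (fun k => (P k).2) a3 erefl H3.
have app (F : nat -> {poly (R -> R)}) (a : nat -> R -> R) : (forall k, gp (F k)) ->
   (forall n, good (a n) /\
      forall k x, `|a n x - (F k)`_n x| * (e ^+ 2) ^+ n <= 2 * e * (1 / 2) ^+ k) ->
   (forall n x, `|a n x| * (e ^+ 2) ^+ n <= 2 * e) ->
   forall s k x, `|s| <= e ^+ 2 / 2 -> `|psum a s x - (F k).[fun=> s] x| <= 4 * e * (1 / 2) ^+ k.
  move=> Fg H Ba s k x se; rewrite horner_psum.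
  have ha : convrad a (e ^+ 2) by apply: rad_bound Ba => n; case: (H n).
  have hF : convrad (fun n => (F k)`_n) (e ^+ 2).
    split; first exact: Fg.
    move=> r' rr; exists (2 * e * (1 / 2) ^+ k + 2 * e).
      by rewrite addr_ge0 ?mulr_ge0 ?exprn_ge0// ltW.
    move=> n z; have /andP[r'0 /ltW r'e] := rr.
    apply: (@le_trans _ _ (`|(F k)`_n z| * (e ^+ 2) ^+ n)).
      by rewrite ler_wpM2l// lerXn2r ?nnegrE// ltW.
    have [_ /(_ k z) h1] := H n; have h2 := Ba n z.
    have h3 : `|(F k)`_n z| <= `|a n z - (F k)`_n z| + `|a n z|.
      by rewrite distrC -{1}[(F k)`_n z](subrK (a n z)); exact: ler_normD.
    apply: (le_trans (ler_wpM2r (exprn_ge0 n (ltW r0)) h3)).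
    by rewrite mulrDl; exact: lerD.
  have se' : `|s| < e ^+ 2 by lra.
  rewrite -mulN1r -(psum_lin x (-1) ha hF se').
  have -> : 4 * e * (1 / 2) ^+ k = 2 * (2 * e * (1 / 2) ^+ k) by ring.
  apply: (psum_bound r0) => // [n|n z].
    by apply: goodD; [case: (H n)|apply: goodZ; exact: Fg].
  by rewrite mulN1r; case: (H n).
have A2 := app _ _ (fun k => (Pg k).1) H2 B2.
have A3 := app _ _ (fun k => (Pg k).2) H3 B3.
have rad2 := rad_bound ga2 B2; have rad3 := rad_bound ga3 B3.
have small (s : R) : `|s| <= e ^+ 2 / 2 -> `|s| <= e ^+ 2 /\ `|s| < e ^+ 2.
  by move: r0; move: (e ^+ 2) `|s| => p q h1 h2; split; lra.
have sol (s : R) : `|s| <= e ^+ 2 / 2 ->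
   [/\ good2 (psum a2 s, psum a3 s), Bfun (psum a2 s) e, Bfun (psum a3 s) e &
    GF s (psum a2 s, psum a3 s) = (psum a2 s, psum a3 s)].
  move=> se; have [se1 se2] := small s se.
  have gg : good2 (psum a2 s, psum a3 s) by split; [exact: (psum_good rad2 se2)|exact: (psum_good rad3 se2)].
  have clos (u v : R) (w : nat -> R) (C : R) : 0 <= C -> (forall k, `|w k| <= v) -> (forall k, `|u - w k| <= C * (1 / 2) ^+ k) ->
     `|u| <= v.
    move=> C0 h1 h2; apply/ler_addgt0Pr => d d0; have [k Hk] := geom_small C h12 d0.
    rewrite -(subrK (w k) u); apply: (le_trans (ler_normD _ _)); rewrite addrC; apply: lerD => //.
    exact: le_trans (h2 k) Hk.
  have e40 : 0 <= 4 * e by rewrite mulr_ge0// ltW.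
  have hb2 : Bfun (psum a2 s) e.
    move=> x; apply: (clos _ _ (fun k => (P k).1.[fun=> s] x) (4 * e) e40) => k; last exact: A2.
    by have [h1 _ _ _] := Pst k; exact: (Bpoly_horner se1 h1).
  have hb3 : Bfun (psum a3 s) e.
    move=> x; apply: (clos _ _ (fun k => (P k).2.[fun=> s] x) (4 * e) e40) => k; last exact: A3.
    by have [_ h1 _ _] := Pst k; exact: (Bpoly_horner se1 h1).
  split=> //.
  have key k : Bfun ((GF s (psum a2 s, psum a3 s)).1 - (hor s (P k.+1)).1) (4 * e * (1 / 2) ^+ k / 2) /\
     Bfun ((GF s (psum a2 s, psum a3 s)).2 - (hor s (P k.+1)).2) (4 * e * (1 / 2) ^+ k / 2).
    have -> : hor s (P k.+1) = GF s (hor s (P k)) by apply: GP_hor; exact: Pg.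
    have [h1 h2 _ _] := Pst k.
    apply: HF => //; first exact: hor_good.
    + by rewrite mulr_ge0// exprn_ge0.
    + exact: (Bpoly_horner se1 h1).
    + exact: (Bpoly_horner se1 h2).
    + by move=> x; apply: A2.
    + by move=> x; apply: A3.
  have fin (u v : R -> R) (w : nat -> R -> R) : (forall k, Bfun (u - w k.+1) (4 * e * (1 / 2) ^+ k / 2)) ->
      (forall k x, `|v x - w k x| <= 4 * e * (1 / 2) ^+ k) -> u = v.
    move=> h1 h2; apply/funext => x; apply/eqP; rewrite -subr_eq0 -normr_le0.
    apply/ler_addgt0Pr => d d0; rewrite add0r; have [k Hk] := geom_small (4 * e) h12 d0.
    have E : u x - v x = (u x - w k.+1 x) - (v x - w k.+1 x) by ring.
    rewrite E; apply: (le_trans (ler_normB _ _)); apply: le_trans Hk.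
    apply: (le_trans (lerD (h1 k x) (h2 k.+1 x))); rewrite exprS.
    by move: ((1 / 2) ^+ k) => z; lra.
  have F1 := fin _ (psum a2 s) (fun k => (P k).1.[fun=> s]) (fun k => (key k).1) (fun k x => A2 s k x se).
  have F2 := fin _ (psum a3 s) (fun k => (P k).2.[fun=> s]) (fun k => (key k).2) (fun k x => A3 s k x se).
  by rewrite [LHS]surjective_pairing F1 F2.
exists e, a2, a3; split=> //.
  by move=> s /sol [].
move=> s f se gf f1 f2 Ef; have [gg hb2 hb3 Eg] := sol s se; have [se1 _] := small s se.
set g := (_, _) in gg Eg *.
have it k : Bfun (f.1 - g.1) (2 * e * (1 / 2) ^+ k) /\ Bfun (f.2 - g.2) (2 * e * (1 / 2) ^+ k).
  elim: k => [|k [h1 h2]].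
    rewrite expr0 mulr1; have -> : 2 * e = e + e by ring.
    by split; apply: (majD mF) => //; apply: (majN mF).
  have d0 : 0 <= 2 * e * (1 / 2) ^+ k by rewrite !mulr_ge0 ?exprn_ge0// ltW.
  have := HF s f g _ gf gg d0 se1 f1 f2 hb2 hb3 h1 h2; rewrite Ef Eg.
  by have -> : 2 * e * (1 / 2) ^+ k.+1 = 2 * e * (1 / 2) ^+ k / 2 by rewrite exprSr; field.
have eq0 (u v : R -> R) : (forall k, Bfun (u - v) (2 * e * (1 / 2) ^+ k)) -> u = v.
  move=> huv; apply/funext => x; apply/eqP; rewrite -subr_eq0 -normr_le0.
  apply/ler_addgt0Pr => d d0; rewrite add0r; have [k Hk] := geom_small (2 * e) h12 d0.
  exact: le_trans (huv k x) Hk.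
by rewrite [LHS]surjective_pairing (eq0 _ _ (fun k => (it k).1)) (eq0 _ _ (fun k => (it k).2)).
Qed.

End FixedPoint.

(** * Smooth curves in H1 *)

Section BoundedOperators.
Context {R : realType}.
Implicit Types (f g u v y w A B : R -> R) (r s t x C k K m b l : R) (n N : nat) (T : (R -> R) -> (R -> R) -> R -> R).

(** [bop] for some constant, closed under the operations that build the derivative of a
    solution. *)
Definition bbop T := exists2 K, 0 <= K & bop K T.

Lemma bbop_fst : bbop (fun f _ => f).
Proof. by exists 1 => //; split=> // g2 g3 m _ _ h2 _ x; rewrite mul1r; exact: h2. Qed.

Lemma bbop_snd : bbop (fun _ g => g).
Proof. by exists 1 => //; split=> // g2 g3 m _ _ _ h3 x; rewrite mul1r; exact: h3. Qed.

Lemma bbopD T T' : bbop T -> bbop T' -> bbop (fun f g x => T f g x + T' f g x).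
Proof.
move=> [K K0 [TG TL TB]] [K' K'0 [TG' TL' TB']]; exists (K + K'); first exact: addr_ge0.
split=> [g2 g3 h2 h3|g2 g3 g2' g3' a h2 h3 h2' h3'|g2 g3 m h2 h3 m2 m3 x].
- by apply: goodD; [exact: TG|exact: TG'].
- rewrite TL// TL'//; apply/funext => x; ring.
- by rewrite mulrDl; apply: (le_trans (ler_normD _ _)); apply: lerD; [exact: TB|exact: TB'].
Qed.

Lemma bbopM A T : good A -> bbop T -> bbop (fun f g x => A x * T f g x).
Proof.
move=> hA [K K0 [TG TL TB]]; have [M M0 HM] := good_bounded hA.
exists (M * K); first by rewrite mulr_ge0// ltW.
split=> [g2 g3 h2 h3|g2 g3 g2' g3' a h2 h3 h2' h3'|g2 g3 m h2 h3 m2 m3 x].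
- by apply: goodM => //; exact: TG.
- rewrite TL//; apply/funext => x; ring.
- by rewrite normrM -mulrA; apply: ler_pM => //; exact: TB.
Qed.

Lemma bbop_J T : bbop T -> bbop (fun f g x => J (T f g) (cl x)).
Proof.
move=> [K K0 [TG TL TB]]; exists (2 * K); first by rewrite mulr_ge0.
split=> [g2 g3 h2 h3|g2 g3 g2' g3' a h2 h3 h2' h3'|g2 g3 m h2 h3 m2 m3 x].
- by apply: J_good; have [] := TG g2 g3 h2 h3.
- rewrite TL//; apply/funext => x; have /andP[x1 _] := cl_itv x.
  by rewrite J_lin//; [have [] := TG g2 g3 h2 h3|have [] := TG g2' g3' h2' h3'].
- rewrite -mulrA; apply: J_sup => [|t _|]; [by have [] := TG g2 g3 h2 h3|exact: TB|exact: cl_itv].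
Qed.

Lemma bbop_at T (p : R) : bbop T -> bbop (fun f g _ => T f g p).
Proof.
move=> [K K0 [TG TL TB]]; exists K => //.
split=> [g2 g3 h2 h3|g2 g3 g2' g3' a h2 h3 h2' h3'|g2 g3 m h2 h3 m2 m3 x].
- exact: goodC.
- by rewrite TL.
- exact: TB.
Qed.

Lemma psum_bbop T (a b : nat -> R -> R) r s : bbop T -> convrad a r -> convrad b r -> `|s| < r ->
  psum (fun n => T (a n) (b n)) s = T (psum a s) (psum b s).
Proof. by move=> [K K0 hT] ha hb sr; exact: (psum_op K0 hT ha hb sr). Qed.

Lemma bbop_convrad T (a b : nat -> R -> R) r : bbop T -> convrad a r -> convrad b r ->
  convrad (fun n => T (a n) (b n)) r.
Proof. by move=> [K K0 hT] ha hb; exact: (bop_rad K0 hT ha hb). Qed.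

(** The derivative of the solution y of y'' = w, y(-1) = y(1) = 0. *)
Definition dslope (w : R -> R) x := (- (1 / 2)) * J (fun z => J w (cl z)) (cl 1) + J w (cl x).

Lemma bbop_dslope T : bbop T -> bbop (fun f g => dslope (T f g)).
Proof.
move=> hT; have h1 := bbop_J hT; have h2 := bbop_at 1 (bbop_J h1).
exact: bbopD (bbopM (goodC (- (1/2))) h2) h1.
Qed.

Lemma continuous_const (a : R) : continuous (fun _ : R => a).
Proof. by case: (goodC a). Qed.

Lemma J0 x : -1 <= x -> J (fun=> 0) x = 0 :> R.
Proof.
move=> x1; have := @J_lin _ (fun=> 0) (fun=> 0) (-1) x (@continuous_const 0) (@continuous_const 0) x1.
by rewrite mulr0 addr0 mulN1r subrr.
Qed.

Lemma JZ v (a : R) x : continuous v -> -1 <= x -> J (fun z => a * v z) x = a * J v x.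
Proof.
move=> cv x1; have := @J_lin _ (fun=> 0) v a x (@continuous_const 0) cv x1.
by rewrite J0// add0r => <-; congr (J _ _); apply/funext => z; rewrite add0r.
Qed.

Definition primit u v := good v /\ u = fun x => J v (cl x).

Lemma J1 x : -1 <= x -> J (fun=> 1) x = x + 1 :> R.
Proof.
move=> x1; have c1 := @continuous_const 1.
have dF t : is_derive t 1 (fun t => J (fun=> 1) t - (1 * t + 1)) 0.
  have d1 := is_derive_J t c1.
  have d2 := is_derive_affine 1 1 t (fun x => is_derive_id x 1).
  have := is_deriveB d1 d2; rewrite mulr1 subrr; exact.
have := deriv0_cst dF x1 (fun _ _ => erefl); rewrite J_N1 => E2.
by lra.
Qed.

Lemma J_addc W b x : continuous W -> -1 <= x -> J (fun z => b + W z) x = b * (x + 1) + J W x.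
Proof.
move=> cW x1; rewrite -(J1 x1) addrC -(J_lin b cW (@continuous_const 1) x1).
by congr (J _ _); apply/funext => z; rewrite mulr1 addrC.
Qed.

Lemma J_cl w x : continuous w -> J (fun z => J w (cl z)) (cl x) = J (J w) (cl x).
Proof.
move=> cw; apply: J_ext; [by case: (J_good cw)|exact: J_cont|exact: cl_itv|].
by move=> z zI; rewrite cl_idI.
Qed.

Lemma bvp_primit A g y : good A -> good g -> bvp A g y -> primit y (dslope (fun x => A x * y x + g x)).
Proof.
move=> hA hg [[b hy] y1].
have [w wE] : exists w, w = fun x => A x * y x + g x by eexists.
have gw : good w by rewrite wE; exact: iv_w hA hg hy.
have yE x : y x = b * (cl x + 1) + J (J w) (cl x) by rewrite hy.2 wE.
rewrite -wE; clear hy wE.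
have bE : b = - (1 / 2) * J (fun z => J w (cl z)) (cl 1).
  have cl1 : cl 1 = 1 :> R by rewrite cl_id// lexx; lra.
  move: (yE 1); rewrite -(J_cl 1 gw.1) y1; move: (J _ (cl 1)) => p; rewrite cl1 => E.
  lra.
have E : dslope w = fun z => b + (fun z => J w (cl z)) z.
  by apply/funext => z; rewrite /dslope -bE.
have gJ := J_good gw.1.
split; rewrite E; first exact: (goodD (goodC b) gJ).
apply/funext => x; have /andP[x1 _] := cl_itv x.
by rewrite yE -(J_cl x gw.1); exact: (esym (J_addc b gJ.1 x1)).
Qed.

End BoundedOperators.

Section SmoothCurves.
Context {R : realType}.
Implicit Types (f g u v y w A B : R -> R) (r s t x C k K m b l : R) (n N : nat).

Lemma primit_wd u v : primit u v -> cI u /\ wd u v.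
Proof.
move=> [[cv _] ->]; have dJ x := is_derive_J x cv.
have E : eqI (J v) (fun x => J v (cl x)) by move=> x xI; rewrite cl_idI.
split; first by apply: (cont_eqI E); apply: continuous_subspaceT; exact: is_derive_cont dJ.
by apply: wd_eqI E _ (wd_C1 dJ cv).
Qed.

Lemma primit_H10 u v : primit u v -> u 1 = 0 -> H10 u.
Proof.
move=> h u1; have [cu wu] := primit_wd h; split=> //; first exact: wd_H1 cu wu.
have [_ ->] := h; rewrite cl_id ?J_N1//; lra.
Qed.

(** The H10 norm is the L2 norm of the derivative, which its sup norm dominates. *)
Lemma primit_norm3 (Q V : triple R) m : 0 <= m -> (forall i, primit (Q i) (V i)) -> (forall i, Q i 1 = 0) ->
  (forall i x, `|V i x| <= m) -> norm3 Q <= 3 * m.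
Proof.
move=> m0 hQ Q1 Hm.
have hH i : H1 (Q i) by apply: H10_H1; exact: (primit_H10 (hQ i) (Q1 i)).
have dV : wd3 Q V by move=> i; have [_ h] := primit_wd (hQ i); exact: h.
have := norm3_sq hH dV; rewrite sum_ord3 => E.
have b i : ip (V i) (V i) <= 2 * m ^+ 2.
  apply: (le_trans (ler_norm _)); apply: integ_bound.
    by apply: L2M; apply: good_L2; case: (hQ i).
  by move=> x _; rewrite normrM expr2; apply: ler_pM.
rewrite -(ler_pXn2r (n := 2))// ?nnegrE ?norm3_ge0 ?mulr_ge0// E.
have b0 := b (inord 0); have b1 := b (inord 1); have b2 := b (inord 2).
move: (ip _ _) (ip _ _) (ip _ _) b0 b1 b2 => p q z h0 h1 h2.
by rewrite exprMn; move: (sqr_ge0 m) h0 h1 h2; move: (m ^+ 2) => M; lra.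
Qed.

(** A curve in H10 given by the power series of its derivative in x, so that its H1 norm is
    controlled by sup norms. *)
Definition pcurve (V : 'I_3 -> nat -> R -> R) t : triple R := fun i x => J (psum (V i) t) (cl x).

Lemma psum_J1 (V : nat -> R -> R) r t : convrad V r -> `|t| < r ->
  psum (fun n x => J (V n) (cl x)) t = fun x => J (psum V t) (cl x).
Proof. by move=> hV tr; have := psum_bbop (bbop_J (bbop_fst (R := R))) hV hV tr. Qed.

Lemma pcurve_bdry (V : nat -> R -> R) r t : convrad V r -> (forall n, J (V n) (cl 1) = 0) -> `|t| < r ->
  J (psum V t) (cl 1) = 0.
Proof.
move=> hV H tr; have /(congr1 (fun f => f 1)) <- := psum_J1 hV tr.
apply: psum_lim; rewrite (_ : (fun N => _) = fun=> 0); first exact: cvg_cst.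
by apply/funext => N; rewrite /part big1// => i _; rewrite H mul0r.
Qed.

Lemma dser_bdry (V : nat -> R -> R) r : convrad V r -> (forall n, J (V n) (cl 1) = 0) ->
  forall n, J (dser V n) (cl 1) = 0.
Proof.
move=> [gV _] H n; have /andP[x1 _] := cl_itv (1 : R).
by rewrite JZ ?H ?mulr0//; case: (gV n.+1).
Qed.

(** The Taylor estimate of [psum_taylor], uniform in x and applied to the derivative in x,
    is an estimate in the H10 norm. *)
Lemma pcurve_deriv V r t : 0 < r -> (forall i, convrad (V i) r) -> (forall i n, J (V i n) (cl 1) = 0) ->
  `|t| < r -> curve_deriv (pcurve V) t (pcurve (fun i => dser (V i)) t).
Proof.
move=> r0 hV H tr.
have hD i := rad_dser r0 (hV i); have HD i := dser_bdry (hV i) (H i).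
have pr (W : 'I_3 -> nat -> R -> R) (s : R) : (forall i, convrad (W i) r) -> `|s| < r -> forall i, primit (pcurve W s i) (psum (W i) s).
  by move=> hW sr i; split=> //; exact: psum_good (hW i) sr.
have p1 (W : 'I_3 -> nat -> R -> R) (s : R) : (forall i, convrad (W i) r) -> (forall i n, J (W i n) (cl 1) = 0) -> `|s| < r ->
    forall i, pcurve W s i 1 = 0.
  by move=> hW H' sr i; exact: pcurve_bdry (hW i) (H' i) sr.
split; first by move=> i; exact: primit_H10 (pr _ _ hD tr i) (p1 _ _ hD HD tr i).
have T i : exists C d, [/\ 0 <= C, 0 < d & forall (u : R) x, `|u| < d -> `|t + u| < r /\
    `|psum (V i) (t + u) x - psum (V i) t x - u * psum (dser (V i)) t x| <= C * u ^+ 2].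
  exact: psum_taylor.
have [C [d [C0 d0 HT]]] : exists C d, [/\ 0 <= C, 0 < d & forall i (u : R) x, `|u| < d -> `|t + u| < r /\
    `|psum (V i) (t + u) x - psum (V i) t x - u * psum (dser (V i)) t x| <= C * u ^+ 2].
  have /choice [C /choice [d HC]] := T.
  exists (\sum_i C i), (\big[Num.min/1]_i d i); split.
  - by apply: sumr_ge0 => i _; case: (HC i).
  - by elim/big_ind: _ => [//|x y x0 y0|i _]; [rewrite lt_min x0|case: (HC i)].
  move=> i u x ud; have [Ci0 _ /(_ u x)] := HC i.
  have di : `|u| < d i.
    by apply: lt_le_trans ud _; rewrite (bigD1 i)//= ge_min lexx.
  move=> /(_ di) [h1 h2]; split=> //; apply: (le_trans h2); rewrite ler_wpM2r ?sqr_ge0//.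
  by rewrite (bigD1 i)//= lerDl sumr_ge0// => j _; case: (HC j).
apply/cvgrPdist_lt => e e0.
have e1 : 0 < Num.min d (e / (3 * (C + 1))).
  by rewrite lt_min d0 divr_gt0//; lra.
near=> s.
have s0 : s != 0 by near: s; exact: nbhs_dnbhs_neq.
have sd : `|s| < Num.min d (e / (3 * (C + 1))).
  by near: s; apply: dnbhs0_lt.
move: sd; rewrite lt_min => /andP[sd se].
have tsr : `|s + t| < r by rewrite addrC; have [] := HT (inord 0) s 0 sd.
rewrite sub0r normrN ger0_norm ?norm3_ge0//.
have a0 : 0 < `|s| by rewrite normr_gt0.
apply: (@le_lt_trans _ _ (3 * (C * `|s|))); last first.
  move: se; rewrite ltr_pdivlMr; last by lra.
  by move: `|s| a0 => z z0; nra.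
have Cs : 0 <= C * `|s| by rewrite mulr_ge0// ltW.
apply: (@primit_norm3 _ (fun i x => s^-1 * (psum (V i) (s + t) x + (-1) * psum (V i) t x) + (-1) * psum (dser (V i)) t x)) => //.
- move=> i; have [g1 e1'] := pr V (s + t) hV tsr i; have [g2 e2] := pr V t hV tr i.
  have [g3 e3] := pr _ t hD tr i.
  have g12 : good (fun x => psum (V i) (s + t) x + -1 * psum (V i) t x) by exact: goodD g1 (goodZ _ g2).
  have g12s : good (fun x => s^-1 * (psum (V i) (s + t) x + -1 * psum (V i) t x)) by exact: goodZ.
  split; first exact: goodD g12s (goodZ _ g3).
  apply/funext => x; have /andP[x1 _] := cl_itv x.
  rewrite J_lin; [|by case: g12s|by case: g3|by []].
  rewrite JZ//; last by case: g12.
  rewrite J_lin; [|by case: g1|by case: g2|by []].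
  by rewrite mulN1r mulN1r.
- move=> i.
  have b1 := p1 V (s + t) hV H tsr i; have b2 := p1 V t hV H tr i; have b3 := p1 _ t hD HD tr i.
  rewrite [LHS](_ : _ = s^-1 * (pcurve V (s + t) i 1 - pcurve V t i 1) - pcurve (fun i => dser (V i)) t i 1)//.
  by rewrite b1 b2 b3 !subr0 mulr0.
- move=> i x; have [_ h] := HT i s x sd.
  rewrite -(ler_pM2l a0) -normrM.
  have -> : s * (s^-1 * (psum (V i) (s + t) x + -1 * psum (V i) t x) + -1 * psum (dser (V i)) t x) =
     psum (V i) (t + s) x - psum (V i) t x - s * psum (dser (V i)) t x.
    by rewrite [t + s]addrC; field.
  apply: (le_trans h); rewrite -real_normK ?num_real// expr2; move: `|s| => z; nra.
Unshelve. all: by end_near.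
Qed.

Lemma pcurve_smooth V r : 0 < r -> (forall i, convrad (V i) r) -> (forall i n, J (V i n) (cl 1) = 0) ->
  forall e, e <= r -> smooth3 [set t | `|t| < e] (pcurve V).
Proof.
move=> r0 hV H e er; exists (fun n => pcurve (fun i => iter n dser (V i))); split=> // n t te.
have tr : `|t| < r by apply: lt_le_trans er.
have P (k : nat) : (forall i, convrad (iter k dser (V i)) r) /\ forall i (m : nat), J (iter k dser (V i) m) (cl 1) = 0.
  elim: k => [|k [IH1 IH2]]; first by [].
  by split=> i; [exact: (rad_dser r0 (IH1 i))|exact: dser_bdry (IH1 i) (IH2 i)].
have [P1 P2] := P n.
exact: (@pcurve_deriv (fun i => iter n dser (V i)) r t r0 P1 P2 tr).
Qed.

Lemma psum_smooth (a : nat -> R -> R) r k x : 0 < r -> convrad a r ->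
  forall e, e <= r -> smooth [set t | `|t| < e] (fun t => k + psum a t x).
Proof.
move=> r0 ha e er; pose F n t := (if n is 0%N then k else 0) + psum (iter n dser a) t x.
have hr n : convrad (iter n dser a) r by elim: n => [//|n IH]; exact: rad_dser.
have dF n t (G : R -> R) : `|t| < r -> (forall s, `|s| < r -> G s = F n s) -> is_derive t 1 G (F n.+1 t).
  move=> tr GE; have [C [d [C0 d0 HT]]] := psum_taylor (hr n) tr.
  apply: (@is_derive_quad _ _ _ _ C _ d0) => h hd; have [h1 h2] := HT h x hd.
  rewrite GE// GE// /F add0r.
  have G0 (p q u z : R) : p + q - (p + u) - z = q - u - z by ring.
  by rewrite G0.
have E n t : `|t| < r -> derive1n n (fun t => k + psum a t x) t = F n t.
  elim: n t => [//|n IH] t tr.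
  by rewrite derive1nS; have := dF n t _ tr IH => d; rewrite derive1E; exact: derive_val.
move=> n t te; have tr : `|t| < r by apply: lt_le_trans er.
by have [] := dF n t _ tr (E n).
Qed.

End SmoothCurves.

(** * The linearized system at the bifurcation point *)

Section Bridges.
Context {R : realType}.
Implicit Types (f g u v y w A B : R -> R) (r s t x C k K m b l : R) (n N : nat).

Lemma iv_sol A g b y : good A -> good g -> iv A g b y -> sol y (fun x => A x * y x + g x).
Proof.
move=> hA hg hy; have [z [z1 [zE _ _ dz dz1]]] := iv_C2 hA hg hy.
have [_ Ew] := iv_w hA hg hy.
exists z, z1; split=> // [x xI|x]; first by rewrite zE cl_idI.
by rewrite Ew; exact: dz1.
Qed.

Lemma sol_cI u w : sol u w -> cI u.
Proof.
move=> [z [z1 [uz dz _]]]; apply: (cont_eqI (eqI_sym uz)).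
by apply: continuous_subspaceT; exact: is_derive_cont dz.
Qed.

(** A classical solution satisfies the Volterra equation by integrating twice. *)
Lemma sol_iv A g u w : good A -> good g -> sol u w -> u (-1) = 0 ->
  (forall x, I11 x -> w x = A x * u x + g x) -> exists b, iv A g b (u \o cl).
Proof.
move=> hA hg hu u0 wE; have gu : good (u \o cl) by apply: good_cl; exact: sol_cI hu.
have [z [z1 [uz dz dz1]]] := hu.
pose w' x := A x * (u \o cl) x + g x.
have gw : good w' by apply: goodD hg; exact: goodM.
have wE' x : w (cl x) = w' x.
  by rewrite -(gw.2 x) /w' /= cl_cl wE//; exact: cl_I11.
have dJ x := is_derive_J x gw.1; have cJ := is_derive_cont dJ.
have dJJ x := is_derive_J x cJ.
exists (z1 (-1)); split=> // x; have /andP[x1 x2] := cl_itv x.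
have e1 t : -1 <= t -> z1 t = z1 (-1) + J w' t.
  move=> t1.
  have dF (q : R) : is_derive q 1 (fun q => z1 q - J w' q) 0.
    by have d1 := dz1 q; have := is_deriveB d1 (dJ q); rewrite wE' subrr; exact.
  by have := deriv0_cst dF t1 (fun _ _ => erefl); rewrite J_N1 => E; lra.
have dG (q : R) : is_derive q 1 (fun q => z q - (z1 (-1) * q + z1 (-1)) - J (J w') q) (z1 q - z1 (-1) - J w' q).
  have d1 := dz q; have d2 := is_derive_affine (z1 (-1)) (z1 (-1)) q (fun x => is_derive_id x 1).
  by have := is_deriveB (is_deriveB d1 d2) (dJJ q); rewrite mulr1; exact.
have dG0 (q : R) : -1 <= q <= cl x -> z1 q - z1 (-1) - J w' q = 0.
  by move=> /andP[q1 _]; rewrite e1//; ring.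
have := deriv0_cst dG x1 dG0; rewrite J_N1 /=.
have m1 : I11 (-1 : R) by exact: I11_N1.
rewrite -(uz _ m1) u0 -(uz _ (cl_I11 x)) => E; lra.
Qed.

Lemma sol_bvp A g u w : good A -> good g -> sol u w -> u (-1) = 0 -> u 1 = 0 ->
  (forall x, I11 x -> w x = A x * u x + g x) -> bvp A g (u \o cl).
Proof.
move=> hA hg hu u0 u1 wE; split; first exact: sol_iv hu u0 wE.
by rewrite /= cl_idI//; exact: I11_1.
Qed.

Lemma bvp_H10 A g y : good A -> good g -> bvp A g y -> H10 y.
Proof. by move=> hA hg hy; apply: (primit_H10 (bvp_primit hA hg hy)); case: hy. Qed.

Lemma bvp_sol A g y : good A -> good g -> bvp A g y -> sol y (fun x => A x * y x + g x).
Proof. by move=> hA hg [[b hy] _]; exact: iv_sol hy. Qed.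

Lemma sol_eqIl u v w : eqI u v -> sol u w -> sol v w.
Proof.
move=> E [z [z1 [uz dz dz1]]]; exists z, z1; split=> // x xI.
by rewrite -E// uz.
Qed.

Lemma solD u u' w w' a : sol u w -> sol u' w' -> sol (fun x => u x + a * u' x) (fun x => w x + a * w' x).
Proof.
move=> [z [z1 [uz dz dz1]]] [z' [z1' [uz' dz' dz1']]].
exists (fun x => z x + a * z' x), (fun x => z1 x + a * z1' x); split=> [x xI|x|x].
- by rewrite uz// uz'.
- have dc : is_derive x 1 (fun=> a : R) (0 : R) by exact: is_derive_cst.
  have d1 := dz x; have := is_deriveM1 dc (dz' x); rewrite mul0r addr0 => d2.
  exact: is_deriveD d1 d2.
- have dc : is_derive x 1 (fun=> a : R) (0 : R) by exact: is_derive_cst.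
  have d1 := dz1 x; have := is_deriveM1 dc (dz1' x); rewrite mul0r addr0 => d2.
  exact: is_deriveD d1 d2.
Qed.

(** Iterating the hypothesis from any a priori bound halves the defect from the value 2 a
    each time. *)
Lemma absorb f a : (exists m, Bfun f m) -> (forall m, Bfun f m -> Bfun f (a + m / 2)) -> Bfun f (2 * a).
Proof.
move=> [m Hm] H x; have h12 : 0 <= (1 / 2 : R) < 1 by lra.
have it (k : nat) : Bfun f (2 * a + (m - 2 * a) * (1 / 2) ^+ k).
  elim: k => [|k IH]; first by rewrite expr0 mulr1 addrC subrK.
  by have := H _ IH; rewrite exprSr; congr Bfun; field.
apply/ler_addgt0Pr => e e0; have [k Hk] := geom_small (m - 2 * a) h12 e0.
by apply: (le_trans (it k x)); rewrite lerD2l.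
Qed.

Lemma eqI_good u v : good u -> good v -> eqI u v -> u = v.
Proof. by move=> hu hv E; apply: good_eq. Qed.

Lemma integ_zero : integ (fun=> 0 : R) = 0.
Proof. by rewrite integ_cst mulr0. Qed.

Lemma ip_zero f : ip f (fun=> 0) = 0.
Proof. by rewrite -[RHS]integ_zero; apply: integ_eq => x _; rewrite mulr0. Qed.

End Bridges.

Section Linearization.
Context {R : realType} (chi : R -> triple R) (lamc : R) (hc : R -> R).
Context (chi_branch : is_branch chi) (mu_decr : mu_decreasing chi) (lamcP : is_lambda_c chi lamc)
  (hc_ker : kerL lamc (chi lamc) hc) (hc_neq0 : ~ eqI hc 0).
Implicit Types (f g u v y w : R -> R) (r s t x C k K m b l : R) (n N : nat).

(** From here to [coupling]: the coefficients of the equations linearized at the bifurcation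
    point. [branch_c] is the second component of the branch, [pot2] and [pot3] are the
    potentials in the two equations, [src2] and [src3] the derivatives in lambda, and
    [coupling] the derivative of the third equation in q2, all made constant outside [-1,
    1]. *)
Definition branch_c : R -> R := q2 (chi lamc) \o cl.
Definition kernel_h : R -> R := hc \o cl.
Definition branch_w x := branch_c x * branch_c x - 4.
Definition pot2 x := lamc ^+ 2 * (3 * (branch_c x * branch_c x) - 4).
Definition pot3 x := lamc ^+ 2 * branch_w x.
Definition src2 x := 2 * lamc * (branch_c x * branch_w x).
Definition src3 x := 2 * lamc * (branch_w x * kernel_h x).
Definition coupling x := 2 * lamc ^+ 2 * (branch_c x * kernel_h x).

(** By [kernel_form_weak] this is minus the H10 inner product with h_c, but it involves no
    derivative of y. *)
Definition kernel_form y := ip (fun x => pot3 x * kernel_h x) y.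

Let l0 : 0 < lamc. Proof. by case: lamcP. Qed.

Lemma hc_H10 : H10 hc. Proof. by case: hc_ker. Qed.

Lemma good_branch_c : good branch_c.
Proof. by apply: good_cl; have [] := branch_q2 chi_branch l0. Qed.

Lemma good_kernel_h : good kernel_h.
Proof. by apply: good_cl; exact: H10_cI hc_H10. Qed.

Lemma good_branch_w : good branch_w.
Proof. exact: goodB (goodM good_branch_c good_branch_c) (goodC 4). Qed.

Lemma good_pot2 : good pot2.
Proof. exact: goodZ (goodB (goodZ _ (goodM good_branch_c good_branch_c)) (goodC 4)). Qed.

Lemma good_pot3 : good pot3. Proof. exact: goodZ good_branch_w. Qed.
Lemma good_src2 : good src2. Proof. exact: goodZ (goodM good_branch_c good_branch_w). Qed.
Lemma good_src3 : good src3. Proof. exact: goodZ (goodM good_branch_w good_kernel_h). Qed.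
Lemma good_coupling : good coupling. Proof. exact: goodZ (goodM good_branch_c good_kernel_h). Qed.

Lemma kernel_h_neq0 : kernel_h <> fun=> 0.
Proof.
move=> E; apply: hc_neq0 => x xI; have := congr1 (fun f => f x) E.
by rewrite /kernel_h /= cl_idI.
Qed.

Lemma hc_sol : sol hc (fun x => pot3 x * kernel_h x).
Proof.
have := kerL_sol chi_branch l0 hc_ker; apply: sol_eqI => x xI.
by rewrite /pot3 /branch_w /branch_c /kernel_h /= cl_idI// -[q2 _ _ * _]expr2 mulrA.
Qed.

Lemma kernel_h_iv : exists bh, iv pot3 (fun=> 0) bh kernel_h.
Proof.
have [_ hm _] := hc_H10; apply: (sol_iv good_pot3 (goodC 0) hc_sol hm) => x xI.
by rewrite addr0 /kernel_h /= cl_idI.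
Qed.

Lemma kernel_h_1 : kernel_h 1 = 0.
Proof. by have [_ _ h1] := hc_H10; rewrite /kernel_h /= cl_idI//; exact: I11_1. Qed.

Lemma iv_zero A : iv A (fun=> 0) 0 (fun=> 0 : R).
Proof.
split; first exact: goodC; move=> x; have /andP[x1 _] := cl_itv x.
rewrite mul0r add0r (_ : (fun t => A t * 0 + 0) = fun=> 0); last first.
  by apply/funext => t; rewrite mulr0 addr0.
rewrite (@J_ext _ (J (fun=> 0)) (fun=> 0)) ?J0//.
- by apply: J_cont; exact: continuous_const.
- exact: continuous_const.
- exact: cl_itv.
- by move=> t /I11P/andP[t1 _]; rewrite J0.
Qed.

Lemma kernel_h_slope bh : iv pot3 (fun=> 0) bh kernel_h -> bh != 0.
Proof.
move=> hh; apply/eqP => b0; apply: kernel_h_neq0; rewrite b0 in hh.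
exact: iv_uniq good_pot3 (goodC 0) hh (iv_zero _).
Qed.

Lemma kernel_form_weak y : H10 y -> ip (wD hc) (wD y) = - kernel_form y.
Proof.
move=> hy; rewrite (sol_weak _ hc_sol hy)//.
by apply: good_cI; exact: goodM good_pot3 good_kernel_h.
Qed.

Lemma kernel_form_kernel_h : kernel_form kernel_h < 0.
Proof.
have E : kernel_form kernel_h = kernel_form hc by apply: ip_eq => // x xI; rewrite /kernel_h /= cl_idI.
have := kernel_form_weak hc_H10; rewrite E => E2; rewrite -oppr_gt0 -E2 lt0r ip_ge0 andbT.
apply/eqP => E3; apply: hc_neq0 => x xI; have := poincare hc_H10 (H1_wd (H10_H1 hc_H10)) xI.
by rewrite E3 mulr0 => h; apply/eqP; rewrite -sqrf_eq0 eq_le h sqr_ge0.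
Qed.

(** A nonzero solution would be a zero of the second variation in the direction (0, y). *)
Lemma pot2_nondegenerate b y : iv pot2 (fun=> 0) b y -> y 1 = 0 -> b = 0.
Proof.
move=> hy y1; have hb : bvp pot2 (fun=> 0) y by split=> //; exists b.
have hH := bvp_H10 good_pot2 (goodC 0) hb; have hs := bvp_sol good_pot2 (goodC 0) hb.
have gy := hy.1; have gw := iv_w good_pot2 (goodC 0) hy.
have [n0 n00 /(_ y hH)] := nu_coercive chi_branch l0.
rewrite (sol_weak (good_cI gw) hs hH).
have -> : ip (fun x => pot2 x * y x + 0) y = lamc ^+ 2 * integ (fun x => (3 * q2 (chi lamc) x ^+ 2 - 4) * y x ^+ 2).
  rewrite -integZ; last first.
    apply: (itg_eq (f := fun x => (3 * (branch_c x * branch_c x) - 4) * (y x * y x))) => [x xI|].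
      by rewrite /branch_c /= cl_idI// !expr2.
    apply: itg_cont; apply: good_cI; apply: goodM (goodM gy gy).
    exact: goodB (goodZ _ (goodM good_branch_c good_branch_c)) (goodC 4).
  by apply: integ_eq => x xI; rewrite /pot2 /branch_c /= cl_idI//; ring.
rewrite addrC subrr => h; have I0 : integ (fun x => y x ^+ 2) = 0.
  apply/eqP; rewrite eq_le; apply/andP; split; last by apply: integ_ge0 => x _; exact: sqr_ge0.
  by move: h; move: (integ _) => I h; nra.
have y0 : y = fun=> 0.
  apply: eqI_good => //; first exact: goodC.
  exact: (H10_int0 hH I0).
have E1 := hy.2 1; have E2 := (iv_zero pot2).2 1; rewrite y0 in E1; move: E1 E2 => /=.
rewrite [cl 1]cl_idI; last exact: I11_1.
by move: (J _ 1) => p E1 E2; lra.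
Qed.

(** y / (2 lambda_c) is the function w of [transversality]. *)
Lemma transversal_pairing y : bvp pot2 src2 y -> ip (fun x => coupling x * y x + src3 x) kernel_h != 0.
Proof.
move=> hy; have hH := bvp_H10 good_pot2 good_src2 hy; have hs := bvp_sol good_pot2 good_src2 hy.
have gy := bvp_good hy.
pose w x := 0 + (2 * lamc)^-1 * y x.
have l20 : 2 * lamc != 0 by rewrite mulf_neq0 ?gt_eqF.
have wH : H10 w by have := H10D H10_0 (H10Z (2 * lamc)^-1 hH).
have zs : sol (fun=> 0 : R) (fun=> 0 : R).
  exists (fun=> 0), (fun=> 0); split=> // x; exact: is_derive_cst.
have ws := solD (2 * lamc)^-1 zs hs.
have tr := transversality chi_branch mu_decr lamcP hc_ker hc_neq0 wH.
have {}tr : integ (fun x => (q2 (chi lamc) x ^+ 2 - 4 + 2 * lamc ^+ 2 * (q2 (chi lamc) x * w x)) * hc x ^+ 2) < 0.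
  apply: tr; apply: sol_eqI ws => x xI; rewrite /pot2 /src2 /branch_w /w /branch_c /= cl_idI//.
  by move: (q2 (chi lamc) x) (y x) => p q; field; rewrite gt_eqF.
have E : ip (fun x => coupling x * y x + src3 x) kernel_h = 2 * lamc *
   integ (fun x => (q2 (chi lamc) x ^+ 2 - 4 + 2 * lamc ^+ 2 * (q2 (chi lamc) x * w x)) * hc x ^+ 2).
  rewrite -integZ; last first.
    apply: (itg_eq (f := fun x => (branch_w x + 2 * lamc ^+ 2 * (branch_c x * ((2 * lamc)^-1 * y x))) * (kernel_h x * kernel_h x))).
      by move=> x xI; rewrite /branch_w /kernel_h /branch_c /w /= cl_idI// !expr2 add0r.
    apply: itg_cont; apply: good_cI; apply: goodM (goodM good_kernel_h good_kernel_h).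
    exact: goodD good_branch_w (goodZ _ (goodM good_branch_c (goodZ _ gy))).
  apply: integ_eq => x xI; rewrite /coupling /src3 /branch_w /w /branch_c /kernel_h /= cl_idI//.
  by move: (q2 (chi lamc) x) (y x) (hc x) => p q z; field; rewrite gt_eqF.
by rewrite E mulf_neq0// lt_eqF.
Qed.

End Linearization.

(** * The reduced system and the bifurcating curve *)

Section Invariance.
Context {R : realType}.
Implicit Types (f g u v y w : R -> R) (r s t x C k K m b l lam : R) (n N : nat) (Q P : triple R).

Lemma H1_3_eq3 Q P : eq3 Q P -> (forall i, H1 (P i)) -> forall i, H1 (Q i).
Proof. by move=> E hP i; apply: H1_eqI (eqI_sym (E i)) (hP i). Qed.

Lemma cH_eq3 Q P : eq3 Q P -> cH P -> cH Q.
Proof.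
move=> E [hP b1 b2 b3]; have m1 : I11 (-1 : R) by exact: I11_N1.
have p1 : I11 (1 : R) by exact: I11_1.
split; first exact: H1_3_eq3 E hP.
- by rewrite /q1 !E.
- by rewrite /q2 !E.
- by rewrite /q3 !E.
Qed.

Lemma norm3_eq3 Q P : eq3 Q P -> (forall i, H1 (P i)) -> norm3 Q = norm3 P.
Proof.
move=> E hP; have hQ := H1_3_eq3 E hP.
have dP := H1_wd3 hP.
have dQ : wd3 Q (fun i => wD (P i)) by move=> i; apply: wd_eqI (eqI_sym (E i)) _ (dP i).
have E2 : norm3 Q ^+ 2 = norm3 P ^+ 2 by exact: etrans (norm3_sq hQ dQ) (esym (norm3_sq hP dP)).
have p0 := norm3_ge0 Q; have q0 := norm3_ge0 P.
by move: (norm3 Q) (norm3 P) E2 p0 q0 => p q E2 p0 q0; apply/eqP; rewrite -(@eqrXn2 _ 2)//; apply/eqP.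
Qed.

Lemma critical_eq3 lam Q P : 0 < lam -> eq3 Q P -> critical lam P -> critical lam Q.
Proof.
move=> lam0 E cP; have hP : cH P by case: cP.
have hQ := cH_eq3 E hP.
have [s1 s2 s3] := (critical_sol lam0 hP).1 cP.
have E1 : eqI (q1 P) (q1 Q) by exact: eqI_sym (E _).
have E2 : eqI (q2 P) (q2 Q) by exact: eqI_sym (E _).
have E3 : eqI (q3 P) (q3 Q) by exact: eqI_sym (E _).
apply/(critical_sol lam0 hQ); split.
- by apply: (sol_eqIl E1); apply: sol_eqI s1 => x xI; rewrite E1// E2// E3.
- by apply: (sol_eqIl E2); apply: sol_eqI s2 => x xI; rewrite E1// E2// E3.
- by apply: (sol_eqIl E3); apply: sol_eqI s3 => x xI; rewrite E1// E2// E3.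
Qed.

(** The Euler-Lagrange system in the plane q1 = 2/3. *)
Definition planar lam u v :=
  sol u (fun x => lam ^+ 2 * (u x * (u x ^+ 2 + v x ^+ 2 - 4))) /\
  sol v (fun x => lam ^+ 2 * (v x * (u x ^+ 2 + v x ^+ 2 - 4))).

(** The first Euler-Lagrange equation holds identically in the plane q1 = 2/3. *)
Lemma critical_planar lam Q : 0 < lam -> cH Q -> eqI (q1 Q) (fun=> 2 / 3) ->
  critical lam Q <-> planar lam (q2 Q) (q3 Q).
Proof.
move=> lam0 hQ E1; rewrite (critical_sol lam0 hQ).
have N z (p q : R) : z = 2 / 3 -> N23 z p q = p ^+ 2 + q ^+ 2 - 4.
  by move=> ->; rewrite /N23 /msq; field.
have N0 z (p q : R) : z = 2 / 3 -> N1 z p q = 0.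
  by move=> ->; rewrite /N1 /msq; field.
split=> [[_ s2 s3]|[s2 s3]]; split.
- by apply: sol_eqI s2 => x xI; rewrite N// E1.
- by apply: sol_eqI s3 => x xI; rewrite N// E1.
- apply: (sol_eqIl (eqI_sym E1)); exists (fun=> 2 / 3), (fun=> 0); split=> // x.
    exact: is_derive_cst.
  by rewrite N0 ?E1//; [rewrite mulr0; exact: is_derive_cst|exact: cl_I11].
- by apply: sol_eqI s2 => x xI; rewrite N// E1.
- by apply: sol_eqI s3 => x xI; rewrite N// E1.
Qed.

(** The equation of a = q1 - 2/3 is a'' = lambda^2 W a, and W >= 0 for a near 0; testing it
    with a gives a = 0. *)
Lemma critical_near_planar lam Q : 0 < lam -> critical lam Q ->
  (forall x, I11 x -> `|q1 Q x - 2 / 3| <= 1 / 8) -> eqI (q1 Q) (fun=> 2 / 3).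
Proof.
move=> lam0 cQ sm; have hQ : cH Q by case: cQ.
have [s1 _ _] := (critical_sol lam0 hQ).1 cQ.
have [hH [b1 b2] _ _] := hQ.
have cq1 : cI (q1 Q) by exact: (hH _).1.
have cq2 : cI (q2 Q) by exact: (hH _).1.
have cq3 : cI (q3 Q) by exact: (hH _).1.
pose a x := q1 Q x + (-1) * (2 / 3).
have cs : sol (fun=> 2 / 3 : R) (fun=> 0 : R).
  by exists (fun=> 2 / 3), (fun=> 0); split=> // x; exact: is_derive_cst.
have sa := solD (-1) s1 cs.
have ha : H10 a.
  split; rewrite /a ?b1 ?b2 /qplus; try lra.
  have h23 : H1 (fun=> 2 / 3 : R).
    by apply: sol_H1 cs; apply: continuous_subspaceT; exact: continuous_const.
  exact: H1D (hH _) (H1Z (-1) h23).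
pose W x := q2 Q x ^+ 2 + q3 Q x ^+ 2 + 3 * a x ^+ 2 + 8 * a x + 4.
have ca := H10_cI ha.
have E x : N1 (q1 Q x) (q2 Q x) (q3 Q x) = a x * W x.
  rewrite /W /a /N1 /msq; by move: (q1 Q x) (q2 Q x) (q3 Q x) => p q z; field.
have {}sa : sol a (fun x => lam ^+ 2 * (a x * W x)).
  by apply: sol_eqI sa => x _; rewrite E mulr0 addr0.
have cw : cI (fun x => lam ^+ 2 * (a x * W x)) by rewrite /W; wcont.
have I0 : 0 <= ip (fun x => lam ^+ 2 * (a x * W x)) a.
  apply: integ_ge0 => x xI; have := sm x xI; rewrite (_ : _ - _ = a x); last by rewrite /a mulN1r.
  rewrite ler_norml /W => /andP[h1 h2].
  have G : lam ^+ 2 * (a x * (q2 Q x ^+ 2 + q3 Q x ^+ 2 + 3 * a x ^+ 2 + 8 * a x + 4)) * a x =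
    lam ^+ 2 * a x ^+ 2 * (q2 Q x ^+ 2 + q3 Q x ^+ 2 + 3 * a x ^+ 2 + (8 * a x + 4)) by ring.
  rewrite G mulr_ge0//; first by rewrite mulr_ge0// sqr_ge0.
  have pos : 0 <= 8 * a x + 4 by move: (a x) h1 => z; lra.
  apply: addr_ge0 => //; apply: addr_ge0; last by rewrite mulr_ge0 ?sqr_ge0.
  exact: addr_ge0 (sqr_ge0 _) (sqr_ge0 _).
have := sol_weak cw sa ha => D0.
move=> x xI; have := poincare ha (H1_wd (H10_H1 ha)) xI; rewrite D0 => P.
have : a x ^+ 2 = 0.
  apply/eqP; rewrite eq_le sqr_ge0 andbT; apply: (le_trans P).
  by move: (ip _ _) I0 => z; lra.
by move/eqP; rewrite sqrf_eq0 /a mulN1r subr_eq0 => /eqP.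
Qed.

Lemma Gw_eval1 (L0 lc c h w0 s l y2 y3 : R -> R) x :
  (Gw L0 lc c h w0 s l y2 y3).1 x = (Gw (L0 x) (lc x) (c x) (h x) (w0 x) (s x) (l x) (y2 x) (y3 x)).1.
Proof. by []. Qed.

Lemma Gw_eval2 (L0 lc c h w0 s l y2 y3 : R -> R) x :
  (Gw L0 lc c h w0 s l y2 y3).2 x = (Gw (L0 x) (lc x) (c x) (h x) (w0 x) (s x) (l x) (y2 x) (y3 x)).2.
Proof. by []. Qed.

(** The nonlinear term of the second equation about (c, 0) is its value, plus its linear
    part, plus the first component of [Gw]. *)
Lemma Gw_identity1 (lc c h s l y2 y3 : R) :
  (l + lc) ^+ 2 * ((c + y2) * ((c + y2) ^+ 2 + s * (h + y3) ^+ 2 - 4)) =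
  lc ^+ 2 * (c * c - 4) * c + (lc ^+ 2 * (3 * (c * c) - 4) * y2 +
   ((Gw (lc ^+ 2) lc c h (c * c - 4) s l y2 y3).1 + l * (2 * lc * (c * (c * c - 4))))).
Proof. by rewrite /Gw /=; ring. Qed.

(** The same for the third equation, divided by t. *)
Lemma Gw_identity2 (lc c h s l y2 y3 : R) :
  (l + lc) ^+ 2 * ((h + y3) * ((c + y2) ^+ 2 + s * (h + y3) ^+ 2 - 4)) =
  lc ^+ 2 * (c * c - 4) * h + (lc ^+ 2 * (c * c - 4) * y3 +
   (2 * lc ^+ 2 * (c * h) * y2 + l * (2 * lc * ((c * c - 4) * h)) +
    (Gw (lc ^+ 2) lc c h (c * c - 4) s l y2 y3).2)).
Proof. by rewrite /Gw /=; ring. Qed.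

End Invariance.

Section Operators.
Context {R : realType} (chi : R -> triple R) (lamc : R) (hc : R -> R).
Context (chi_branch : is_branch chi) (mu_decr : mu_decreasing chi) (lamcP : is_lambda_c chi lamc)
  (hc_ker : kerL lamc (chi lamc) hc) (hc_neq0 : ~ eqI hc 0).
Implicit Types (f g u v y w : R -> R) (r s t x C k K m b l : R) (n N : nat).

Local Notation A2 := (pot2 chi lamc).
Local Notation A3 := (pot3 chi lamc).
Local Notation B2 := (src2 chi lamc).
Local Notation B3 := (src3 chi lamc hc).
Local Notation F2 := (coupling chi lamc hc).
Local Notation c0 := (branch_c chi lamc).
Local Notation w0 := (branch_w chi lamc).
Local Notation h0 := (kernel_h hc).
Local Notation Nf := (kernel_form chi lamc hc).

Let l0 : 0 < lamc. Proof. by case: lamcP. Qed.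

(** The solution operator of the linearized system at the bifurcation point, bounded in the
    sense used for power series; linearity follows from uniqueness. *)
Lemma operators : exists (Sl : (R -> R) -> (R -> R) -> R) (S2 S3 : (R -> R) -> (R -> R) -> R -> R),
 [/\ forall g2 g3, good g2 -> good g3 ->
      Srel A2 A3 B2 B3 F2 h0 g2 g3 (Sl g2 g3) (S2 g2 g3) (S3 g2 g3),
     forall g2 g3 l y2 y3, good g2 -> good g3 -> Srel A2 A3 B2 B3 F2 h0 g2 g3 l y2 y3 ->
      [/\ l = Sl g2 g3, y2 = S2 g2 g3 & y3 = S3 g2 g3] &
     [/\ bbop (fun g2 g3 _ => Sl g2 g3), bbop S2 & bbop S3]].
Proof.
have [bh hh] := kernel_h_iv chi_branch lamcP hc_ker.
have gA2 := good_pot2 chi_branch lamcP; have gA3 := good_pot3 chi_branch lamcP.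
have gB2 := good_src2 chi_branch lamcP; have gB3 := good_src3 chi_branch lamcP hc_ker.
have gF := (good_coupling chi_branch lamcP hc_ker).
have [Sl [S2 [S3 [HS HU [K K0 HK]]]]] := solution_operator gA2 gA3 gB2 gB3 gF
  (pot2_nondegenerate chi_branch lamcP) hh (kernel_h_slope chi_branch lamcP hc_neq0 hh)
  (kernel_h_1 hc_ker) (ltr0_neq0 (kernel_form_kernel_h chi_branch lamcP hc_ker hc_neq0))
  (transversal_pairing chi_branch mu_decr lamcP hc_ker hc_neq0).
have lin g2 g3 g2' g3' a : good g2 -> good g3 -> good g2' -> good g3' ->
   [/\ Sl (fun x => g2 x + a * g2' x) (fun x => g3 x + a * g3' x) = Sl g2 g3 + a * Sl g2' g3',
       S2 (fun x => g2 x + a * g2' x) (fun x => g3 x + a * g3' x) = (fun x => S2 g2 g3 x + a * S2 g2' g3' x) &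
       S3 (fun x => g2 x + a * g2' x) (fun x => g3 x + a * g3' x) = (fun x => S3 g2 g3 x + a * S3 g2' g3' x)].
  move=> h1 h2 h3 h4; have h13 := goodD h1 (goodZ a h3); have h24 := goodD h2 (goodZ a h4).
  have [e1 e2 e3] := HU _ _ _ _ _ h13 h24
     (Srel_lin gA2 gA3 gB2 gB3 gF hh a h1 h2 h3 h4 (HS _ _ h1 h2) (HS _ _ h3 h4)).
  by rewrite -e1 -e2 -e3.
exists Sl, S2, S3; split=> //; split; exists K; rewrite ?ltW//; split.
- by move=> g2 g3 _ _; exact: goodC.
- by move=> g2 g3 g2' g3' a h1 h2 h3 h4; have [-> _ _] := lin _ _ _ _ a h1 h2 h3 h4.
- by move=> g2 g3 m h1 h2 m1 m2 x; have [h _] := HK _ _ m h1 h2 m1 m2.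
- by move=> g2 g3 h1 h2; have [] := Srel_good (HS g2 g3 h1 h2).
- by move=> g2 g3 g2' g3' a h1 h2 h3 h4; have [_ -> _] := lin _ _ _ _ a h1 h2 h3 h4.
- by move=> g2 g3 m h1 h2 m1 m2 x; have [_ h] := HK _ _ m h1 h2 m1 m2; case: (h x).
- by move=> g2 g3 h1 h2; have [] := Srel_good (HS g2 g3 h1 h2).
- by move=> g2 g3 g2' g3' a h1 h2 h3 h4; have [_ _ ->] := lin _ _ _ _ a h1 h2 h3 h4.
- by move=> g2 g3 m h1 h2 m1 m2 x; have [_ h] := HK _ _ m h1 h2 m1 m2; case: (h x).
Qed.

Lemma branch_c_sol : sol c0 (fun x => A3 x * c0 x).
Proof.
have [cc hs] := branch_q2 chi_branch l0.
have E : eqI (q2 (chi lamc)) c0 by move=> x xI; rewrite /branch_c /= cl_idI.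
apply: (sol_eqIl E); apply: sol_eqI hs => x xI.
by rewrite /pot3 /branch_w /branch_c /= cl_idI// expr2; ring.
Qed.

Lemma kernel_h_sol : sol h0 (fun x => A3 x * h0 x).
Proof.
have E : eqI hc h0 by move=> x xI; rewrite /kernel_h /= cl_idI.
apply: (sol_eqIl E); exact: hc_sol chi_branch lamcP hc_ker.
Qed.

(** The remainder for the desingularized unknowns (l, y2, y3), where q3 = t (h_c + y3) and s
    = t^2. *)
Definition Gs s l y2 y3 := Gw (fun=> lamc ^+ 2) (fun=> lamc) c0 h0 w0 (fun=> s) (fun=> l) y2 y3.

(** Multiplying the desingularized third equation by t recovers the planar system. *)
Lemma Srel_planar t l y2 y3 : good y2 -> good y3 ->
  Srel A2 A3 B2 B3 F2 h0 (Gs (t ^+ 2) l y2 y3).1 (Gs (t ^+ 2) l y2 y3).2 l y2 y3 ->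
  planar (l + lamc) (fun x => c0 x + y2 x) (fun x => t * (h0 x + y3 x)).
Proof.
move=> gy2 gy3 [b2 b3 _].
have gA2 := good_pot2 chi_branch lamcP; have gA3 := good_pot3 chi_branch lamcP.
have gB2 := good_src2 chi_branch lamcP; have gB3 := good_src3 chi_branch lamcP hc_ker.
have gF := (good_coupling chi_branch lamcP hc_ker); have gc := good_branch_c chi_branch lamcP; have gh := good_kernel_h hc_ker.
have gw := good_branch_w chi_branch lamcP.
have [gG1 gG2] : good (Gs (t ^+ 2) l y2 y3).1 /\ good (Gs (t ^+ 2) l y2 y3).2.
  by apply: (Gw_closed (P := @good R)) => //; try exact: goodC; [exact: goodD|exact: goodM].
have s2 := bvp_sol gA2 (goodD gG1 (goodZ l gB2)) b2.
have s3 := bvp_sol gA3 (goodD (goodD (goodM gF gy2) (goodZ l gB3)) gG2) b3.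
have e2 : eqI (fun x => c0 x + 1 * y2 x) (fun x => c0 x + y2 x) by move=> x _; rewrite mul1r.
have e3 : eqI (fun x => 0 + t * (h0 x + 1 * y3 x)) (fun x => t * (h0 x + y3 x)).
  by move=> x _; rewrite add0r mul1r.
have zs : sol (fun=> 0 : R) (fun=> 0 : R).
  by exists (fun=> 0), (fun=> 0); split=> // x; exact: is_derive_cst.
split.
- apply: (sol_eqIl e2); apply: sol_eqI (solD 1 branch_c_sol s2) => x xI.
  by rewrite Gw_eval1 exprMn Gw_identity1 mul1r.
- apply: (sol_eqIl e3); apply: sol_eqI (solD t zs (solD 1 kernel_h_sol s3)) => x xI.
  rewrite add0r mul1r Gw_eval2 exprMn.
  have G (p q z v : R) : p = q * (z * v) -> t * p = q * (t * z * v) by move=> ->; ring.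
  by apply: G; rewrite Gw_identity2.
Qed.

Lemma bop_weak K K' T : K <= K' -> bop K T -> bop K' T.
Proof.
move=> KK [TG TL TB]; split=> // g2 g3 m h2 h3 m2 m3 x.
by apply: (le_trans (TB _ _ _ h2 h3 m2 m3 x)); rewrite ler_wpM2r//; exact: Bfun_ge0 m2.
Qed.

Lemma convrad_le (a : nat -> R -> R) r s : s <= r -> convrad a r -> convrad a s.
Proof.
move=> sr [ga H]; split=> // r' /andP[h1 h2]; apply: H; rewrite h1/=; exact: lt_le_trans sr.
Qed.

(** The analytic fixed point at s = t^2. Its coefficients of order 0 vanish, so y2 and y3
    are divisible by t^2; since everything depends on t^2 up to the factor t in q3, the
    coordinates are even or odd. The remainders H_t are obtained as curves in H10 from the
    derivatives of y2 and y3 in x. *)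
Lemma bifurcation_curve : exists (rt e0 : R) (al : nat -> R -> R) (V : 'I_3 -> nat -> R -> R) (Y2 Y3 : R -> R -> R),
 [/\ [/\ 0 < rt, 0 < e0, convrad al rt & al 0%N = fun=> 0],
  (forall i, convrad (V i) rt) /\ (forall i n, J (V i n) (cl 1) = 0),
  (forall t, `|t| < rt ->
    [/\ good (Y2 t), good (Y3 t),
        Srel A2 A3 B2 B3 F2 h0 (Gs (t ^+ 2) (psum al t 0) (Y2 t) (Y3 t)).1 (Gs (t ^+ 2) (psum al t 0) (Y2 t) (Y3 t)).2
          (psum al t 0) (Y2 t) (Y3 t),
        Nf (pcurve V t (inord 2)) = 0 &
        forall x, [/\ pcurve V t (inord 0) x = 0, t ^+ 2 * pcurve V t (inord 1) x = Y2 t x &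
           t ^+ 2 * pcurve V t (inord 2) x = t * Y3 t x]]),
  (forall t, `|t| < rt -> psum al (- t) 0 = psum al t 0 /\
     forall x, [/\ pcurve V (- t) (inord 0) x = pcurve V t (inord 0) x,
       pcurve V (- t) (inord 1) x = pcurve V t (inord 1) x &
       pcurve V (- t) (inord 2) x = - pcurve V t (inord 2) x]) &
  (forall t l y2 y3, `|t| < rt -> good y2 -> good y3 ->
     Srel A2 A3 B2 B3 F2 h0 (Gs (t ^+ 2) l y2 y3).1 (Gs (t ^+ 2) l y2 y3).2 l y2 y3 ->
     Bfun (Gs (t ^+ 2) l y2 y3).1 e0 -> Bfun (Gs (t ^+ 2) l y2 y3).2 e0 ->
     [/\ l = psum al t 0, y2 = Y2 t & y3 = Y3 t])].
Proof.
have [Sl [S2 [S3 [HS HU [bl bS2 bS3]]]]] := operators.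
have gA2 := good_pot2 chi_branch lamcP; have gA3 := good_pot3 chi_branch lamcP.
have gB2 := good_src2 chi_branch lamcP; have gB3 := good_src3 chi_branch lamcP hc_ker.
have gF := (good_coupling chi_branch lamcP hc_ker); have gc := good_branch_c chi_branch lamcP; have gh := good_kernel_h hc_ker.
have gw := good_branch_w chi_branch lamcP.
pose T1 g2 g3 (x : R) := Sl g2 g3.
have [Kl Kl0 hl] := bl; have [K2 K20 h2] := bS2; have [K3 K30 h3] := bS3.
pose K := Kl + K2 + K3.
have K0 : 0 <= K by rewrite !addr_ge0.
have b1 : bop K T1 by apply: bop_weak hl; rewrite /K; lra.
have b2 : bop K S2 by apply: bop_weak h2; rewrite /K; lra.
have b3 : bop K S3 by apply: bop_weak h3; rewrite /K; lra.
have [e0 [a2 [a3 [e00 [ga2 ga3] Ha Hfix Huniq]]]] := analytic_fixed_point K0 b1 b2 b3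
   (goodC (lamc ^+ 2)) (goodC lamc) gc gh gw.
have GFE s f2 f3 : GF T1 S2 S3 (fun=> lamc ^+ 2) (fun=> lamc) c0 h0 w0 s (f2, f3) =
   Gs s (Sl f2 f3) (S2 f2 f3) (S3 f2 f3) by [].
have r0 : 0 < e0 ^+ 2 by rewrite exprn_gt0.
have ra2 : convrad a2 (e0 ^+ 2) by apply: (rad_bound ga2) => n x; exact: (Ha n x).1.
have ra3 : convrad a3 (e0 ^+ 2) by apply: (rad_bound ga3) => n x; exact: (Ha n x).2.
pose rt := e0 / 2.
have rt0 : 0 < rt by rewrite divr_gt0.
have rt2 : rt ^+ 2 = e0 ^+ 2 / 4 by rewrite /rt; field.
have rtle : rt ^+ 2 <= e0 ^+ 2 by rewrite rt2; lra.
have rt20 : 0 < rt ^+ 2 by rewrite exprn_gt0.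
have small t : `|t| < rt -> `|t ^+ 2| <= e0 ^+ 2 / 2 /\ `|t ^+ 2| < rt ^+ 2.
  by move=> ht; have := sqr_lt (ltW rt0) ht; rewrite rt2 => h; split=> //; lra.
have q2' := convrad_le rtle ra2; have q3' := convrad_le rtle ra3.
have Bz e : 0 <= e -> Bfun (fun=> 0 : R) e by move=> he x; rewrite normr0.
(* At s = 0 the zero pair is a fixed point, and it is the only small one. *)
have [a20 a30] : a2 0%N = (fun=> 0) /\ a3 0%N = (fun=> 0).
  have z0 : `|0 : R| <= e0 ^+ 2 / 2 by rewrite normr0 divr_ge0 ?ltW.
  have T00 : GF T1 S2 S3 (fun=> lamc ^+ 2) (fun=> lamc) c0 h0 w0 0 (fun=> 0, fun=> 0) = (fun=> 0, fun=> 0).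
    have t1 : Sl (fun=> 0) (fun=> 0) = 0 by have := congr1 (fun f => f 0) (bop0 b1).
    rewrite GFE t1 (bop0 b2) (bop0 b3) [LHS]surjective_pairing; congr (_, _); apply/funext => x.
      by rewrite Gw_eval1 /Gw /=; ring.
    by rewrite Gw_eval2 /Gw /=; ring.
  have := Huniq 0 (fun=> 0, fun=> 0) z0 (conj (goodC 0) (goodC 0)) (Bz _ (ltW e00)) (Bz _ (ltW e00)) T00.
  by move=> [E2 E3]; split; apply/funext => x; rewrite -(psum0 _ x (erefl 0)); [rewrite -E2|rewrite -E3].
(* The derivatives in x of the solutions y2 and y3, as bounded operators on the right-
   hand sides. *)
pose Z2 g2 g3 := dslope (fun x => A2 x * S2 g2 g3 x + (g2 x + B2 x * T1 g2 g3 x)).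
pose Z3 g2 g3 := dslope (fun x => A3 x * S3 g2 g3 x + (F2 x * S2 g2 g3 x + B3 x * T1 g2 g3 x + g3 x)).
have bZ2 : bbop Z2.
  by apply: bbop_dslope; apply: bbopD (bbopM gA2 bS2) _; apply: bbopD (@bbop_fst R) (bbopM gB2 bl).
have bZ3 : bbop Z3.
  apply: bbop_dslope; apply: bbopD (bbopM gA3 bS3) _.
  by apply: bbopD (bbopD (bbopM gF bS2) (bbopM gB3 bl)) (@bbop_snd R).
have pZ2 g2 g3 : good g2 -> good g3 -> primit (S2 g2 g3) (Z2 g2 g3).
  move=> i2 i3; have [hb _ _] := HS _ _ i2 i3; have := bvp_primit gA2 (goodD i2 (goodZ _ gB2)) hb.
  by congr primit; rewrite /Z2; congr dslope; apply/funext => x; rewrite [B2 x * _]mulrC.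
have pZ3 g2 g3 : good g2 -> good g3 -> primit (S3 g2 g3) (Z3 g2 g3).
  move=> i2 i3; have [hb2 hb _] := HS _ _ i2 i3.
  have := bvp_primit gA3 (goodD (goodD (goodM gF (bvp_good hb2)) (goodZ _ gB3)) i3) hb.
  by congr primit; rewrite /Z3; congr dslope; apply/funext => x; rewrite [B3 x * _]mulrC.
have dZ2 g2 g3 : good g2 -> good g3 -> J (Z2 g2 g3) (cl 1) = 0.
  move=> i2 i3; have [_ /(congr1 (fun f => f 1)) <-] := pZ2 _ _ i2 i3.
  by have [[_ hb] _ _] := HS _ _ i2 i3.
have dZ3 g2 g3 : good g2 -> good g3 -> J (Z3 g2 g3) (cl 1) = 0.
  move=> i2 i3; have [_ /(congr1 (fun f => f 1)) <-] := pZ3 _ _ i2 i3.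
  by have [_ [_ hb] _] := HS _ _ i2 i3.
have Z20 : Z2 (fun=> 0) (fun=> 0) = fun=> 0 by have [k _ hk] := bZ2; exact: bop0 hk.
have Z30 : Z3 (fun=> 0) (fun=> 0) = fun=> 0 by have [k _ hk] := bZ3; exact: bop0 hk.
pose u1 n := T1 (a2 n) (a3 n); pose u2 n := Z2 (a2 n) (a3 n); pose u3 n := Z3 (a2 n) (a3 n).
have ru1 : convrad u1 (rt ^+ 2) by exact: bbop_convrad bl q2' q3'.
have ru2 : convrad u2 (rt ^+ 2) by exact: bbop_convrad bZ2 q2' q3'.
have ru3 : convrad u3 (rt ^+ 2) by exact: bbop_convrad bZ3 q2' q3'.
have su2 := rad_shift rt20 ru2; have su3 := rad_shift rt20 ru3.
pose al := evenc u1.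
pose V (i : 'I_3) := if i == inord 1 then evenc (fun n => u2 n.+1)
   else if i == inord 2 then oddc (fun n => u3 n.+1) else (fun _ _ => 0).
have n10 : (inord 0 == inord 1 :> 'I_3) = false by rewrite -val_eqE /= !inordK.
have n20 : (inord 0 == inord 2 :> 'I_3) = false by rewrite -val_eqE /= !inordK.
have n12 : (inord 2 == inord 1 :> 'I_3) = false by rewrite -val_eqE /= !inordK.
have V0 : V (inord 0) = fun _ _ => 0 by rewrite /V n10 n20.
have V1 : V (inord 1) = evenc (fun n => u2 n.+1) by rewrite /V eqxx.
have V2 : V (inord 2) = oddc (fun n => u3 n.+1) by rewrite /V n12 eqxx.
have ral : convrad al rt by exact: rad_evenc.
have psz t x : psum (fun _ _ => 0) t x = 0.
  apply: psum_lim; rewrite (_ : (fun N => _) = fun=> 0); first exact: cvg_cst.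
  by apply/funext => N; rewrite /part big1// => i _; rewrite mul0r.
have J00 x : J (fun=> 0) (cl x) = 0 by apply: J0; case/andP: (cl_itv x).
have pc0 t x : pcurve V t (inord 0) x = 0.
  rewrite /pcurve V0 (_ : psum _ t = fun=> 0) ?J00//; apply/funext => z; exact: psz.
have pc1 t : `|t| < rt -> pcurve V t (inord 1) = fun x => J (psum (fun n => u2 n.+1) (t ^+ 2)) (cl x).
  move=> ht; rewrite /pcurve V1; apply/funext => x; congr (J _ _).
  by apply/funext => z; exact: (psum_even z rt0 su2 ht).
have pc2 t : `|t| < rt -> pcurve V t (inord 2) = fun x => t * J (psum (fun n => u3 n.+1) (t ^+ 2)) (cl x).
  move=> ht; rewrite /pcurve V2; apply/funext => x; have /andP[x1 _] := cl_itv x.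
  have [_ st] := small t ht; have gp3 := psum_good su3 st.
  rewrite -JZ//; last by case: gp3.
  by congr (J _ _); apply/funext => z; exact: (psum_odd z rt0 su3 ht).
have sh (T : (R -> R) -> (R -> R) -> R -> R) (Z : (R -> R) -> (R -> R) -> R -> R) t x : bbop Z ->
    (forall g2 g3, good g2 -> good g3 -> primit (T g2 g3) (Z g2 g3)) -> Z (fun=> 0) (fun=> 0) = (fun=> 0) -> `|t| < rt ->
    t ^+ 2 * J (psum (fun n => Z (a2 n.+1) (a3 n.+1)) (t ^+ 2)) (cl x) = T (psum a2 (t ^+ 2)) (psum a3 (t ^+ 2)) x.
  move=> bZ pZ Z0 ht; have [_ st] := small t ht; have /andP[x1 _] := cl_itv x.
  have rZ : convrad (fun n => Z (a2 n) (a3 n)) (rt ^+ 2) by exact: bbop_convrad bZ q2' q3'.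
  have gs := psum_good (rad_shift rt20 rZ) st.
  have [_ ->] := pZ _ _ (psum_good q2' st) (psum_good q3' st).
  rewrite -(psum_bbop bZ q2' q3' st) -JZ//; last by case: gs.
  congr (J _ _); apply/funext => z; rewrite (psum_shift z rt20 rZ st) a20 a30 Z0 add0r.
  by [].
exists rt, e0, al, V, (fun t => S2 (psum a2 (t ^+ 2)) (psum a3 (t ^+ 2))), (fun t => S3 (psum a2 (t ^+ 2)) (psum a3 (t ^+ 2))).
have alE t : `|t| < rt -> psum al t 0 = Sl (psum a2 (t ^+ 2)) (psum a3 (t ^+ 2)).
  move=> ht; have [_ st] := small t ht.
  by rewrite /al (psum_even 0 rt0 ru1 ht) (psum_bbop bl q2' q3' st).
split.
- split=> //; rewrite /al /evenc /= /u1 a20 a30; apply/funext => x.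
  by have := congr1 (fun f => f 0) (bop0 b1).
- split=> i; rewrite /V; case: ifP => _; [exact: rad_evenc| |move=> n|move=> n].
  + case: ifP => _; [exact: rad_oddc|split=> [n|r' _]; first exact: goodC].
    by exists 0 => // n x; rewrite normr0 mul0r.
  + by rewrite /evenc; case: ifP => _; rewrite ?J00//; exact: dZ2.
  + case: ifP => _; rewrite ?J00//.
    by rewrite /oddc; case: ifP => _; rewrite ?J00//; exact: dZ3.
- move=> t ht; have [st1 st] := small t ht.
  have gs2 := psum_good q2' st; have gs3 := psum_good q3' st.
  have hS := HS _ _ gs2 gs3; have [i2 i3] := Srel_good hS.
  have Efix := Hfix (t ^+ 2) st1; rewrite GFE in Efix.
  rewrite (alE t ht); set G := Gs _ _ _ _ in Efix *.
  have hS' : Srel A2 A3 B2 B3 F2 h0 G.1 G.2 (Sl (psum a2 (t ^+ 2)) (psum a3 (t ^+ 2)))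
    (S2 (psum a2 (t ^+ 2)) (psum a3 (t ^+ 2))) (S3 (psum a2 (t ^+ 2)) (psum a3 (t ^+ 2))).
    by rewrite Efix.
  clear Efix; split; [exact: i2|exact: i3|exact: hS'| |move=> x; split].
  + have hN : Nf (S3 (psum a2 (t ^+ 2)) (psum a3 (t ^+ 2))) = 0 by case: hS.
    have [->|t0] := eqVneq t 0.
      rewrite pc2 ?normr0//; have -> : (fun x => 0 * J (psum (fun n => u3 n.+1) (0 ^+ 2)) (cl x)) = fun=> 0.
        by apply/funext => x; rewrite mul0r.
      exact: ip_zero.
    have -> : pcurve V t (inord 2) = fun x => t^-1 * S3 (psum a2 (t ^+ 2)) (psum a3 (t ^+ 2)) x.
      apply/funext => x; rewrite pc2// -(sh S3 Z3 t x bZ3 pZ3 Z30 ht).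
      by rewrite mulrA; congr (_ * _); rewrite expr2 mulKf.
    rewrite /kernel_form ipC ipZl//; [|exact: good_L2|by apply: good_L2; exact: goodM].
    by rewrite ipC -/(kernel_form chi lamc hc _) hN mulr0.
  + exact: pc0.
  + by rewrite pc1// (sh S2 Z2 t x bZ2 pZ2 Z20 ht).
  + by rewrite pc2// mulrCA (sh S3 Z3 t x bZ3 pZ3 Z30 ht).
- move=> t ht; have htn : `|- t| < rt by rewrite normrN.
  split; first by rewrite !alE// sqrrN.
  by move=> x; rewrite !pc0 !pc1// !pc2// sqrrN mulNr.
- move=> t l y2 y3 ht gy2 gy3 hS B1' B2'; have [st1 st] := small t ht.
  set G := Gs _ _ _ _ in hS B1' B2'.
  have [gG1 gG2] : good G.1 /\ good G.2.
    by apply: (Gw_closed (P := @good R)) => //; try exact: goodC; [exact: goodD|exact: goodM].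
  have [e1 e2 e3] := HU _ _ _ _ _ gG1 gG2 hS.
  have E : GF T1 S2 S3 (fun=> lamc ^+ 2) (fun=> lamc) c0 h0 w0 (t ^+ 2) (G.1, G.2) = (G.1, G.2).
    by rewrite GFE -e1 -e2 -e3 -/G -surjective_pairing.
  have := Huniq (t ^+ 2) (G.1, G.2) st1 (conj gG1 gG2) B1' B2' E.
  by rewrite alE// => -[<- <-].
Qed.

End Operators.

(** * A priori estimates near the bifurcation point *)

Section SmallRadius.
Context {R : realType}.
Implicit Types (r s t x C k K m e : R) (n N : nat).

Lemma psum_local (a : nat -> R -> R) r e : 0 < r -> convrad a r -> 0 < e ->
  exists d, [/\ 0 < d, d <= r & forall (u : R) x, `|u| < d -> `|psum a u x - a 0%N x| <= e].
Proof.
move=> r0 ha e0; have hs := rad_shift r0 ha.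
have r2 : 0 < r / 2 < r by lra.
have [gs /(_ _ r2) [C C0 HC]] := hs.
have r20 : 0 < r / 2 by lra.
exists (Num.min (r / 4) (e / (2 * C + 1))); split.
- by rewrite lt_min !divr_gt0//; lra.
- by rewrite ge_min; apply/orP; left; lra.
move=> u x; rewrite lt_min => /andP[u1 u2].
have ur : `|u| < r by lra.
rewrite (psum_shift x r0 ha ur) [_ + _ * _]addrC addrK normrM.
have ur2 : `|u| <= r / 2 / 2 by move: u1; move: (`|u|) => z; lra.
have := psum_bound r20 gs HC ur2 x => B.
apply: (le_trans (ler_wpM2l (normr_ge0 u) B)).
move: u2; rewrite ltr_pdivlMr; last by lra.
have := normr_ge0 u; move: (`|u|) => z; nra.
Qed.

(** The perturbations of the two potentials are polynomials without constant term in the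
    increments (l, d, d'). *)
Lemma coef_small (lamc M eta : R) : 0 <= M -> 0 < eta -> exists2 m, 0 < m <= 1 &
  forall l c d d', `|c| <= M -> `|l| <= m -> `|d| <= m -> `|d'| <= m ->
  `|(l + lamc) ^+ 2 * ((c + d) ^+ 2 + d' ^+ 2 - 4) - lamc ^+ 2 * (c * c - 4)| <= eta /\
  `|(l + lamc) ^+ 2 * ((c + d) ^+ 2 + (c + d) * (c + d') + (c + d') ^+ 2 - 4)
     - lamc ^+ 2 * (3 * (c * c) - 4)| <= eta.
Proof.
move=> M0 e0.
pose f1 l c d d' : R := (lamc * l + lamc * l + l * l) * (c * c - 4) +
   (lamc * lamc + (lamc * l + lamc * l + l * l)) * (c * d + c * d + d * d + d' * d').
pose f2 l c d d' : R := (lamc * l + lamc * l + l * l) * (3 * (c * c) - 4) +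
   (lamc * lamc + (lamc * l + lamc * l + l * l)) * (c * d + c * d + d * d + (c * d' + c * d' + d' * d') + (c * d' + d * c + d * d')).
have E1 l c d d' : (l + lamc) ^+ 2 * ((c + d) ^+ 2 + d' ^+ 2 - 4) - lamc ^+ 2 * (c * c - 4) = f1 l c d d'.
  by rewrite /f1; ring.
have E2 l c d d' : (l + lamc) ^+ 2 * ((c + d) ^+ 2 + (c + d) * (c + d') + (c + d') ^+ 2 - 4)
     - lamc ^+ 2 * (3 * (c * c) - 4) = f2 l c d d'.
  by rewrite /f2; ring.
have mB := @majorant_abs R.
have B0 : Babs (0 : R) 0 by rewrite /Babs normr0.
have d0 : 0 <= (0 : R) by [].
have [K1 H1] : exists K, forall m l c d d', 0 <= m <= 1 -> `|c| <= M -> `|l| <= m -> `|d| <= m -> `|d'| <= m ->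
    cl2 (Babs (R := R)) m 0 1 K (f1 l c d d') (f1 l c d d').
  eexists => m l c d d' m01 hc hl hd hd'.
  have cc (t : R) : cl2 (Babs (R:=R)) m 0 0 `|t| t t by apply: cl2_cst => //; rewrite /Babs.
  have c1 t : `|t| <= m -> cl2 (Babs (R:=R)) m 0 1 1 t t.
    by move=> h; split; rewrite ?mul1r ?expr1 ?subrr ?mulr0 /Babs ?normr0.
  have k1 : cl2 (Babs (R:=R)) m 0 0 M c c by apply: cl2_cst.
  have k2 := c1 _ hl; have k3 := c1 _ hd; have k4 := c1 _ hd'.
  have k5 := cc 4; have k6 := cc lamc.
  rewrite /f1; cl2_solve.
have [K2 H2] : exists K, forall m l c d d', 0 <= m <= 1 -> `|c| <= M -> `|l| <= m -> `|d| <= m -> `|d'| <= m ->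
    cl2 (Babs (R := R)) m 0 1 K (f2 l c d d') (f2 l c d d').
  eexists => m l c d d' m01 hc hl hd hd'.
  have cc (t : R) : cl2 (Babs (R:=R)) m 0 0 `|t| t t by apply: cl2_cst => //; rewrite /Babs.
  have c1 t : `|t| <= m -> cl2 (Babs (R:=R)) m 0 1 1 t t.
    by move=> h; split; rewrite ?mul1r ?expr1 ?subrr ?mulr0 /Babs ?normr0.
  have k1 : cl2 (Babs (R:=R)) m 0 0 M c c by apply: cl2_cst.
  have k2 := c1 _ hl; have k3 := c1 _ hd; have k4 := c1 _ hd'.
  have k5 := cc 4; have k6 := cc lamc; have k7 := cc 3.
  rewrite /f2; cl2_solve.
pose K := `|K1| + `|K2| + 1.
have Kp : 0 < K by rewrite ltr_wpDl// addr_ge0.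
exists (Num.min 1 (eta / K)).
  by rewrite lt_min ltr01 divr_gt0//= ge_min lexx.
move=> l c d d' hc hl hd hd'.
set m := Num.min _ _ in hl hd hd'.
have m01 : 0 <= m <= 1.
  by rewrite ge_min lexx andbT le_min ler01 divr_ge0// ltW.
have mK : m * K <= eta by rewrite -ler_pdivlMr// ge_min lexx orbT.
have m0 : 0 <= m by case/andP: m01.
have fin (X K' : R) : `|X| <= K' * m ^+ 1 -> `|K'| <= K -> `|X| <= eta.
  move=> h1 h2; apply: (le_trans h1); rewrite expr1; apply: le_trans mK.
  rewrite [leRHS]mulrC ler_wpM2r//; exact: le_trans (ler_norm _) h2.
rewrite E1 E2; split.
- have [_ h _ _] := H1 m l c d d' m01 hc hl hd hd'; apply: (fin _ K1 h).
  by rewrite /K -addrA lerDl addr_ge0.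
- have [_ h _ _] := H2 m l c d d' m01 hc hl hd hd'; apply: (fin _ K2 h).
  by rewrite /K addrAC lerDr addr_ge0.
Qed.

End SmallRadius.

Section APriori.
Context {R : realType} (chi : R -> triple R) (lamc : R) (hc : R -> R).
Context (chi_branch : is_branch chi) (mu_decr : mu_decreasing chi) (lamcP : is_lambda_c chi lamc)
  (hc_ker : kerL lamc (chi lamc) hc) (hc_neq0 : ~ eqI hc 0).
Implicit Types (f g u v y w : R -> R) (r s t x C k K m b l : R) (n N : nat).

Local Notation A2 := (pot2 chi lamc).
Local Notation A3 := (pot3 chi lamc).
Local Notation c0 := (branch_c chi lamc).
Local Notation w0 := (branch_w chi lamc).
Local Notation h0 := (kernel_h hc).
Local Notation Nf := (kernel_form chi lamc hc).

Let l0 : 0 < lamc. Proof. by case: lamcP. Qed.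

(** The weak equation of h_c removes the derivatives from the inner product. *)
Lemma dot3_third Q : H10_3 Q -> dot3 Q (third hc) = - Nf (Q (inord 2)).
Proof.
move=> hQ; have hh := hc_H10 hc_ker.
have hT : H10_3 (third hc) by exact: (single_H10 (inord 2) hh).
have QH := H10_3_H1 hQ; have TH := H10_3_H1 hT.
rewrite (dot3E QH TH (H1_wd3 QH) (H1_wd3 TH)) sum_ord3.
have n02 : (inord 0 == inord 2 :> 'I_3) = false by rewrite -val_eqE /= !inordK.
have n12 : (inord 1 == inord 2 :> 'I_3) = false by rewrite -val_eqE /= !inordK.
have LQ i : L2 (wD (Q i)) by exact: (H1_wd (QH i)).1.
rewrite /third n02 n12 eqxx !ip_wD0// !add0r ipC.
exact: kernel_form_weak chi_branch lamcP hc_ker _ (hQ _).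
Qed.

(** A small perturbation W of the third linearized equation, for y transverse to the kernel:
    the bound of [kernel_bvp] controls y by W (g + y), and the term in y is absorbed. *)
Lemma kernel_small : exists2 K, 0 <= K & forall y g W (w a : R), H10 y -> cI g -> cI W ->
  sol y (fun x => A3 x * y x + W x * (g x + y x)) -> Nf y = 0 ->
  (forall x, I11 x -> `|W x| <= w) -> (forall x, I11 x -> `|g x| <= a) -> K * w <= 1 / 2 ->
  forall x, I11 x -> `|y x| <= 2 * (K * w * a).
Proof.
have gA3 := good_pot3 chi_branch lamcP.
have [bh hh] := kernel_h_iv chi_branch lamcP hc_ker.
have [_ _ [K K0 HK]] := kernel_bvp gA3 hh (kernel_h_slope chi_branch lamcP hc_neq0 hh) (kernel_h_1 hc_ker)
  (ltr0_neq0 (kernel_form_kernel_h chi_branch lamcP hc_ker hc_neq0)).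
exists K => // y g W w a hy cg cW hs N0 Ww ga Kw x xI.
have [_ ym yp] := hy; have cy := H10_cI hy.
have gy := good_cl cy; have gg := good_cl cg; have gW := good_cl cW.
have gf : good (fun x => (W \o cl) x * ((g \o cl) x + (y \o cl) x)) by apply: goodM gW (goodD gg gy).
have hb : bvp A3 (fun x => (W \o cl) x * ((g \o cl) x + (y \o cl) x)) (y \o cl).
  by apply: (sol_bvp gA3 gf hs ym yp) => z zI; rewrite /= cl_idI.
have N0' : Nf (y \o cl) = 0 by rewrite -N0; apply: ip_eq => // z zI; rewrite /= cl_idI.
have w0' : 0 <= w by apply: le_trans (Ww x xI).
have a0 : 0 <= a by apply: le_trans (ga x xI).
have : Bfun (y \o cl) (2 * (K * w * a)).
  apply: absorb; first by have [M _ HM] := good_bounded gy; exists M.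
  move=> m Hm z.
  have m0 : 0 <= m by exact: Bfun_ge0 Hm.
  have B z' : `|(W \o cl) z' * ((g \o cl) z' + (y \o cl) z')| <= w * (a + m).
    rewrite normrM; apply: ler_pM => //; first by apply: Ww; exact: cl_I11.
    apply: (le_trans (ler_normD _ _)); apply: lerD; last exact: Hm.
    by apply: ga; exact: cl_I11.
  apply: (le_trans (HK _ _ _ gf hb N0' B z)).
  rewrite mulrA mulrDr lerD2l mulrC; move: Kw m0; move: (K * w) => p; nra.
by move/(_ x); rewrite /= cl_idI.
Qed.

(** A small perturbation of a nondegenerate homogeneous equation is nondegenerate, by
    absorption. *)
Lemma coercive_small : exists2 K, 0 <= K & forall y W (w : R), H10 y -> cI W ->
  sol y (fun x => A2 x * y x + W x * y x) ->
  (forall x, I11 x -> `|W x| <= w) -> K * w <= 1 / 2 -> eqI y 0.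
Proof.
have gA2 := good_pot2 chi_branch lamcP.
have [_ [K K0 HK]] := coercive_bvp gA2 (pot2_nondegenerate chi_branch lamcP).
exists K => // y W w hy cW hs Ww Kw x xI.
have [_ ym yp] := hy; have cy := H10_cI hy.
have gy := good_cl cy; have gW := good_cl cW.
have gf : good (fun x => (W \o cl) x * (y \o cl) x) by apply: goodM.
have hb : bvp A2 (fun x => (W \o cl) x * (y \o cl) x) (y \o cl).
  by apply: (sol_bvp gA2 gf hs ym yp) => z zI; rewrite /= cl_idI.
have w0' : 0 <= w by apply: le_trans (Ww x xI).
have : Bfun (y \o cl) (2 * 0).
  apply: absorb; first by have [M _ HM] := good_bounded gy; exists M.
  move=> m Hm z.
  have m0 : 0 <= m by exact: Bfun_ge0 Hm.
  have B z' : `|(W \o cl) z' * (y \o cl) z'| <= w * m.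
    by rewrite normrM; apply: ler_pM => //; apply: Ww; exact: cl_I11.
  apply: (le_trans (HK _ _ _ gf hb B z)).
  rewrite mulrA add0r; move: Kw m0; move: (K * w) => p; nra.
by move/(_ x); rewrite /= cl_idI// mulr0 normr_le0 => /eqP.
Qed.

Lemma cH_diff Q i : cH Q -> H10 (fun x => Q i x + (-1) * chi lamc i x).
Proof.
move=> hQ; have hc0 := branch_cH chi_branch l0.
by apply: H10_eqI (cH_sub hQ hc0 i) => x _; rewrite mulN1r.
Qed.

Lemma branch_cE x : I11 x -> c0 x = q2 (chi lamc) x.
Proof. by move=> xI; rewrite /branch_c /= cl_idI. Qed.

Lemma kernel_hE x : I11 x -> h0 x = hc x.
Proof. by move=> xI; rewrite /kernel_h /= cl_idI. Qed.

Section NearBifurcation.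
Context (K2 K3 eta m M : R).
Context (HK2 : forall y W (w : R), H10 y -> cI W ->
  sol y (fun x => A2 x * y x + W x * y x) ->
  (forall x, I11 x -> `|W x| <= w) -> K2 * w <= 1 / 2 -> eqI y 0).
Context (HK3 : forall y g W (w a : R), H10 y -> cI g -> cI W ->
  sol y (fun x => A3 x * y x + W x * (g x + y x)) -> Nf y = 0 ->
  (forall x, I11 x -> `|W x| <= w) -> (forall x, I11 x -> `|g x| <= a) -> K3 * w <= 1 / 2 ->
  forall x, I11 x -> `|y x| <= 2 * (K3 * w * a)).
Context (hK2 : K2 * eta <= 1 / 2) (hK3 : K3 * eta <= 1 / 2).
Context (cM : forall x, `|c0 x| <= M) (hM : forall x, `|h0 x| <= M).
Context (coef : forall l c d d', `|c| <= M -> `|l| <= m -> `|d| <= m -> `|d'| <= m ->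
  `|(l + lamc) ^+ 2 * ((c + d) ^+ 2 + d' ^+ 2 - 4) - lamc ^+ 2 * (c * c - 4)| <= eta /\
  `|(l + lamc) ^+ 2 * ((c + d) ^+ 2 + (c + d) * (c + d') + (c + d') ^+ 2 - 4)
     - lamc ^+ 2 * (3 * (c * c) - 4)| <= eta).
Context (Q : triple R) (lam : R) (lam0 : 0 < lam) (cQ : critical lam Q) (q1E : eqI (q1 Q) (fun=> 2 / 3)).
Context (lm : `|lam - lamc| <= m) (d2 : forall x, I11 x -> `|q2 Q x - q2 (chi lamc) x| <= m)
  (d3 : forall x, I11 x -> `|q3 Q x| <= m).

Lemma near_cH : cH Q. Proof. by case: cQ. Qed.

Lemma near_cI i : cI (Q i). Proof. by case: near_cH => h _ _ _; exact: (h _).1. Qed.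

Lemma near_H10 : H10 (q3 Q).
Proof. by have [h _ _ [a b]] := near_cH; split=> //; exact: h. Qed.

Lemma cI_c : cI (q2 (chi lamc)). Proof. by have [] := branch_q2 chi_branch l0. Qed.

(** The perturbation of the third potential between the bifurcation point and Q. *)
Definition Wq x := lam ^+ 2 * (q2 Q x ^+ 2 + q3 Q x ^+ 2 - 4) - lamc ^+ 2 * (q2 (chi lamc) x * q2 (chi lamc) x - 4).

Lemma cI_Wq : cI Wq. Proof.
have c2 : cI (q2 Q) := @near_cI (inord 1); have c3 : cI (q3 Q) := @near_cI (inord 2).
by have cc := cI_c; rewrite /Wq; wcont. Qed.

Lemma Wq_small x : I11 x -> `|Wq x| <= eta.
Proof.
move=> xI; have ic : `|q2 (chi lamc) x| <= M by rewrite -branch_cE.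
have [h _] := coef ic lm (d2 xI) (d3 xI).
have G (a b : R) : b + (a - b) = a by rewrite addrC subrK.
by move: h; rewrite subrK G.
Qed.

(** Without component along the kernel, q3 solves a homogeneous perturbed equation and
    vanishes by the estimate K3; the difference of the second components then vanishes by
    K2. *)
Lemma on_branch : Nf (q3 Q) = 0 -> (forall x, I11 x -> `|q2 (chi lam) x - q2 (chi lamc) x| <= m) ->
  eq3 Q (chi lam).
Proof.
move=> N0 dl; have [s2 s3] := (critical_planar lam0 near_cH q1E).1 cQ.
have q30 : eqI (q3 Q) (fun=> 0).
  move=> x xI; apply/eqP; rewrite -normr_le0.
  have c00 : cI (fun=> 0 : R) by apply: continuous_subspaceT; exact: continuous_const.
  have s3' : sol (q3 Q) (fun x => A3 x * q3 Q x + Wq x * (0 + q3 Q x)).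
    apply: sol_eqI s3 => z zI; rewrite /pot3 /branch_w branch_cE// /Wq; ring.
  have z0 (z : R) : I11 z -> `|0 : R| <= (0 : R) by rewrite normr0.
  by have := HK3 near_H10 c00 cI_Wq s3' N0 Wq_small z0 hK3 xI; rewrite !mulr0.
have [cl2' sl] := branch_q2 chi_branch lam0.
have hcl := branch_cH chi_branch lam0.
have Hd : H10 (fun x => q2 Q x + (-1) * q2 (chi lam) x).
  by apply: H10_eqI (cH_sub near_cH hcl (inord 1)) => x _; rewrite mulN1r.
pose W x := lam ^+ 2 * (q2 Q x ^+ 2 + q2 Q x * q2 (chi lam) x + q2 (chi lam) x ^+ 2 - 4)
  - lamc ^+ 2 * (3 * (q2 (chi lamc) x * q2 (chi lamc) x) - 4).
have c2 : cI (q2 Q) := @near_cI (inord 1); have cc := cI_c.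
have cW : cI W by rewrite /W; wcont.
have sd : sol (fun x => q2 Q x + (-1) * q2 (chi lam) x)
    (fun x => A2 x * (q2 Q x + (-1) * q2 (chi lam) x) + W x * (q2 Q x + (-1) * q2 (chi lam) x)).
  apply: sol_eqI (solD (-1) s2 sl) => x xI; rewrite /pot2 branch_cE// /W q30//; ring.
have WB x : I11 x -> `|W x| <= eta.
  move=> xI; have ic : `|q2 (chi lamc) x| <= M by rewrite -branch_cE.
  have [_ h] := coef ic lm (d2 xI) (dl x xI).
  have G (a b : R) : b + (a - b) = a by rewrite addrC subrK.
  by move: h; rewrite !G subrK.
have d0 := HK2 Hd cW sd WB hK2.
have q1l := branch_q1 chi_branch lam0.
have q3l : eqI (q3 (chi lam)) 0 by have [_ /(_ lam lam0) [[_ q30']]] := chi_branch.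
apply: forall3 => x xI.
- by rewrite -/(q1 Q x) -/(q1 (chi lam) x) q1E// q1l.
- by apply/eqP; rewrite -subr_eq0 -mulN1r; apply/eqP; exact: (d0 x xI).
- by rewrite -/(q3 Q x) -/(q3 (chi lam) x) q30// q3l.
Qed.

(** Dividing q3 by its component t keeps the third equation, which is linear in q3 for fixed
    potential, and the estimate K3 keeps the quotient close to h_c. *)
Lemma off_branch t : t != 0 -> Nf (fun x => t^-1 * q3 Q x + (-1) * hc x) = 0 ->
  exists y2 y3, [/\ good y2, good y3,
   (forall x, `|y2 x| <= m) /\ (forall x, `|y3 x| <= 2 * (K3 * eta * M)),
   Srel A2 A3 (src2 chi lamc) (src3 chi lamc hc) (coupling chi lamc hc) h0
      (Gs chi lamc hc (t ^+ 2) (lam - lamc) y2 y3).1 (Gs chi lamc hc (t ^+ 2) (lam - lamc) y2 y3).2 (lam - lamc) y2 y3 &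
   eqI (q2 Q) (fun x => c0 x + y2 x) /\ eqI (q3 Q) (fun x => t * (h0 x + y3 x))].
Proof.
move=> t0 N0; have [s2 s3] := (critical_planar lam0 near_cH q1E).1 cQ.
have [cc sc] := branch_q2 chi_branch l0.
have hh := hc_H10 hc_ker; have chc := H10_cI hh.
have H2 : H10 (fun x => q2 Q x + (-1) * q2 (chi lamc) x) by exact: (cH_diff (inord 1) near_cH).
have Hp : H10 (fun x => t^-1 * q3 Q x + (-1) * hc x) by apply: H10D (H10Z _ near_H10) (H10Z _ hh).
set u := (fun x => q2 Q x + _) in H2; set v := (fun x => _) in Hp N0.
pose y2 := u \o cl; pose y3 := v \o cl.
have cu := H10_cI H2; have cv := H10_cI Hp.
have gy2 : good y2 by exact: good_cl.
have gy3 : good y3 by exact: good_cl.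
have y2E x : I11 x -> y2 x = q2 Q x - q2 (chi lamc) x.
  by move=> xI; rewrite /y2 /u /= cl_idI// mulN1r.
have y3E x : I11 x -> y3 x = t^-1 * q3 Q x - hc x.
  by move=> xI; rewrite /y3 /v /= cl_idI// mulN1r.
have gA2 := good_pot2 chi_branch lamcP; have gA3 := good_pot3 chi_branch lamcP.
have gB2 := good_src2 chi_branch lamcP; have gB3 := good_src3 chi_branch lamcP hc_ker.
have gF := good_coupling chi_branch lamcP hc_ker.
have gc := good_branch_c chi_branch lamcP; have gh := good_kernel_h hc_ker.
have gw := good_branch_w chi_branch lamcP.
pose l := lam - lamc.
have [gG1 gG2] : good (Gs chi lamc hc (t ^+ 2) l y2 y3).1 /\ good (Gs chi lamc hc (t ^+ 2) l y2 y3).2.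
  by apply: (Gw_closed (P := @good R)) => //; try exact: goodC; [exact: goodD|exact: goodM].
have zs : sol (fun=> 0 : R) (fun=> 0 : R).
  by exists (fun=> 0), (fun=> 0); split=> // x; exact: is_derive_cst.
have sq2 x : I11 x -> q2 Q x = c0 x + y2 x by move=> xI; rewrite y2E// branch_cE// addrC subrK.
have sq3 x : I11 x -> q3 Q x = t * (h0 x + y3 x).
  by move=> xI; rewrite y3E// kernel_hE// [hc x + _]addrC subrK mulVKf.
have L x : I11 x -> lam ^+ 2 * (q2 Q x ^+ 2 + q3 Q x ^+ 2 - 4) =
    (l + lamc) ^+ 2 * ((c0 x + y2 x) ^+ 2 + t ^+ 2 * (h0 x + y3 x) ^+ 2 - 4).
  by move=> xI; rewrite sq2// sq3// exprMn /l subrK.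
have [_ um up] := H2; have [_ vm vp] := Hp.
have b2 : bvp A2 (fun x => (Gs chi lamc hc (t ^+ 2) l y2 y3).1 x + l * src2 chi lamc x) y2.
  apply: (sol_bvp gA2 (goodD gG1 (goodZ l gB2)) (solD (-1) s2 sc) um up) => x xI.
  have -> : q2 Q x + -1 * q2 (chi lamc) x = y2 x by rewrite /y2 /= cl_idI.
  rewrite mulrCA L// sq2// -branch_cE// Gw_eval1.
  have I1 := Gw_identity1 lamc (c0 x) (h0 x) (t ^+ 2) l (y2 x) (y3 x).
  rewrite mulrCA in I1; rewrite I1 /pot2 /src2 /branch_w; ring.
have s3' : sol v (fun x => t^-1 * (lam ^+ 2 * (q3 Q x * (q2 Q x ^+ 2 + q3 Q x ^+ 2 - 4))) + (-1) * (A3 x * h0 x)).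
  have := solD (-1) (solD t^-1 zs s3) (hc_sol chi_branch lamcP hc_ker).
  have E : eqI (fun x => 0 + t^-1 * q3 Q x + -1 * hc x) v by move=> x _; rewrite add0r.
  by move=> hs; apply: (sol_eqIl E); apply: sol_eqI hs => x _; rewrite add0r.
have p3E x : I11 x -> t^-1 * (lam ^+ 2 * (q3 Q x * (q2 Q x ^+ 2 + q3 Q x ^+ 2 - 4))) =
    (h0 x + y3 x) * (lam ^+ 2 * (q2 Q x ^+ 2 + q3 Q x ^+ 2 - 4)).
  by move=> xI; rewrite {1}(sq3 x xI) [lam ^+ 2 * (_ * _)]mulrCA -[t * _ * _]mulrA mulKf.
have b3 : bvp A3 (fun x => coupling chi lamc hc x * y2 x + l * src3 chi lamc hc x + (Gs chi lamc hc (t ^+ 2) l y2 y3).2 x) y3.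
  apply: (sol_bvp gA3 (goodD (goodD (goodM gF gy2) (goodZ l gB3)) gG2) s3' vm vp) => x xI.
  have -> : v x = y3 x by rewrite /y3 /= cl_idI.
  rewrite p3E// L// Gw_eval2.
  have I1 := Gw_identity2 lamc (c0 x) (h0 x) (t ^+ 2) l (y2 x) (y3 x).
  rewrite mulrCA in I1; rewrite I1 /pot3 /coupling /src3 /branch_w; ring.
exists y2, y3; split=> //; [split|].
- apply: good_le => // x xI; rewrite y2E//; exact: d2.
- apply: good_le => // x xI.
  have s3'' : sol v (fun x => A3 x * v x + Wq x * (hc x + v x)).
    apply: sol_eqI s3' => z zI; rewrite p3E//.
    have -> : v z = y3 z by rewrite /y3 /= cl_idI.
    rewrite kernel_hE// /pot3 /branch_w branch_cE// /Wq; ring.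
  rewrite /y3 /= cl_idI//; apply: (HK3 Hp chc cI_Wq s3'' N0 Wq_small _ hK3 xI) => z zI.
  by rewrite -kernel_hE.
- split=> //; rewrite -N0; apply: ip_eq => // x xI; by rewrite /y3 /= cl_idI.
Qed.

End NearBifurcation.

End APriori.

(** * The bifurcation theorem *)

Section Assembly.
Context {R : realType}.
Implicit Types (f g u v y w : R -> R) (r s t x C k K m b l lam : R) (n N : nat) (Q P h : triple R).

Lemma cH_add P h : cH P -> H10_3 h -> cH (P + h).
Proof.
move=> [hP [a1 a2] [b1 b2] [c1 c2]] hh.
have e i x : (P + h) i x = P i x + h i x by [].
have z i : h i (-1) = 0 /\ h i 1 = 0 by case: (hh i).
have [z0 z0'] := z (inord 0); have [z1 z1'] := z (inord 1); have [z2 z2'] := z (inord 2).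
split.
- by move=> i; have := H1D (hP i) (H10_H1 (hh i)).
- by rewrite /q1 !e z0 z0' !addr0.
- by rewrite /q2 !e z1 z1' !addr0.
- by rewrite /q3 !e z2 z2' !addr0.
Qed.

Lemma planar_eqI lam u v u' v' : eqI u u' -> eqI v v' -> planar lam u v -> planar lam u' v'.
Proof.
move=> E E' [s1 s2]; split.
- by apply: (sol_eqIl E); apply: sol_eqI s1 => x xI; rewrite E// E'.
- by apply: (sol_eqIl E'); apply: sol_eqI s2 => x xI; rewrite E// E'.
Qed.

Lemma pcurve_H10 (V : 'I_3 -> nat -> R -> R) r t : (forall i, convrad (V i) r) ->
  (forall i n, J (V i n) (cl 1) = 0) -> `|t| < r -> H10_3 (pcurve V t).
Proof.
move=> hV H tr i; apply: (@primit_H10 _ _ (psum (V i) t)); last exact: pcurve_bdry (hV i) (H i) tr.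
by split=> //; exact: psum_good (hV i) tr.
Qed.

(** The derivatives in x are close to their constant coefficient in t, and they control the
    H10 norm. *)
Lemma pcurve_bounded (V : 'I_3 -> nat -> R -> R) r : 0 < r -> (forall i, convrad (V i) r) ->
  (forall i n, J (V i n) (cl 1) = 0) -> exists d B, [/\ 0 < d, 0 <= B &
  forall t, `|t| < d -> `|t| < r -> norm3 (pcurve V t) <= B].
Proof.
move=> r0 hV H.
have /choice [p Hp] : forall i, exists p : R * R, [/\ 0 < p.1, 0 < p.2 &
    forall (t : R) x, `|t| < p.1 -> `|psum (V i) t x| <= p.2].
  move=> i; have [d [d0 _ Hd]] := psum_local r0 (hV i) ltr01.
  have [gV _] := hV i; have [M M0 HM] := good_bounded (gV 0%N).
  exists (d, 1 + M); split=> //=; first by lra.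
  move=> t x ht; rewrite -(subrK (V i 0%N x) (psum _ _ _)).
  by apply: (le_trans (ler_normD _ _)); apply: lerD; [exact: Hd|exact: HM].
pose B := \sum_i (p i).2.
have B0 : 0 <= B by apply: sumr_ge0 => i _; case: (Hp i) => _ /ltW.
exists (\big[Num.min/1]_i (p i).1), (3 * B); split.
- by elim/big_ind: _ => [//|x y x0 y0|i _]; [rewrite lt_min x0|case: (Hp i)].
- by rewrite mulr_ge0.
move=> t td tr; apply: (@primit_norm3 _ _ (fun i => psum (V i) t)) => // [i|i|i x].
- by split=> //; exact: psum_good (hV i) tr.
- exact: pcurve_bdry (hV i) (H i) tr.
- have [_ _ /(_ t x)] := Hp i => h; have : `|t| < (p i).1.
    by apply: lt_le_trans td _; rewrite (bigD1 i)//= ge_min lexx.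
  move=> /h {}h; apply: (le_trans h).
  by rewrite /B (bigD1 i)//= lerDl sumr_ge0// => j _; case: (Hp j) => _ /ltW.
Qed.

Lemma smallness (e0 Kg K2 K3 M : R) : 0 < e0 -> 0 <= Kg -> 0 <= K2 -> 0 <= K3 -> 0 <= M ->
  exists e1 eta, [/\ 0 < e1 <= 1, 0 < eta, Kg * e1 ^+ 2 <= e0 &
     [/\ K2 * eta <= 1 / 2, K3 * eta <= 1 / 2 & 2 * (K3 * eta * M) <= e1]].
Proof.
move=> e00 Kg0 K20 K30 M0.
pose e1 := Num.min 1 (e0 / (Kg + 1)).
have e1p : 0 < e1 by rewrite lt_min ltr01 divr_gt0//; lra.
have e11 : e1 <= 1 by rewrite ge_min lexx.
have e1K : e1 * (Kg + 1) <= e0 by rewrite -ler_pdivlMr ?ge_min ?lexx ?orbT//; lra.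
have KM : 0 <= K3 * M by rewrite mulr_ge0.
pose eta := Num.min (1 / (2 * (K2 + 1))) (Num.min (1 / (2 * (K3 + 1))) (e1 / (2 * (K3 * M) + 1))).
have etap : 0 < eta by rewrite !lt_min !divr_gt0//; lra.
exists e1, eta; split=> //; first by rewrite e1p.
- have h : e1 * Kg * e1 <= e1 * Kg by rewrite ler_piMr// mulr_ge0// ltW.
  have -> : Kg * e1 ^+ 2 = e1 * Kg * e1 by ring.
  by apply: (le_trans h); apply: le_trans e1K; rewrite mulrDr mulr1 lerDl ltW.
- split; [apply: half_of_small => //; by rewrite ge_min lexx
         |apply: half_of_small => //; by rewrite !ge_min lexx orbT|].
  have : eta * (2 * (K3 * M) + 1) <= e1 by rewrite -ler_pdivlMr ?ge_min ?lexx ?orbT//; lra.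
  move: etap KM; move: (eta) (e1) => z e; rewrite -[K3 * z * M]mulrAC; move: (K3 * M) => q; nra.
Qed.

End Assembly.

Unset Implicit Arguments.

Theorem theorem5p2 (R : realType) (chi : R -> triple R) (lamc : R)
    (hc : R -> R)
    (chi_branch : is_branch chi) (mu_decr : mu_decreasing chi)
    (lamcP : is_lambda_c chi lamc)
    (hc_ker : kerL lamc (chi lamc) hc) (hc_neq0 : ~ eqI hc 0) :
  exists (delta eps : R) (A : set (triple R))
         (lambda : R -> R) (H : R -> triple R),
    [/\ 0 < delta <= lamc, 0 < eps & nbhd_in_cH (chi lamc) A] /\
    [/\ forall t, `|t| < eps -> `|lambda t - lamc| < delta /\ orth hc (H t),
        smooth [set t | `|t| < eps] lambda &
        smooth3 [set t | `|t| < eps] H] /\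
    (forall (lam : R) (Q : triple R),
      (`|lam - lamc| < delta /\ A Q) /\ critical lam Q <->
      (`|lam - lamc| < delta /\ eq3 Q (chi lam)) \/
      (exists t, [/\ `|t| < eps, lam = lambda t &
         eq3 Q (chi lamc + t *: third hc + t ^+ 2 *: H t)])) /\
    (forall t, `|t| < eps ->
      [/\ lambda (- t) = lambda t, eqI (q1 (H (- t))) (q1 (H t)),
          eqI (q2 (H (- t))) (q2 (H t)) &
          eqI (q3 (H (- t))) (- q3 (H t))]).
Proof.
have l0 : 0 < lamc by case: lamcP.
have [rt [e0 [al [V [Y2 [Y3 [[rt0 e00 ral al0] [rV bV] curve parity uniq]]]]]]] :=
  bifurcation_curve chi_branch mu_decr lamcP hc_ker hc_neq0.
have gc := good_branch_c chi_branch lamcP; have gh := good_kernel_h hc_ker; have gw := good_branch_w chi_branch lamcP.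
have [M1 M10 HM1] := good_bounded gc; have [M2 M20 HM2] := good_bounded gh.
have [M3 M30 HM3] := good_bounded gw.
have [M [Mp [MB1 MB2 MB3 MB4 MB5]]] : exists M, 0 <= M /\ [/\ M1 <= M, M2 <= M, M3 <= M, lamc <= M & lamc ^+ 2 <= M].
  exists (lamc ^+ 2 + lamc + M1 + M2 + M3); have := sqr_ge0 lamc; move: (lamc ^+ 2) => z z0.
  by split; [lra|split; lra].
have [Kg Kg0 HKg] := Gw_cl2 Mp (ler01 : 0 <= 1 :> R).
have [K2 K20 HK2] := coercive_small chi_branch lamcP.
have [K3 K30 HK3] := kernel_small chi_branch lamcP hc_ker hc_neq0.
have [e1 [eta [/andP[e10 e11] eta0 Kge [Ke2 Ke3 KeM]]]] := smallness e00 Kg0 K20 K30 Mp.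
have [m0 /andP[m00 m01] coef0] := coef_small lamc Mp eta0.
have [m [mp mm0 me1]] : exists m, [/\ 0 < m, m <= m0 & m <= e1].
  by exists (Num.min m0 e1); rewrite lt_min m00 e10 !ge_min !lexx orbT.
have coef l c d d' : `|c| <= M -> `|l| <= m -> `|d| <= m -> `|d'| <= m ->
  `|(l + lamc) ^+ 2 * ((c + d) ^+ 2 + d' ^+ 2 - 4) - lamc ^+ 2 * (c * c - 4)| <= eta /\
  `|(l + lamc) ^+ 2 * ((c + d) ^+ 2 + (c + d) * (c + d') + (c + d') ^+ 2 - 4)
     - lamc ^+ 2 * (3 * (c * c) - 4)| <= eta.
  by move=> h1 h2 h3 h4; apply: coef0 => //; apply: le_trans mm0.
clear coef0.
have [rho [rho0 rhom rho8]] : exists rho, [/\ 0 < rho, 2 * rho <= m & 2 * rho <= 1 / 8].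
  exists (Num.min m (1 / 8) / 2); have h : 0 < Num.min m (1 / 8) by rewrite lt_min mp; lra.
  have h1 : Num.min m (1 / 8) <= m by rewrite ge_min lexx.
  have h2 : Num.min m (1 / 8) <= 1 / 8 by rewrite ge_min lexx orbT.
  by clear -h h1 h2; split; lra.
have [d d0 Hd] := branch_cont chi_branch l0 rho0.
have [delta [delta0 deltal deltam deltad]] : exists delta, [/\ 0 < delta, delta <= lamc, delta <= m & delta <= d].
  exists (Num.min lamc (Num.min m d)); split.
  - by rewrite !lt_min l0 mp d0.
  - by rewrite ge_min lexx.
  - by rewrite !ge_min lexx orbT.
  - by rewrite !ge_min lexx !orbT.
have [d1 [d10 d1r Hal]] : exists d1, [/\ 0 < d1, d1 <= rt & forall (u : R) x, `|u| < d1 -> `|psum al u x - al 0%N x| <= delta / 2].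
  by apply: psum_local => //; rewrite divr_gt0.
have [dV [BV [dV0 BV0 HV]]] := pcurve_bounded rt0 rV bV.
pose nT := norm3 (third hc : triple R).
have nT0 : 0 <= nT by exact: norm3_ge0.
have [eps [eps0 epsr epse epsd [epsV epsN]]] : exists eps, [/\ 0 < eps, eps <= rt, eps <= e1, eps <= d1 &
    eps <= dV /\ eps * (nT + BV + 1) <= rho].
  have s0 : 0 < nT + BV + 1 by rewrite ltr_wpDl// addr_ge0.
  exists (Num.min (Num.min rt e1) (Num.min d1 (Num.min dV (rho / (nT + BV + 1))))); split.
  - by rewrite !lt_min rt0 e10 d10 dV0 divr_gt0.
  - by rewrite !ge_min lexx.
  - by rewrite !ge_min lexx !orbT.
  - by rewrite !ge_min lexx !orbT.
  - split; first by rewrite !ge_min lexx !orbT.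
    by rewrite -ler_pdivlMr// !ge_min lexx !orbT.
have s0 : 0 < nT + BV + 1 by rewrite ltr_wpDl// addr_ge0.
have hhc := hc_H10 hc_ker.
have hT : H10_3 (third hc) by exact: (single_H10 (inord 2) hhc).
have Nh0 := kernel_form_kernel_h chi_branch lamcP hc_ker hc_neq0.
have NhE : kernel_form chi lamc hc (kernel_h hc) = kernel_form chi lamc hc hc by apply: ip_eq => // x xI; rewrite kernel_hE.
(* The squared H10 norm of h_c. *)
pose D := - kernel_form chi lamc hc hc.
have D0 : 0 < D by rewrite /D -NhE oppr_gt0.
have hchi := branch_cH chi_branch l0.
pose lambda t := lamc + psum al t 0.
pose H := pcurve V.
have HH t : `|t| < eps -> H10_3 (H t).
  by move=> ht; apply: (pcurve_H10 rV bV); exact: lt_le_trans epsr.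
have HC t : `|t| < eps -> _ := fun ht => curve t (lt_le_trans ht epsr).
have NH t : `|t| < eps -> kernel_form chi lamc hc (H t (inord 2)) = 0 by move=> /HC [].
have n02 : (inord 0 == inord 2 :> 'I_3) = false by rewrite -val_eqE /= !inordK.
have n12 : (inord 1 == inord 2 :> 'I_3) = false by rewrite -val_eqE /= !inordK.
have T0E x : third hc (inord 0) x = 0 by rewrite /third n02.
have T1E x : third hc (inord 1) x = 0 by rewrite /third n12.
have T2E x : third hc (inord 2) x = hc x by rewrite /third eqxx.
have lamE t : `|t| < eps -> `|lambda t - lamc| < delta.
  move=> ht; rewrite /lambda addrC addKr.
  have := Hal t 0 (lt_le_trans ht epsd); rewrite al0 subr0 => h; apply: (le_lt_trans h).
  by rewrite ltr_pdivrMr// ltr_pMr// ltr1n.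
have hth t : H10_3 (t *: third hc : triple R) by exact: H10_3Z.
have hpert t : `|t| < eps -> H10_3 (t *: third hc + t ^+ 2 *: H t).
  by move=> ht; apply: H10_3D => //; apply: H10_3Z; exact: HH.
have npert t : `|t| < eps -> norm3 (t *: third hc + t ^+ 2 *: H t) < rho.
  move=> ht; have hHt := HH t ht; have hH2 := H10_3Z (t ^+ 2) hHt.
  apply: (le_lt_trans (norm3D (hth t) hH2)).
  rewrite norm3Z// norm3Z// -/nT normrX.
  have hB : norm3 (H t) <= BV by apply: HV; [exact: lt_le_trans epsV|exact: lt_le_trans epsr].
  have t1 : `|t| <= 1 by apply: (le_trans (ltW ht)); exact: le_trans e11.
  have t0 := normr_ge0 t; have nH := norm3_ge0 (H t).
  have s1 : `|t| ^+ 2 * norm3 (H t) <= `|t| * BV.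
    by apply: ler_pM => //; rewrite expr2 ler_piMl.
  have s2 : `|t| * (nT + BV + 1) < rho.
    by apply: lt_le_trans epsN; rewrite ltr_pM2r.
  apply: le_lt_trans s2; rewrite -addrA mulrDr lerD2l; apply: (le_trans s1).
  by rewrite ler_wpM2l// lerDl.
have dpert t : `|t| < eps -> dot3 (t *: third hc + t ^+ 2 *: H t) (third hc) = t * D.
  move=> ht; rewrite (dot3_third chi_branch lamcP hc_ker (hpert t ht)).
  have gA3 := good_pot3 chi_branch lamcP.
  have LA : L2 (fun x => pot3 chi lamc x * kernel_h hc x) by apply: good_L2; exact: goodM.
  have Lh : L2 hc by apply: L2_cont; exact: H10_cI hhc.
  have LH : L2 (H t (inord 2)) by apply: L2_cont; apply: H10_cI; exact: HH.
  have -> : kernel_form chi lamc hc ((t *: third hc + t ^+ 2 *: H t) (inord 2)) =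
     t * kernel_form chi lamc hc hc + t ^+ 2 * kernel_form chi lamc hc (H t (inord 2)).
    rewrite /kernel_form ![ip _ hc]ipC ![ip _ (H t _)]ipC ![ip _ ((_ + _) _)]ipC.
    rewrite -(ipZl t)// -(ipZl (t ^+ 2))// -ipDl//; try exact: L2Z.
    apply: ip_eq => // x _.
    have -> : (t *: third hc + t ^+ 2 *: H t) (inord 2) x = t * third hc (inord 2) x + t ^+ 2 * H t (inord 2) x by [].
    by rewrite T2E.
  by rewrite NH// mulr0 addr0 /D mulrN.
(* The last condition bounds the component along the kernel, so that the parameter t of a
   solution in the neighbourhood lies in the domain of the curve. *)
pose A : set (triple R) := [set Q | [/\ cH Q, norm3 (Q - chi lamc) < rho &
   `|dot3 (Q - chi lamc) (third hc)| < eps * D]].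
have subE Q t : eq3 Q (chi lamc + t *: third hc + t ^+ 2 *: H t) ->
    eq3 (Q - chi lamc) (t *: third hc + t ^+ 2 *: H t).
  move=> E i x xI; have G (a b c e : R) : a = b + c + e -> a - b = c + e by move=> ->; ring.
  exact: G (E i x xI).
have dot_eq3 Q P : eq3 Q P -> H10_3 P -> H10_3 Q -> dot3 Q (third hc) = dot3 P (third hc).
  move=> E hP hQ; rewrite !(dot3_third chi_branch lamcP hc_ker)//; congr (- _).
  by apply: ip_eq => // x xI; exact: E.
have chi3 : eqI (q3 (chi lamc)) 0 by have [_ /(_ lamc l0) [[_ ?]]] := chi_branch.
have q1c := branch_q1 chi_branch l0.
have lam_pos lam : `|lam - lamc| < delta -> 0 < lam.
  rewrite ltr_norml ltrBrDr => /andP[h _]; apply: le_lt_trans h.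
  by rewrite addrC subr_ge0.
have chi_near lam : `|lam - lamc| < delta -> norm3 (chi lam - chi lamc) < rho.
  by move=> hl; have [_] := Hd (lam - lamc) (lt_le_trans hl deltad); rewrite subrK.
exists delta, eps, A, lambda, H; split; last split; last split.
- split=> //; first by rewrite delta0.
  split; first by move=> Q [].
  have T0 : 0 < nT + 1 by rewrite ltr_wpDl.
  exists (Num.min rho (eps * D / (nT + 1))); first by rewrite lt_min rho0 divr_gt0// mulr_gt0.
  move=> P hP; rewrite lt_min => /andP[n1 n2]; split=> //.
  have hPd := cH_sub hP hchi.
  apply: (le_lt_trans (dot3_CS hPd hT)); rewrite -/nT.
  move: n2; rewrite ltr_pdivlMr//; apply: le_lt_trans.
  by rewrite ler_wpM2l ?norm3_ge0// lerDl.
- split.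
  + move=> t ht; split; first exact: lamE.
    split; first exact: HH.
    by rewrite (dot3_third chi_branch lamcP hc_ker (HH t ht)) NH// oppr0.
  + exact: psum_smooth rt0 ral eps epsr.
  + exact: pcurve_smooth rt0 rV bV eps epsr.
- move=> lam Q; split.
  + move=> [[hl [hQ nQ dQ]] cQ]; have lam0 := lam_pos lam hl.
    have hQd := cH_sub hQ hchi.
    have bnd i x : I11 x -> `|Q i x - chi lamc i x| <= 2 * rho.
      move=> xI; apply: (le_trans (norm3_sup i hQd xI)).
      by rewrite ler_wpM2l// ltW.
    have q1E : eqI (q1 Q) (fun=> 2 / 3).
      apply: critical_near_planar lam0 cQ _ => x xI.
      by have := bnd (inord 0) x xI; rewrite -/(q1 Q x) -/(q1 (chi lamc) x) q1c// => h; exact: le_trans rho8.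
    have d2 x : I11 x -> `|q2 Q x - q2 (chi lamc) x| <= m.
      by move=> xI; exact: le_trans (bnd (inord 1) x xI) rhom.
    have d3 x : I11 x -> `|q3 Q x| <= m.
      move=> xI; have := bnd (inord 2) x xI; rewrite -/(q3 Q x) -/(q3 (chi lamc) x) chi3// subr0 => h.
      exact: le_trans rhom.
    have lm : `|lam - lamc| <= m by apply: (le_trans (ltW hl)).
    have cM x : `|branch_c chi lamc x| <= M by exact: le_trans MB1.
    have hM x : `|kernel_h hc x| <= M by exact: le_trans MB2.
    have NQ : dot3 (Q - chi lamc) (third hc) = - kernel_form chi lamc hc (q3 Q).
      rewrite (dot3_third chi_branch lamcP hc_ker hQd); congr (- _).
      apply: ip_eq => // x xI.
      have -> : (Q - chi lamc) (inord 2) x = q3 Q x - q3 (chi lamc) x by [].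
      by rewrite chi3// subr0.
    (* The component of Q along the kernel; on the curve it is the parameter, since H t
       is orthogonal to the kernel. *)
    pose t := - kernel_form chi lamc hc (q3 Q) / D.
    have ht : `|t| < eps.
      by rewrite /t -NQ normrM normfV (gtr0_norm D0) ltr_pdivrMr.
    have [t0|t0] := eqVneq t 0.
      left; split=> //; apply: (on_branch chi_branch lamcP HK2 HK3 Ke2 Ke3 cM coef lam0 cQ q1E lm d2 d3).
        by move/eqP: t0; rewrite mulf_eq0 invr_eq0 (gt_eqF D0) orbF oppr_eq0 => /eqP.
      move=> x xI; have hld := cH_sub (branch_cH chi_branch lam0) hchi.
      have := norm3_sup (inord 1) hld xI => h; apply: (le_trans h); apply: le_trans rhom.
      exact: (ler_wpM2l (ler0n R 2) (ltW (chi_near lam hl))).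
    right; exists t.
    have NE : kernel_form chi lamc hc (q3 Q) = - (t * D) by rewrite /t divfK ?gt_eqF// opprK.
    have Nt : kernel_form chi lamc hc (fun x => t^-1 * q3 Q x + (-1) * hc x) = 0.
      have gA3 := good_pot3 chi_branch lamcP.
      have LA : L2 (fun x => pot3 chi lamc x * kernel_h hc x) by apply: good_L2; exact: goodM.
      have Lh : L2 hc by apply: L2_cont; exact: H10_cI hhc.
      have Lq : L2 (q3 Q) by apply: L2_cont; have [h _ _ _] := hQ; exact: (h _).1.
      rewrite /kernel_form ipC ipDl//; [|exact: L2Z|exact: L2Z].
      rewrite !ipZl// ![ip _ (fun x => pot3 _ _ x * _)]ipC -/(kernel_form chi lamc hc _) -/(kernel_form chi lamc hc _) NE.
      by rewrite -/(kernel_form chi lamc hc hc) mulrN mulKf// mulN1r /D opprK addrN.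
    have [y2 [y3 [gy2 gy3 [By2 By3] hS [e2 e3]]]] :=
      off_branch chi_branch lamcP hc_ker HK3 Ke3 cM hM coef lam0 cQ q1E lm d2 d3 t0 Nt.
    have mF := @majorant_fun R.
    have cl1 (u : R -> R) : Bfun u e1 -> cl2 Bfun e1 0 1 1 u u.
      by move=> hu; split; rewrite ?mul1r ?expr1 ?subrr ?mulr0// => x; rewrite normr0.
    have B0 : Bfun (0 : R -> R) 0 by move=> x; rewrite normr0.
    have Bs : Bfun (fun=> t ^+ 2 : R) (e1 ^+ 2).
      move=> x; rewrite normrX lerXn2r ?nnegrE// ?(ltW e10)//.
      by apply: (le_trans (ltW ht)).
    have e01 : 0 <= e1 <= 1 by rewrite ltW.
    have [] := HKg _ Bfun e1 0 (fun=> lamc ^+ 2) (fun=> lamc) (branch_c chi lamc) (kernel_h hc) (branch_w chi lamc) (fun=> t ^+ 2)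
      (fun=> lam - lamc) y2 y3 (fun=> lam - lamc) y2 y3 mF B0 e01 (lexx 0).
    * by move=> x; rewrite ger0_norm// sqr_ge0.
    * by move=> x; rewrite ger0_norm// ltW.
    * exact: cM.
    * exact: hM.
    * by move=> x; exact: le_trans MB3.
    * exact: Bs.
    * by apply: cl1 => x; exact: le_trans me1.
    * by apply: cl1 => x; exact: le_trans me1.
    * by apply: cl1 => x; exact: le_trans KeM.
    move=> [_ G1 _ _] [_ G2 _ _].
    have [El E2 E3] := uniq t (lam - lamc) y2 y3 (lt_le_trans ht epsr) gy2 gy3 hS
      (maj_le mF G1 Kge) (maj_le mF G2 Kge).
    split=> //; first by rewrite /lambda -El addrC subrK.
    have [_ _ _ _ cv] := HC t ht.
    apply: forall3 => x xI; have [v0 v1 v2] := cv x.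
    * have -> : (chi lamc + t *: third hc + t ^+ 2 *: H t) (inord 0) x =
         q1 (chi lamc) x + t * third hc (inord 0) x + t ^+ 2 * pcurve V t (inord 0) x by [].
      by rewrite v0 T0E !mulr0 !addr0 q1c//; exact: q1E.
    * have -> : (chi lamc + t *: third hc + t ^+ 2 *: H t) (inord 1) x =
         q2 (chi lamc) x + t * third hc (inord 1) x + t ^+ 2 * pcurve V t (inord 1) x by [].
      rewrite v1 T1E mulr0 addr0 -E2 -(branch_cE chi lamc xI); exact: e2.
    * have -> : (chi lamc + t *: third hc + t ^+ 2 *: H t) (inord 2) x =
         q3 (chi lamc) x + t * third hc (inord 2) x + t ^+ 2 * pcurve V t (inord 2) x by [].
      rewrite v2 T2E chi3// add0r -E3 -mulrDr -(kernel_hE hc xI); exact: e3.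
  + move=> [[hl E]|[t [ht lE E]]].
    * have lam0 := lam_pos lam hl; have hcl := branch_cH chi_branch lam0.
      have hQ := cH_eq3 E hcl; split; last first.
        by apply: (critical_eq3 lam0 E); have [_ /(_ lam lam0) []] := chi_branch.
      split=> //; split=> //.
        rewrite (norm3_eq3 (P := chi lam - chi lamc)); first exact: chi_near.
          by move=> i x xI; have := E i x xI => h; rewrite [LHS](_ : _ = Q i x - chi lamc i x)// h.
        exact: H10_3_H1 (cH_sub hcl hchi).
      rewrite (dot3_third chi_branch lamcP hc_ker (cH_sub hQ hchi)).
      have q3l : eqI (q3 (chi lam)) 0 by have [_ /(_ lam lam0) [[_ ?]]] := chi_branch.
      have -> : kernel_form chi lamc hc ((Q - chi lamc) (inord 2)) = 0.
        rewrite -[RHS](ip_zero (fun x => pot3 chi lamc x * kernel_h hc x)); apply: ip_eq => // x xI.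
        rewrite [LHS](_ : _ = Q (inord 2) x - q3 (chi lamc) x)// E// -/(q3 (chi lam) x) q3l// chi3//.
        by rewrite subrr.
      by rewrite oppr0 normr0 mulr_gt0.
    * have hP : cH (chi lamc + (t *: third hc + t ^+ 2 *: H t)) by apply: cH_add => //; exact: hpert.
      rewrite addrA in hP.
      have hQ := cH_eq3 E hP; have Es := subE _ _ E; have hl := lamE t ht.
      split; first split; first by rewrite lE.
        split=> //; first by rewrite (norm3_eq3 Es) ?npert//; exact: H10_3_H1 (hpert t ht).
        rewrite (dot_eq3 _ _ Es (hpert t ht) (cH_sub hQ hchi)) dpert// normrM (gtr0_norm D0).
        by rewrite ltr_pM2r.
      have lam0 : 0 < lam by rewrite lE; exact: lam_pos.
      apply: (critical_eq3 lam0 E).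
      have [gY2 gY3 hS _ cv] := HC t ht.
      have PE i x : (chi lamc + t *: third hc + t ^+ 2 *: H t) i x =
         chi lamc i x + t * third hc i x + t ^+ 2 * pcurve V t i x by [].
      apply/(critical_planar lam0 hP).
        move=> x xI; have [v0 _ _] := cv x; rewrite /q1 PE v0 T0E !mulr0 !addr0.
        exact: q1c.
      have := Srel_planar chi_branch lamcP hc_ker gY2 gY3 hS.
      have -> : psum al t 0 + lamc = lam by rewrite lE /lambda addrC.
      apply: planar_eqI => x xI; have [_ v1 v2] := cv x.
        by rewrite /q2 PE v1 T1E mulr0 addr0 branch_cE.
      by rewrite /q3 PE v2 T2E -/(q3 (chi lamc) x) chi3// add0r -mulrDr kernel_hE.
- move=> t ht; have [p1 p2] := parity t (lt_le_trans ht epsr).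
  split; first by rewrite /lambda p1.
  + by move=> x _; have [] := p2 x.
  + by move=> x _; have [] := p2 x.
  + by move=> x _; have [_ _] := p2 x.
Qed.
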